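(* For every prime number $p\equiv 1 \mod 4$ there is a sequence of primes $(q_k)_k$, each satisfying $q_k\equiv 1 \mod 4$, $q_k \neq p$ and $\left(\frac{p}{q_k}\right)=-1$, such that \[ \lim_{k\to\infty} \frac{\log(\mathrm{kiss}(X^{p,q_k}))}{\log(n_k)} = \frac{4}{3}, \] where $n_k$ is the number of vertices of $X^{p,q_k}$.
   Context: Let $p\neq q$ be primes with $p\equiv q\equiv 1 \mod 4$ and Legendre symbol $\left(\frac{p}{q}\right)=-1$. Let $\mathbb{H}(\mathbb{Z})=\{x_0+x_1 i+x_2 j+x_3 k : x_i\in\mathbb{Z}\}$ be the integral Hamiltonian quaternions ($i^2=j^2=k^2=ijk=-1$), with norm $N(x)=x_0^2+x_1^2+x_2^2+x_3^2$. Let $\Lambda(2)$ be the set of $x\in\mathbb{H}(\mathbb{Z})$ with $x\equiv 1 \mod 2$ (i.e. $x_0$ odd and $x_1,x_2,x_3$ even) and $N(x)=p^m$ for some integer $m\geq 0$, modulo the equivalence $x\sim y \iff x=\pm p^m y$ for some $m\in\mathbb{Z}$; quaternion multiplication makes $\Lambda(2)$ a group (it is free). Let $S\subset\Lambda(2)$ be the set of classes of $x$ with $N(x)=p$, $x_0>0$, $x_0$ odd; it is a symmetric generating set with $|S|=p+1$. Let $\Lambda(2q)$ be the normal subgroup of classes $[x_0+x_1i+x_2j+x_3k]\in\Lambda(2)$ with $2q\mid x_1,x_2,x_3$. The Lubotzky–Phillips–Sarnak graph is the Cayley graph $X^{p,q}=\mathrm{Cay}(\Lambda(2)/\Lambda(2q),S)$,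 a $(p+1)$-regular graph. The kissing number $\mathrm{kiss}(G)$ of a graph is the number of distinct shortest oriented cycles in $G$, i.e. oriented cycles whose length equals the girth (the smallest length of a non-backtracking closed walk). *)

(* Defs.v *)
From Stdlib Require Export ZArith Znumtheory List Reals.
Import ListNotations.
Open Scope Z_scope.

Record quat := Quat { x0 : Z; x1 : Z; x2 : Z; x3 : Z }.

Definition qmul (a b : quat) : quat :=
  Quat (x0 a * x0 b - x1 a * x1 b - x2 a * x2 b - x3 a * x3 b)
       (x0 a * x1 b + x1 a * x0 b + x2 a * x3 b - x3 a * x2 b)
       (x0 a * x2 b - x1 a * x3 b + x2 a * x0 b + x3 a * x1 b)
       (x0 a * x3 b + x1 a * x2 b - x2 a * x1 b + x3 a * x0 b).

Definition qconj (a : quat) : quat := Quat (x0 a) (- x1 a) (- x2 a) (- x3 a).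

Definition qscale (c : Z) (a : quat) : quat :=
  Quat (c * x0 a) (c * x1 a) (c * x2 a) (c * x3 a).

Definition qnorm (a : quat) : Z :=
  x0 a * x0 a + x1 a * x1 a + x2 a * x2 a + x3 a * x3 a.

(** x is a representative of an element of Lambda(2):
    x = 1 mod 2 and N(x) = p^m for some m >= 0. *)
Definition inL2 (p : Z) (x : quat) : Prop :=
  Z.odd (x0 x) = true /\ (2 | x1 x) /\ (2 | x2 x) /\ (2 | x3 x) /\
  exists m : nat, qnorm x = p ^ Z.of_nat m.

(** x ~ y  iff  x = +- p^m y for some integer m
    (written p^a x = e p^b y with a, b >= 0, e = +-1). *)
Definition lam_eq (p : Z) (x y : quat) : Prop :=
  exists (a b : nat) (e : Z), (e = 1 \/ e = -1) /\
    qscale (p ^ Z.of_nat a) x = qscale (e * p ^ Z.of_nat b) y.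

Definition inL2q (p q : Z) (z : quat) : Prop :=
  exists w, lam_eq p w z /\
    (2 * q | x1 w) /\ (2 * q | x2 w) /\ (2 * q | x3 w).

(** Equality of the cosets [x] Lambda(2q) = [y] Lambda(2q) in
    Lambda(2)/Lambda(2q): [y]^{-1}[x] in Lambda(2q); the inverse of [y]
    in Lambda(2) is [conj y] since y * conj y = N(y) = p^m ~ 1. *)
Definition coset_eq (p q : Z) (x y : quat) : Prop :=
  inL2q p q (qmul (qconj y) x).

Definition inS (p : Z) (s : quat) : Prop :=
  inL2 p s /\ qnorm s = p /\ 0 < x0 s /\ Z.odd (x0 s) = true.

(** Adjacency in the LPS graph X^{p,q} = Cay(Lambda(2)/Lambda(2q), S)
    (vertices given by representatives in Lambda(2)); we take the underlying
    simple graph (distinct endpoints). *)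
Definition lps_adj (p q : Z) (u v : quat) : Prop :=
  ~ coset_eq p q u v /\ exists s, inS p s /\ coset_eq p q v (qmul u s).

Definition vnth (w : list quat) (i : nat) : quat :=
  nth (Nat.modulo i (length w)) w (Quat 0 0 0 0).

Definition nb_closed_walk (p q : Z) (w : list quat) : Prop :=
  (1 <= length w)%nat /\
  (forall i, (i < length w)%nat -> inL2 p (vnth w i)) /\
  (forall i, (i < length w)%nat -> lps_adj p q (vnth w i) (vnth w (S i))) /\
  (forall i, (i < length w)%nat -> ~ coset_eq p q (vnth w (S (S i))) (vnth w i)).

Definition lps_girth (p q : Z) (g : nat) : Prop :=
  (exists w, nb_closed_walk p q w /\ length w = g) /\
  (forall w, nb_closed_walk p q w -> (g <= length w)%nat).

Definition same_oriented_cycle (p q : Z) (w1 w2 : list quat) : Prop :=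
  length w1 = length w2 /\
  exists r, forall i, (i < length w1)%nat ->
    coset_eq p q (vnth w1 (i + r)) (vnth w2 i).

Definition lps_kiss (p q : Z) (n : nat) : Prop :=
  exists g, lps_girth p q g /\
  exists W : list (list quat), length W = n /\
    (forall w, In w W -> nb_closed_walk p q w /\ length w = g) /\
    (forall i j, (i < n)%nat -> (j < n)%nat -> i <> j ->
        ~ same_oriented_cycle p q (nth i W []) (nth j W [])) /\
    (forall w, nb_closed_walk p q w -> length w = g ->
        exists w', In w' W /\ same_oriented_cycle p q w w').

Definition lps_nverts (p q : Z) (n : nat) : Prop :=
  exists l : list quat, length l = n /\
    (forall x, In x l -> inL2 p x) /\
    (forall i j, (i < n)%nat -> (j < n)%nat -> i <> j ->
        ~ coset_eq p q (nth i l (Quat 0 0 0 0)) (nth j l (Quat 0 0 0 0))) /\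
    (forall x, inL2 p x -> exists y, In y l /\ coset_eq p q x y).

Definition legendre_minus_one (p q : Z) : Prop :=
  ~ (q | p) /\ ~ (exists x, (q | x * x - p)).

(* Main.v *)
(** Primitive elements of [Lambda(2q)] have norm [p^(2h)] and are, up to sign, the quaternions
    [p^h - 2mq^2 + 2qv] with [v] purely imaginary of norm [m (p^h - mq^2)]. So the girth of
    [X^{p,q}] is [2h] for the least [h] admitting such a [v] with [m >= 1], and Legendre's theorem
    on [n = 3 mod 8] bounds [p^h] by a multiple of [q^2]. The shortest closed walks through a
    vertex are counted by the numbers [r_3 (m (p^h - mq^2))], which are at most [q^(1 + o(1))]; as
    the graph has [q^(3 + o(1))] vertices, the limit is 4/3 as soon as one of these [r_3] is at
    least [q^(1 - o(1))].

    Siegel's lower bound for [r_3] is replaced by an average over [q]. Conjugating one pure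
    quaternion of norm [n] by quaternions of norm [l l'], for primes [l] and [l'] modulo which [-n]
    is a square, gives many others, and a variance estimate shows that for all but few [x] below
    [X] a quarter of the primes [l] near [X^(1/2)] serve for [n = m (p^h - m x^2)]. The primes [q]
    with [(p/q) = -1] are numerous enough to contain an unexceptional one, because every sum of
    two squares that is a nonresidue modulo [p] has such a prime factor. *)

From mathcomp Require ssreflect ssrfun ssrbool eqtype ssrnat seq div prime bigop binomial path zify.
Require Import Defs.
From Stdlib Require Import ZArith Znumtheory List Reals Lia Lra ClassicalEpsilon Permutation.
Import ListNotations.

(** * Finite counting *)

(** Conjugation by single primes would give only about [X^(1/2)] representations. Two quaternions of
    norms [l] and [l'] that carry [v] to the same vector differ by an element commuting with [v],
    which is scalar as long as [l * l' < n], where [n] is about [X^2]; so far the primes could go up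
    to [X]. The variance estimate, however, controls a pair of primes only while [l * l'], the
    period of their joint behaviour, is below [X]. Primes near [X^(1/2)] satisfy this, and products
    of two of them fill the range that the commutation argument allows.

    Three counts stand in for deeper theorems. Legendre's theorem is proved with a number all of
    whose primes split, in place of a prime in an arithmetic progression. The primes [q] are shown
    to have density at least [x^(-1/k)] only at arbitrarily large scales [x], which suffices for a
    sequence. The order of the quotient group is not computed: it is bounded above by counting
    projective points modulo [q], and below by Cauchy-Schwarz from the same upper bound on words of
    [Lambda(2q)] that bounds the kissing number. *)

Definition dec (P : Prop) : bool :=
  if excluded_middle_informative P then true else false.

Lemma decE (P : Prop) : dec P = true <-> P.
Proof. unfold dec; destruct (excluded_middle_informative P); split; intros; auto; discriminate. Qed.

Lemma decF (P : Prop) : dec P = false <-> ~ P.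
Proof. unfold dec; destruct (excluded_middle_informative P); split; intros; auto; try discriminate; contradiction. Qed.

Definition zlen {A} (l : list A) : Z := Z.of_nat (length l).

Fixpoint zsum {A} (f : A -> Z) (l : list A) : Z :=
  match l with [] => 0 | x :: m => f x + zsum f m end.

Definition b2z (P : Prop) : Z := if dec P then 1 else 0.

Definition cnt {A} (P : A -> Prop) (l : list A) : Z := zsum (fun x => b2z (P x)) l.

Definition zr (a b : Z) : list Z :=
  map (fun i => a + Z.of_nat i) (seq 0 (Z.to_nat (b - a))).

Lemma b2z_true (P : Prop) : P -> b2z P = 1.
Proof. intro H; unfold b2z; rewrite (proj2 (decE P) H); auto. Qed.

Lemma b2z_false (P : Prop) : ~ P -> b2z P = 0.
Proof. intro H; unfold b2z; rewrite (proj2 (decF P) H); auto. Qed.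

Lemma b2z_bound (P : Prop) : 0 <= b2z P <= 1.
Proof. unfold b2z; destruct (dec P); lia. Qed.

Lemma b2z_iff (P Q : Prop) : (P <-> Q) -> b2z P = b2z Q.
Proof.
  intro H; destruct (classic P) as [p|p].
  - rewrite !b2z_true; tauto.
  - rewrite !b2z_false; tauto.
Qed.

Lemma in_zr (a b x : Z) : In x (zr a b) <-> a <= x < b.
Proof.
  unfold zr; rewrite in_map_iff; split.
  - intros [i [<- Hi]]; apply in_seq in Hi; lia.
  - intros H; exists (Z.to_nat (x - a)); rewrite in_seq; lia.
Qed.

Lemma nodup_zr (a b : Z) : NoDup (zr a b).
Proof.
  apply FinFun.Injective_map_NoDup; [intros i j; lia | apply seq_NoDup].
Qed.

Lemma zlen_zr (a b : Z) : a <= b -> zlen (zr a b) = b - a.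
Proof. intro; unfold zlen, zr; rewrite length_map, length_seq; lia. Qed.

Lemma zr_empty (a b : Z) : b <= a -> zr a b = [].
Proof. intro; unfold zr; replace (Z.to_nat (b - a)) with 0%nat by lia; reflexivity. Qed.

Lemma zr_split (a b c : Z) : a <= b <= c -> zr a c = zr a b ++ zr b c.
Proof.
  intro H; unfold zr.
  replace (Z.to_nat (c - a)) with (Z.to_nat (b - a) + Z.to_nat (c - b))%nat by lia.
  rewrite seq_app, map_app; f_equal.
  assert (Hg : forall m k, map (fun i => a + Z.of_nat i) (seq (Z.to_nat (b - a) + k) m) =
                           map (fun i => b + Z.of_nat i) (seq k m)).
  { induction m as [|m IH]; intro k; auto.
    cbn [seq map]; f_equal; [lia|].
    rewrite <- IH; f_equal; f_equal; lia. }
  rewrite <- Hg, Nat.add_0_r; reflexivity.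
Qed.

Lemma zr_snoc (a b : Z) : a <= b -> zr a (b + 1) = zr a b ++ [b].
Proof.
  intro H; rewrite (zr_split a b (b + 1)) by lia; f_equal.
  unfold zr; replace (Z.to_nat (b + 1 - b)) with 1%nat by lia; cbn; rewrite Z.add_0_r; auto.
Qed.

Lemma zlen_cons {A} (x : A) l : zlen (x :: l) = 1 + zlen l.
Proof. unfold zlen; cbn [length]; lia. Qed.
Lemma zlen_app {A} (l m : list A) : zlen (l ++ m) = zlen l + zlen m.
Proof. unfold zlen; rewrite length_app; lia. Qed.
Lemma zlen_map {A B} (f : A -> B) l : zlen (map f l) = zlen l.
Proof. unfold zlen; rewrite length_map; auto. Qed.
Lemma zlen_nonneg {A} (l : list A) : 0 <= zlen l.
Proof. unfold zlen; lia. Qed.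

Lemma zsum_app {A} (f : A -> Z) l m : zsum f (l ++ m) = zsum f l + zsum f m.
Proof. induction l; cbn in *; lia. Qed.

Lemma zsum_map {A B} (f : B -> Z) (g : A -> B) l : zsum f (map g l) = zsum (fun x => f (g x)) l.
Proof. induction l; cbn in *; lia. Qed.

Lemma zsum_ext {A} (f g : A -> Z) l : (forall x, In x l -> f x = g x) -> zsum f l = zsum g l.
Proof. induction l; cbn; intros; auto. rewrite H, IHl; auto. Qed.

Lemma zsum_le {A} (f g : A -> Z) l : (forall x, In x l -> f x <= g x) -> zsum f l <= zsum g l.
Proof.
  induction l as [|a l IH]; cbn; intros H; [lia|].
  assert (f a <= g a) by auto. assert (zsum f l <= zsum g l) by auto. lia.
Qed.

Lemma zsum_add {A} (f g : A -> Z) l : zsum (fun x => f x + g x) l = zsum f l + zsum g l.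
Proof. induction l; cbn in *; lia. Qed.

Lemma zsum_sub {A} (f g : A -> Z) l : zsum (fun x => f x - g x) l = zsum f l - zsum g l.
Proof. induction l; cbn in *; lia. Qed.

Lemma zsum_scale {A} (c : Z) (f : A -> Z) l : zsum (fun x => c * f x) l = c * zsum f l.
Proof. induction l; cbn in *; lia. Qed.

Lemma zsum_const {A} (c : Z) (l : list A) : zsum (fun _ => c) l = c * zlen l.
Proof. induction l; cbn [zsum]; rewrite ?zlen_cons; [cbn; lia|]. rewrite IHl; lia. Qed.

Lemma zsum_swap {A B} (f : A -> B -> Z) l m :
  zsum (fun x => zsum (f x) m) l = zsum (fun y => zsum (fun x => f x y) l) m.
Proof.
  induction l as [|a l IH]; cbn.
  - symmetry; induction m; cbn in *; lia.
  - rewrite IH; symmetry; apply (zsum_add (f a) (fun y => zsum (fun x => f x y) l)).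
Qed.

Lemma zsum_nonneg {A} (f : A -> Z) l : (forall x, In x l -> 0 <= f x) -> 0 <= zsum f l.
Proof.
  intro H; apply Z.le_trans with (zsum (fun _ => 0) l); [rewrite zsum_const; lia|].
  apply zsum_le; auto.
Qed.

Lemma zsum_bound {A} (f : A -> Z) c l : (forall x, In x l -> f x <= c) -> zsum f l <= c * zlen l.
Proof. intro H; rewrite <- zsum_const; apply zsum_le; auto. Qed.

Lemma zsum_zero {A} (f : A -> Z) l : (forall x, In x l -> f x = 0) -> zsum f l = 0.
Proof. intro H; rewrite (zsum_ext f (fun _ => 0)); auto; rewrite zsum_const; lia. Qed.

Lemma zsum_term {A} (f : A -> Z) l a :
  (forall x, In x l -> 0 <= f x) -> In a l -> f a <= zsum f l.
Proof.
  induction l as [|b l IH]; cbn; intros H [].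
  - subst; assert (0 <= zsum f l) by (apply zsum_nonneg; auto); lia.
  - assert (0 <= f b) by auto; assert (f a <= zsum f l) by auto; lia.
Qed.

Lemma zsum_perm {A} (f : A -> Z) l m : Permutation l m -> zsum f l = zsum f m.
Proof. induction 1; cbn in *; lia. Qed.

Lemma zsum_abs {A} (f : A -> Z) l : Z.abs (zsum f l) <= zsum (fun x => Z.abs (f x)) l.
Proof. induction l; cbn in *; lia. Qed.

Definition sel {A} (P : A -> Prop) (l : list A) : list A := filter (fun x => dec (P x)) l.

Lemma in_sel {A} (P : A -> Prop) l x : In x (sel P l) <-> In x l /\ P x.
Proof. unfold sel; rewrite filter_In, decE; tauto. Qed.

Lemma nodup_sel {A} (P : A -> Prop) l : NoDup l -> NoDup (sel P l).
Proof. apply NoDup_filter. Qed.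

Lemma cnt_sel {A} (P : A -> Prop) l : cnt P l = zlen (sel P l).
Proof.
  induction l; cbn; auto. unfold cnt, b2z in *; cbn. destruct (dec (P a)); rewrite ?zlen_cons;
  unfold sel in *; lia.
Qed.

Lemma cnt_nonneg {A} (P : A -> Prop) l : 0 <= cnt P l.
Proof. rewrite cnt_sel; apply zlen_nonneg. Qed.

Lemma cnt_iff {A} (P Q : A -> Prop) l : (forall x, In x l -> (P x <-> Q x)) -> cnt P l = cnt Q l.
Proof. intro H; apply zsum_ext; intros; apply b2z_iff; auto. Qed.

(** Cardinality bounds are phrased through duplicate-free lists, so that no enumeration of [P] has
    to be given in advance; [finite_enum] recovers one from any upper bound. *)
Definition atmost {A} (b : Z) (P : A -> Prop) : Prop :=
  forall l, NoDup l -> (forall x, In x l -> P x) -> zlen l <= b.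

Definition atleast {A} (b : Z) (P : A -> Prop) : Prop :=
  exists l, NoDup l /\ (forall x, In x l -> P x) /\ b <= zlen l.

Lemma atmost_list {A} (L : list A) (P : A -> Prop) :
  (forall x, P x -> In x L) -> atmost (zlen L) P.
Proof.
  intros H l Hl HP; unfold zlen.
  assert (length l <= length L)%nat by (apply NoDup_incl_length; auto; intros x Hx; auto). lia.
Qed.

Lemma atmost_le {A} b c (P Q : A -> Prop) :
  atmost b P -> b <= c -> (forall x, Q x -> P x) -> atmost c Q.
Proof. intros H Hb HQ l Hl Hx; assert (zlen l <= b) by (apply H; auto); lia. Qed.

Lemma atmost_nonneg {A} b (P : A -> Prop) : atmost b P -> 0 <= b.
Proof. intro H; apply (H []); [constructor | intros x []]. Qed.

Lemma nodup_map_inj {A B} (f : A -> B) l :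
  NoDup l -> (forall x y, In x l -> In y l -> f x = f y -> x = y) -> NoDup (map f l).
Proof.
  induction 1 as [|a l Ha Hl IH]; cbn; intro Hf; constructor.
  - rewrite in_map_iff; intros [y [Hy Hin]].
    assert (y = a) by (apply Hf; auto); subst; auto.
  - apply IH; intros; apply Hf; auto.
Qed.

Lemma atmost_inj {A B} (f : A -> B) b (P : A -> Prop) (Q : B -> Prop) :
  atmost b Q -> (forall x, P x -> Q (f x)) ->
  (forall x y, P x -> P y -> f x = f y -> x = y) -> atmost b P.
Proof.
  intros HQ HP Hi l Hl Hx; rewrite <- (zlen_map f).
  apply HQ; [apply nodup_map_inj; auto|].
  intros y Hy; apply in_map_iff in Hy; destruct Hy as [x [<- Hy]]; auto.
Qed.

(** Double counting: every listed element satisfies at least one [Q i], and the sum of the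
    indicators is then taken over the elements first. *)
Lemma atmost_cover {A I} (L : list I) (b : I -> Z) (Q : I -> A -> Prop) (P : A -> Prop) :
  (forall x, P x -> exists i, In i L /\ Q i x) -> (forall i, In i L -> atmost (b i) (Q i)) ->
  atmost (zsum b L) P.
Proof.
  intros Hc Hb l Hl HP.
  apply Z.le_trans with (zsum (fun x => zsum (fun i => b2z (Q i x)) L) l).
  - replace (zlen l) with (zsum (fun _ => 1) l) by (rewrite zsum_const; lia).
    apply zsum_le; intros x Hx; destruct (Hc x) as [i [Hi HQ]]; auto.
    rewrite <- (b2z_true (Q i x)) by auto.
    apply (zsum_term (fun i => b2z (Q i x))); auto; intros; apply b2z_bound.
  - rewrite zsum_swap; apply zsum_le; intros i Hi.
    fold (cnt (Q i) l); rewrite cnt_sel; apply (Hb i Hi); [apply nodup_sel; auto|].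
    intros x Hx; apply in_sel in Hx; tauto.
Qed.

Lemma atmost_fiber {A B} (f : A -> B) (m k : Z) (P : A -> Prop) (Q : B -> Prop) :
  atmost m Q -> (forall x, P x -> Q (f x)) -> 0 <= k ->
  (forall y, Q y -> atmost k (fun x => P x /\ f x = y)) -> atmost (m * k) P.
Proof.
  intros HQ HP Hk Hf l Hl Hx.
  assert (Hd : forall x y : B, {x = y} + {x <> y}) by (intros; apply excluded_middle_informative).
  set (L := nodup Hd (map f l)).
  assert (HL : zlen L <= m).
  { apply HQ; [apply NoDup_nodup|]. intros y Hy; apply nodup_In in Hy.
    apply in_map_iff in Hy; destruct Hy as [x [<- Hy]]; auto. }
  apply Z.le_trans with (zsum (fun _ => k) L).
  - apply (atmost_cover L (fun _ => k) (fun y x => P x /\ f x = y) (fun x => In x l)); auto.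
    + intros x Hxl; exists (f x); split; auto. apply nodup_In, in_map; auto.
    + intros y Hy; apply Hf. apply nodup_In, in_map_iff in Hy; destruct Hy as [x [<- Hy]]; auto.
  - rewrite zsum_const; nia.
Qed.

(** A duplicate-free list in [P] is either complete or can be lengthened, and the bound stops the
    lengthening. *)
Lemma finite_enum {A} b (P : A -> Prop) : atmost b P ->
  exists L, NoDup L /\ forall x, In x L <-> P x.
Proof.
  intro H.
  assert (Hn : forall n : nat, (exists L, NoDup L /\ forall x, In x L <-> P x) \/
     exists l : list A, NoDup l /\ (forall x, In x l -> P x) /\ length l = n).
  { induction n as [|n [IH|[l [Hl [HP Hn]]]]]; auto.
    - right; exists []; repeat split; [constructor | intros x []].
    - destruct (classic (exists x, P x /\ ~ In x l)) as [[x [Hx Hi]]|Hno].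
      + right; exists (x :: l); repeat split.
        * constructor; auto.
        * intros y [<-|Hy]; auto.
        * cbn; lia.
      + left; exists l; split; auto. intro x; split; auto.
        intro Hx; destruct (classic (In x l)); auto. exfalso; eauto. }
  destruct (Hn (S (Z.to_nat b))) as [|[l [Hl [HP Hlen]]]]; auto.
  exfalso; assert (zlen l <= b) by (apply H; auto); unfold zlen in *; lia.
Qed.

Lemma atleast_atmost {A} b c (P : A -> Prop) : atleast b P -> atmost c P -> b <= c.
Proof. intros [l [Hl [HP Hb]]] H; assert (zlen l <= c) by (apply H; auto); lia. Qed.

Lemma atleast_inj {A B} (f : A -> B) b (P : A -> Prop) (Q : B -> Prop) :
  atleast b P -> (forall x, P x -> Q (f x)) ->
  (forall x y, P x -> P y -> f x = f y -> x = y) -> atleast b Q.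
Proof.
  intros [l [Hl [HP Hb]]] HQ Hi; exists (map f l); split; [|split].
  - apply nodup_map_inj; auto.
  - intros y Hy; apply in_map_iff in Hy; destruct Hy as [x [<- Hy]]; auto.
  - rewrite zlen_map; auto.
Qed.

Lemma pair_list {A B} (l : list A) (m : list B) : zlen (list_prod l m) = zlen l * zlen m.
Proof. unfold zlen; rewrite length_prod; lia. Qed.

Lemma nodup_prod {A B} (l : list A) (m : list B) : NoDup l -> NoDup m -> NoDup (list_prod l m).
Proof.
  induction 1 as [|a l Ha Hl IH]; cbn; intro Hm; [constructor|].
  apply NoDup_app; auto.
  - apply FinFun.Injective_map_NoDup; auto. intros x y; congruence.
  - intros [x y] Hx Hy; apply in_map_iff in Hx; destruct Hx as [z [Hz _]].
    apply in_prod_iff in Hy; injection Hz; intros; subst; tauto.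
Qed.

Lemma atmost_prod {A B} b c (P : A -> Prop) (Q : B -> Prop) :
  atmost b P -> atmost c Q -> atmost (b * c) (fun z => P (fst z) /\ Q (snd z)).
Proof.
  intros HP HQ; apply (atmost_fiber fst b c _ P); auto; [tauto | eapply atmost_nonneg; eauto |].
  intros y Hy; apply (atmost_inj snd c _ Q); auto; [tauto|].
  intros [u v] [u' v']; cbn; intuition congruence.
Qed.

Lemma atmost_union {A} b c (P Q R : A -> Prop) :
  atmost b P -> atmost c Q -> (forall x, R x -> P x \/ Q x) -> atmost (b + c) R.
Proof.
  intros HP HQ HR.
  replace (b + c) with (zsum (fun i : bool => if i then b else c) [true; false]) by (cbn; lia).
  apply (atmost_cover [true; false] _ (fun (i : bool) x => if i then P x else Q x)).
  - intros x Hx; destruct (HR x Hx); [exists true|exists false]; cbn; auto.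
  - intros [|] _; auto.
Qed.

Lemma atmost_interval (a b : Z) : a <= b -> atmost (b - a) (fun x => a <= x < b).
Proof. intro; rewrite <- zlen_zr by lia; apply atmost_list; intros; apply in_zr; auto. Qed.

(** * Integral quaternions *)

Definition q1 : quat := Quat 1 0 0 0.

Definition qdvd (l : Z) (x : quat) : Prop := exists y, x = qscale l y.

Ltac qring :=
  repeat match goal with x : quat |- _ => destruct x end;
  unfold qmul, qconj, qscale, qnorm, q1 in *; cbn [Defs.x0 Defs.x1 Defs.x2 Defs.x3] in *;
  try (f_equal; ring).

Lemma qmulA x y z : qmul x (qmul y z) = qmul (qmul x y) z.
Proof. qring. Qed.
Lemma qnorm_mul x y : qnorm (qmul x y) = qnorm x * qnorm y.
Proof. qring. ring. Qed.
Lemma qnorm_conj x : qnorm (qconj x) = qnorm x.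
Proof. qring. Qed.
Lemma qnorm_scale c x : qnorm (qscale c x) = c * c * qnorm x.
Proof. qring. ring. Qed.
Lemma qconj_mul x y : qconj (qmul x y) = qmul (qconj y) (qconj x).
Proof. qring. Qed.
Lemma qconjK x : qconj (qconj x) = x.
Proof. qring. Qed.
Lemma qconj_scale c x : qconj (qscale c x) = qscale c (qconj x).
Proof. qring. Qed.
Lemma qmul_conj_l x y : qmul (qconj x) (qmul x y) = qscale (qnorm x) y.
Proof. qring. Qed.
Lemma qmul_conj_r x y : qmul x (qmul (qconj x) y) = qscale (qnorm x) y.
Proof. qring. Qed.
Lemma qmul_scale_l c x y : qmul (qscale c x) y = qscale c (qmul x y).
Proof. qring. Qed.
Lemma qmul_scale_r c x y : qmul x (qscale c y) = qscale c (qmul x y).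
Proof. qring. Qed.
Lemma qscale_scale c d x : qscale c (qscale d x) = qscale (c * d) x.
Proof. qring. Qed.
Lemma qscale_1 x : qscale 1 x = x.
Proof. destruct x; unfold qscale; cbn [Defs.x0 Defs.x1 Defs.x2 Defs.x3]; f_equal; ring. Qed.
Lemma qmul_1_l x : qmul q1 x = x.
Proof. destruct x; unfold qmul, q1; cbn [Defs.x0 Defs.x1 Defs.x2 Defs.x3]; f_equal; ring. Qed.
Lemma qmul_1_r x : qmul x q1 = x.
Proof. destruct x; unfold qmul, q1; cbn [Defs.x0 Defs.x1 Defs.x2 Defs.x3]; f_equal; ring. Qed.
Lemma qnorm_nonneg x : 0 <= qnorm x.
Proof. unfold qnorm; nia. Qed.

Lemma quat_eq x y : x0 x = x0 y -> x1 x = x1 y -> x2 x = x2 y -> x3 x = x3 y -> x = y.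
Proof. destruct x, y; cbn; congruence. Qed.

Lemma qscale_inj c x y : c <> 0 -> qscale c x = qscale c y -> x = y.
Proof.
  intros Hc H; destruct x, y; unfold qscale in H; cbn in H; injection H; intros.
  f_equal; nia.
Qed.

Lemma qdvd_comp l x : qdvd l x <-> ((l | x0 x) /\ (l | x1 x) /\ (l | x2 x) /\ (l | x3 x)).
Proof.
  split.
  - intros [y ->]; destruct y; cbn; repeat split; apply Z.divide_factor_l.
  - intros [[a Ha] [[b Hb] [[c Hc] [d Hd]]]]; exists (Quat a b c d).
    apply quat_eq; cbn; lia.
Qed.

Lemma qdvd_mul_r l x y : qdvd l x -> qdvd l (qmul x y).
Proof. intros [z ->]; exists (qmul z y); apply qmul_scale_l. Qed.
Lemma qdvd_mul_l l x y : qdvd l y -> qdvd l (qmul x y).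
Proof. intros [z ->]; exists (qmul x z); apply qmul_scale_r. Qed.
Lemma qdvd_conj l x : qdvd l x -> qdvd l (qconj x).
Proof. intros [z ->]; exists (qconj z); apply qconj_scale. Qed.
Lemma qdvd_scale l x : qdvd l (qscale l x).
Proof. exists x; auto. Qed.
Lemma qdvd_scale_mono l c x : qdvd l x -> qdvd l (qscale c x).
Proof. intros [z ->]; exists (qscale c z); rewrite !qscale_scale; f_equal; lia. Qed.

Lemma qdvd_gauss l c x : rel_prime l c -> qdvd l (qscale c x) -> qdvd l x.
Proof.
  intros Hr H; apply qdvd_comp in H; apply qdvd_comp; destruct x; cbn in *.
  repeat split; apply Gauss with c; tauto.
Qed.

Definition centered (m a : Z) : Z := (a + m / 2) mod m - m / 2.

Lemma centered_spec m a : 0 < m ->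
  (m | a - centered m a) /\ - (m / 2) <= centered m a <= m / 2 /\ 2 * (m / 2) <= m.
Proof.
  intro Hm; unfold centered.
  pose proof (Z.mod_pos_bound (a + m / 2) m Hm).
  pose proof (Z_div_mod_eq_full (a + m / 2) m).
  pose proof (Z_div_mod_eq_full m 2). pose proof (Z.mod_pos_bound m 2).
  split; [exists ((a + m / 2) / m); nia|]. lia.
Qed.

Lemma centered_odd m a : 0 < m -> Z.odd m = true ->
  - (m - 1) <= 2 * centered m a <= m - 1.
Proof.
  intros Hm Ho; destruct (centered_spec m a Hm) as [_ [H1 _]].
  apply Z.odd_spec in Ho; destruct Ho as [k ->].
  assert ((2 * k + 1) / 2 = k) by (rewrite Z.mul_comm, Z.div_add_l by lia; cbn; lia). lia.
Qed.

Definition qcentered (m : Z) (x : quat) : quat :=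
  Quat (centered m (x0 x)) (centered m (x1 x)) (centered m (x2 x)) (centered m (x3 x)).

Lemma qcentered_spec m x : 0 < m -> exists t, x = Quat
   (x0 (qcentered m x) + m * x0 t) (x1 (qcentered m x) + m * x1 t)
   (x2 (qcentered m x) + m * x2 t) (x3 (qcentered m x) + m * x3 t).
Proof.
  intro Hm.
  destruct (centered_spec m (x0 x) Hm) as [[a Ha] _].
  destruct (centered_spec m (x1 x) Hm) as [[b Hb] _].
  destruct (centered_spec m (x2 x) Hm) as [[c Hc] _].
  destruct (centered_spec m (x3 x) Hm) as [[d Hd] _].
  exists (Quat a b c d); apply quat_eq; cbn; lia.
Qed.

(** For odd [m] each coordinate is at most [(m - 1) / 2], which gives the strict inequality. For
    even [m] the norm can reach [m * m], and this is why the descent treats even [m] separately. *)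
Lemma qcentered_norm m x : 0 < m -> Z.odd m = true -> qnorm (qcentered m x) < m * m.
Proof.
  intros Hm Ho; unfold qnorm, qcentered; cbn [Defs.x0 Defs.x1 Defs.x2 Defs.x3].
  assert (H : forall a, 4 * (centered m a * centered m a) <= (m - 1) * (m - 1)).
  { intro a; pose proof (centered_odd m a Hm Ho). nia. }
  pose proof (H (x0 x)); pose proof (H (x1 x)); pose proof (H (x2 x)); pose proof (H (x3 x)). nia.
Qed.

Lemma sq_dvd_prime l a : prime l -> (l | a * a) -> (l | a).
Proof. intros Hl H; destruct (prime_mult l Hl a a H); auto. Qed.

Lemma parity_sq a : (a * a) mod 2 = a mod 2.
Proof.
  rewrite Z.mul_mod by lia. pose proof (Z.mod_pos_bound a 2).
  assert (a mod 2 = 0 \/ a mod 2 = 1) as [-> | ->] by lia; reflexivity.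
Qed.

(** One step of Lagrange's descent, carried out inside the right ideal
    [{y | l divides conj x * y}]. *)
Lemma ideal_descent l x y m : prime l -> qdvd l (qmul (qconj x) y) -> qnorm y = m * l ->
  1 < m < l ->
  exists y' m', qdvd l (qmul (qconj x) y') /\ qnorm y' = m' * l /\ 0 < m' < m.
Proof.
  intros Hl HI HN Hm.
  destruct (Z.odd m) eqn:Ho.
  - set (w := qcentered m y).
    destruct (qcentered_spec m y) as [t Ht]; [lia|]. fold w in Ht.
    assert (Hw : qnorm w < m * m) by (apply qcentered_norm; auto; lia).
    assert (exists m', qnorm w = m * m') as [m' Hm'].
    { exists (l - m * qnorm t - 2 * (x0 w * x0 t + x1 w * x1 t + x2 w * x2 t + x3 w * x3 t)).
      assert (HN' := HN). rewrite Ht in HN'. unfold qnorm in *; cbn [Defs.x0 Defs.x1 Defs.x2 Defs.x3] in *. nia. }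
    (* If [m' = 0], then [m] divides every coordinate of [y], hence [m] divides [l], against
       [1 < m < l]. *)
    assert (Hpos : 0 < m').
    { pose proof (qnorm_nonneg w).
      destruct (Z.eq_dec m' 0) as [->|]; [|nia]. exfalso.
      assert (Hw0 : qnorm w = 0) by lia.
      assert (x0 w = 0 /\ x1 w = 0 /\ x2 w = 0 /\ x3 w = 0) as (Z0 & Z1 & Z2 & Z3)
        by (unfold qnorm in Hw0; repeat split; nia).
      rewrite Z0, Z1, Z2, Z3 in Ht.
      assert (m * (m * qnorm t) = m * l).
      { rewrite Z.mul_assoc, <- HN, Ht. unfold qnorm; cbn [Defs.x0 Defs.x1 Defs.x2 Defs.x3]; ring. }
      assert (m * qnorm t = l) by nia.
      assert (Hd : (m | l)) by (exists (qnorm t); lia).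
      destruct (prime_divisors l Hl m Hd) as [|[|[|]]]; lia. }
    (* Modulo [m], [y] equals [w], so [y * conj w] is the scalar [N(w)], itself divisible by [m].
       Right multiplication stays in the right ideal. *)
    assert (exists y', qmul y (qconj w) = qscale m y') as [y' Hy'].
    { exists (Quat (m' + (x0 (qmul t (qconj w)))) (x1 (qmul t (qconj w)))
              (x2 (qmul t (qconj w))) (x3 (qmul t (qconj w)))).
      rewrite Ht; unfold qnorm in Hm'; destruct w, t; unfold qmul, qconj, qscale in *;
      cbn [Defs.x0 Defs.x1 Defs.x2 Defs.x3] in *; f_equal; nia. }
    exists y', m'; repeat split; auto; try nia.
    + apply qdvd_gauss with m.
      * apply rel_prime_sym, rel_prime_le_prime; auto; lia.
      * rewrite <- qmul_scale_r, <- Hy', qmulA; apply qdvd_mul_r; auto.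
    + assert (H := f_equal qnorm Hy'); rewrite qnorm_mul, qnorm_conj, qnorm_scale, HN, Hm' in H.
      nia.
  - assert (Hev : exists k, m = 2 * k).
    { exists (m / 2); rewrite Zodd_mod in Ho; pose proof (Z_div_mod_eq_full m 2).
      pose proof (Z.mod_pos_bound m 2). assert (m mod 2 <> 1) by (intro He; rewrite He in Ho; discriminate). lia. }
    destruct Hev as [k ->].
    assert (Hsum : (x0 y + x1 y + x2 y + x3 y) mod 2 = 0).
    { pose proof (parity_sq (x0 y)); pose proof (parity_sq (x1 y)).
      pose proof (parity_sq (x2 y)); pose proof (parity_sq (x3 y)).
      assert ((x0 y * x0 y + x1 y * x1 y + x2 y * x2 y + x3 y * x3 y) mod 2 = 0).
      { fold (qnorm y); rewrite HN. rewrite <- Z.mul_assoc, Z.mul_comm. apply Z.mod_mul; lia. }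
      Z.div_mod_to_equations; lia. }
    (* Once the coordinates are paired by parity, the product of [y] with one of [1 + i], [1 + j],
       [1 + k] is divisible by 2; halving it brings the norm from [m * l] to [(m / 2) * l]. *)
    assert (Hh : exists u y', qmul y u = qscale 2 y' /\ qnorm u = 2).
    { assert (Hc : ((x0 y - x1 y) mod 2 = 0 /\ (x2 y - x3 y) mod 2 = 0) \/
                   ((x0 y - x2 y) mod 2 = 0 /\ (x1 y - x3 y) mod 2 = 0) \/
                   ((x0 y - x3 y) mod 2 = 0 /\ (x1 y - x2 y) mod 2 = 0))
        by (Z.div_mod_to_equations; lia).
      destruct Hc as [[A B]|[[A B]|[A B]]];
        apply Z.mod_divide in A; try lia; apply Z.mod_divide in B; try lia;
        destruct A as [a A]; destruct B as [b B].
      - exists (Quat 1 1 0 0), (Quat a (a + x1 y) (b + x3 y) (- b)).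
        split; [|reflexivity]. apply quat_eq; cbn [qmul qscale Defs.x0 Defs.x1 Defs.x2 Defs.x3]; lia.
      - exists (Quat 1 0 1 0), (Quat a (- (b) * -1 ) (a + x2 y) (b + x3 y)).
        split; [|reflexivity]. apply quat_eq; cbn [qmul qscale Defs.x0 Defs.x1 Defs.x2 Defs.x3]; lia.
      - exists (Quat 1 0 0 1), (Quat a (b + x2 y) (- b) (a + x3 y)).
        split; [|reflexivity]. apply quat_eq; cbn [qmul qscale Defs.x0 Defs.x1 Defs.x2 Defs.x3]; lia. }
    destruct Hh as [u [y' [Hu Nu]]].
    exists y', k; repeat split; try lia.
    + apply qdvd_gauss with 2.
      * apply rel_prime_sym, rel_prime_le_prime; auto; lia.
      * rewrite <- qmul_scale_r, <- Hu, qmulA; apply qdvd_mul_r; auto.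
    + assert (H := f_equal qnorm Hu); rewrite qnorm_mul, qnorm_scale, HN, Nu in H. nia.
Qed.

Lemma ideal_generator l x : prime l -> forall n, (0 <= n)%nat -> forall y m,
  (Z.to_nat m < n)%nat -> qdvd l (qmul (qconj x) y) -> qnorm y = m * l -> 0 < m < l ->
  exists s, qdvd l (qmul (qconj x) s) /\ qnorm s = l.
Proof.
  intros Hl n _; induction n as [|n IH]; intros y m Hn HI HN Hm; [lia|].
  destruct (Z.eq_dec m 1) as [->|].
  - exists y; split; auto; lia.
  - destruct (ideal_descent l x y m) as (y' & m' & H1 & H2 & H3); auto; [lia|].
    apply (IH y' m'); auto; lia.
Qed.

(** The Lipschitz order is not Euclidean; descent takes the place of division. Reduced modulo [l],
    [x] lies in the right ideal [{y | l divides conj x * y}] and has norm [m * l] with [m < l]. The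
    descent finds [s] of norm [l] in that ideal, and [l] divides [conj s * x], which means
    [x = s * u]. *)
Lemma quat_factor l x : prime l -> Z.odd l = true -> (l | qnorm x) -> ~ qdvd l x ->
  exists a u, x = qmul a u /\ qnorm a = l.
Proof.
  intros Hl Ho HN Hx.
  pose proof (prime_ge_2 l Hl).
  set (w := qcentered l x).
  destruct (qcentered_spec l x) as [t Ht]; [lia|]. fold w in Ht.
  assert (Hw : qnorm w < l * l) by (apply qcentered_norm; auto; lia).
  destruct HN as [k Hk].
  assert (exists m, qnorm w = m * l) as [m Hm].
  { exists (k - l * qnorm t - 2 * (x0 w * x0 t + x1 w * x1 t + x2 w * x2 t + x3 w * x3 t)).
    assert (Hk' := Hk). rewrite Ht in Hk'. unfold qnorm in *; cbn [Defs.x0 Defs.x1 Defs.x2 Defs.x3] in *. nia. }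
  assert (HI : qdvd l (qmul (qconj x) w)).
  { exists (Quat (k - x0 (qmul (qconj x) t)) (- x1 (qmul (qconj x) t))
      (- x2 (qmul (qconj x) t)) (- x3 (qmul (qconj x) t))).
    assert (Hk' : qmul (qconj x) x = Quat (k * l) 0 0 0).
    { rewrite <- Hk; qring. }
    assert (E0 : x0 (qmul (qconj x) x) = k * l) by (rewrite Hk'; auto).
    assert (E1 : x1 (qmul (qconj x) x) = 0) by (rewrite Hk'; auto).
    assert (E2 : x2 (qmul (qconj x) x) = 0) by (rewrite Hk'; auto).
    assert (E3 : x3 (qmul (qconj x) x) = 0) by (rewrite Hk'; auto).
    assert (Y0 : x0 x = x0 w + l * x0 t) by (rewrite Ht at 1; auto).
    assert (Y1 : x1 x = x1 w + l * x1 t) by (rewrite Ht at 1; auto).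
    assert (Y2 : x2 x = x2 w + l * x2 t) by (rewrite Ht at 1; auto).
    assert (Y3 : x3 x = x3 w + l * x3 t) by (rewrite Ht at 1; auto).
    clear Ht Hk' Hk Hx Hm Hw. clearbody w.
    destruct x as [a b c d], w as [e f g h], t as [i j o r]; unfold qmul, qconj, qscale in *;
    cbn [Defs.x0 Defs.x1 Defs.x2 Defs.x3] in *.
    assert (e = a - l * i) by lia. assert (f = b - l * j) by lia.
    assert (g = c - l * o) by lia. assert (h = d - l * r) by lia. subst.
    f_equal; lia. }
  assert (0 < m).
  { pose proof (qnorm_nonneg w). destruct (Z.eq_dec m 0) as [->|]; [|nia]. exfalso; apply Hx.
    assert (x0 w = 0 /\ x1 w = 0 /\ x2 w = 0 /\ x3 w = 0) as (Z0 & Z1 & Z2 & Z3)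
      by (unfold qnorm in Hm; repeat split; nia).
    rewrite Z0, Z1, Z2, Z3 in Ht. exists t; rewrite Ht; unfold qscale; f_equal; lia. }
  destruct (ideal_generator l x Hl (S (Z.to_nat m)) (Nat.le_0_l _) w m) as [s [Hs Ns]]; auto; [nia|].
  apply qdvd_conj in Hs. rewrite qconj_mul, qconjK in Hs. destruct Hs as [u Hu].
  exists s, u; split; auto.
  apply (qscale_inj l); [lia|].
  rewrite <- qmul_scale_r, <- Hu, qmul_conj_r, Ns; auto.
Qed.

(** This is [y x y = tr(y x) y - N(y) conj x]. Modulo [N(y)], sandwiching by [y] only rescales
    [y]. *)
Lemma sandwich y x : qmul y (qmul x y) =
  Quat (2 * x0 (qmul y x) * x0 y - qnorm y * x0 x) (2 * x0 (qmul y x) * x1 y + qnorm y * x1 x)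
       (2 * x0 (qmul y x) * x2 y + qnorm y * x2 x) (2 * x0 (qmul y x) * x3 y + qnorm y * x3 x).
Proof. qring. Qed.

(** As [l] does not divide [w], some [y] makes the trace [tau] of [w * y] prime to [l]. By
    [sandwich], [w y a = a (u y) a] is [tau a] modulo [l]; since [l] divides [conj b * w], it
    divides [tau (conj b * a)]. *)
Lemma left_factor_unique l w a b u u' : prime l -> Z.odd l = true -> ~ qdvd l w ->
  qnorm a = l -> qnorm b = l -> w = qmul a u -> w = qmul b u' -> qdvd l (qmul (qconj b) a).
Proof.
  intros Hl Ho Hw Na Nb Ha Hb.
  pose proof (prime_ge_2 l Hl).
  assert (exists y, ~ (l | 2 * x0 (qmul w y))) as [y Hy].
  { apply NNPP; intro Hn. apply Hw. apply qdvd_comp.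
    assert (Hall : forall y, (l | x0 (qmul w y))).
    { intro y. assert (H1 : (l | 2 * x0 (qmul w y))) by (apply NNPP; intro; apply Hn; exists y; auto).
      apply Gauss with 2; auto. apply rel_prime_sym, rel_prime_le_prime; auto.
      apply Z.odd_spec in Ho; destruct Ho; lia. }
    pose proof (Hall (Quat 1 0 0 0)) as A. pose proof (Hall (Quat 0 1 0 0)) as B.
    pose proof (Hall (Quat 0 0 1 0)) as C. pose proof (Hall (Quat 0 0 0 1)) as D.
    destruct w; cbn in *.
    repeat split; [destruct A as [k Hk]; exists k | destruct B as [k Hk]; exists (-k) |
     destruct C as [k Hk]; exists (-k) | destruct D as [k Hk]; exists (-k)]; lia. }
  set (tau := 2 * x0 (qmul w y)).
  assert (Hrp : rel_prime l tau) by (apply prime_rel_prime; auto).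
  apply qdvd_gauss with tau; auto.
  assert (Htau : tau = 2 * x0 (qmul a (qmul u y))) by (unfold tau; rewrite Ha, qmulA; auto).
  assert (E : exists r, qscale tau a = Quat (x0 (qmul w (qmul y a)) + l * x0 r)
     (x1 (qmul w (qmul y a)) + l * x1 r) (x2 (qmul w (qmul y a)) + l * x2 r)
     (x3 (qmul w (qmul y a)) + l * x3 r)).
  { exists (qconj (qmul u y)).
    rewrite Ha, <- qmulA, (qmulA u y a), (sandwich a (qmul u y)), Na, <- Htau.
    apply quat_eq; cbn; ring. }
  destruct E as [r Hr].
  exists (Quat (x0 (qmul u' (qmul y a)) + x0 (qmul (qconj b) r))
    (x1 (qmul u' (qmul y a)) + x1 (qmul (qconj b) r))
    (x2 (qmul u' (qmul y a)) + x2 (qmul (qconj b) r))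
    (x3 (qmul u' (qmul y a)) + x3 (qmul (qconj b) r))).
  rewrite <- qmul_scale_r, Hr.
  assert (Hw' : qmul w (qmul y a) = qmul b (qmul u' (qmul y a))) by (rewrite Hb, <- !qmulA; auto).
  rewrite Hw'. set (z := qmul u' (qmul y a)).
  assert (Hz := qmul_conj_l b z). rewrite Nb in Hz.
  assert (H0 := f_equal x0 Hz); assert (H1 := f_equal x1 Hz);
  assert (H2 := f_equal x2 Hz); assert (H3 := f_equal x3 Hz).
  clear - H0 H1 H2 H3. clearbody z. destruct b, z, r; unfold qmul, qconj, qscale in *;
  cbn [Defs.x0 Defs.x1 Defs.x2 Defs.x3] in *. f_equal; lia.
Qed.

(** * Words in the generators *)

Definition odd1 (x : quat) : Prop :=
  Z.odd (x0 x) = true /\ (2 | x1 x) /\ (2 | x2 x) /\ (2 | x3 x).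

Fixpoint wprod (ws : list quat) : quat :=
  match ws with [] => q1 | s :: r => qmul s (wprod r) end.

Lemma odd1_intro a b c d : odd1 (Quat (2 * a + 1) (2 * b) (2 * c) (2 * d)).
Proof.
  repeat split; cbn [x0 x1 x2 x3]; try apply Z.divide_factor_l.
  apply Z.odd_spec; exists a; lia.
Qed.

Lemma odd1_elim x : odd1 x -> exists a b c d, x = Quat (2 * a + 1) (2 * b) (2 * c) (2 * d).
Proof.
  intros [H [[b Hb] [[c Hc] [d Hd]]]]. apply Z.odd_spec in H; destruct H as [a Ha].
  exists a, b, c, d. apply quat_eq; cbn [Defs.x0 Defs.x1 Defs.x2 Defs.x3]; lia.
Qed.

Lemma odd1_mul x y : odd1 x -> odd1 y -> odd1 (qmul x y).
Proof.
  intros Hx Hy; apply odd1_elim in Hx, Hy.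
  destruct Hx as (a & b & c & d & ->), Hy as (e & f & g & h & ->).
  repeat split; cbn [qmul Defs.x0 Defs.x1 Defs.x2 Defs.x3].
  - apply Z.odd_spec; eexists (2 * a * e + a + e - 2 * b * f - 2 * c * g - 2 * d * h); ring.
  - eexists ((2*a+1)*f + b*(2*e+1) + 2*c*h - 2*d*g); ring.
  - eexists ((2*a+1)*g - 2*b*h + c*(2*e+1) + 2*d*f); ring.
  - eexists ((2*a+1)*h + 2*b*g - 2*c*f + d*(2*e+1)); ring.
Qed.

Lemma odd1_conj x : odd1 x -> odd1 (qconj x).
Proof.
  intros (H & H1 & H2 & H3); repeat split; cbn; auto; apply Z.divide_opp_r; auto.
Qed.

Lemma odd1_scale_inv p x : Z.odd p = true -> odd1 (qscale p x) -> odd1 x.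
Proof.
  intros Hp (H & H1 & H2 & H3); cbn in *.
  rewrite Z.odd_mul, Hp in H; cbn in H.
  assert (R : rel_prime 2 p).
  { apply prime_rel_prime; [apply prime_2|]. intros [k Hk]; rewrite Hk, Z.odd_mul in Hp.
    rewrite Bool.andb_comm in Hp; discriminate. }
  repeat split; auto; apply Gauss with p; auto.
Qed.

Lemma odd1_q1 : odd1 q1.
Proof. apply (odd1_intro 0 0 0 0). Qed.

Lemma inS_odd1 p s : inS p s -> odd1 s.
Proof. intros [[H [H1 [H2 [H3 _]]]] _]; repeat split; auto. Qed.
Lemma inS_norm p s : inS p s -> qnorm s = p.
Proof. intros [_ [H _]]; auto. Qed.
Lemma inS_pos p s : inS p s -> 0 < x0 s.
Proof. intros [_ [_ [H _]]]; auto. Qed.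
Lemma inS_intro p s : odd1 s -> qnorm s = p -> 0 < x0 s -> inS p s.
Proof.
  intros (H & H1 & H2 & H3) HN Hp; repeat split; auto.
  exists 1%nat; rewrite HN; cbn; lia.
Qed.
Lemma inS_conj p s : inS p s -> inS p (qconj s).
Proof.
  intro H; apply inS_intro; [apply odd1_conj; eapply inS_odd1; eauto | | apply (inS_pos _ _ H)].
  rewrite qnorm_conj; apply inS_norm; auto.
Qed.

Lemma inL2_intro p x m : odd1 x -> qnorm x = p ^ Z.of_nat m -> inL2 p x.
Proof. intros (H & H1 & H2 & H3) HN; repeat split; eauto. Qed.
Lemma inL2_odd1 p x : inL2 p x -> odd1 x.
Proof. intros (H & H1 & H2 & H3 & _); repeat split; auto. Qed.

Lemma prime1_odd p : p mod 4 = 1 -> Z.odd p = true.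
Proof. intro H; apply Z.odd_spec; exists (2 * (p / 4)); Z.div_mod_to_equations; lia. Qed.

(** A Lipschitz quaternion of norm 1 mod 4 has exactly one odd coordinate. *)
Lemma unit_normalize a : qnorm a mod 4 = 1 ->
  exists e, qnorm e = 1 /\ odd1 (qmul a e) /\ 0 < x0 (qmul a e).
Proof.
  intro H. destruct a as [a b c d]; unfold qnorm in H; cbn in H.
  assert (S : forall x, exists k r, x = 2 * k + r /\ (r = 0 \/ r = 1)).
  { intro x; exists (x / 2), (x mod 2); Z.div_mod_to_equations; lia. }
  destruct (S a) as (a' & r0 & -> & R0). destruct (S b) as (b' & r1 & -> & R1).
  destruct (S c) as (c' & r2 & -> & R2). destruct (S d) as (d' & r3 & -> & R3).
  assert (Hr : (r0 * r0 + r1 * r1 + r2 * r2 + r3 * r3) mod 4 = 1).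
  { rewrite <- H.
    match goal with |- _ = ?X mod 4 => replace X with
      (r0 * r0 + r1 * r1 + r2 * r2 + r3 * r3 +
        (a' * a' + a' * r0 + b' * b' + b' * r1 + c' * c' + c' * r2 + d' * d' + d' * r3) * 4) by ring end.
    rewrite Z.mod_add; lia. }
  assert (Hsgn : forall e a, qnorm e = 1 -> odd1 (qmul a e) ->
    exists e, qnorm e = 1 /\ odd1 (qmul a e) /\ 0 < x0 (qmul a e)).
  { intros e z He Ho. destruct (Z_lt_le_dec 0 (x0 (qmul z e))).
    - exists e; auto.
    - exists (qscale (-1) e); rewrite qnorm_scale, He, qmul_scale_r; repeat split; auto;
      destruct Ho as (O & O1 & O2 & O3); cbn [qscale Defs.x0 Defs.x1 Defs.x2 Defs.x3].
      + rewrite Z.odd_mul, O; auto.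
      + apply Z.divide_mul_r; auto.
      + apply Z.divide_mul_r; auto.
      + apply Z.divide_mul_r; auto.
      + apply Z.odd_spec in O; destruct O; lia. }
  destruct R0 as [-> | ->], R1 as [-> | ->], R2 as [-> | ->], R3 as [-> | ->]; try discriminate Hr.
  - apply (Hsgn (Quat 0 0 0 1)); [reflexivity|].
    replace (qmul _ _) with (Quat (2 * (- d' - 1) + 1) (2 * c') (2 * (- b')) (2 * a'))
      by (apply quat_eq; cbn [qmul Defs.x0 Defs.x1 Defs.x2 Defs.x3]; ring). apply odd1_intro.
  - apply (Hsgn (Quat 0 0 1 0)); [reflexivity|].
    replace (qmul _ _) with (Quat (2 * (- c' - 1) + 1) (2 * (- d')) (2 * (a')) (2 * b'))
      by (apply quat_eq; cbn [qmul Defs.x0 Defs.x1 Defs.x2 Defs.x3]; ring). apply odd1_intro.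
  - apply (Hsgn (Quat 0 1 0 0)); [reflexivity|].
    replace (qmul _ _) with (Quat (2 * (- b' - 1) + 1) (2 * a') (2 * d') (2 * (- c')))
      by (apply quat_eq; cbn [qmul Defs.x0 Defs.x1 Defs.x2 Defs.x3]; ring). apply odd1_intro.
  - apply (Hsgn (Quat 1 0 0 0)); [reflexivity|].
    replace (qmul _ _) with (Quat (2 * a' + 1) (2 * b') (2 * c') (2 * d'))
      by (apply quat_eq; cbn [qmul Defs.x0 Defs.x1 Defs.x2 Defs.x3]; ring). apply odd1_intro.
Qed.

(** A unit moved across the factorisation normalises the left factor. Then [p u = conj s * x] shows
    that [u] satisfies the same congruence modulo 2. *)
Lemma S_factor p x : prime p -> p mod 4 = 1 -> odd1 x -> (p | qnorm x) -> ~ qdvd p x ->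
  exists s u, inS p s /\ odd1 u /\ x = qmul s u.
Proof.
  intros Hp H4 Hx HN Hd.
  destruct (quat_factor p x) as (a & u & Hu & Na); auto; [apply prime1_odd; auto|].
  destruct (unit_normalize a) as (e & Ne & Oe & Pe); [rewrite Na; auto|].
  assert (Hs : inS p (qmul a e)).
  { apply inS_intro; auto; rewrite qnorm_mul, Na, Ne; lia. }
  assert (Hxs : x = qmul (qmul a e) (qmul (qconj e) u)).
  { rewrite Hu, <- qmulA, qmul_conj_r, Ne, qscale_1; auto. }
  exists (qmul a e), (qmul (qconj e) u); split; [|split]; auto.
  apply odd1_scale_inv with p; [apply prime1_odd; auto|].
  replace (qscale p _) with (qmul (qconj (qmul a e)) x).
  - apply odd1_mul; auto; apply odd1_conj; auto.
  - rewrite Hxs at 1; rewrite qmul_conj_l, (inS_norm _ _ Hs); auto.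
Qed.

Lemma odd1_norm1 t : odd1 t -> qnorm t = 1 -> exists e, (e = 1 \/ e = -1) /\ t = qscale e q1.
Proof.
  intros Ht Hn; apply odd1_elim in Ht; destruct Ht as (a & b & c & d & ->).
  unfold qnorm in Hn; cbn [Defs.x0 Defs.x1 Defs.x2 Defs.x3] in Hn.
  assert (b = 0 /\ c = 0 /\ d = 0) as (-> & -> & ->) by (repeat split; nia).
  assert (a = 0 \/ a = -1) as [-> | ->] by nia; [exists 1 | exists (-1)]; split; auto.
Qed.

(** Here [conj s' * s = p t] with [t] of norm 1 and odd, so [t] is 1 or -1; positivity of both real
    parts settles the sign. *)
Lemma S_unique p w s s' u u' : prime p -> p mod 4 = 1 -> ~ qdvd p w -> inS p s -> inS p s' ->
  w = qmul s u -> w = qmul s' u' -> s = s'.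
Proof.
  intros Hp H4 Hw Hs Hs' E E'.
  pose proof (prime_ge_2 p Hp).
  pose proof (inS_norm _ _ Hs) as N. pose proof (inS_norm _ _ Hs') as N'.
  destruct (left_factor_unique p w s s' u u') as [t Ht]; auto; [apply prime1_odd; auto|].
  assert (Nt : qnorm t = 1).
  { assert (H1 := f_equal qnorm Ht). rewrite qnorm_mul, qnorm_conj, qnorm_scale, N, N' in H1. nia. }
  destruct (odd1_norm1 t) as (e & He & ->); auto.
  { apply odd1_scale_inv with p; [apply prime1_odd; auto|]. rewrite <- Ht.
    apply odd1_mul; [apply odd1_conj|]; eapply inS_odd1; eauto. }
  assert (Hse : s = qscale e s').
  { apply (qscale_inj p); [lia|]. rewrite <- N' at 1.
    rewrite <- qmul_conj_r, Ht, !qmul_scale_r, qmul_1_r; auto. }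
  destruct He as [-> | ->]; [rewrite qscale_1 in Hse; auto|].
  exfalso. pose proof (inS_pos _ _ Hs); pose proof (inS_pos _ _ Hs').
  rewrite Hse in H0; cbn [qscale Defs.x0] in H0; lia.
Qed.

Lemma prim_peel p s w : prime p -> inS p s -> qdvd p (qmul s w) -> exists u, w = qmul (qconj s) u.
Proof.
  intros Hp Hs [u Hu]; exists u. pose proof (prime_ge_2 p Hp).
  apply (qscale_inj p); [lia|].
  rewrite <- (inS_norm _ _ Hs) at 1. rewrite <- qmul_conj_l, Hu, qmul_scale_r; auto.
Qed.

Lemma wprod_norm p ws : Forall (inS p) ws -> qnorm (wprod ws) = p ^ Z.of_nat (length ws).
Proof.
  induction 1 as [|s ws Hs Hws IH]; [reflexivity|].
  cbn [wprod length]; rewrite qnorm_mul, IH, (inS_norm _ _ Hs).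
  rewrite Nat2Z.inj_succ, Z.pow_succ_r; lia.
Qed.

Lemma wprod_odd1 p ws : Forall (inS p) ws -> odd1 (wprod ws).
Proof.
  induction 1 as [|s ws Hs Hws IH]; [apply odd1_q1|].
  apply odd1_mul; auto; eapply inS_odd1; eauto.
Qed.

Lemma wprod_app a b : wprod (a ++ b) = qmul (wprod a) (wprod b).
Proof.
  induction a; cbn [wprod app]; [rewrite qmul_1_l; auto|]. rewrite IHa, qmulA; auto.
Qed.

Fixpoint reduced (ws : list quat) : Prop :=
  match ws with
  | s :: r => match r with [] => True | t :: _ => t <> qconj s end /\ reduced r
  | [] => True
  end.

Lemma not_qdvd_q1 p : prime p -> ~ qdvd p q1.
Proof.
  intros Hp H; apply qdvd_comp in H; destruct H as [H _]; cbn in H.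
  pose proof (prime_ge_2 p Hp). apply Z.divide_1_r_nonneg in H; lia.
Qed.

Lemma S_not_qdvd p s : prime p -> inS p s -> ~ qdvd p s.
Proof.
  intros Hp Hs [t Ht]. pose proof (prime_ge_2 p Hp).
  assert (H1 := f_equal qnorm Ht). rewrite (inS_norm _ _ Hs), qnorm_scale in H1.
  assert (Hd : (p | 1)) by (exists (qnorm t); nia). apply Z.divide_1_r_nonneg in Hd; lia.
Qed.

(** If [p] divided [s * w], then [w = conj s * u], and uniqueness of the left factor would make
    [conj s] the next letter. This is the freeness of [Lambda(2)]. *)
Lemma reduced_prim p ws : prime p -> p mod 4 = 1 -> Forall (inS p) ws -> reduced ws ->
  ~ qdvd p (wprod ws).
Proof.
  intros Hp H4 HF; induction HF as [|s ws Hs Hws IH]; intro Hr; [apply not_qdvd_q1; auto|].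
  destruct Hr as [Hr1 Hr]. specialize (IH Hr). intro Hd.
  destruct (prim_peel p s (wprod ws)) as [u Hu]; auto.
  destruct ws as [|t ws].
  - cbn in Hd. rewrite qmul_1_r in Hd. apply (S_not_qdvd p s); auto.
  - apply Hr1. inversion Hws; subst.
    apply (S_unique p (wprod (t :: ws)) t (qconj s) (wprod ws) u); auto.
    apply inS_conj; auto.
Qed.

Lemma prim_factor_r p x y : ~ qdvd p (qmul x y) -> ~ qdvd p y.
Proof. intros H Hy; apply H, qdvd_mul_l; auto. Qed.
Lemma prim_factor_l p x y : ~ qdvd p (qmul x y) -> ~ qdvd p x.
Proof. intros H Hy; apply H, qdvd_mul_r; auto. Qed.

Lemma word_exists p : prime p -> p mod 4 = 1 -> forall g x, odd1 x ->
  qnorm x = p ^ Z.of_nat g -> ~ qdvd p x ->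
  exists ws e, length ws = g /\ Forall (inS p) ws /\ (e = 1 \/ e = -1) /\ x = qscale e (wprod ws).
Proof.
  intros Hp H4 g. pose proof (prime_ge_2 p Hp).
  induction g as [|g IH]; intros x Ho HN Hd.
  - destruct (odd1_norm1 x) as (e & He & ->); auto.
    exists [], e; repeat split; auto.
  - rewrite Nat2Z.inj_succ, Z.pow_succ_r in HN by lia.
    destruct (S_factor p x) as (s & u & Hs & Hu & E); auto; [exists (p ^ Z.of_nat g); lia|].
    subst x.
    destruct (IH u) as (ws & e & Hl & HF & He & ->); auto.
    + rewrite qnorm_mul, (inS_norm _ _ Hs) in HN. nia.
    + eapply prim_factor_r; eauto.
    + exists (s :: ws), e; repeat split; auto; [cbn; lia|].
      cbn [wprod]; rewrite qmul_scale_r; auto.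
Qed.

Lemma word_unique p : prime p -> p mod 4 = 1 -> forall ws ws' e e', Forall (inS p) ws ->
  Forall (inS p) ws' -> length ws = length ws' -> (e = 1 \/ e = -1) -> (e' = 1 \/ e' = -1) ->
  ~ qdvd p (wprod ws) -> qscale e (wprod ws) = qscale e' (wprod ws') -> ws = ws'.
Proof.
  intros Hp H4; pose proof (prime_ge_2 p Hp).
  induction ws as [|s ws IH]; intros [|t ws'] e e' F F' L He He' Hd E; try discriminate; auto.
  inversion F; inversion F'; subst; cbn [wprod] in *.
  assert (E1 : qmul s (wprod ws) = qmul t (qscale (e * e') (wprod ws'))).
  { rewrite qmul_scale_r. rewrite <- (qscale_1 (qmul s _)).
    replace 1 with (e * e) at 1 by (destruct He; subst; lia).
    rewrite <- qscale_scale, E, qscale_scale; auto. }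
  assert (s = t) by (eapply (S_unique p _ s t); eauto). subst t.
  f_equal. apply (IH ws' e e'); auto.
  - eapply prim_factor_r; eauto.
  - assert (E2 : qmul (qconj s) (qscale e (qmul s (wprod ws))) =
                 qmul (qconj s) (qscale e' (qmul s (wprod ws')))) by (f_equal; auto).
    rewrite !qmul_scale_r, !qmul_conj_l, !qscale_scale in E2.
    rewrite (inS_norm _ _ H2) in E2. apply (qscale_inj p); [lia|].
    rewrite !qscale_scale, (Z.mul_comm p e), (Z.mul_comm p e'); auto.
Qed.

Lemma prim_reduced p ws : Forall (inS p) ws -> ~ qdvd p (wprod ws) -> reduced ws.
Proof.
  induction 1 as [|s ws Hs Hws IH]; cbn [reduced wprod]; auto.
  intro Hd; split; [|apply IH; eapply prim_factor_r; eauto].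
  destruct ws as [|t ws]; auto. intros ->. apply Hd. cbn [wprod].
  rewrite qmul_conj_r, (inS_norm _ _ Hs). apply qdvd_scale.
Qed.

(** * The Jacobi symbol *)

Fixpoint zprod {A} (f : A -> Z) (l : list A) : Z :=
  match l with [] => 1 | x :: m => f x * zprod f m end.

Lemma zprod_app {A} (f : A -> Z) l m : zprod f (l ++ m) = zprod f l * zprod f m.
Proof. induction l; cbn [zprod app]; [lia|]. rewrite IHl; ring. Qed.
Lemma zprod_mul {A} (f g : A -> Z) l : zprod (fun x => f x * g x) l = zprod f l * zprod g l.
Proof. induction l; cbn [zprod]; [lia|]. rewrite IHl; ring. Qed.
Lemma zprod_map {A B} (f : B -> Z) (g : A -> B) l : zprod f (map g l) = zprod (fun x => f (g x)) l.
Proof. induction l; cbn [zprod map]; [lia|]. rewrite IHl; ring. Qed.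
Lemma zprod_ext {A} (f g : A -> Z) l : (forall x, In x l -> f x = g x) -> zprod f l = zprod g l.
Proof. induction l; cbn; intros; auto. rewrite H, IHl; auto. Qed.
Lemma zprod_perm {A} (f : A -> Z) l m : Permutation l m -> zprod f l = zprod f m.
Proof. induction 1; cbn [zprod]; try congruence; ring. Qed.
Lemma zprod_const {A} (c : Z) (l : list A) : zprod (fun _ => c) l = c ^ zlen l.
Proof.
  induction l; cbn [zprod]; [reflexivity|].
  rewrite zlen_cons, IHl, Z.pow_add_r by (pose proof (zlen_nonneg l); lia). ring.
Qed.

Definition par (z : Z) : Z := if Z.odd z then -1 else 1.

Lemma par_add x y : par (x + y) = par x * par y.
Proof. unfold par; rewrite Z.odd_add; destruct (Z.odd x), (Z.odd y); reflexivity. Qed.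
Lemma par_mul_odd a x : Z.odd a = true -> par (a * x) = par x.
Proof. intro H; unfold par; rewrite Z.odd_mul, H; reflexivity. Qed.
Lemma par_sq x : par x * par x = 1.
Proof. unfold par; destruct (Z.odd x); reflexivity. Qed.
Lemma par_zsum {A} (f : A -> Z) l : par (zsum f l) = zprod (fun x => par (f x)) l.
Proof. induction l; cbn [zsum zprod]; [reflexivity|]. rewrite par_add, IHl; auto. Qed.
Lemma par_pow x : 0 <= x -> (-1) ^ x = par x.
Proof.
  intro H; rewrite <- (Z2Nat.id x) by auto. induction (Z.to_nat x) as [|n IH]; [reflexivity|].
  rewrite Nat2Z.inj_succ, Z.pow_succ_r, IH by lia.
  unfold Z.succ; rewrite par_add; unfold par at 3; cbn [Z.odd]; ring.
Qed.

(** Sign and absolute value of the residue of [y] mod [n] of least absolute value. *)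
Definition sg (n y : Z) : Z := if 2 * (y mod n) <? n then 1 else -1.
Definition ar (n y : Z) : Z := if 2 * (y mod n) <? n then y mod n else n - y mod n.

Definition hf (n : Z) : list Z := zr 1 ((n - 1) / 2 + 1).
(** The Jacobi symbol, for odd [n > 0] and [a] prime to [n], in the form of Gauss's lemma. *)
Definition jac (a n : Z) : Z := zprod (fun x => sg n (a * x)) (hf n).

Lemma in_hf n x : Z.odd n = true -> (In x (hf n) <-> 1 <= x /\ 2 * x < n).
Proof.
  intro Ho; apply Z.odd_spec in Ho; destruct Ho as [k ->]. unfold hf; rewrite in_zr.
  assert ((2 * k + 1 - 1) / 2 = k) as -> by (Z.div_mod_to_equations; lia). lia.
Qed.

Lemma sg_pm n y : sg n y = 1 \/ sg n y = -1.
Proof. unfold sg; destruct (_ <? _); auto. Qed.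

Lemma sg_ar n y : 0 < n -> (n | y - sg n y * ar n y).
Proof.
  intro Hn; unfold sg, ar. pose proof (Z_div_mod_eq_full y n).
  destruct (_ <? _); [exists (y / n) | exists (y / n + 1)]; lia.
Qed.

Lemma sg_cong n y z : 0 < n -> (n | y - z) -> sg n y = sg n z.
Proof.
  intros Hn [k Hk]; unfold sg. replace y with (z + k * n) by lia. rewrite Z.mod_add by lia; auto.
Qed.

Lemma ar_range n y : 0 < n -> Z.odd n = true -> ~ (n | y) -> In (ar n y) (hf n).
Proof.
  intros Hn Ho Hd; apply in_hf; auto; unfold ar.
  pose proof (Z.mod_pos_bound y n Hn).
  assert (y mod n <> 0) by (intro H0; apply Hd, Z.mod_divide; auto; lia).
  apply Z.odd_spec in Ho; destruct Ho as [k Hk].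
  destruct (Z.ltb_spec (2 * (y mod n)) n); lia.
Qed.

Lemma sg_small n x : 0 <= x -> 2 * x < n -> sg n x = 1.
Proof. intros; unfold sg; rewrite Z.mod_small by lia; destruct (Z.ltb_spec (2 * x) n); lia. Qed.

Lemma sg_neg n y : 0 < n -> Z.odd n = true -> ~ (n | y) -> sg n (- y) = - sg n y.
Proof.
  intros Hn Ho Hd. pose proof (Z.mod_pos_bound y n Hn).
  assert (y mod n <> 0) by (intro H0; apply Hd, Z.mod_divide; auto; lia).
  unfold sg; rewrite Z.mod_opp_l_nz by lia.
  apply Z.odd_spec in Ho; destruct Ho as [k Hk].
  destruct (Z.ltb_spec (2 * (y mod n)) n), (Z.ltb_spec (2 * (n - y mod n)) n); lia.
Qed.

Lemma sg_mul_pm n e y : 0 < n -> Z.odd n = true -> ~ (n | y) -> e = 1 \/ e = -1 ->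
  sg n (e * y) = e * sg n y.
Proof.
  intros Hn Ho Hd [-> | ->]; [rewrite !Z.mul_1_l; auto|].
  replace (-1 * y) with (- y) by lia. rewrite sg_neg; auto; lia.
Qed.

Lemma ndiv_mul n a x : Z.odd n = true -> rel_prime a n -> In x (hf n) -> ~ (n | a * x).
Proof.
  intros Ho Hr Hx Hd; apply in_hf in Hx; auto.
  apply Gauss in Hd; [|apply rel_prime_sym; auto].
  apply Z.divide_pos_le in Hd; lia.
Qed.

(** If [a x] and [a y] agreed up to sign, [n] would divide [x - y] or [x + y], which is impossible
    for distinct elements of the half-system. No primality of [n] enters. *)
Lemma ar_perm n a : 0 < n -> Z.odd n = true -> rel_prime a n ->
  Permutation (map (fun x => ar n (a * x)) (hf n)) (hf n).
Proof.
  intros Hn Ho Hr. apply NoDup_Permutation_bis.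
  - apply nodup_map_inj; [apply nodup_zr|].
    intros x y Hx Hy E. apply in_hf in Hx, Hy; auto.
    pose proof (sg_ar n (a * x) Hn) as [k Hk]. pose proof (sg_ar n (a * y) Hn) as [j Hj].
    rewrite E in Hk.
    assert (Hc : (n | a * (x - y)) \/ (n | a * (x + y))).
    { destruct (sg_pm n (a * x)) as [A|A], (sg_pm n (a * y)) as [B|B]; rewrite A in Hk; rewrite B in Hj.
      - left; exists (k - j); lia.
      - right; exists (k + j); lia.
      - right; exists (k + j); lia.
      - left; exists (k - j); lia. }
    assert (rel_prime n a) by (apply rel_prime_sym; auto).
    destruct Hc as [Hc|Hc]; apply Gauss in Hc; auto; destruct Hc as [c Hc].
    + assert (c = 0) by nia. subst. lia.
    + assert (0 < c < 1) by nia. lia.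
  - rewrite length_map; auto.
  - intros y Hy; apply in_map_iff in Hy; destruct Hy as [x [<- Hx]].
    apply ar_range; auto. apply ndiv_mul; auto.
Qed.

(** Reindexing the signs of [a] along the permutation [x -> ar n (b * x)] splits the sign of [a b x]
    into that of [b x] and that of [a * ar n (b * x)]. Multiplicativity thus holds for composite [n]
    without factoring it. *)
Lemma jac_mul n a b : 0 < n -> Z.odd n = true -> rel_prime a n -> rel_prime b n ->
  jac (a * b) n = jac a n * jac b n.
Proof.
  intros Hn Ho Ha Hb; unfold jac.
  rewrite <- (zprod_perm (fun x => sg n (a * x)) _ _ (ar_perm n b Hn Ho Hb)), zprod_map.
  rewrite (Z.mul_comm (zprod _ _)), <- zprod_mul. apply zprod_ext; intros x Hx; cbv beta.
  rewrite (sg_cong n (a * b * x) (sg n (b * x) * (a * ar n (b * x)))); auto.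
  - rewrite sg_mul_pm; auto; [|apply sg_pm].
    apply ndiv_mul; auto. apply ar_range; auto. apply ndiv_mul; auto.
  - destruct (sg_ar n (b * x) Hn) as [k Hk]. exists (a * k). transitivity (a * (b * x - sg n (b * x) * ar n (b * x))); [ring | rewrite Hk; ring].
Qed.

Lemma jac_cong n a b : 0 < n -> (n | a - b) -> jac a n = jac b n.
Proof.
  intros Hn [k Hk]; unfold jac; apply zprod_ext; intros x _.
  apply sg_cong; auto. exists (k * x). nia.
Qed.

Lemma jac_1 n : Z.odd n = true -> jac 1 n = 1.
Proof.
  intro Ho; unfold jac. rewrite (zprod_ext _ (fun _ => 1)).
  - rewrite zprod_const. apply Z.pow_1_l, zlen_nonneg.
  - intros x Hx; apply in_hf in Hx; auto. apply sg_small; lia.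
Qed.

Lemma jac_pm a n : jac a n = 1 \/ jac a n = -1.
Proof.
  unfold jac; induction (hf n) as [|x l IH]; cbn [zprod]; auto.
  destruct (sg_pm n (a * x)) as [-> | ->], IH as [-> | ->]; auto.
Qed.

Lemma zlen_hf n : 0 < n -> zlen (hf n) = (n - 1) / 2.
Proof. intro; unfold hf; rewrite zlen_zr; Z.div_mod_to_equations; lia. Qed.

Lemma jac_m1 n : 0 < n -> Z.odd n = true -> jac (-1) n = par ((n - 1) / 2).
Proof.
  intros Hn Ho; unfold jac. rewrite (zprod_ext _ (fun _ => -1)).
  - rewrite zprod_const, zlen_hf by auto. apply par_pow. Z.div_mod_to_equations; lia.
  - intros x Hx. apply in_hf in Hx; auto. replace (-1 * x) with (- x) by lia.
    rewrite sg_neg; auto; [rewrite sg_small; lia|]. intro H; apply Z.divide_pos_le in H; lia.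
Qed.

Lemma jac_2 n : 0 < n -> n mod 8 = 3 -> jac 2 n = -1.
Proof.
  intros Hn H8; unfold jac. set (m := n / 8).
  assert (Hm : n = 8 * m + 3) by (unfold m; Z.div_mod_to_equations; lia).
  assert (0 <= m) by lia.
  unfold hf. replace ((n - 1) / 2 + 1) with (4 * m + 2) by (Z.div_mod_to_equations; lia).
  rewrite (zr_split 1 (2 * m + 1)) by lia. rewrite zprod_app.
  rewrite (zprod_ext _ (fun _ => 1)).
  - rewrite (zprod_ext _ (fun _ => -1) (zr (2 * m + 1) (4 * m + 2))).
    + rewrite !zprod_const, !zlen_zr, Z.pow_1_l, par_pow by lia.
      unfold par. replace (Z.odd _) with true; [reflexivity|]. symmetry; apply Z.odd_spec.
      exists m; lia.
    + intros x Hx; apply in_zr in Hx. unfold sg. rewrite Z.mod_small by lia.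
      destruct (Z.ltb_spec (2 * (2 * x)) n); lia.
  - intros x Hx; apply in_zr in Hx. apply sg_small; lia.
Qed.

(** Eisenstein's form of Gauss's lemma. For odd [a] and [n] each sign is a product of three
    parities, and those of [x] and of [ar n (a * x)] cancel over the half-system, which [ar]
    permutes. *)
Lemma jac_par n a : 0 < n -> Z.odd n = true -> Z.odd a = true -> rel_prime a n ->
  jac a n = par (zsum (fun x => a * x / n) (hf n)).
Proof.
  intros Hn Ho Ha Hr. rewrite par_zsum.
  assert (Hs : forall y, sg n y = par y * par (y / n) * par (ar n y)).
  { intro y. assert (E : par y = par (y / n) * par (y mod n)).
    { rewrite (Z_div_mod_eq_full y n) at 1. rewrite par_add, par_mul_odd; auto. }
    assert (E2 : par (y mod n) = sg n y * par (ar n y)).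
    { unfold sg, ar; destruct (_ <? _); [lia|].
      replace (n - y mod n) with (n + (- (y mod n))) by lia. rewrite par_add.
      unfold par; rewrite Z.odd_opp, Ho; destruct (Z.odd (y mod n)); reflexivity. }
    rewrite E, E2. pose proof (par_sq (y / n)). pose proof (par_sq (ar n y)).
    replace (par (y / n) * (sg n y * par (ar n y)) * par (y / n) * par (ar n y)) with
      (sg n y * (par (y / n) * par (y / n)) * (par (ar n y) * par (ar n y))) by ring.
    rewrite H, H0; lia. }
  unfold jac. rewrite (zprod_ext _ (fun x => par x * par (a * x / n) * par (ar n (a * x)))).
  2: { intros x _. rewrite Hs, par_mul_odd; auto. }
  rewrite !zprod_mul.
  rewrite <- (zprod_map par (fun x => ar n (a * x))), (zprod_perm par _ _ (ar_perm n a Hn Ho Hr)).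
  assert (zprod (fun x => par x) (hf n) * zprod par (hf n) = 1).
  { rewrite <- zprod_mul. rewrite (zprod_ext _ (fun _ => 1)); [|intros; apply par_sq].
    rewrite zprod_const. apply Z.pow_1_l, zlen_nonneg. }
  transitivity (zprod (fun x => par x) (hf n) * zprod par (hf n) * zprod (fun x => par (a * x / n)) (hf n));
   [| rewrite H; ring].
  change (fun x => par x) with par. ring.
Qed.

Lemma floor_count n m h : 0 < n -> 0 <= m -> ~ (n | m) -> m / n <= h ->
  m / n = cnt (fun y => n * y < m) (zr 1 (h + 1)).
Proof.
  intros Hn Hm Hd Hh. set (q := m / n).
  assert (0 <= q) by (apply Z.div_pos; lia).
  pose proof (Z_div_mod_eq_full m n). pose proof (Z.mod_pos_bound m n Hn). fold q in H0.
  assert (m mod n <> 0) by (intro H2; apply Hd, Z.mod_divide; auto; lia).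
  unfold cnt. rewrite (zr_split 1 (q + 1)) by lia. rewrite zsum_app.
  rewrite (zsum_ext _ (fun _ => 1)), zsum_const, zlen_zr by
    (try lia; intros x Hx; apply in_zr in Hx; apply b2z_true; nia).
  rewrite (zsum_zero _ (zr (q + 1) (h + 1))); [lia|].
  intros x Hx; apply in_zr in Hx; apply b2z_false; nia.
Qed.

(** Eisenstein's count: the two floor sums count the points of the rectangle on either side of the
    line [n y = a x], and coprimality keeps every point off the line. *)
Lemma jac_recip a n : 0 < a -> 0 < n -> Z.odd a = true -> Z.odd n = true -> rel_prime a n ->
  jac a n * jac n a = par ((a - 1) / 2 * ((n - 1) / 2)).
Proof.
  intros Ha Hn Oa On Hr. assert (Hr' : rel_prime n a) by (apply rel_prime_sym; auto).
  rewrite !jac_par, <- par_add by auto. f_equal.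
  assert (F : forall a n, 0 < a -> 0 < n -> Z.odd a = true -> Z.odd n = true -> rel_prime a n ->
    zsum (fun x => a * x / n) (hf n) = zsum (fun x => cnt (fun y => n * y < a * x) (hf a)) (hf n)).
  { clear; intros a n Ha Hn Oa On Hr. apply zsum_ext; intros x Hx.
    pose proof (ndiv_mul n a x On Hr Hx). apply in_hf in Hx; auto. apply floor_count; auto; [nia|].
    apply Z.odd_spec in Oa; destruct Oa as [k ->].
    replace ((2 * k + 1 - 1) / 2) with k by (Z.div_mod_to_equations; lia).
    assert ((2 * k + 1) * x / n < k + 1); [|lia]. apply Z.div_lt_upper_bound; nia. }
  rewrite (F a n), (F n a) by auto. unfold cnt. rewrite (zsum_swap _ (hf a)), <- zsum_add.
  rewrite (zsum_ext _ (fun _ => (a - 1) / 2)), zsum_const, zlen_hf; auto.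
  intros x Hx. rewrite <- zsum_add, (zsum_ext _ (fun _ => 1)), zsum_const, zlen_hf; auto; [lia|].
  intros y Hy. pose proof (ndiv_mul n a x On Hr Hx) as Hd.
  assert (n * y <> a * x) by (intro E; apply Hd; exists y; lia).
  destruct (Z_lt_le_dec (n * y) (a * x)).
  - rewrite b2z_true, b2z_false; lia.
  - rewrite b2z_false, b2z_true; lia.
Qed.

Lemma jac_sq n x : 0 < n -> Z.odd n = true -> rel_prime x n -> jac (x * x) n = 1.
Proof.
  intros Hn Ho Hr; rewrite jac_mul by auto. destruct (jac_pm x n) as [-> | ->]; auto.
Qed.

(** * Roots of polynomials modulo a prime, and the criterion for squares *)

Fixpoint peval (cs : list Z) (x : Z) : Z :=
  match cs with [] => 0 | c :: r => c + x * peval r x end.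
Fixpoint padd (cs ds : list Z) : list Z :=
  match cs, ds with [], _ => ds | _, [] => cs | c :: r, d :: s => (c + d) :: padd r s end.
Definition pscale (k : Z) (cs : list Z) := map (fun c => k * c) cs.
(** The quotient in the division by [X - r], with coefficients from the constant term upwards. *)
Fixpoint pquot (cs : list Z) (r : Z) : list Z :=
  match cs with [] => [] | c :: s => padd s (pscale r (pquot s r)) end.

Lemma peval_padd cs ds x : peval (padd cs ds) x = peval cs x + peval ds x.
Proof. revert ds; induction cs; intros [|d ds]; cbn [peval padd]; rewrite ?IHcs; ring. Qed.
Lemma peval_pscale k cs x : peval (pscale k cs) x = k * peval cs x.
Proof. unfold pscale; induction cs; cbn [peval map]; rewrite ?IHcs; ring. Qed.
Lemma padd_length cs ds : (length ds <= length cs)%nat -> length (padd cs ds) = length cs.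
Proof. revert ds; induction cs; intros [|d ds] H; cbn in *; auto; [lia|]. rewrite IHcs; lia. Qed.
Lemma padd_last cs ds : (length ds < length cs)%nat -> last (padd cs ds) 0 = last cs 0.
Proof.
  revert ds; induction cs as [|c cs IH]; intros [|d ds] H; cbn [length] in *; auto; try lia.
  cbn [padd]. destruct cs as [|c' cs]; [cbn in H; lia|].
  specialize (IH ds ltac:(lia)).
  destruct (padd (c' :: cs) ds) eqn:E; [|exact IH].
  destruct ds; discriminate.
Qed.
Lemma pquot_spec cs r x : peval cs x - peval cs r = (x - r) * peval (pquot cs r) x.
Proof.
  induction cs as [|c s IH]; cbn [peval pquot]; [ring|].
  rewrite peval_padd, peval_pscale.
  replace (c + x * peval s x - (c + r * peval s r)) with
    ((x - r) * peval s x + r * (peval s x - peval s r)) by ring. rewrite IH. ring.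
Qed.
Lemma pquot_length cs r : length (pquot cs r) = pred (length cs).
Proof.
  induction cs as [|c s IH]; cbn [pquot length pred]; auto.
  apply padd_length; unfold pscale; rewrite length_map, IH; lia.
Qed.

Lemma lagrange_roots l : prime l -> forall d cs, length cs = S d -> ~ (l | last cs 0) ->
  forall rs, NoDup rs -> (forall x, In x rs -> 0 <= x < l /\ (l | peval cs x)) ->
  (length rs <= d)%nat.
Proof.
  intros Hl; induction d as [|d IH]; intros cs Hc Hlast rs Hn Hr.
  - destruct cs as [|c [|]]; try discriminate. destruct rs as [|x rs]; auto.
    destruct (Hr x) as [_ Hx]; [left; auto|]. cbn in Hx, Hlast. exfalso; apply Hlast.
    destruct Hx as [k Hk]; exists k; lia.
  - destruct rs as [|r rs]; [cbn; lia|]. inversion Hn; subst.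
    cbn [length]; apply le_n_S. destruct cs as [|c cs]; [discriminate|].
    apply (IH (pquot (c :: cs) r)); auto.
    + rewrite pquot_length; cbn in *; lia.
    + cbn [pquot]. rewrite padd_last.
      * intro; apply Hlast. destruct cs; [discriminate|auto].
      * unfold pscale; rewrite length_map, pquot_length; cbn in *. lia.
    + intros x Hx. destruct (Hr x) as [Hx1 [k Hk]]; [right; auto|].
      destruct (Hr r) as [Hr1 [j Hj]]; [left; auto|]. split; auto.
      assert (H : (l | (x - r) * peval (pquot (c :: cs) r) x))
        by (rewrite <- pquot_spec; exists (k - j); lia).
      apply prime_mult in H; auto. destruct H as [[m Hm]|H]; auto.
      assert (m = 0) by nia. subst. assert (x = r) by lia. subst; contradiction.
Qed.

(** The congruences [a x = sg * ar] are multiplied over the half-system; the product of the [ar] is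
    that of the [x], which is prime to [l] and cancels. *)
Lemma gauss_lemma l a : prime l -> Z.odd l = true -> rel_prime a l ->
  (l | a ^ ((l - 1) / 2) - jac a l).
Proof.
  intros Hl Ho Hr. pose proof (prime_ge_2 l Hl).
  assert (Hp : ~ (l | zprod (fun x => x) (hf l))).
  { assert (forall m, (forall x, In x m -> In x (hf l)) -> ~ (l | zprod (fun x => x) m)).
    { induction m as [|x m IH]; cbn [zprod]; intros Hm Hd.
      - apply Z.divide_1_r_nonneg in Hd; lia.
      - apply prime_mult in Hd; auto. destruct Hd as [Hd|Hd].
        + assert (Hx : In x (hf l)) by (apply Hm; left; auto). apply in_hf in Hx; auto.
          apply Z.divide_pos_le in Hd; lia.
        + apply IH; auto. intros; apply Hm; right; auto. }
    apply H0; auto. }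
  assert (Hd : forall m, (l | zprod (fun x => a * x) m - zprod (fun x => sg l (a * x) * ar l (a * x)) m)).
  { induction m as [|x m IH]; cbn [zprod]; [exists 0; lia|].
    destruct IH as [k Hk]. destruct (sg_ar l (a * x)) as [j Hj]; [lia|].
    exists (j * zprod (fun x => a * x) m + sg l (a * x) * ar l (a * x) * k).
    revert Hk Hj. generalize (a * x) (sg l (a * x) * ar l (a * x)) (zprod (fun x => a * x) m)
      (zprod (fun x => sg l (a * x) * ar l (a * x)) m). clear.
    intros y w u v Hk Hj. replace y with (w + j * l) by lia.
    replace u with (v + k * l) by lia. ring. }
  specialize (Hd (hf l)). rewrite !zprod_mul in Hd. fold (jac a l) in Hd.
  rewrite <- (zprod_map (fun x => x) (fun x => ar l (a * x))) in Hd.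
  rewrite (zprod_perm _ _ _ (ar_perm l a ltac:(lia) Ho Hr)) in Hd.
  rewrite zprod_const, zlen_hf in Hd by lia.
  rewrite <- Z.mul_sub_distr_r in Hd. apply prime_mult in Hd; auto. tauto.
Qed.

(** If [a] were not a square, [a] and the [h = (l - 1) / 2] distinct nonzero squares would be
    [h + 1] roots of [X^h - 1]. *)
Lemma jac_prime_square l a : prime l -> Z.odd l = true -> rel_prime a l -> jac a l = 1 ->
  exists x, (l | x * x - a).
Proof.
  intros Hl Ho Hr Hj. pose proof (prime_ge_2 l Hl).
  apply NNPP; intro Hn. assert (Hns : forall x, ~ (l | x * x - a)) by (intros x Hx; apply Hn; eauto).
  set (h := (l - 1) / 2). assert (Hh : l = 2 * h + 1).
  { unfold h; apply Z.odd_spec in Ho; destruct Ho; Z.div_mod_to_equations; lia. }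
  assert (Hpow : forall x, rel_prime x l -> jac x l = 1 -> (l | (x mod l) ^ h - 1)).
  { intros x Hx Hx1. assert (E : rel_prime (x mod l) l).
    { apply rel_prime_sym, prime_rel_prime; auto. intro Hd. apply Z.mod_divide in Hd; [|lia].
      rewrite Z.mod_mod in Hd by lia. apply Z.mod_divide in Hd; [|lia].
      destruct Hx as [_ _ Hx]. apply Hx in Hd; [|apply Z.divide_refl]. apply Z.divide_1_r_nonneg in Hd; lia. }
    pose proof (gauss_lemma l (x mod l) Hl Ho E). fold h in H0.
    assert (E2 : jac (x mod l) l = 1).
    { transitivity (jac x l); auto. apply jac_cong; [lia|]. exists (- (x / l)).
      pose proof (Z_div_mod_eq_full x l). lia. }
    rewrite E2 in H0; auto. }
  set (P := -1 :: repeat 0 (Z.to_nat h - 1) ++ [1]).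
  assert (HP : forall x, peval P x = x ^ h - 1).
  { assert (Hrep : forall n x, peval (repeat 0 n ++ [1]) x = x ^ Z.of_nat n).
    { induction n; intro x; [cbn [repeat app peval Z.of_nat]; rewrite Z.pow_0_r; ring|]. cbn [repeat app peval]. rewrite IHn, Nat2Z.inj_succ, Z.pow_succ_r; lia. }
    intro x; unfold P; cbn [peval]. rewrite Hrep.
    replace (x * x ^ Z.of_nat (Z.to_nat h - 1)) with (x ^ h); [lia|].
    rewrite <- Z.pow_succ_r by lia. f_equal. lia. }
  assert (Hc := lagrange_roots l Hl (Z.to_nat h) P).
  assert (length P = S (Z.to_nat h)).
  { unfold P; cbn [length]; rewrite length_app, repeat_length; cbn; lia. }
  assert (last P 0 = 1).
  { unfold P. rewrite app_comm_cons. apply last_last. }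
  specialize (Hc H0). rewrite H1 in Hc.
  specialize (Hc ltac:(intro Hd; apply Z.divide_1_r_nonneg in Hd; lia)).
  specialize (Hc (a mod l :: map (fun x => (x * x) mod l) (hf l))).
  assert (H2 : (S (length (map (fun x => (x * x) mod l)%Z (hf l))) <= Z.to_nat h)%nat).
  - apply Hc.
    + constructor.
      * rewrite in_map_iff; intros [x [Hx _]]. apply (Hns x).
        exists (x * x / l - a / l). pose proof (Z_div_mod_eq_full (x * x) l).
        pose proof (Z_div_mod_eq_full a l). nia.
      * apply nodup_map_inj; [apply nodup_zr|]. intros x y Hx Hy E. apply in_hf in Hx, Hy; auto.
        assert (Hd : (l | (x - y) * (x + y))).
        { exists (x * x / l - y * y / l). pose proof (Z_div_mod_eq_full (x * x) l).
          pose proof (Z_div_mod_eq_full (y * y) l). nia. }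
        apply prime_mult in Hd; auto. destruct Hd as [[c Hd]|[c Hd]]; [assert (c = 0) by nia; lia|].
        assert (0 < c < 1) by nia; lia.
    + intros y [<- | Hy]; rewrite HP.
      * split; [apply Z.mod_pos_bound; lia|]. apply Hpow; auto.
      * apply in_map_iff in Hy; destruct Hy as [x [<- Hx]]. split; [apply Z.mod_pos_bound; lia|].
        apply in_hf in Hx; auto.
        assert (Hxl : rel_prime x l) by (apply rel_prime_le_prime; auto; lia).
        apply Hpow; [|apply jac_sq; auto; lia].
        apply rel_prime_sym, rel_prime_mult; apply rel_prime_sym; auto.
  - rewrite length_map in H2.
    pose proof (zlen_hf l ltac:(lia)). unfold zlen in H3. fold h in H3. lia.
Qed.

(** * Ternary quadratic forms *)

Definition sum3 (n : Z) : Prop := exists a b c, n = a * a + b * b + c * c.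

Definition tform (a b c d e f x y z : Z) : Z :=
  a * x * x + b * y * y + c * z * z + 2 * d * x * y + 2 * e * x * z + 2 * f * y * z.

Lemma shift_small A B : 0 < A -> exists k, - A <= 2 * (B + k * A) <= A.
Proof.
  intro HA. destruct (centered_spec A B HA) as [[k Hk] [H1 H2]].
  exists (- k). replace (B + - k * A) with (centered A B) by lia. lia.
Qed.

Lemma sq_half A B : 0 < A -> - A <= 2 * B <= A -> 4 * (B * B) <= A * A.
Proof. intros; nia. Qed.

(** Gauss's reduction of positive ternary forms of determinant 1: alternate reduction of the
    leading binary form and of the leading binary form of the adjoint. *)
Lemma ternary_reduction : forall N K : nat, forall a b c d e f x y z,
  0 < a <= Z.of_nat N -> 0 < a * b - d * d <= Z.of_nat K ->
  a * b * c + 2 * d * e * f - a * f * f - b * e * e - c * d * d = 1 ->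
  sum3 (tform a b c d e f x y z).
Proof.
  induction N as [|N IHN]; [intros; lia|].
  induction K as [|K IHK]; [intros; lia|].
  intros a b c d e f x y z Ha HA Hdet.
  (* The shear in [z] keeps [a] and [A = a b - d^2], and changes the middle coefficient [a f - d e]
     of the adjoint by multiples of [A]. *)
  destruct (shift_small (a * b - d * d) (a * f - d * e)) as [k Hk]; [lia|].
  set (e' := e + k * d). set (f' := f + k * b). set (c' := c + 2 * k * f + k * k * b).
  assert (E1 : tform a b c d e f x y z = tform a b c' d e' f' x (y - k * z) z)
    by (unfold tform, e', f', c'; ring).
  rewrite E1. assert (Hdet' : a * b * c' + 2 * d * e' * f' - a * f' * f' - b * e' * e' - c' * d * d = 1)
    by (rewrite <- Hdet; unfold e', f', c'; ring).
  assert (Hk' : - (a * b - d * d) <= 2 * (a * f' - d * e') <= a * b - d * d).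
  { replace (a * f' - d * e') with (a * f - d * e + k * (a * b - d * d))
      by (unfold e', f'; ring). auto. }
  clearbody e' f' c'. clear E1 Hk Hdet. clear e f c.
  generalize dependent (y - k * z). clear y. intro y.
  set (A := a * b - d * d) in *. set (B := a * f' - d * e') in *.
  (* [A], [B] and [C] describe the leading binary form of the adjoint; its determinant is [a]
     because the ternary determinant is 1. *)
  destruct (ex_intro (fun C => C = a * c' - e' * e') _ eq_refl) as [C EC].
  assert (HACB : A * C - B * B = a).
  { transitivity (a * (a * b * c' + 2 * d * e' * f' - a * f' * f' - b * e' * e' - c' * d * d)).
    - rewrite EC; unfold A, B; ring.
    - rewrite Hdet'; ring. }
  assert (HC : 0 < C) by (apply Z.mul_pos_cancel_l with A; [lia|]; pose proof (Z.square_nonneg B); lia).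
  destruct (Z_lt_le_dec C A) as [HCA|HCA].
  { replace (tform a b c' d e' f' x y z) with (tform a c' b e' d f' x z y) by (unfold tform; ring).
    apply IHK; auto; [rewrite <- EC; lia | lia]. }
  assert (H3A : 3 * (A * A) <= 4 * a).
  { pose proof (sq_half A B ltac:(lia) Hk'). assert (A * A <= A * C) by (apply Z.mul_le_mono_nonneg_l; lia). lia. }
  destruct (shift_small a d) as [j Hj]; [lia|].
  set (d2 := d + j * a). set (b2 := b + 2 * j * d + j * j * a). set (f2 := f' + j * e').
  assert (E2 : tform a b c' d e' f' x y z = tform a b2 c' d2 e' f2 (x - j * y) y z)
    by (unfold tform, d2, b2, f2; ring).
  rewrite E2. assert (Hdet2 : a * b2 * c' + 2 * d2 * e' * f2 - a * f2 * f2 - b2 * e' * e' - c' * d2 * d2 = 1)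
    by (rewrite <- Hdet'; unfold d2, b2, f2; ring).
  assert (EA : a * b2 - d2 * d2 = A) by (unfold A, b2, d2; ring).
  assert (EB : a * f2 - d2 * e' = B) by (unfold B, f2, d2; ring).
  assert (Hj' : - a <= 2 * d2 <= a) by (unfold d2; lia).
  clearbody d2 b2 f2. clearbody A B. clear E2 Hdet' Hj. clear b d f'.
  generalize (x - j * y). clear x. intro x.
  assert (Hb2 : 0 < b2) by (apply Z.mul_pos_cancel_l with a; [lia|]; pose proof (Z.square_nonneg d2); lia).
  destruct (Z_lt_le_dec b2 a) as [Hba|Hba].
  { replace (tform a b2 c' d2 e' f2 x y z) with (tform b2 a c' d2 f2 e' y x z) by (unfold tform; ring).
    set (K' := Z.to_nat A).
    apply IHN with (K := K'); unfold K'; lia. }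
  assert (H3a : 3 * (a * a) <= 4 * A).
  { pose proof (sq_half a d2 ltac:(lia) Hj'). assert (a * a <= a * b2) by (apply Z.mul_le_mono_nonneg_l; lia). lia. }
  (* When neither swap makes progress, [3 A^2 <= 4 a] and [3 a^2 <= 4 A] hold together and leave
     only [a = A = 1]. *)
  assert (a = 1).
  { destruct (Z.eq_dec a 1); auto. exfalso. assert (2 <= a) by lia.
    assert (A <= a).
    { destruct (Z_lt_le_dec a A); auto. exfalso. assert (a * A < A * A) by (apply Z.mul_lt_mono_pos_r; lia).
      assert (2 * A <= a * A) by (apply Z.mul_le_mono_nonneg_r; lia). lia. }
    assert (2 * a <= a * a) by (apply Z.mul_le_mono_nonneg_r; lia). lia. } subst a.
  assert (A = 1).
  { destruct (Z.eq_dec A 1); auto. exfalso. assert (2 * A <= A * A) by (apply Z.mul_le_mono_nonneg_r; lia). lia. }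
  subst A.
  assert (d2 = 0) by lia. assert (B = 0) by lia. assert (b2 = 1) by lia.
  assert (f2 = 0) by lia.
  exists (x + e' * z), y, z. unfold tform.
  replace c' with (1 + e' * e') by lia. replace d2 with 0 by lia. replace b2 with 1 by lia.
  replace f2 with 0 by lia. rewrite H. ring.
Qed.

(** The form with matrix [[a, b, 1], [b, 2P, 0], [1, 0, n]] has determinant 1 and represents [n]. *)
Lemma sum3_of_root n P t : 0 < n -> 0 < P -> Z.odd P = true -> Z.odd n = true -> rel_prime P n ->
  (n | 2 * P + 1) -> (P | t * t + n) -> sum3 n.
Proof.
  intros Hn HP Po No Hr [d Hd] Ht.
  assert (0 < d) by nia.
  assert (Hdo : Z.odd d = true).
  { assert (H1 : Z.odd (2 * P + 1) = true) by (apply Z.odd_spec; exists P; lia).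
    rewrite Hd, Z.odd_mul in H1. destruct (Z.odd d); auto. }
  (* Adding [P] corrects the parity; an odd [s] makes [d * s^2 + 1] even, hence divisible by [2 P]
     and not only by [P]. *)
  assert (exists s, (P | s * s + n) /\ Z.odd s = true) as [s [Hs So]].
  { destruct (Z.odd t) eqn:To; [exists t; auto|]. exists (t + P); split.
    - destruct Ht as [k Hk]; exists (k + 2 * t + P). lia.
    - rewrite Z.odd_add, To, Po; auto. }
  assert (Hp2 : (P | d * (s * s) + 1)).
  { apply Gauss with n; auto. destruct Hs as [k Hk]. exists (2 * (s * s) + k).
    replace (n * (d * (s * s) + 1)) with ((2 * P + 1) * (s * s) + n) by (rewrite Hd; ring). lia. }
  assert (H2P : (2 * P | d * (s * s) + 1)).
  { destruct Hp2 as [k Hk].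
    assert (Ho : Z.odd (k * P) = false).
    { rewrite <- Hk, Z.odd_add, !Z.odd_mul, Hdo, So; reflexivity. }
    rewrite Z.odd_mul, Po, Bool.andb_true_r in Ho.
    assert (He : Z.even k = true) by (rewrite <- Z.negb_odd, Ho; auto).
    apply Z.even_spec in He. destruct He as [u ->]. exists u. lia. }
  destruct H2P as [a Ha].
  (* With [d * s^2 + 1 = 2 P a], the first entry of the matrix is [d * a]. The leading minor is
     [2 P d a - b^2 = d], and the determinant is [n d - 2 P = 1]. *)
  set (b := d * s).
  assert (Hab : b * b + d = d * a * (2 * P)) by (unfold b; nia).
  assert (0 < a) by nia.
  replace n with (tform (d * a) (2 * P) n b 1 0 0 0 1) by (unfold tform; ring).
  apply (ternary_reduction (Z.to_nat (d * a)) (Z.to_nat d)); nia.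
Qed.

(** * Split numbers *)

Lemma mod8_odd n : n mod 8 = 3 -> Z.odd n = true.
Proof. intro; apply Z.odd_spec; exists (4 * (n / 8) + 1); Z.div_mod_to_equations; lia. Qed.

Lemma rel_prime_mul a b c : rel_prime a c -> rel_prime b c -> rel_prime (a * b) c.
Proof. intros; apply rel_prime_sym, rel_prime_mult; apply rel_prime_sym; auto. Qed.

Lemma rel_prime_mul_inv_l a b c : rel_prime (a * b) c -> rel_prime a c.
Proof. intro H; apply (rel_prime_div _ _ _ H), Z.divide_factor_l. Qed.
Lemma rel_prime_mul_inv_r a b c : rel_prime (a * b) c -> rel_prime b c.
Proof. intro H; apply (rel_prime_div _ _ _ H), Z.divide_factor_r. Qed.

Lemma rel_prime_cong a b m : (m | a - b) -> rel_prime a m -> rel_prime b m.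
Proof.
  intros [k Hk] H. apply rel_prime_sym, bezout_rel_prime.
  apply rel_prime_sym, rel_prime_bezout in H. destruct H as [u v H].
  apply (Bezout_intro _ _ _ (u + v * k) v). rewrite <- H. replace a with (b + k * m) by lia. ring.
Qed.

Lemma bezout_solve a m c : rel_prime a m -> exists x, (m | a * x - c).
Proof.
  intro H; apply rel_prime_bezout in H; destruct H as [u v H].
  exists (u * c), (- v * c). assert (E : u * a = 1 - v * m) by lia.
  transitivity (c * (u * a) - c); [ring | rewrite E; ring].
Qed.

Lemma prime_factor m : 1 < m -> exists l, prime l /\ (l | m).
Proof.
  intro Hm. rewrite <- (Z2Nat.id m) in * by lia. revert Hm.
  induction (Z.to_nat m) as [n IH] using lt_wf_ind. intro Hm.
  destruct (prime_dec (Z.of_nat n)) as [|Hn]; [exists (Z.of_nat n); auto using Z.divide_refl|].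
  apply not_prime_divide in Hn; auto. destruct Hn as [d [Hd Hdn]].
  destruct (IH (Z.to_nat d)) as [l [Hl Hl']]; [lia|lia|].
  exists l; split; auto. rewrite Z2Nat.id in Hl' by lia. eapply Z.divide_trans; eauto.
Qed.

(** For [n = 3 mod 8], [jac d n] is the quadratic character of the field of discriminant [-n]. *)
Lemma jac_split_recip n l : 0 < n -> n mod 8 = 3 -> 0 < l -> Z.odd l = true -> rel_prime l n ->
  jac l n = jac (- n) l.
Proof.
  intros Hn H8 Hl Ho Hr. pose proof (mod8_odd n H8) as Hno.
  pose proof (jac_recip l n Hl Hn Ho Hno Hr) as R.
  replace (- n) with (-1 * n) by lia.
  assert (rel_prime n l) by (apply rel_prime_sym; auto).
  assert (rel_prime (-1) l).
  { apply rel_prime_sym, bezout_rel_prime. apply (Bezout_intro _ _ _ 0 (-1)). lia. }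
  assert (R2 : par ((l - 1) / 2 * ((n - 1) / 2)) = par ((l - 1) / 2)).
  { rewrite Z.mul_comm; apply par_mul_odd, Z.odd_spec.
    exists (2 * (n / 8)); Z.div_mod_to_equations; lia. }
  rewrite R2 in R. rewrite (jac_mul l (-1) n), jac_m1, <- R by auto.
  destruct (jac_pm l n) as [-> | ->], (jac_pm n l) as [-> | ->]; lia.
Qed.

Lemma odd_of_rel_prime l n : rel_prime l (2 * n) -> Z.odd l = true.
Proof.
  intro H. destruct (Z.odd l) eqn:E; auto. exfalso.
  assert (He : Z.even l = true) by (rewrite <- Z.negb_odd, E; auto). apply Z.even_spec in He.
  destruct He as [k ->]. apply rel_prime_mul_inv_l in H. destruct H as [_ _ H].
  assert (Hd : (2 | 1)) by (apply H; [apply Z.divide_refl | apply Z.divide_factor_l]).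
  apply Z.divide_1_r_nonneg in Hd; lia.
Qed.

Definition split_num (n m : Z) : Prop :=
  0 < m /\ rel_prime m (2 * n) /\ forall l, prime l -> (l | m) -> jac l n = 1.

Lemma split_num_mul n a b : split_num n a -> split_num n b -> split_num n (a * b).
Proof.
  intros (A & A1 & A2) (B & B1 & B2); split; [nia | split; [apply rel_prime_mul; auto|]].
  intros l Hl Hd; apply prime_mult in Hd; auto. destruct Hd; auto.
Qed.

Lemma rel_prime_2n_n x n : rel_prime x (2 * n) -> rel_prime x n.
Proof. intro H; apply rel_prime_sym. apply rel_prime_sym in H. apply rel_prime_mul_inv_r in H; auto. Qed.

(** Modulo a prime factor of [x^2 + n y^2], [-n y^2] is a square, hence so is [-n]. The choice
    [y = (2 n)^(k + 1)] keeps the value congruent to [x^2] modulo [2 n] and leaves infinitely many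
    values available. *)
Lemma split_num_norm n x k : 0 < n -> n mod 8 = 3 -> rel_prime x (2 * n) -> 0 <= k ->
  split_num n (x * x + n * (2 * n) ^ k * (2 * n) ^ k * (2 * n) * (2 * n)).
Proof.
  intros Hn H8 Hx Hk. pose proof (mod8_odd n H8) as Hno.
  set (y := (2 * n) ^ k * (2 * n)). assert (0 < y) by (unfold y; apply Z.mul_pos_pos; [apply Z.pow_pos_nonneg|]; lia).
  replace (n * (2 * n) ^ k * (2 * n) ^ k * (2 * n) * (2 * n)) with (n * y * y) by (unfold y; ring).
  assert (Hrm : rel_prime (x * x + n * y * y) (2 * n)).
  { apply (rel_prime_cong (x * x)); [|apply rel_prime_mul; auto].
    exists (- (n * y * (2 * n) ^ k)). unfold y; ring. }
  assert (Hxx : 0 <= x * x) by apply Z.square_nonneg.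
  split; [nia | split; [auto|]].
  intros l Hl Hd. pose proof (prime_ge_2 l Hl).
  assert (Hrl : rel_prime l (2 * n)) by (apply (rel_prime_div _ _ _ Hrm); auto).
  pose proof (odd_of_rel_prime l n Hrl) as Hlo.
  assert (Hln : rel_prime l n) by (apply rel_prime_2n_n; auto).
  rewrite jac_split_recip; auto; [|lia].
  assert (Hly : rel_prime y l).
  { unfold y. assert (rel_prime (2 * n) l) by (apply rel_prime_sym; auto).
    apply rel_prime_mul; auto. clear - H1 Hk Hl. rewrite <- (Z2Nat.id k) by auto.
    induction (Z.to_nat k); [cbn; apply rel_prime_1|].
    rewrite Nat2Z.inj_succ, Z.pow_succ_r by lia. apply rel_prime_mul; auto. }
  assert (Hlnm : rel_prime (- n) l).
  { replace (- n) with (-1 * n) by lia. apply rel_prime_mul; [|apply rel_prime_sym; auto].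
    apply rel_prime_sym, bezout_rel_prime. apply (Bezout_intro _ _ _ 0 (-1)). lia. }
  assert (E : jac (- n * (y * y)) l = jac (- n) l).
  { rewrite jac_mul, jac_sq by (auto using rel_prime_mul; lia). lia. }
  rewrite <- E, (jac_cong l _ (x * x)) by (try lia; destruct Hd as [c Hc]; exists (- c); lia).
  apply jac_sq; auto; [lia|].
  apply rel_prime_sym, prime_rel_prime; auto. intros Hlx.
  assert (Hny : (l | n * (y * y))).
  { replace (n * (y * y)) with ((x * x + n * y * y) - x * x) by ring.
    apply Z.divide_sub_r; auto. apply Z.divide_mul_l; auto. }
  apply Gauss in Hny; auto. apply sq_dvd_prime in Hny; auto.
  destruct Hly as [_ _ Hly]. assert (Hd1 : (l | 1)) by (apply Hly; auto using Z.divide_refl).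
  apply Z.divide_1_r_nonneg in Hd1; lia.
Qed.

(** Hensel lifting and the Chinese remainder theorem. *)
Lemma split_num_root n : 0 < n -> n mod 8 = 3 -> forall m, split_num n m -> exists t, (m | t * t + n).
Proof.
  intros Hn H8 m [Hm0 Hm]. rewrite <- (Z2Nat.id m) in * by lia. clear Hm0.
  induction (Z.to_nat m) as [k IH] using lt_wf_ind. destruct Hm as [Hr Hs].
  destruct (Z.eq_dec (Z.of_nat k) 1) as [->|]; [exists 0; apply Z.divide_1_l|].
  destruct (Z.eq_dec (Z.of_nat k) 0) as [E|].
  { exfalso. rewrite E in Hr. destruct Hr as [_ _ Hr].
    assert (Hd : (2 | 1)) by (apply Hr; [apply Z.divide_0_r | apply Z.divide_factor_l]).
    apply Z.divide_1_r_nonneg in Hd; lia. }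
  destruct (prime_factor (Z.of_nat k)) as [l [Hl [P HP]]]; [lia|].
  pose proof (prime_ge_2 l Hl). assert (0 < P) by nia.
  rewrite HP in Hr, Hs.
  pose proof (rel_prime_mul_inv_r _ _ _ Hr) as Hrl. pose proof (odd_of_rel_prime l n Hrl) as Hlo.
  assert (Hln : rel_prime l n) by (apply rel_prime_2n_n; auto).
  destruct (IH (Z.to_nat P)) as [t [c Hc]].
  { nia. }
  { rewrite Z2Nat.id by lia. split; [apply rel_prime_mul_inv_l in Hr; auto|].
    intros l' Hl' Hd; apply Hs; auto. apply Z.divide_mul_l; auto. }
  rewrite Z2Nat.id in Hc by lia. rewrite HP.
  assert (Hlt : rel_prime 2 l).
  { apply rel_prime_sym; apply rel_prime_sym in Hrl. apply rel_prime_mul_inv_l in Hrl.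
    apply rel_prime_sym; auto. }
  destruct (classic (l | P)) as [HlP|HlP].
  - assert (Htl : rel_prime (2 * t) l).
    { apply rel_prime_mul; auto. apply rel_prime_sym, prime_rel_prime; auto. intros [u Hu].
      destruct HlP as [v Hv]. destruct Hln as [_ _ Hln].
      assert (Hd : (l | n)) by (exists (c * v - u * t); nia).
      assert (Hd1 : (l | 1)) by (apply Hln; auto using Z.divide_refl).
      apply Z.divide_1_r_nonneg in Hd1; lia. }
    destruct (bezout_solve (2 * t) l (- c) Htl) as [s [k1 Hk]].
    destruct HlP as [v Hv]. exists (t + P * s). exists (k1 + v * s * s).
    replace ((t + P * s) * (t + P * s) + n) with (t * t + n + 2 * t * s * P + P * P * s * s) by ring.
    rewrite Hc. replace (2 * t * s) with (- c + k1 * l) by lia. rewrite Hv at 4. ring.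
  - assert (Hj : jac (- n) l = 1).
    { rewrite <- jac_split_recip; auto; [|lia]. apply Hs; auto. apply Z.divide_factor_r. }
    destruct (jac_prime_square l (- n)) as [r [k1 Hk1]]; auto.
    { replace (- n) with (-1 * n) by lia. apply rel_prime_mul; [|apply rel_prime_sym; auto].
      apply rel_prime_sym, bezout_rel_prime. apply (Bezout_intro _ _ _ 0 (-1)). lia. }
    assert (HPl : rel_prime P l) by (apply rel_prime_sym, prime_rel_prime; auto).
    destruct (bezout_solve P l (r - t) HPl) as [s [k2 Hk2]].
    exists (t + P * s).
    assert (D1 : (P | (t + P * s) * (t + P * s) + n)) by (exists (c + 2 * t * s + P * s * s); lia).
    destruct D1 as [u Hu].
    assert (D2 : (l | P * u)).
    { replace (P * u) with ((t + P * s) * (t + P * s) + n) by lia.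
      replace (t + P * s) with (r + k2 * l) by lia. exists (k1 + 2 * r * k2 + k2 * k2 * l). nia. }
    apply Gauss in D2; [|apply rel_prime_sym; auto]. destruct D2 as [w ->].
    exists w. lia.
Qed.

(** When [jac _ n] is the quadratic character, this is the number of ideals of norm [m]. *)
Definition fdiv (n m : Z) : Z := zsum (fun d => b2z (d | m) * jac d n) (zr 1 (m + 1)).
Definition gdiv (n l m : Z) : Z := zsum (fun d => b2z ((d | m) /\ ~ (l | d)) * jac d n) (zr 1 (m + 1)).

Lemma zsum_extend (f : Z -> Z) a b c : a <= b <= c -> (forall x, b <= x < c -> f x = 0) ->
  zsum f (zr a c) = zsum f (zr a b).
Proof.
  intros H H0; rewrite (zr_split a b c) by auto. rewrite zsum_app, (zsum_zero f (zr b c)); [lia|].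
  intros x Hx; apply in_zr in Hx; auto.
Qed.

Lemma zsum_multiples (f : Z -> Z) l b : 0 < l -> 0 <= b ->
  (forall x, ~ (l | x) -> f x = 0) ->
  zsum f (zr 1 (l * b + 1)) = zsum (fun y => f (l * y)) (zr 1 (b + 1)).
Proof.
  intros Hl Hb Hf. rewrite <- (Z2Nat.id b) by auto. induction (Z.to_nat b) as [|n IH].
  { rewrite !zr_empty by lia. reflexivity. }
  rewrite Nat2Z.inj_succ. unfold Z.succ.
  rewrite (zr_snoc 1 (Z.of_nat n + 1)) by lia. rewrite (zr_snoc 1) by nia.
  rewrite !zsum_app. cbn [zsum]. rewrite <- IH.
  rewrite (zsum_extend _ 1 (l * Z.of_nat n + 1) (l * (Z.of_nat n + 1))); [lia | nia |].
  intros x Hx. apply Hf. intros [k Hk]. assert (Z.of_nat n < k < Z.of_nat n + 1) by nia. lia.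
Qed.

Lemma b2z_split (P Q : Prop) : b2z P = b2z (P /\ ~ Q) + b2z (P /\ Q).
Proof.
  destruct (classic P) as [p|p]; [destruct (classic Q) as [q|q]|].
  - rewrite (b2z_true P), (b2z_false (P /\ ~ Q)), (b2z_true (P /\ Q)) by tauto; auto.
  - rewrite (b2z_true P), (b2z_true (P /\ ~ Q)), (b2z_false (P /\ Q)) by tauto; auto.
  - rewrite (b2z_false P), (b2z_false (P /\ ~ Q)), (b2z_false (P /\ Q)) by tauto; auto.
Qed.

(** A divisor of [l * m] that [l] divides is [l] times a divisor of [m], and the character changes
    its sign. *)
Lemma fdiv_gdiv n l m : 0 < n -> Z.odd n = true -> rel_prime (l * m) n -> 0 < l -> 0 < m ->
  jac l n = -1 -> fdiv n (l * m) = gdiv n l (l * m) - fdiv n m.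
Proof.
  intros Hn Ho Hr Hl Hm Hj. unfold fdiv, gdiv.
  rewrite (zsum_ext (fun d => b2z (d | l * m) * jac d n)
    (fun d => b2z ((d | l * m) /\ ~ (l | d)) * jac d n + b2z ((d | l * m) /\ (l | d)) * jac d n)).
  2: { intros d _. rewrite <- Z.mul_add_distr_r. f_equal.
       apply b2z_split. }
  rewrite zsum_add. rewrite (zsum_multiples (fun d => b2z ((d | l * m) /\ (l | d)) * jac d n)) by
    (try lia; intros x Hx; rewrite b2z_false by tauto; lia).
  rewrite (zsum_ext (fun y => b2z ((l * y | l * m) /\ (l | l * y)) * jac (l * y) n)
    (fun y => - 1 * (b2z (y | m) * jac y n))).
  - rewrite zsum_scale. lia.
  - intros y _. destruct (classic (y | m)) as [Hy|Hy].
    + assert (C : (l * y | l * m) /\ (l | l * y))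
        by (split; [apply Z.mul_divide_mono_l; auto | apply Z.divide_factor_l]).
      rewrite (b2z_true _ C), (b2z_true _ Hy).
      assert (rel_prime l n) by (apply rel_prime_mul_inv_l in Hr; auto).
      assert (rel_prime y n) by (apply (rel_prime_div m); auto; apply rel_prime_mul_inv_r in Hr; auto).
      rewrite jac_mul, Hj by auto. lia.
    + assert (C : ~ ((l * y | l * m) /\ (l | l * y)))
        by (intros [A _]; apply Hy; apply Z.mul_divide_cancel_l in A; auto; lia).
      rewrite (b2z_false _ C), (b2z_false _ Hy). lia.
Qed.

Lemma gdiv_mul n l m : prime l -> 0 < m -> gdiv n l (l * m) = gdiv n l m.
Proof.
  intros Hl Hm. pose proof (prime_ge_2 l Hl). unfold gdiv.
  rewrite (zsum_extend _ 1 (m + 1) (l * m + 1)); [| nia |].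
  2: { intros x Hx; rewrite b2z_false; [lia|]; intros [A B].
       assert (A' : (x | m)) by (apply Gauss with l; auto; apply rel_prime_sym, prime_rel_prime; auto).
       apply Z.divide_pos_le in A'; lia. }
  apply zsum_ext; intros d _. f_equal. apply b2z_iff. split; intros [A B]; split; auto.
  - apply Gauss with l; auto. apply rel_prime_sym, prime_rel_prime; auto.
  - apply Z.divide_mul_r; auto.
Qed.

Lemma gdiv_ndiv n l m : ~ (l | m) -> gdiv n l m = fdiv n m.
Proof.
  intro H; apply zsum_ext; intros d _. f_equal. apply b2z_iff. split; [tauto|].
  intro Hd; split; auto. intro; apply H; eapply Z.divide_trans; eauto.
Qed.

Lemma jac_split_divisor n d m : 0 < n -> Z.odd n = true -> split_num n m -> 0 < d -> (d | m) -> jac d n = 1.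
Proof.
  intros Hn Ho Hs Hd. rewrite <- (Z2Nat.id d) in * by lia.
  induction (Z.to_nat d) as [k IH] using lt_wf_ind. intro Hdm.
  destruct (Z.eq_dec (Z.of_nat k) 1) as [->|]; [apply jac_1; auto|].
  destruct (prime_factor (Z.of_nat k)) as [l [Hl [c Hc]]]; [lia|].
  pose proof (prime_ge_2 l Hl). assert (0 < c) by nia.
  assert (Hr : rel_prime (Z.of_nat k) n).
  { apply (rel_prime_div m); auto. apply rel_prime_2n_n, Hs. }
  rewrite Hc in *. rewrite jac_mul; auto.
  - rewrite <- (Z2Nat.id c) at 1 by lia. rewrite IH.
    + destruct Hs as (_ & _ & Hs). rewrite Hs; auto. eapply Z.divide_trans; [|exact Hdm]. apply Z.divide_factor_r.
    + nia.
    + lia.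
    + rewrite Z2Nat.id by lia. eapply Z.divide_trans; [|exact Hdm]. apply Z.divide_factor_l.
  - apply rel_prime_mul_inv_l in Hr; auto.
  - apply rel_prime_mul_inv_r in Hr; auto.
Qed.

Lemma fdiv_split n m : 0 < n -> Z.odd n = true -> split_num n m -> 1 <= fdiv n m.
Proof.
  intros Hn Ho Hs. unfold fdiv.
  apply Z.le_trans with (b2z (1 | m) * jac 1 n).
  - rewrite b2z_true, jac_1 by (auto using Z.divide_1_l). lia.
  - apply (zsum_term (fun d => b2z (d | m) * jac d n)).
    + intros d Hd; apply in_zr in Hd. destruct (classic (d | m)).
      * rewrite (jac_split_divisor n d m); auto; [|lia]. pose proof (b2z_bound (d | m)). lia.
      * rewrite b2z_false; auto. lia.
    + apply in_zr. destruct Hs. lia.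
Qed.

(** Nonsplit primes are removed two at a time: a factor [l^2] does not change [fdiv], because
    [fdiv_gdiv] applied twice cancels, and a simple factor [l] makes it vanish. *)
Lemma fdiv_spec n m : 0 < n -> Z.odd n = true -> 0 < m -> rel_prime m (2 * n) ->
  0 <= fdiv n m /\ (fdiv n m <> 0 -> exists m1 e, split_num n m1 /\ m = m1 * (e * e)).
Proof.
  intros Hn Ho Hm. rewrite <- (Z2Nat.id m) in * by lia.
  induction (Z.to_nat m) as [k IH] using lt_wf_ind. intro Hr.
  destruct (classic (split_num n (Z.of_nat k))) as [Hs|Hs].
  { pose proof (fdiv_split n _ Hn Ho Hs). split; [lia|]. intros _. exists (Z.of_nat k), 1. split; auto; lia. }
  assert (exists l, prime l /\ (l | Z.of_nat k) /\ jac l n = -1) as [l [Hl [[c Hc] Hj]]].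
  { apply NNPP; intro Hno. apply Hs. split; [lia | split; [auto|]]. intros l Hl Hd.
    destruct (jac_pm l n); auto. exfalso; eauto. }
  pose proof (prime_ge_2 l Hl). assert (0 < c) by nia.
  rewrite Z.mul_comm in Hc. rewrite Hc in *.
  assert (Hrn : rel_prime (l * c) n) by (apply rel_prime_2n_n; auto).
  rewrite fdiv_gdiv, gdiv_mul; auto; [|lia].
  destruct (classic (l | c)) as [[b Hb]|Hlc].
  - rewrite Z.mul_comm in Hb. subst c. assert (0 < b) by nia.
    rewrite fdiv_gdiv; auto; [|apply rel_prime_mul_inv_r in Hrn; auto|lia].
    replace (gdiv n l (l * b) - (gdiv n l (l * b) - fdiv n b)) with (fdiv n b) by lia.
    rewrite <- (Z2Nat.id b) at 1 2 by lia.
    destruct (IH (Z.to_nat b)) as [H2 H3]; [nia|lia| |].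
    { rewrite Z2Nat.id by lia. do 2 apply rel_prime_mul_inv_r in Hr. auto. }
    split; auto. intro Hf; destruct (H3 Hf) as (m1 & e & Hm1 & E).
    exists m1, (l * e); split; auto. rewrite Z2Nat.id in E by lia. rewrite E; ring.
  - rewrite gdiv_ndiv by auto. split; [lia|]. intro; lia.
Qed.

(** * Sums of three squares *)

Lemma cnt_zr_split (P : Z -> Prop) a b c : a <= b <= c -> cnt P (zr a c) = cnt P (zr a b) + cnt P (zr b c).
Proof. intro H; unfold cnt; rewrite (zr_split a b c), zsum_app; auto. Qed.

Lemma cnt_zero {A} (P : A -> Prop) l : (forall x, In x l -> ~ P x) -> cnt P l = 0.
Proof. intro H; apply zsum_zero; intros; apply b2z_false; auto. Qed.

Lemma cnt_atmost {A} (P : A -> Prop) l b : NoDup l -> atmost b (fun x => In x l /\ P x) -> cnt P l <= b.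
Proof.
  intros Hl H; rewrite cnt_sel; apply H; [apply nodup_sel; auto|]. intros x Hx; apply in_sel; auto.
Qed.

Lemma atmost_1 {A} (P : A -> Prop) : (forall x y, P x -> P y -> x = y) -> atmost 1 P.
Proof.
  intros H [|a [|b l]] Hl HP; [cbn; lia | cbn; lia |]. exfalso.
  inversion Hl; subst. apply H2. rewrite (H a b); [left; auto | apply HP; left; auto |].
  apply HP; right; left; auto.
Qed.

Lemma ap_short d M a u w : 0 < M -> rel_prime d M -> w <= u + M ->
  cnt (fun e => (M | d * e - a)) (zr u w) <= 1.
Proof.
  intros HM Hr Hw. apply cnt_atmost; [apply nodup_zr|]. apply atmost_1.
  intros x y [Hx [k Hk]] [Hy [j Hj]]. apply in_zr in Hx, Hy.
  assert (Hd : (M | d * (x - y))) by (exists (k - j); lia).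
  apply Gauss in Hd; [|apply rel_prime_sym; auto]. destruct Hd as [c Hc].
  assert (c = 0) by nia. subst; lia.
Qed.

Lemma ap_full d M a u : 0 < M -> rel_prime d M ->
  cnt (fun e => (M | d * e - a)) (zr u (u + M)) = 1.
Proof.
  intros HM Hr. pose proof (ap_short d M a u (u + M) HM Hr ltac:(lia)).
  destruct (bezout_solve d M a Hr) as [x [k Hk]].
  set (y := u + (x - u) mod M). pose proof (Z.mod_pos_bound (x - u) M HM).
  assert (1 <= cnt (fun e => (M | d * e - a)) (zr u (u + M))); [|lia].
  apply Z.le_trans with (b2z (M | d * y - a)).
  - rewrite b2z_true; [lia|]. exists (k - d * ((x - u) / M)). unfold y.
    pose proof (Z_div_mod_eq_full (x - u) M). replace ((x - u) mod M) with (x - u - M * ((x - u) / M)) by lia.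
    transitivity (d * x - a - d * (M * ((x - u) / M))); [ring | rewrite Hk; ring].
  - apply (zsum_term (fun e => b2z (M | d * e - a))); [intros; apply b2z_bound|].
    apply in_zr; unfold y; lia.
Qed.

Lemma ap_count d M a b u w : 0 < M -> rel_prime d M ->
  Z.abs (cnt (fun e => (M | d * e - a)) (zr u w) - cnt (fun e => (M | d * e - b)) (zr u w)) <= 1.
Proof.
  intros HM Hr. remember (Z.to_nat (w - u)) as L eqn:HL. revert u HL.
  induction L as [L IH] using lt_wf_ind. intros u HL.
  destruct (Z_lt_le_dec (u + M) w).
  - rewrite !(cnt_zr_split _ u (u + M) w), !ap_full by (auto; lia).
    pose proof (IH (Z.to_nat (w - (u + M))) ltac:(lia) (u + M) eq_refl). lia.
  - pose proof (ap_short d M a u w HM Hr ltac:(lia)). pose proof (ap_short d M b u w HM Hr ltac:(lia)).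
    pose proof (cnt_nonneg (fun e => (M | d * e - a)) (zr u w)).
    pose proof (cnt_nonneg (fun e => (M | d * e - b)) (zr u w)). lia.
Qed.

Lemma cnt_cut (P : Z -> Prop) d N u c : 0 < d -> N / d + 1 <= c -> u <= N / d + 1 ->
  cnt (fun e => d * e <= N /\ P e) (zr u c) = cnt P (zr u (N / d + 1)).
Proof.
  intros Hd Hc Hu. rewrite (cnt_zr_split _ u (N / d + 1) c) by lia.
  pose proof (Z_div_mod_eq_full N d). pose proof (Z.mod_pos_bound N d Hd).
  rewrite (cnt_zero _ (zr (N / d + 1) c)).
  - rewrite Z.add_0_r. apply cnt_iff. intros x Hx; apply in_zr in Hx.
    split; [tauto|]. intro; split; auto. nia.
  - intros x Hx [H1 _]; apply in_zr in Hx. nia.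
Qed.

(** Arranged by pairs [d * e = m] for the hyperbola method; [Ssum_fdiv] identifies it with the sum
    of [fdiv n m] over [m <= N] congruent to [a] modulo [2 n]. *)
Definition Ssum (n N a : Z) : Z :=
  zsum (fun d => jac d n * cnt (fun e => d * e <= N /\ (2 * n | d * e - a)) (zr 1 (N + 1))) (zr 1 (N + 1)).

Lemma Ssum_fdiv n N a : 0 < n -> 0 <= N ->
  Ssum n N a = zsum (fun m => b2z (2 * n | m - a) * fdiv n m) (zr 1 (N + 1)).
Proof.
  intros Hn HN.
  rewrite (zsum_ext (fun m => b2z (2 * n | m - a) * fdiv n m)
    (fun m => zsum (fun d => jac d n * b2z ((2 * n | m - a) /\ (d | m))) (zr 1 (N + 1)))).
  2: { intros m Hm; apply in_zr in Hm. unfold fdiv.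
       rewrite <- zsum_scale. rewrite (zsum_extend _ 1 (m + 1) (N + 1)); [| lia |].
       - apply zsum_ext. intros d _. destruct (classic (d | m)) as [h|h].
         + rewrite (b2z_true _ h), (b2z_iff ((2 * n | m - a) /\ (d | m)) (2 * n | m - a)) by tauto. ring.
         + rewrite (b2z_false _ h), (b2z_false ((2 * n | m - a) /\ (d | m))) by tauto. ring.
       - intros d Hd. rewrite b2z_false; [ring|]. intros [_ A]. apply Z.divide_pos_le in A; lia. }
  rewrite (zsum_swap (fun m d => jac d n * b2z ((2 * n | m - a) /\ (d | m)))).
  apply zsum_ext. intros d Hd; apply in_zr in Hd. rewrite zsum_scale. f_equal.
  rewrite (zsum_ext _ (fun m => b2z (m <= N /\ (2 * n | m - a) /\ (d | m)))).
  2: { intros m Hm; apply in_zr in Hm. apply b2z_iff. intuition lia. }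
  rewrite <- (zsum_extend (fun m => b2z (m <= N /\ (2 * n | m - a) /\ (d | m))) 1 (N + 1) (d * N + 1)) by
    (try nia; intros m Hm; apply b2z_false; lia).
  rewrite zsum_multiples by (try lia; intros x Hx; apply b2z_false; tauto).
  apply cnt_iff. intros e _. pose proof (Z.divide_factor_l d e). tauto.
Qed.

(** Dirichlet's hyperbola method. For [d > R] the roles of [d] and [e] are exchanged, with
    [jac d n = jac e n] because [d * e] has character 1. In both parts one variable is at most [R],
    and for each of its values two residue classes differ by at most 1. *)
Lemma Ssum_diff n R a : 0 < n -> Z.odd n = true -> 0 <= R -> rel_prime a (2 * n) -> jac a n = 1 ->
  Z.abs (Ssum n (R * R) a - Ssum n (R * R) 1) <= 2 * R.
Proof.
  intros Hn Ho HR Ha Hj.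
  assert (H1 : rel_prime 1 (2 * n)) by apply rel_prime_1.
  assert (Hunit : forall a d e, rel_prime a (2 * n) -> (2 * n | d * e - a) -> rel_prime (d * e) (2 * n)).
  { clear; intros a d e Ha Hd. apply (rel_prime_cong a); auto.
    replace (a - d * e) with (- (d * e - a)) by ring. apply Z.divide_opp_r; auto. }
  assert (Hs : forall a, rel_prime a (2 * n) -> jac a n = 1 -> Ssum n (R * R) a =
    zsum (fun d => jac d n * cnt (fun e => (2 * n | d * e - a)) (zr 1 (R * R / d + 1))) (zr 1 (R + 1)) +
    zsum (fun e => jac e n * cnt (fun d => (2 * n | e * d - a)) (zr (R + 1) (R * R / e + 1))) (zr 1 (R + 1))).
  { clear a Ha Hj; intros a Ha Hj. unfold Ssum.
    match goal with |- zsum ?g _ = _ => set (hh := g) end.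
    rewrite (zr_split 1 (R + 1) (R * R + 1)), zsum_app by nia. unfold hh. f_equal.
    - apply zsum_ext. intros d Hd; apply in_zr in Hd. f_equal.
      assert (R * R / d <= R * R) by (apply Z.div_le_upper_bound; nia).
      assert (0 <= R * R / d) by (apply Z.div_pos; nia).
      apply cnt_cut; lia.
    - unfold cnt at 1. rewrite (zsum_ext _ (fun d => zsum (fun e => jac d n * b2z (d * e <= R * R /\ (2 * n | d * e - a))) (zr 1 (R + 1)))).
      + rewrite zsum_swap. apply zsum_ext. intros e He; apply in_zr in He.
        rewrite (zsum_ext _ (fun d => jac e n * b2z (e * d <= R * R /\ (2 * n | e * d - a)))).
        * rewrite zsum_scale. f_equal.
          assert (R * R / e <= R * R) by (apply Z.div_le_upper_bound; nia).
          assert (R <= R * R / e) by (apply Z.div_le_lower_bound; nia).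
          apply (cnt_cut (fun d => (2 * n | e * d - a))); lia.
        * intros d Hd. rewrite (Z.mul_comm d e). destruct (classic (e * d <= R * R /\ (2 * n | e * d - a))) as [h|h].
          -- rewrite (b2z_true _ h). destruct h as [_ h]. pose proof (Hunit a e d Ha h) as Hu.
             apply rel_prime_2n_n in Hu.
             assert (jac e n * jac d n = 1).
             { rewrite <- jac_mul; [|auto|auto|apply rel_prime_mul_inv_l in Hu; auto | apply rel_prime_mul_inv_r in Hu; auto].
               rewrite <- Hj. apply jac_cong; auto. destruct h as [k Hk]; exists (2 * k). lia. }
             destruct (jac_pm e n) as [E|E], (jac_pm d n) as [D|D]; rewrite E, D in *; lia.
          -- rewrite (b2z_false _ h). lia.
      + intros d Hd; apply in_zr in Hd. rewrite zsum_scale. f_equal.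
        rewrite <- (zsum_extend _ 1 (R + 1) (R * R + 1)); [auto | nia |].
        intros e He. apply b2z_false. nia. }
  rewrite (Hs a), (Hs 1) by (auto using jac_1). 
  set (A1 := zsum _ _). set (B1 := zsum _ _). set (A2 := zsum _ _) at 1. set (B2 := zsum _ _) at 1.
  assert (Hstep : forall u w : Z -> Z, Z.abs
     (zsum (fun d => jac d n * cnt (fun e => (2 * n | d * e - a)) (zr (u d) (w d))) (zr 1 (R + 1)) -
      zsum (fun d => jac d n * cnt (fun e => (2 * n | d * e - 1)) (zr (u d) (w d))) (zr 1 (R + 1))) <= R).
  { intros u w. rewrite <- zsum_sub. eapply Z.le_trans; [apply zsum_abs|].
    apply Z.le_trans with (1 * zlen (zr 1 (R + 1))); [|rewrite zlen_zr; lia].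
    apply zsum_bound. intros d _. destruct (classic (rel_prime d (2 * n))) as [h|h].
    - pose proof (ap_count d (2 * n) a 1 (u d) (w d) ltac:(lia) h).
      destruct (jac_pm d n) as [-> | ->]; lia.
    - rewrite !cnt_zero; [lia | |].
      + intros e _ h'. apply h. apply (rel_prime_mul_inv_l d e). first [apply (Hunit a d e Ha h') | apply (Hunit 1 d e H1 h')].
      + intros e _ h'. apply h. apply (rel_prime_mul_inv_l d e). first [apply (Hunit a d e Ha h') | apply (Hunit 1 d e H1 h')]. }
  pose proof (Hstep (fun _ => 1) (fun d => R * R / d + 1)) as D1.
  pose proof (Hstep (fun _ => R + 1) (fun d => R * R / d + 1)) as D2.
  fold A1 A2 in D1. unfold A1, A2, B1, B2. cbv beta in *. lia.
Qed.

(** The split numbers congruent to 1 that make the sum large are values of [x^2 + n y^2]. *)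
Lemma Ssum_1_large n : 0 < n -> n mod 8 = 3 -> exists R, 0 <= R /\ 2 * R < Ssum n (R * R) 1.
Proof.
  intros Hn H8. pose proof (mod8_odd n H8) as Ho.
  (* The [J * T] values collected below must outnumber [2 R = 8 n T]. *)
  set (J := 8 * n + 1). set (D := fun j => n * (2 * n) ^ j * (2 * n) ^ j * (2 * n) * (2 * n)).
  assert (HD : forall j, 0 <= j < J -> 0 <= D j <= D J).
  { intros j Hj. unfold D. assert (0 < (2 * n) ^ j <= (2 * n) ^ J).
    { split; [apply Z.pow_pos_nonneg; lia | apply Z.pow_le_mono_r; lia]. }
    assert ((2 * n) ^ j * (2 * n) ^ j <= (2 * n) ^ J * (2 * n) ^ J) by nia.
    assert (0 <= n * ((2 * n) * (2 * n))) by nia.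
    split; [nia|]. replace (n * (2 * n) ^ j * (2 * n) ^ j * (2 * n) * (2 * n)) with
      ((n * (2 * n * (2 * n))) * ((2 * n) ^ j * (2 * n) ^ j)) by ring.
    replace (n * (2 * n) ^ J * (2 * n) ^ J * (2 * n) * (2 * n)) with
      ((n * (2 * n * (2 * n))) * ((2 * n) ^ J * (2 * n) ^ J)) by ring. nia. }
  assert (Hinj : forall i j, 0 <= i -> 0 <= j -> D i = D j -> i = j).
  { intros i j Hi Hj E. unfold D in E.
    assert (E2 : (2 * n) ^ (i + i) = (2 * n) ^ (j + j)) by (rewrite !Z.pow_add_r by lia; nia).
    apply Z.pow_inj_r in E2; lia. }
  (* For [s >= T] the squares [(1 + 2 n s)^2] are further apart than any [D j], so a value
     determines both [s] and [j]. *)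
  set (T := D J + 1). assert (0 < T) by (unfold T; pose proof (HD 0 ltac:(unfold J; lia)); lia).
  exists (4 * n * T). split; [nia|].
  set (f := fun w : Z * Z => (1 + 2 * n * snd w) * (1 + 2 * n * snd w) + D (fst w)).
  set (L := map f (list_prod (zr 0 J) (zr T (2 * T)))).
  rewrite Ssum_fdiv by nia. set (N := 4 * n * T * (4 * n * T)).
  assert (HL : zlen L = J * T).
  { unfold L. rewrite zlen_map, pair_list, !zlen_zr; unfold J; lia. }
  assert (HLd : NoDup L).
  { unfold L. apply nodup_map_inj; [apply nodup_prod; apply nodup_zr|].
    intros [i s] [j t] Hx Hy E. apply in_prod_iff in Hx, Hy. rewrite !in_zr in Hx, Hy.
    unfold f in E; cbn [fst snd] in E. pose proof (HD i ltac:(lia)). pose proof (HD j ltac:(lia)).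
    assert (s = t).
    { destruct (Z.lt_trichotomy s t) as [h|[h|h]]; auto; exfalso; unfold T in *.
      - assert (s + 1 <= t) by lia. assert (1 + 2 * n * s + 1 <= 1 + 2 * n * t) by nia.
        assert (D J + 1 <= 2 * n * s) by nia. nia.
      - assert (t + 1 <= s) by lia. assert (1 + 2 * n * t + 1 <= 1 + 2 * n * s) by nia.
        assert (D J + 1 <= 2 * n * t) by nia. nia. }
    subst t. f_equal. apply Hinj; lia. }
  assert (HLs : forall m, In m L -> split_num n m /\ 1 <= m <= N /\ (2 * n | m - 1)).
  { intros m Hm. apply in_map_iff in Hm. destruct Hm as [[j t] [<- Hm]].
    apply in_prod_iff in Hm. rewrite !in_zr in Hm. unfold f; cbn [fst snd].
    pose proof (HD j ltac:(lia)). split; [|split].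
    - apply split_num_norm; auto; [|lia]. apply (rel_prime_cong 1); [|apply rel_prime_1].
      exists (- t); ring.
    - split; [nia|]. unfold N. assert (1 + 2 * n * t + 1 <= 4 * n * T) by nia.
      assert (D j < 2 * n * t) by (unfold T in *; nia). nia.
    - exists (t * (2 + 2 * n * t) + (n * (2 * n) ^ j * (2 * n) ^ j * (2 * n))). unfold D. ring. }
  assert (Hnon : forall m, In m (zr 1 (N + 1)) -> 0 <= b2z (2 * n | m - 1) * fdiv n m).
  { intros m Hm. apply in_zr in Hm. destruct (classic (2 * n | m - 1)) as [h|h].
    - rewrite b2z_true by auto. destruct (fdiv_spec n m) as [H1 _]; auto; try lia.
      apply (rel_prime_cong 1); [|apply rel_prime_1]. destruct h as [k Hk]; exists (- k); lia.
    - rewrite b2z_false by auto; lia. }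
  apply Z.lt_le_trans with (zlen L); [rewrite HL; unfold J; nia|].
  apply Z.le_trans with (cnt (fun m => In m L) (zr 1 (N + 1))).
  - rewrite cnt_sel. unfold zlen. apply inj_le. apply NoDup_incl_length; auto.
    intros m Hm. apply in_sel. split; auto. apply in_zr. apply HLs in Hm. lia.
  - apply zsum_le. intros m Hm. destruct (classic (In m L)) as [h|h].
    + rewrite b2z_true by auto. destruct (HLs m h) as (A & B & C). rewrite b2z_true by auto.
      pose proof (fdiv_split n m Hn Ho A). lia.
    + rewrite b2z_false by auto. auto.
Qed.

(** With [n = 2 a + 1], any [P] congruent to [a] modulo [2 n] satisfies [n | 2 P + 1]. Since
    [2 a = -1] modulo [n] and [jac 2 n = jac (-1) n = -1], [a] has character 1, so its class carries
    a nonzero divisor sum because the class of 1 carries a large one. This yields [m = m1 * e^2] in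
    the class with [m1] split. Replacing [e^2] by the split number [e^2 + n (2 n)^2], which is
    congruent to it, gives [P]. *)
Theorem sum3_mod8 n : 0 < n -> n mod 8 = 3 -> sum3 n.
Proof.
  intros Hn H8. pose proof (mod8_odd n H8) as Ho.
  set (a := (n - 1) / 2).
  assert (Ea : n = 2 * a + 1) by (unfold a; Z.div_mod_to_equations; lia).
  assert (Oa : Z.odd a = true).
  { apply Z.odd_spec; exists (2 * (n / 8)); unfold a; Z.div_mod_to_equations; lia. }
  assert (Ran : rel_prime a n).
  { apply bezout_rel_prime. apply (Bezout_intro _ _ _ (-2) 1). lia. }
  assert (R2 : rel_prime 2 n).
  { apply bezout_rel_prime. apply (Bezout_intro _ _ _ (- a) 1). lia. }
  assert (Ra2 : rel_prime a (2 * n)).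
  { apply rel_prime_mult; auto. apply rel_prime_sym, prime_rel_prime; [apply prime_2|].
    intros [k Hk]; rewrite Hk, Z.odd_mul, Bool.andb_comm in Oa; discriminate. }
  assert (Ja : jac a n = 1).
  { assert (E : jac (2 * a) n = jac (-1) n) by (apply jac_cong; auto; exists 1; lia).
    rewrite jac_mul, jac_2, jac_m1 in E by auto. fold a in E. unfold par in E. rewrite Oa in E. lia. }
  destruct (Ssum_1_large n Hn H8) as [R [HR HS]].
  pose proof (Ssum_diff n R a Hn Ho HR Ra2 Ja) as HD.
  assert (HSa : Ssum n (R * R) a <> 0) by lia.
  rewrite Ssum_fdiv in HSa by nia.
  assert (exists m, 1 <= m /\ (2 * n | m - a) /\ fdiv n m <> 0) as (m & Hm & [k Hk] & Hf).
  { apply NNPP; intro Hno. apply HSa, zsum_zero. intros m Hm. apply in_zr in Hm.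
    destruct (Z.eq_dec (fdiv n m) 0) as [->|h]; [lia|].
    rewrite b2z_false; [lia|]. intro h'. apply Hno; exists m; split; [lia|auto]. }
  assert (Rm : rel_prime m (2 * n)) by (apply (rel_prime_cong a); auto; exists (- k); lia).
  destruct (fdiv_spec n m Hn Ho ltac:(lia) Rm) as [_ H2].
  destruct (H2 Hf) as (m1 & e & Hm1 & Em).
  assert (Re : rel_prime e (2 * n)).
  { rewrite Em in Rm. do 2 apply rel_prime_mul_inv_r in Rm. auto. }
  pose proof (split_num_norm n e 0 Hn H8 Re ltac:(lia)) as Hw.
  pose proof (split_num_mul n _ _ Hm1 Hw) as HP.
  set (P := m1 * (e * e + n * (2 * n) ^ 0 * (2 * n) ^ 0 * (2 * n) * (2 * n))) in *.
  destruct (split_num_root n Hn H8 P HP) as [t Ht].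
  assert (HPm : (2 * n | P - m)).
  { rewrite Em. exists (m1 * n * (2 * n)). unfold P. rewrite Z.pow_0_r. ring. }
  destruct HP as (HP0 & HPr & _).
  apply (sum3_of_root n P t); auto.
  - apply (odd_of_rel_prime P n); auto.
  - apply rel_prime_2n_n; auto.
  - destruct HPm as [j Hj]. exists (1 + 4 * (j + k)). lia.
Qed.

(** * Upper bounds for representations by two and three squares *)

Definition G2 (n : Z) (z : Z * Z) : Prop := fst z * fst z + snd z * snd z = n.
(** Multiplication by the Gaussian integer [c + d i]. *)
Definition gmul (c d : Z) (z : Z * Z) : Z * Z := (c * fst z - d * snd z, c * snd z + d * fst z).

Lemma atmost_image {A B} (f : A -> B) b (P : A -> Prop) :
  atmost b P -> atmost b (fun y => exists x, P x /\ y = f x).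
Proof.
  intro H. destruct (finite_enum b P H) as [L [HL HP]].
  apply (atmost_le (zlen (map f L)) b (fun y => exists x, P x /\ y = f x)).
  - apply atmost_list. intros y [x [Hx ->]]. apply in_map, HP; auto.
  - rewrite zlen_map. apply H; auto. intros x; apply HP.
  - auto.
Qed.

Lemma two_squares_descent l : prime l -> forall n : nat, forall a b m, (Z.to_nat m < n)%nat ->
  a * a + b * b = m * l -> 0 < m < l -> exists c d, l = c * c + d * d.
Proof.
  intros Hl; induction n as [|n IH]; intros a b m Hn E Hm; [lia|].
  destruct (Z.eq_dec m 1) as [->|]; [exists a, b; lia|].
  destruct (centered_spec m a) as [[s Hs] [Ha1 Ha2]]; [lia|].
  destruct (centered_spec m b) as [[t Ht] [Hb1 _]]; [lia|].
  set (u := centered m a) in *. set (v := centered m b) in *.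
  assert (Hu : 4 * (u * u) <= m * m) by (apply sq_half; lia).
  assert (Hv : 4 * (v * v) <= m * m) by (apply sq_half; lia).
  assert (exists m', u * u + v * v = m' * m) as [m' Hm'].
  { exists (l - 2 * (u * s + v * t) - m * (s * s + t * t)).
    assert (a = u + s * m) by lia. assert (b = v + t * m) by lia. nia. }
  assert (0 <= m' < m).
  { pose proof (Z.square_nonneg u). pose proof (Z.square_nonneg v). nia. }
  assert (m' <> 0).
  { intros ->. assert (u = 0) by nia. assert (v = 0) by nia.
    assert (Hd : (m | l)). { exists (s * s + t * t). assert (a = s * m) by lia. assert (b = t * m) by lia. nia. }
    destruct (prime_divisors l Hl m Hd) as [|[|[|]]]; lia. }
  (* These are the coordinates, up to conjugation, of [(a + b i) * conj (u + v i)] divided by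
     [m]. *)
  apply (IH (s * u + t * v + m') (s * v - t * u) m'); [lia| |lia].
  assert (Ea : a = u + s * m) by lia. assert (Eb : b = v + t * m) by lia.
  assert (K : m * m * ((s * u + t * v + m') * (s * u + t * v + m') + (s * v - t * u) * (s * v - t * u)) = m * m * (m' * l)).
  { transitivity ((a * a + b * b) * (u * u + v * v)).
    - transitivity ((a * u + b * v) * (a * u + b * v) + (a * v - b * u) * (a * v - b * u)); [|ring].
      rewrite Ea, Eb. 
      replace ((u + s * m) * u + (v + t * m) * v) with (m * (s * u + t * v) + (u * u + v * v)) by ring.
      rewrite Hm'. ring.
    - rewrite E, Hm'. ring. }
  apply Z.mul_cancel_l in K; nia.
Qed.

Lemma fermat_two_squares l a b : prime l -> (l | a * a + b * b) -> ~ (l | a) ->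
  exists c d, l = c * c + d * d.
Proof.
  intros Hl [k Hk] Ha. pose proof (prime_ge_2 l Hl).
  destruct (centered_spec l a) as [[s Hs] [Ha1 Ha2]]; [lia|].
  destruct (centered_spec l b) as [[t Ht] [Hb1 _]]; [lia|].
  set (u := centered l a) in *. set (v := centered l b) in *.
  assert (Hu : 4 * (u * u) <= l * l) by (apply sq_half; lia).
  assert (Hv : 4 * (v * v) <= l * l) by (apply sq_half; lia).
  assert (u <> 0) by (intro h; apply Ha; exists s; lia).
  set (m := k - 2 * (u * s + v * t) - l * (s * s + t * t)).
  assert (Em : u * u + v * v = m * l).
  { unfold m. assert (a = u + s * l) by lia. assert (b = v + t * l) by lia. nia. }
  apply (two_squares_descent l Hl (S (Z.to_nat m)) u v m); auto.
  pose proof (Z.square_nonneg v). assert (0 < u * u) by nia. nia.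
Qed.

(** The product [(a c + b d)(a c - b d)] equals [a^2 (c^2 + d^2) - d^2 (a^2 + b^2)], so [l] divides
    one of its factors. *)
Lemma gauss_factor l a b c d : prime l -> l = c * c + d * d -> (l | a * a + b * b) ->
  (exists w, (a, b) = gmul c d w) \/ (exists w, (a, b) = gmul c (- d) w).
Proof.
  intros Hl E [k Hk]. pose proof (prime_ge_2 l Hl).
  assert (H0 : forall c d, l = c * c + d * d -> (l | a * c + b * d) -> exists w, (a, b) = gmul c d w).
  { clear c d E; intros c d E [x Hx].
    assert (Hy : (l | b * c - a * d)).
    { apply sq_dvd_prime; auto. exists (k * l - x * x * l).
      replace ((b * c - a * d) * (b * c - a * d)) with
        ((a * a + b * b) * (c * c + d * d) - (a * c + b * d) * (a * c + b * d)) by ring.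
      rewrite Hk, Hx, <- E. ring. }
    destruct Hy as [y Hy]. exists (x, y). unfold gmul; cbn [fst snd].
    f_equal; apply Z.mul_cancel_l with l; try lia.
    - transitivity (c * (x * l) - d * (y * l)); [|ring]. rewrite <- Hx, <- Hy, E. ring.
    - transitivity (c * (y * l) + d * (x * l)); [|ring]. rewrite <- Hx, <- Hy, E. ring. }
  assert (Hd : (l | (a * c + b * d) * (a * c + b * - d))).
  { exists (a * a - d * d * k).
    replace ((a * c + b * d) * (a * c + b * - d)) with (a * a * (c * c + d * d) - d * d * (a * a + b * b)) by ring.
    rewrite Hk, <- E. ring. }
  apply prime_mult in Hd; auto. destruct Hd as [Hd|Hd]; [left | right]; apply H0; auto. lia.
Qed.

Lemma gmul_norm c d w : fst (gmul c d w) * fst (gmul c d w) + snd (gmul c d w) * snd (gmul c d w) =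
  (c * c + d * d) * (fst w * fst w + snd w * snd w).
Proof. unfold gmul; cbn [fst snd]; ring. Qed.

Lemma gmul_comm c d e f w : gmul c d (gmul e f w) = gmul e f (gmul c d w).
Proof. unfold gmul; cbn [fst snd]; f_equal; ring. Qed.

Lemma iter_comm {A} (f g : A -> A) : (forall x, f (g x) = g (f x)) -> forall n x,
  f (Nat.iter n g x) = Nat.iter n g (f x).
Proof.
  intros H n x; induction n as [|n IH]; auto.
  change (f (g (Nat.iter n g x)) = g (Nat.iter n g (f x))). rewrite H, IH; auto.
Qed.

(** If [l = c^2 + d^2], a representation loses [e] Gaussian factors [c + d i] or [c - d i]; these
    commute, so only the number of each kind matters, with [e + 1] possibilities. If [l] is no sum
    of two squares, it divides both coordinates and the count does not grow. *)
Lemma r2_prime_pow l : prime l -> forall (e : nat) n b, 0 < n -> ~ (l | n) -> atmost b (G2 n) ->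
  atmost (Z.of_nat (S e) * b) (G2 (l ^ Z.of_nat e * n)).
Proof.
  intros Hl e n b Hn Hln Hb. pose proof (prime_ge_2 l Hl).
  pose proof (atmost_nonneg _ _ Hb) as Hb0.
  destruct (classic (exists c d, l = c * c + d * d)) as [(c & d & E)|Hno].
  - assert (Hz : forall e z, G2 (l ^ Z.of_nat e * n) z -> exists i, (i <= e)%nat /\ exists w, G2 n w /\
       z = Nat.iter i (gmul c d) (Nat.iter (e - i) (gmul c (- d)) w)).
    { clear e; induction e as [|e IH]; intros [x y] Hz.
      - exists 0%nat; split; auto. exists (x, y). split; auto. unfold G2 in *. cbn [Z.of_nat] in Hz.
        rewrite Z.pow_0_r in Hz. lia.
      - rewrite Nat2Z.inj_succ, Z.pow_succ_r in Hz by lia.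
        assert (Hd : (l | x * x + y * y)) by (exists (l ^ Z.of_nat e * n); unfold G2 in Hz; cbn [fst snd] in Hz; lia).
        destruct (gauss_factor l x y c d Hl E Hd) as [[w Hw]|[w Hw]].
        + destruct (IH w) as (i & Hi & v & Hv & ->).
          { unfold G2 in *. rewrite Hw, gmul_norm, <- E in Hz. nia. }
          exists (S i); split; [lia|]. exists v; split; auto.
        + destruct (IH w) as (i & Hi & v & Hv & ->).
          { unfold G2 in *. rewrite Hw, gmul_norm in Hz. replace (c * c + - d * - d) with l in Hz by lia. nia. }
          exists i; split; [lia|]. exists v; split; auto. rewrite Hw.
          rewrite (iter_comm (gmul c (- d)) (gmul c d)) by (intro; apply gmul_comm).
          replace (S e - i)%nat with (S (e - i)) by lia. reflexivity. }
    replace (Z.of_nat (S e) * b) with (zsum (fun _ : nat => b) (seq 0 (S e)))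
      by (rewrite zsum_const; unfold zlen; rewrite length_seq; lia).
    apply (atmost_cover (seq 0 (S e)) (fun _ => b) (fun i z => exists w, G2 n w /\
       z = Nat.iter i (gmul c d) (Nat.iter (e - i) (gmul c (- d)) w))).
    + intros z Hz'. destruct (Hz e z Hz') as (i & Hi & Hw). exists i; split; auto. apply in_seq; lia.
    + intros i _. apply (atmost_image (fun w => Nat.iter i (gmul c d) (Nat.iter (e - i) (gmul c (- d)) w))); auto.
  - assert (Hdiv : forall x y, (l | x * x + y * y) -> (l | x) /\ (l | y)).
    { intros x y Hd. split; apply NNPP; intro h; apply Hno.
      - apply (fermat_two_squares l x y); auto.
      - apply (fermat_two_squares l y x); auto. rewrite Z.add_comm; auto. }
    assert (Hi : atmost b (G2 (l ^ Z.of_nat e * n))).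
    { induction e as [e IH] using lt_wf_ind. destruct e as [|[|e]].
      - cbn [Z.of_nat]; rewrite Z.pow_0_r, Z.mul_1_l; auto.
      - intros [|z L] _ HL; [cbn; lia|]. exfalso. specialize (HL z (or_introl eq_refl)).
        destruct z as [x y]. unfold G2 in HL; cbn [fst snd] in HL. change (Z.of_nat 1) with 1 in HL.
        rewrite Z.pow_1_r in HL.
        destruct (Hdiv x y) as [[s ->] [t ->]]; [exists n; lia|]. apply Hln. exists (s * s + t * t). nia.
      - apply (atmost_le b b (fun z => exists w, G2 (l ^ Z.of_nat e * n) w /\ z = gmul l 0 w)); [|lia|].
        + apply atmost_image, IH; lia.
        + intros [x y] Hz. unfold G2 in Hz; cbn [fst snd] in Hz.
          rewrite !Nat2Z.inj_succ, !Z.pow_succ_r in Hz by lia.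
          destruct (Hdiv x y) as [[s ->] [t ->]]; [exists (l * l ^ Z.of_nat e * n); lia|].
          exists (s, t). split; [unfold G2; cbn [fst snd]; nia|].
          unfold gmul; cbn [fst snd]; f_equal; lia. }
    apply (atmost_le b _ (G2 (l ^ Z.of_nat e * n))); auto. nia.
Qed.

Lemma val_decomp l n : prime l -> 0 < n -> exists e n', n = l ^ Z.of_nat e * n' /\ 0 < n' /\ ~ (l | n').
Proof.
  intros Hl Hn. pose proof (prime_ge_2 l Hl). rewrite <- (Z2Nat.id n) in * by lia.
  induction (Z.to_nat n) as [k IH] using lt_wf_ind.
  destruct (classic (l | Z.of_nat k)) as [[c Hc]|h].
  - assert (0 < c) by nia. destruct (IH (Z.to_nat c)) as (e & n' & E & H1 & H2); [nia|lia|].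
    exists (S e), n'; repeat split; auto. rewrite Nat2Z.inj_succ, Z.pow_succ_r by lia.
    rewrite Hc. rewrite Z2Nat.id in E by lia. rewrite E. ring.
  - exists 0%nat, (Z.of_nat k); repeat split; auto. cbn [Z.of_nat]; rewrite Z.pow_0_r; lia.
Qed.

Lemma le_pow2 (t : nat) : Z.of_nat t + 1 <= 2 ^ Z.of_nat t.
Proof.
  induction t; [cbn; lia|]. rewrite Nat2Z.inj_succ, Z.pow_succ_r by lia. lia.
Qed.

(** With [t = e / j] rounded down, [e + 1 <= j (t + 1) <= j 2^t], and the power [j] is taken. *)
Lemma poly_exp (j e : nat) : (1 <= j)%nat ->
  Z.of_nat (S e) ^ Z.of_nat j <= Z.of_nat j ^ Z.of_nat j * 2 ^ Z.of_nat e.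
Proof.
  intro Hj. set (t := (e / j)%nat).
  assert (He : (S e <= j * (t + 1))%nat).
  { unfold t. pose proof (Nat.div_mod e j ltac:(lia)). pose proof (Nat.mod_upper_bound e j ltac:(lia)). lia. }
  assert (Ht : (j * t <= e)%nat) by (unfold t; apply Nat.Div0.mul_div_le).
  pose proof (le_pow2 t).
  assert (Z.of_nat (S e) <= Z.of_nat j * 2 ^ Z.of_nat t) by nia.
  apply Z.le_trans with ((Z.of_nat j * 2 ^ Z.of_nat t) ^ Z.of_nat j).
  - apply Z.pow_le_mono_l; lia.
  - rewrite Z.pow_mul_l, <- Z.pow_mul_r by lia.
    apply Z.mul_le_mono_nonneg_l; [apply Z.pow_nonneg; lia|].
    apply Z.pow_le_mono_r; nia.
Qed.

Lemma G2_one : atmost 4 (G2 1).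
Proof.
  apply (atmost_list [(1, 0); (-1, 0); (0, 1); (0, -1)]). intros [a b] H; unfold G2 in H; cbn [fst snd] in H.
  assert (-1 <= a <= 1) by nia. assert (-1 <= b <= 1) by nia.
  assert (a = -1 \/ a = 0 \/ a = 1) as [-> | [-> | ->]] by lia;
  assert (b = -1 \/ b = 0 \/ b = 1) as [-> | [-> | ->]] by lia; cbn in *; auto; lia.
Qed.

Lemma r2_bound_aux (j : nat) : (1 <= j)%nat -> forall B : nat, exists C, 0 < C /\ forall n, 0 < n ->
  (forall l, prime l -> (l | n) -> l < Z.of_nat B \/ 2 ^ Z.of_nat j <= l) ->
  exists b, atmost b (G2 n) /\ b ^ Z.of_nat j <= C * n.
Proof.
  intros Hj; induction B as [|B [C [HC IH]]].
  - exists (4 ^ Z.of_nat j). split; [apply Z.pow_pos_nonneg; lia|]. intros n Hn.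
    rewrite <- (Z2Nat.id n) in * by lia. induction (Z.to_nat n) as [k IHk] using lt_wf_ind. intro Hp.
    destruct (Z.eq_dec (Z.of_nat k) 1) as [->|].
    { exists 4; split; [apply G2_one | lia]. }
    destruct (prime_factor (Z.of_nat k)) as [l [Hl Hd]]; [lia|].
    destruct (val_decomp l (Z.of_nat k) Hl Hn) as (e & n' & E & H1 & H2).
    pose proof (prime_ge_2 l Hl). destruct e as [|e].
    { exfalso. apply H2. rewrite E in Hd. cbn [Z.of_nat] in Hd. rewrite Z.pow_0_r, Z.mul_1_l in Hd; auto. }
    assert (Hle : 2 <= l ^ Z.of_nat (S e)).
    { rewrite Nat2Z.inj_succ, Z.pow_succ_r by lia. pose proof (Z.pow_pos_nonneg l (Z.of_nat e)). nia. }
    destruct (IHk (Z.to_nat n')) as (b & Hb & Hbj); [nia|lia| |].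
    { rewrite Z2Nat.id by lia. intros l' Hl' Hd'. apply Hp; auto. rewrite E. apply Z.divide_mul_r; auto. }
    rewrite Z2Nat.id in * by lia.
    exists (Z.of_nat (S (S e)) * b). split; [rewrite E; apply r2_prime_pow; auto|].
    rewrite Z.pow_mul_l.
    assert (Hle2 : Z.of_nat (S (S e)) ^ Z.of_nat j <= l ^ Z.of_nat (S e)).
    { destruct (Hp l Hl Hd) as [|Hpl]; [lia|].
      apply Z.le_trans with ((2 ^ Z.of_nat (S e)) ^ Z.of_nat j).
      - apply Z.pow_le_mono_l. pose proof (le_pow2 (S e)). lia.
      - rewrite <- Z.pow_mul_r, Z.mul_comm, Z.pow_mul_r by lia. apply Z.pow_le_mono_l.
        split; [apply Z.pow_nonneg; lia | auto]. }
    rewrite E. replace (4 ^ Z.of_nat j * (l ^ Z.of_nat (S e) * n')) with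
      (l ^ Z.of_nat (S e) * (4 ^ Z.of_nat j * n')) by ring.
    apply Z.mul_le_mono_nonneg; auto; apply Z.pow_nonneg; [lia|]. eapply atmost_nonneg; eauto.
  - exists (Z.of_nat j ^ Z.of_nat j * C + C). assert (0 <= Z.of_nat j ^ Z.of_nat j) by (apply Z.pow_nonneg; lia).
    split; [nia|]. intros n Hn Hp.
    destruct (classic (prime (Z.of_nat B) /\ (Z.of_nat B | n))) as [[HB Hd]|Hno].
    + destruct (val_decomp (Z.of_nat B) n HB Hn) as (e & n' & E & H1 & H2).
      pose proof (prime_ge_2 _ HB).
      destruct (IH n' H1) as (b & Hb & Hbj).
      { intros l Hl Hdl. destruct (Hp l Hl) as [h|h]; auto.
        - rewrite E. apply Z.divide_mul_r; auto.
        - left. destruct (Z.eq_dec l (Z.of_nat B)); [subst; contradiction | lia]. }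
      exists (Z.of_nat (S e) * b). split; [rewrite E; apply r2_prime_pow; auto|].
      rewrite Z.pow_mul_l.
      assert (He : Z.of_nat (S e) ^ Z.of_nat j <= Z.of_nat j ^ Z.of_nat j * Z.of_nat B ^ Z.of_nat e).
      { eapply Z.le_trans; [apply poly_exp; auto|]. apply Z.mul_le_mono_nonneg_l; auto.
        apply Z.pow_le_mono_l; lia. }
      apply Z.le_trans with (Z.of_nat j ^ Z.of_nat j * Z.of_nat B ^ Z.of_nat e * (C * n')).
      * apply Z.mul_le_mono_nonneg; auto; apply Z.pow_nonneg; [lia|]. eapply atmost_nonneg; eauto.
      * rewrite E. assert (0 < Z.of_nat B ^ Z.of_nat e) by (apply Z.pow_pos_nonneg; lia).
        assert (0 <= C * (Z.of_nat B ^ Z.of_nat e * n')) by nia. nia.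
    + destruct (IH n Hn) as (b & Hb & Hbj).
      { intros l Hl Hdl. destruct (Hp l Hl Hdl) as [h|h]; auto. left.
        destruct (Z.eq_dec l (Z.of_nat B)); [subst; tauto | lia]. }
      exists b; split; auto. nia.
Qed.

Lemma r2_bound (j : nat) : (1 <= j)%nat -> exists C, 0 < C /\ forall n, 0 < n ->
  exists b, atmost b (G2 n) /\ b ^ Z.of_nat j <= C * n.
Proof.
  intro Hj. destruct (r2_bound_aux j Hj (Z.to_nat (2 ^ Z.of_nat j))) as [C [HC H]].
  exists C; split; auto. intros n Hn; apply H; auto. intros l _ _.
  rewrite Z2Nat.id by (apply Z.pow_nonneg; lia). lia.
Qed.

(** The bound in the form used later: on numbers up to a fixed power of a large [E], the count is at
    most [E] itself. *)
Lemma r2_small (c : nat) : exists E0, 1 <= E0 /\ forall E n, E0 <= E -> n <= E ^ Z.of_nat c -> atmost E (G2 n).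
Proof.
  destruct (r2_bound (S c)) as [C [HC H]]; [lia|]. exists (C + 1). split; [lia|]. intros E n HE Hn.
  destruct (Z_lt_le_dec 0 n) as [h|h].
  - destruct (H n h) as (b & Hb & Hbj).
    apply (atmost_le b _ (G2 n)); auto.
    destruct (Z_le_gt_dec b E) as [|hb]; auto. exfalso.
    assert (E ^ Z.of_nat (S c) < b ^ Z.of_nat (S c)) by (apply Z.pow_lt_mono_l; lia).
    rewrite (Nat2Z.inj_succ c), (Z.pow_succ_r E) in H0 by lia. rewrite <- Nat2Z.inj_succ in H0.
    assert (0 < E ^ Z.of_nat c) by (apply Z.pow_pos_nonneg; lia). nia.
  - apply (atmost_le 1 _ (fun z => z = (0, 0))); [apply (atmost_list [(0, 0)]); intros z ->; left; auto | lia |].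
    intros [x y] Hz; unfold G2 in Hz; cbn [fst snd] in Hz. f_equal; nia.
Qed.

Definition G3 (n : Z) (v : Z * Z * Z) : Prop :=
  fst (fst v) * fst (fst v) + snd (fst v) * snd (fst v) + snd v * snd v = n.

Lemma r3_upper n E : 0 <= n -> (forall m, m <= n -> atmost E (G2 m)) ->
  atmost ((2 * Z.sqrt n + 1) * E) (G3 n).
Proof.
  intros Hn H. pose proof (atmost_nonneg _ _ (H n ltac:(lia))).
  pose proof (Z.sqrt_nonneg n). pose proof (Z.sqrt_spec n Hn) as Hs.
  apply (atmost_fiber (fun v => snd v) _ E _ (fun z => - Z.sqrt n <= z < Z.sqrt n + 1)); auto.
  - replace (2 * Z.sqrt n + 1) with (Z.sqrt n + 1 - - Z.sqrt n) by lia. apply atmost_interval; lia.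
  - intros [[a b] c] Hv. unfold G3 in Hv; cbn [fst snd] in *. unfold Z.succ in Hs. nia.
  - intros z _. apply (atmost_inj fst E _ (G2 (n - z * z))).
    + apply H. nia.
    + intros [[a b] c] [Hv Hz]. unfold G3, G2 in *; cbn [fst snd] in *. subst. lia.
    + intros [[a b] c] [[a' b'] c'] [_ Hz] [_ Hz'] E'; cbn [fst snd] in *. congruence.
Qed.

(** * Primes modulo which p is a nonresidue *)

(** Written with [jac q p], which is multiplicative in [q]; [cls_legendre] passes to the symbol of
    [p] modulo [q]. *)
Definition cls (p q : Z) : Prop := prime q /\ q mod 4 = 1 /\ jac q p = -1.

Lemma prime_distinct_rel p q : prime p -> prime q -> p <> q -> rel_prime p q.
Proof.
  intros Hp Hq H. apply prime_rel_prime; auto. intro Hd. apply H.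
  pose proof (prime_ge_2 p Hp). destruct (prime_divisors q Hq p Hd) as [|[|[|]]]; try lia.
  pose proof (prime_ge_2 q Hq); lia.
Qed.

Lemma jac_self p : 0 < p -> jac p p = 1.
Proof.
  intro Hp; unfold jac. rewrite (zprod_ext _ (fun _ => 1)).
  - rewrite zprod_const. apply Z.pow_1_l, zlen_nonneg.
  - intros x _. unfold sg. rewrite (Z.mul_comm p x), Z.mod_mul by lia. destruct (Z.ltb_spec (2 * 0) p); lia.
Qed.

Lemma mod4_odd n : n mod 4 = 1 -> Z.odd n = true.
Proof. intro H; apply Z.odd_spec; exists (2 * (n / 4)); Z.div_mod_to_equations; lia. Qed.

Lemma cls_neq p q : prime p -> cls p q -> q <> p.
Proof.
  intros Hp (_ & _ & Hj) ->. rewrite jac_self in Hj; [lia|]. pose proof (prime_ge_2 p Hp); lia.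
Qed.

Lemma cls_legendre p q : prime p -> p mod 4 = 1 -> cls p q -> legendre_minus_one p q.
Proof.
  intros Hp H4 Hc. pose proof (cls_neq p q Hp Hc) as Hne. destruct Hc as (Hq & Hq4 & Hj).
  pose proof (prime_ge_2 p Hp). pose proof (prime_ge_2 q Hq).
  assert (Hr : rel_prime q p) by (apply prime_distinct_rel; auto).
  assert (Hr' : rel_prime p q) by (apply rel_prime_sym; auto).
  assert (Hnd : ~ (q | p)).
  { intro Hd. destruct Hr as [_ _ Hr]. assert (Hd1 : (q | 1)) by (apply Hr; auto using Z.divide_refl).
    apply Z.divide_1_r_nonneg in Hd1; lia. }
  split; auto. intros [x [k Hx]].
  pose proof (jac_recip p q ltac:(lia) ltac:(lia) (mod4_odd p H4) (mod4_odd q Hq4) Hr') as R.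
  assert (E : jac p q = 1).
  { rewrite (jac_cong q p (x * x)) by (try lia; exists (- k); lia).
    apply jac_sq; [lia | apply mod4_odd; auto |]. apply rel_prime_sym, prime_rel_prime; auto.
    intros [u Hu]. apply Hnd. exists (u * x - k). nia. }
  rewrite E, Hj in R. unfold par in R. destruct (Z.odd _) eqn:Eo in R; [|lia].
  rewrite Z.odd_mul in Eo. assert (Z.odd ((p - 1) / 2) = false).
  { destruct (Z.odd ((p - 1) / 2)) eqn:Ep; auto. apply Z.odd_spec in Ep. destruct Ep as [w Hw].
    Z.div_mod_to_equations; lia. }
  rewrite H1 in Eo; discriminate.
Qed.

Lemma odd_sum2_mod4 l c d : Z.odd l = true -> l = c * c + d * d -> l mod 4 = 1.
Proof.
  intros Ho E. assert (S : forall x, (x * x) mod 4 = 0 \/ (x * x) mod 4 = 1).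
  { intro x. assert (x = 2 * (x / 2) + x mod 2) by (Z.div_mod_to_equations; lia).
    assert (x mod 2 = 0 \/ x mod 2 = 1) as [h|h] by (Z.div_mod_to_equations; lia); rewrite h in H; rewrite H.
    - left. replace ((2 * (x / 2) + 0) * (2 * (x / 2) + 0)) with (x / 2 * (x / 2) * 4) by ring. apply Z.mod_mul; lia.
    - right. replace ((2 * (x / 2) + 1) * (2 * (x / 2) + 1)) with (1 + (x / 2 * (x / 2) + x / 2) * 4) by ring.
      rewrite Z.mod_add by lia; auto. }
  pose proof (S c); pose proof (S d). apply Z.odd_spec in Ho. destruct Ho as [k Hk].
  generalize dependent (c * c). generalize dependent (d * d). intros. Z.div_mod_to_equations; lia.
Qed.

(** Prime factors are stripped from [n]. One that divides both [a] and [b] enters as a square and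
    leaves the character alone. Any other is a sum of two squares, hence 1 modulo 4: it is the
    factor sought if its character is -1, and otherwise the cofactor is again a sum of two squares
    of character -1. *)
Lemma cls_factor p : prime p -> Z.odd p = true -> forall n a b, n = a * a + b * b -> 0 < n ->
  Z.odd n = true -> ~ (p | n) -> jac n p = -1 -> exists q, cls p q /\ (q | n).
Proof.
  intros Hp Hpo n. pose proof (prime_ge_2 p Hp).
  intros a b E Hn. revert a b E. rewrite <- (Z2Nat.id n) by lia. clear Hn.
  induction (Z.to_nat n) as [k IH] using lt_wf_ind. intros a b E Ho Hpn Hj.
  assert (Hk0 : 0 <= Z.of_nat k) by lia.
  destruct (Z.eq_dec (Z.of_nat k) 1) as [E1|].
  { rewrite E1, jac_1 in Hj by auto. lia. }
  assert (Z.of_nat k <> 0) by (intro h; apply Hpn; rewrite h; apply Z.divide_0_r).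
  destruct (prime_factor (Z.of_nat k)) as [l [Hl [m Hm]]]; [lia|].
  pose proof (prime_ge_2 l Hl). assert (0 < m) by nia.
  assert (Hlo : Z.odd l = true /\ Z.odd m = true).
  { rewrite Hm, Z.odd_mul in Ho. apply andb_prop in Ho; tauto. }
  assert (Hpr : forall x, ~ (p | x) -> rel_prime x p)
    by (intros x h; apply rel_prime_sym, prime_rel_prime; auto).
  assert (Hpm : ~ (p | m)) by (intro h; apply Hpn; rewrite Hm; apply Z.divide_mul_l; auto).
  assert (Hpl : ~ (p | l)) by (intro h; apply Hpn; rewrite Hm; apply Z.divide_mul_r; auto).
  assert (Hjm : jac m p * jac l p = -1) by (rewrite <- jac_mul; auto; [rewrite <- Hm; auto | lia]).
  destruct (classic ((l | a) /\ (l | b))) as [[[s Hs] [t Ht]]|Hab].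
  - assert (Em : m = l * (s * s + t * t)) by (subst a b; nia).
    set (m' := s * s + t * t) in *. assert (0 < m') by nia.
    assert (Hpm' : ~ (p | m')) by (intro h; apply Hpm; rewrite Em; apply Z.divide_mul_r; auto).
    destruct (IH (Z.to_nat m')) with (a := s) (b := t) as (q & Hq & Hd).
    + nia.
    + rewrite Z2Nat.id by lia; auto.
    + rewrite Z2Nat.id by lia. destruct Hlo as [_ Hmo]. rewrite Em, Z.odd_mul in Hmo.
      apply andb_prop in Hmo; tauto.
    + rewrite Z2Nat.id by lia; auto.
    + rewrite Z2Nat.id by lia. rewrite Em, jac_mul in Hjm by (auto; lia).
      destruct (jac_pm l p) as [L|L]; rewrite L in Hjm; lia.
    + exists q; split; auto. rewrite Z2Nat.id in Hd by lia. rewrite Hm, Em.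
      apply Z.divide_mul_l, Z.divide_mul_r; auto.
  - assert (exists c d, l = c * c + d * d) as (c & d & El).
    { assert (Hd : (l | a * a + b * b)) by (exists m; lia).
      destruct (classic (l | a)) as [h|h].
      - apply (fermat_two_squares l b a); auto. rewrite Z.add_comm; auto.
      - apply (fermat_two_squares l a b); auto. }
    destruct (jac_pm l p) as [L|L].
    2: { exists l; split; [|exists m; auto]. split; [auto|split; auto].
         apply (odd_sum2_mod4 l c d); tauto. }
    assert (exists w, fst w * fst w + snd w * snd w = m) as [w Hw].
    { destruct (gauss_factor l a b c d Hl El) as [[w Hw]|[w Hw]]; [exists m; lia| |]; exists w.
      - pose proof (gmul_norm c d w) as N. rewrite <- Hw in N; cbn [fst snd] in N. rewrite <- El in N. nia.
      - pose proof (gmul_norm c (- d) w) as N. rewrite <- Hw in N; cbn [fst snd] in N.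
        replace (c * c + - d * - d) with l in N by lia. nia. }
    destruct (IH (Z.to_nat m)) with (a := fst w) (b := snd w) as (q & Hq & Hd).
    + nia.
    + rewrite Z2Nat.id by lia; auto.
    + rewrite Z2Nat.id by lia; tauto.
    + rewrite Z2Nat.id by lia; auto.
    + rewrite Z2Nat.id by lia. rewrite L in Hjm; lia.
    + exists q; split; auto. rewrite Z2Nat.id in Hd by lia. rewrite Hm. apply Z.divide_mul_l; auto.
Qed.

Lemma nonresidue_exists p : prime p -> Z.odd p = true -> exists c, rel_prime c p /\ jac c p = -1.
Proof.
  intros Hp Ho. pose proof (prime_ge_2 p Hp). apply NNPP; intro Hno.
  assert (Hall : forall c, In c (zr 1 p) -> exists x, In x (hf p) /\ (p | x * x - c)).
  { intros c Hc; apply in_zr in Hc. assert (Hr : rel_prime c p) by (apply rel_prime_le_prime; auto; lia).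
    destruct (jac_pm c p) as [h|h]; [|exfalso; apply Hno; eauto].
    destruct (jac_prime_square p c Hp Ho Hr h) as [x Hx].
    assert (Hpx : ~ (p | x)).
    { intros [u Hu]. destruct Hx as [v Hv]. assert (Hd : (p | c)) by (exists (u * x - v); nia).
      apply Z.divide_pos_le in Hd; lia. }
    exists (ar p x). split; [apply ar_range; auto; lia|].
    destruct (sg_ar p x) as [k Hk]; [lia|]. destruct Hx as [v Hv].
    exists (v - k * (x + sg p x * ar p x)).
    assert (E : (sg p x * ar p x) * (sg p x * ar p x) = ar p x * ar p x)
      by (destruct (sg_pm p x) as [-> | ->]; ring).
    rewrite <- E. replace (sg p x * ar p x) with (x - k * p) by lia. nia. }
  assert (Hc : atmost ((p - 1) / 2) (fun c => In c (zr 1 p))).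
  { pose proof (zlen_hf p ltac:(lia)) as Hl.
    apply (atmost_le (zlen (hf p)) _ (fun c => In c (zr 1 p))); [|lia|auto].
    set (g := fun c => epsilon (inhabits 0) (fun x => In x (hf p) /\ (p | x * x - c))).
    assert (Hg : forall c, In c (zr 1 p) -> In (g c) (hf p) /\ (p | g c * g c - c)).
    { intros c Hc; unfold g; apply epsilon_spec, Hall; auto. }
    apply (atmost_inj g _ _ (fun x => In x (hf p))).
    - apply atmost_list; auto.
    - intros c Hc; apply Hg; auto.
    - intros c d Hc Hd E. destruct (Hg c Hc) as [_ [u Hu]]. destruct (Hg d Hd) as [_ [v Hv]].
      rewrite E in Hu. apply in_zr in Hc, Hd. assert (c - d = (v - u) * p) by lia.
      assert (v - u = 0) by nia. lia. }
  specialize (Hc (zr 1 p) (nodup_zr _ _) (fun _ h => h)). rewrite zlen_zr in Hc by lia.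
  assert ((p - 1) / 2 * 2 <= p - 1) by (Z.div_mod_to_equations; lia).
  apply Z.odd_spec in Ho; destruct Ho; lia.
Qed.

Lemma crt m n a b : rel_prime m n -> exists x, (m | x - a) /\ (n | x - b).
Proof.
  intro H. destruct (bezout_solve m n (b - a) H) as [s [k Hk]].
  exists (a + m * s); split; [exists s; ring | exists k; lia].
Qed.

Lemma atmost_2 {A} (P : A -> Prop) : (forall x y z, P x -> P y -> P z -> x = y \/ y = z \/ x = z) -> atmost 2 P.
Proof.
  intros H [|a [|b [|c l]]] Hl HP; try (cbn; lia). exfalso.
  inversion Hl as [|? ? H1 H2]; subst. inversion H2 as [|? ? H3 H4]; subst. cbn in *.
  destruct (H a b c) as [|[|]]; subst; auto 6; tauto.
Qed.

Lemma quad_count q a b Q T : prime q -> q <> 2 -> ~ (q | Q) -> 0 <= T ->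
  cnt (fun t => (q | a * a + (b + Q * t) * (b + Q * t))) (zr 0 T) <= 2 * (T / q + 1).
Proof.
  intros Hq H2 HQ HT. pose proof (prime_ge_2 q Hq).
  assert (0 <= T / q) by (apply Z.div_pos; lia).
  apply cnt_atmost; [apply nodup_zr|].
  replace (2 * (T / q + 1)) with (zsum (fun _ => 2) (zr 0 (T / q + 1))) by (rewrite zsum_const, zlen_zr; lia).
  apply (atmost_cover _ (fun _ => 2) (fun i t => t / q = i /\ (q | a * a + (b + Q * t) * (b + Q * t)))).
  - intros t [Ht Hd]. apply in_zr in Ht. exists (t / q); split; auto. apply in_zr.
    split; [apply Z.div_pos; lia|]. assert (t / q <= T / q) by (apply Z.div_le_mono; lia). lia.
  - intros i _. apply atmost_2. intros x y z [Ex [u Hu]] [Ey [v Hv]] [Ez [w Hw]].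
    assert (Hblock : forall x y, x / q = i -> y / q = i -> (q | x - y) -> x = y).
    { intros s t Es Et [c Hc]. pose proof (Z_div_mod_eq_full s q). pose proof (Z_div_mod_eq_full t q).
      pose proof (Z.mod_pos_bound s q). pose proof (Z.mod_pos_bound t q). rewrite Es in *. rewrite Et in *.
      assert (c = 0) by nia. lia. }
    assert (Hpair : forall x y u v, a * a + (b + Q * x) * (b + Q * x) = u * q ->
       a * a + (b + Q * y) * (b + Q * y) = v * q -> (q | x - y) \/ (q | 2 * b + Q * (x + y))).
    { intros s t u' v' Hu' Hv'. assert (Hd : (q | Q * ((s - t) * (2 * b + Q * (s + t))))) by (exists (u' - v'); nia).
      apply Gauss in Hd; [|apply prime_rel_prime; auto]. apply prime_mult in Hd; auto. }
    destruct (Hpair x y u v Hu Hv) as [h|[c1 h]]; [left; apply Hblock; auto|].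
    destruct (Hpair y z v w Hv Hw) as [h'|[c2 h']]; [right; left; apply Hblock; auto|].
    right; right. apply Hblock; auto. apply Gauss with Q; [exists (c1 - c2); lia | apply prime_rel_prime; auto].
Qed.

Lemma prime_dvd_zprod q L : prime q -> (q | zprod (fun x => x) L) -> exists x, In x L /\ (q | x).
Proof.
  intros Hq; induction L as [|a L IH]; cbn [zprod]; intro Hd.
  - pose proof (prime_ge_2 q Hq). apply Z.divide_1_r_nonneg in Hd; lia.
  - apply prime_mult in Hd; auto. destruct Hd as [Hd|Hd].
    + exists a; split; auto. left; auto.
    + destruct (IH Hd) as [x [H1 H2]]. exists x; split; auto. right; auto.
Qed.

Lemma dvd_zprod (x : Z) L : In x L -> (x | zprod (fun x => x) L).
Proof.
  induction L as [|a L IH]; cbn [zprod]; intros []; [subst; apply Z.divide_factor_l|].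
  apply Z.divide_mul_r; auto.
Qed.

Lemma zprod_pos L : (forall x, In x L -> 0 < x) -> 0 < zprod (fun x => x) L.
Proof.
  induction L as [|a L IH]; cbn [zprod]; intro H; [lia|].
  assert (0 < a) by (apply H; left; auto). assert (0 < zprod (fun x => x) L); [|nia].
  apply IH; intros; apply H; right; auto.
Qed.

Lemma pow2_ge x : 0 <= x -> x + 1 <= 2 ^ x.
Proof. intro H; rewrite <- (Z2Nat.id x) by auto. apply le_pow2. Qed.

Lemma geo_sum e a b : a <= b <= e + 1 -> zsum (fun j => 2 ^ (e - j)) (zr a b) <= 2 ^ (e - a + 1) - 2 ^ (e - b + 1).
Proof.
  intros H. replace b with (a + Z.of_nat (Z.to_nat (b - a))) in * by lia.
  induction (Z.to_nat (b - a)) as [|n IH].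
  - rewrite zr_empty by lia. cbn [zsum]. rewrite Z.add_0_r. lia.
  - replace (a + Z.of_nat (S n)) with (a + Z.of_nat n + 1) in * by lia.
    rewrite zr_snoc, zsum_app by lia. cbn [zsum].
    specialize (IH ltac:(lia)).
    replace (e - (a + Z.of_nat n) + 1) with (Z.succ (e - (a + Z.of_nat n))) in IH by lia.
    rewrite (Z.pow_succ_r 2 (e - (a + Z.of_nat n))) in IH by lia.
    replace (e - (a + Z.of_nat n + 1) + 1) with (e - (a + Z.of_nat n)) by lia. lia.
Qed.

Lemma block_sum (P : Z -> Prop) (A : Z -> Z) (g : Z -> Z) J m : J <= m ->
  (forall i j, J <= i <= j -> A i <= A j) ->
  zsum g (sel P (zr (A J + 1) (A m + 1))) =
  zsum (fun j => zsum g (sel P (zr (A j + 1) (A (j + 1) + 1)))) (zr J m).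
Proof.
  intros H HA. replace m with (J + Z.of_nat (Z.to_nat (m - J))) by lia.
  induction (Z.to_nat (m - J)) as [|n IH].
  - rewrite Z.add_0_r, !zr_empty by lia. reflexivity.
  - replace (J + Z.of_nat (S n)) with (J + Z.of_nat n + 1) by lia.
    rewrite (zr_snoc J), zsum_app by lia. cbn [zsum]. rewrite <- IH.
    rewrite (zr_split (A J + 1) (A (J + Z.of_nat n) + 1)).
    + unfold sel; rewrite filter_app, zsum_app. lia.
    + pose proof (HA J (J + Z.of_nat n) ltac:(lia)).
      pose proof (HA (J + Z.of_nat n) (J + Z.of_nat n + 1) ltac:(lia)). lia.
Qed.

(** Sums of two squares [n] congruent to 1 modulo all small class primes, with [jac n p = -1],
    must have a large class prime factor; there would be too few pairs otherwise. *)
Lemma class_primes_many p k J0 : prime p -> p mod 4 = 1 -> 2 <= k -> 0 <= J0 ->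
  exists j, J0 <= j /\ 2 ^ (j * (k - 1)) <= cnt (cls p) (zr 1 (2 ^ (j * k) + 1)).
Proof.
  intros Hp H4 Hk HJ0. pose proof (prime_ge_2 p Hp). pose proof (mod4_odd p H4) as Hpo.
  apply NNPP; intro Hno.
  assert (Hfew : forall j, J0 <= j -> cnt (cls p) (zr 1 (2 ^ (j * k) + 1)) < 2 ^ (j * (k - 1))).
  { intros j Hj. apply Z.nle_gt. intro h. apply Hno. exists j; auto. }
  clear Hno. set (A := fun j => 2 ^ (j * k)).
  assert (HA : forall i j, 0 <= i <= j -> A i <= A j).
  { intros i j Hij; unfold A. apply Z.pow_le_mono_r; nia. }
  assert (HA1 : forall i, 0 <= i -> 1 <= A i).
  { intros i Hi; unfold A. pose proof (Z.pow_pos_nonneg 2 (i * k)). nia. }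
  set (J := J0 + k + 6). set (z := A J).
  set (L := sel (cls p) (zr 1 (z + 1))). set (Pi := zprod (fun x => x) L).
  assert (HPi : 0 < Pi). { apply zprod_pos. intros x Hx. apply in_sel in Hx. destruct Hx as [Hx _]. apply in_zr in Hx; lia. }
  assert (HLd : forall q, cls p q -> q <= z -> (q | Pi)).
  { intros q Hq Hqz. apply dvd_zprod, in_sel. split; auto. apply in_zr.
    destruct Hq as [Hq _]. pose proof (prime_ge_2 q Hq). lia. }
  set (M := 4 * Pi). assert (HMp : rel_prime M p).
  { apply rel_prime_sym, prime_rel_prime; auto. intro Hd. apply prime_mult in Hd; auto.
    destruct Hd as [Hd|Hd].
    - replace 4 with (2 * 2) in Hd by lia. apply sq_dvd_prime in Hd; auto. apply Z.divide_pos_le in Hd; [|lia].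
      assert (p = 2) by lia. subst p. discriminate.
    - apply prime_dvd_zprod in Hd; auto. destruct Hd as [x [Hx Hd]]. apply in_sel in Hx.
      destruct Hx as [_ Hx]. pose proof (cls_neq p x Hp Hx). destruct Hx as [Hx _].
      pose proof (prime_ge_2 x Hx). destruct (prime_divisors x Hx p Hd) as [|[|[|]]]; lia. }
  set (Q := M * p). assert (HQ : 0 < Q) by (unfold Q, M; nia).
  destruct (nonresidue_exists p Hp Hpo) as [c [Hcp Hjc]].
  assert (R1 : rel_prime (-1) p) by (apply bezout_rel_prime; apply (Bezout_intro _ _ _ (-1) 0); lia).
  destruct (jac_prime_square p (-1)) as [io [w Hio]]; auto.
  { rewrite jac_m1 by (auto; lia). unfold par. destruct (Z.odd ((p - 1) / 2)) eqn:Ep; auto.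
    apply Z.odd_spec in Ep. destruct Ep as [v Hv]. Z.div_mod_to_equations; lia. }
  (* Modulo [M] the sum of squares is [1 + 0]. Modulo [p], with [io^2 = -1], it is
     [(c + 1)^2 - (c - 1)^2 = 4 c], a nonresidue. *)
  destruct (crt M p 1 (c + 1) HMp) as [a1 [[u1 Hu1] [u2 Hu2]]].
  destruct (crt M p 0 (io * (c - 1)) HMp) as [b1 [[v1 Hv1] [v2 Hv2]]].
  set (a0 := a1 mod Q). set (b0 := b1 mod Q).
  pose proof (Z.mod_pos_bound a1 Q HQ) as Ba. pose proof (Z.mod_pos_bound b1 Q HQ) as Bb.
  fold a0 in Ba. fold b0 in Bb.
  assert (Ea : a0 = a1 - Q * (a1 / Q)) by (unfold a0; pose proof (Z_div_mod_eq_full a1 Q); lia).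
  assert (Eb : b0 = b1 - Q * (b1 / Q)) by (unfold b0; pose proof (Z_div_mod_eq_full b1 Q); lia).
  set (val := fun st : Z * Z => (a0 + Q * fst st) * (a0 + Q * fst st) + (b0 + Q * snd st) * (b0 + Q * snd st)).
  assert (HvM : forall st, (M | val st - 1)).
  { intros [s t]. unfold val; cbn [fst snd].
    assert (exists x, a0 + Q * s = 1 + M * x) as [x ->].
    { exists (u1 + p * (s - a1 / Q)). rewrite Ea. unfold Q. replace a1 with (1 + u1 * M) at 1 by lia. ring. }
    assert (exists y, b0 + Q * t = M * y) as [y ->].
    { exists (v1 + p * (t - b1 / Q)). rewrite Eb. unfold Q. replace b1 with (v1 * M) at 1 by lia. ring. }
    exists (2 * x + M * x * x + M * y * y). ring. }
  assert (Hvp : forall st, (p | val st - 4 * c)).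
  { intros [s t]. unfold val; cbn [fst snd].
    assert (exists x, a0 + Q * s = c + 1 + p * x) as [x ->].
    { exists (u2 + M * (s - a1 / Q)). rewrite Ea. unfold Q. replace a1 with (c + 1 + u2 * p) at 1 by lia. ring. }
    assert (exists y, b0 + Q * t = io * (c - 1) + p * y) as [y ->].
    { exists (v2 + M * (t - b1 / Q)). rewrite Eb. unfold Q. replace b1 with (io * (c - 1) + v2 * p) at 1 by lia. ring. }
    exists (2 * (c + 1) * x + p * x * x + 2 * io * (c - 1) * y + p * y * y + w * (c - 1) * (c - 1)).
    replace ((c + 1 + p * x) * (c + 1 + p * x) + (io * (c - 1) + p * y) * (io * (c - 1) + p * y) - 4 * c) with
      ((c + 1) * (c + 1) + (io * io) * ((c - 1) * (c - 1)) - 4 * c + p * (2 * (c + 1) * x + p * x * x + 2 * io * (c - 1) * y + p * y * y)) by ring.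
    replace (io * io) with (w * p - 1) by lia. ring. }
  assert (R4 : rel_prime 4 p) by (apply rel_prime_mul_inv_l in HMp; auto).
  assert (R2 : rel_prime 2 p) by (replace 4 with (2 * 2) in R4 by lia; apply rel_prime_mul_inv_l in R4; auto).
  assert (Hval0 : forall st, 0 <= val st).
  { intros [s t]. unfold val; cbn [fst snd]. pose proof (Z.square_nonneg (a0 + Q * s)).
    pose proof (Z.square_nonneg (b0 + Q * t)). lia. }
  assert (Hfac : forall st, exists q, cls p q /\ z < q /\ (q | val st) /\ val st <> 0).
  { intros [s t]. assert (Hv1' := HvM (s, t)). destruct Hv1' as [m1 Hm1].
    assert (0 <= val (s, t)).
    { unfold val; cbn [fst snd]. pose proof (Z.square_nonneg (a0 + Q * s)). pose proof (Z.square_nonneg (b0 + Q * t)). lia. }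
    assert (Hodd : Z.odd (val (s, t)) = true).
    { apply Z.odd_spec. exists (2 * Pi * m1). unfold M in Hm1. lia. }
    assert (val (s, t) <> 0) by (intro h; rewrite h in Hodd; discriminate).
    assert (Hj : jac (val (s, t)) p = -1).
    { rewrite (jac_cong p _ (4 * c)) by (auto; lia). rewrite jac_mul by (auto; lia).
      replace 4 with (2 * 2) by lia. rewrite jac_sq by (auto; lia). lia. }
    destruct (cls_factor p Hp Hpo (val (s, t)) (a0 + Q * s) (b0 + Q * t)) as (q & Hq & Hd); auto; [lia| |].
    { intros h. assert (E : jac (val (s, t)) p = jac 0 p) by (apply jac_cong; [lia|]; rewrite Z.sub_0_r; auto).
      assert (E' : jac p p = jac 0 p) by (apply jac_cong; [lia|]; rewrite Z.sub_0_r; apply Z.divide_refl).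
      rewrite jac_self in E' by lia. lia. }
    exists q; split; [auto|split; [|auto]]. destruct (Z_lt_le_dec z q) as [l|l]; [exact l|]. exfalso.
    destruct (HLd q Hq l) as [x Hx]. destruct Hd as [y Hy].
    destruct Hq as [Hq _]. pose proof (prime_ge_2 q Hq).
    assert (Hd1 : (q | 1)). { exists (y - 4 * x * m1). unfold M in Hm1. rewrite Hx in Hm1. lia. }
    apply Z.divide_1_r_nonneg in Hd1; lia. }
  (* On the box [val <= 2 Q^2 T^2], and [2^c0] majorises [2 Q^2]; [c0] is a multiple of [k] so that
     [Y = T^2 * 2^c0] is again of the form [A m]. *)
  set (c1 := 2 * Q * Q). set (c0 := k * c1). assert (0 < c1) by (unfold c1; nia). assert (0 < c0) by (unfold c0; nia).
  (* [Y = 2^(4 i' k + c0)] is at most the power [4 k + 1] of [E2 = 2^i'], because [c0 <= i']. *)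
  destruct (r2_small (Z.to_nat (4 * k + 1))) as [E0 [HE0 Hr2]].
  set (i' := c0 + k + J + E0). set (i := 2 * i').
  assert (0 < i') by (unfold i', J; lia).
  set (T := A i). set (m := 2 * i + c1). set (Y := A m).
  assert (HT : 1 <= T) by (apply HA1; lia).
  assert (HYe : Y = T * T * 2 ^ c0).
  { unfold Y, T, A, m, c0. rewrite <- !Z.pow_add_r by nia. f_equal. ring. }
  assert (HYb : forall st, 0 <= fst st < T -> 0 <= snd st < T -> val st <= Y).
  { intros [s t]; cbn [fst snd]; intros Hs Ht. unfold val; cbn [fst snd]. rewrite HYe.
    assert (2 * Q * Q <= 2 ^ c0).
    { pose proof (pow2_ge c0). assert (c1 <= c0) by (unfold c0; nia). fold c1. lia. }
    assert (0 <= a0 + Q * s <= Q * T) by nia. assert (0 <= b0 + Q * t <= Q * T) by nia.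
    pose proof (Z.square_le_mono_nonneg (a0 + Q * s) (Q * T) ltac:(lia) ltac:(lia)).
    pose proof (Z.square_le_mono_nonneg (b0 + Q * t) (Q * T) ltac:(lia) ltac:(lia)).
    assert (T * T * (2 * Q * Q) <= T * T * 2 ^ c0) by (apply Z.mul_le_mono_nonneg_l; [apply Z.square_nonneg|lia]). lia. }
  set (E2 := 2 ^ i').
  assert (Hr2' : forall n, n <= Y -> atmost E2 (G2 n)).
  { intros n Hn. apply Hr2.
    - unfold E2. pose proof (pow2_ge i'). unfold i' in *. unfold J in *. lia.
    - eapply Z.le_trans; [exact Hn|]. unfold Y, A, E2. rewrite <- Z.pow_mul_r by lia.
      apply Z.pow_le_mono_r; [lia|]. rewrite Z2Nat.id by lia. unfold m, i. fold c0.
      replace ((2 * (2 * i') + c1) * k) with (4 * i' * k + c0) by (unfold c0; ring).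
      assert (c0 <= i') by (unfold i', J; lia). nia. }
  set (box := list_prod (zr 0 T) (zr 0 T)).
  assert (Hbox : zlen box = T * T) by (unfold box; rewrite pair_list, zlen_zr; lia).
  assert (Hinbox : forall st, In st box -> 0 <= fst st < T /\ 0 <= snd st < T).
  { intros [s t] Hst; apply in_prod_iff in Hst. rewrite !in_zr in Hst. auto. }
  set (g := fun q => cnt (fun st => (q | val st)) box).
  assert (Htot : T * T <= zsum g (sel (cls p) (zr (A J + 1) (A m + 1)))).
  { rewrite <- Hbox. unfold g, cnt. rewrite (zsum_swap (fun q st => b2z (q | val st))).
    replace (zlen box) with (zsum (fun _ => 1) box) by (rewrite zsum_const; lia).
    apply zsum_le. intros st Hst. destruct (Hinbox st Hst) as [Hs Ht].
    destruct (Hfac st) as (q & Hq & Hzq & Hd & Hv0).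
    apply Z.le_trans with (b2z (q | val st)); [rewrite b2z_true by auto; lia|]. apply (zsum_term (fun q => b2z (q | val st))); [intros; apply b2z_bound|].
    apply in_sel. split; auto. apply in_zr. unfold z in Hzq. split; [lia|].
    assert (0 < val st) by (apply Z.le_neq; split; [apply Hval0 | auto]).
    pose proof (Z.divide_pos_le q (val st) H3 Hd). pose proof (HYb st Hs Ht). unfold Y in *. lia. }
  assert (HJi : 0 <= J <= i) by (unfold i, i', J; lia).
  rewrite block_sum in Htot by (try (intros; apply HA); unfold m; lia).
  assert (Hblk : forall j, J <= j -> forall G, 0 <= G -> (forall q, A j < q <= A (j + 1) -> cls p q -> g q <= G) ->
    zsum g (sel (cls p) (zr (A j + 1) (A (j + 1) + 1))) <= 2 ^ ((j + 1) * (k - 1)) * G).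
  { intros j Hj G HG Hgq. apply Z.le_trans with (G * zlen (sel (cls p) (zr (A j + 1) (A (j + 1) + 1)))).
    - apply zsum_bound. intros q Hq. apply in_sel in Hq. destruct Hq as [Hq1 Hq2]. apply in_zr in Hq1.
      apply Hgq; auto; lia.
    - rewrite <- cnt_sel.
      assert (cnt (cls p) (zr (A j + 1) (A (j + 1) + 1)) <= 2 ^ ((j + 1) * (k - 1))); [|nia].
      apply Z.le_trans with (cnt (cls p) (zr 1 (2 ^ ((j + 1) * k) + 1))).
      + pose proof (HA1 j ltac:(lia)). pose proof (HA j (j + 1) ltac:(lia)).
        change (2 ^ ((j + 1) * k)) with (A (j + 1)).
        rewrite (cnt_zr_split _ 1 (A j + 1)) by lia. pose proof (cnt_nonneg (cls p) (zr 1 (A j + 1))). lia.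
      + pose proof (Hfew (j + 1) ltac:(unfold J in *; lia)). lia. }
  (* A prime [q <= T] divides [val] for at most two [t] in each block of length [q], hence at no
     more than [4 T^2 / q] points of the box. *)
  assert (Hsmall : forall j, J <= j < i -> zsum g (sel (cls p) (zr (A j + 1) (A (j + 1) + 1))) <= 2 ^ (2 * i * k + k + 1 - j)).
  { intros j Hj. eapply Z.le_trans; [apply (Hblk j ltac:(lia) (2 ^ (2 + 2 * i * k - j * k)))|].
    - apply Z.pow_nonneg; lia.
    - intros q Hq Hc. assert (Hqp := cls_neq p q Hp Hc). destruct Hc as (Hqpr & Hq4 & Hqj).
      pose proof (prime_ge_2 q Hqpr). pose proof (HA (j + 1) i ltac:(lia)). fold T in H5.
      assert (HqQ : ~ (q | Q)).
      { intro Hd. unfold Q, M in Hd. apply prime_mult in Hd; auto. destruct Hd as [Hd|Hd].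
        - apply prime_mult in Hd; auto. destruct Hd as [Hd|Hd].
          + replace 4 with (2 * 2) in Hd by lia. apply sq_dvd_prime in Hd; auto. apply Z.divide_pos_le in Hd; [|lia].
            assert (q = 2) by lia. subst q. discriminate.
          + apply prime_dvd_zprod in Hd; auto. destruct Hd as [x [Hx Hd]]. apply in_sel in Hx.
            destruct Hx as [Hx1 Hx]. apply in_zr in Hx1. apply Z.divide_pos_le in Hd; [|lia].
            pose proof (HA J j ltac:(lia)). fold z in H6. lia.
        - destruct (prime_divisors p Hp q Hd) as [|[|[|]]]; lia. }
      assert (Hg : q * g q <= 4 * (T * T)).
      { unfold g. apply Z.le_trans with (q * (zlen (zr 0 T) * (2 * (T / q + 1)))).
        - apply Z.mul_le_mono_nonneg_l; [lia|]. unfold cnt, box.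
          assert (Hprod : forall l m (h : Z * Z -> Z), zsum h (list_prod l m) = zsum (fun s => zsum (fun t => h (s, t)) m) l).
          { clear. induction l as [|a l IH]; intros m h; cbn [list_prod zsum]; auto.
            rewrite zsum_app, zsum_map, IH. auto. }
          rewrite Hprod. rewrite Z.mul_comm. apply zsum_bound. intros s _.
          apply (quad_count q (a0 + Q * s) b0 Q T); auto; [|lia]. intros ->; discriminate.
        - rewrite zlen_zr by lia. assert (q * (T / q) <= T) by (apply Z.mul_div_le; lia). nia. }
      assert (A j * 2 ^ (2 + 2 * i * k - j * k) = 4 * (T * T)).
      { unfold T, A. replace 4 with (2 ^ 2) by reflexivity. rewrite <- !Z.pow_add_r by nia. f_equal. ring. }
      assert (0 <= g q) by apply cnt_nonneg. pose proof (HA1 j ltac:(lia)). nia.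
    - rewrite <- Z.pow_add_r by nia. apply Z.pow_le_mono_r; [lia|]. nia. }
  (* For [q > T] blocks of length [q] are too long. Instead the cofactor is fixed: there are at most
     [Y / q] of them, and each [q * n] has at most [E2] representations. The choice [i = 2 i'] later
     absorbs the loss [2^(i' + c0 + k)]. *)
  assert (Hlarge : forall j, i <= j < m -> zsum g (sel (cls p) (zr (A j + 1) (A (j + 1) + 1))) <= 2 ^ (i' + 2 * i * k + c0 + k - 1 - j)).
  { intros j Hj. assert (j * k <= m * k) by nia.
    assert (Em : m * k = 2 * i * k + c0) by (unfold m, c0; ring).
    eapply Z.le_trans; [apply (Hblk j ltac:(lia) (2 ^ (2 * i * k + c0 - j * k) * E2))|].
    - apply Z.mul_nonneg_nonneg; apply Z.pow_nonneg; lia.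
    - intros q Hq Hc. destruct Hc as (Hqpr & Hq4 & Hqj). pose proof (prime_ge_2 q Hqpr).
      assert (HYq : Y / q <= 2 ^ (2 * i * k + c0 - j * k)).
      { apply Z.div_le_upper_bound; [lia|]. apply Z.le_trans with (A j * 2 ^ (2 * i * k + c0 - j * k)).
        - unfold Y, A. rewrite <- Z.pow_add_r by nia. apply Z.pow_le_mono_r; [lia|]. lia.
        - apply Z.mul_le_mono_nonneg_r; [apply Z.pow_nonneg; lia | lia]. }
      apply Z.le_trans with (Y / q * E2); [|apply Z.mul_le_mono_nonneg_r; auto; apply Z.pow_nonneg; lia].
      apply cnt_atmost; [apply nodup_prod; apply nodup_zr|]. fold box.
      apply (atmost_fiber (fun st => val st / q) _ E2 _ (fun n => 1 <= n < Y / q + 1)).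
      + replace (Y / q) with (Y / q + 1 - 1) at 1 by lia. apply atmost_interval.
        assert (0 <= Y / q); [|lia]. apply Z.div_pos; [|lia].
        apply Z.le_trans with 1; [lia|]. apply HA1. unfold m; lia.
      + intros st [Hst [x Hx]]. destruct (Hinbox st Hst) as [Hs Ht]. pose proof (HYb st Hs Ht).
        destruct (Hfac st) as (_ & _ & _ & _ & Hv0). assert (0 < val st) by (apply Z.le_neq; split; [apply Hval0 | auto]).
        rewrite Hx. rewrite Z.div_mul by lia. split; [nia|].
        assert (x <= Y / q) by (apply Z.div_le_lower_bound; lia). lia.
      + apply Z.pow_nonneg; lia.
      + intros n Hn. apply (atmost_inj (fun st => (a0 + Q * fst st, b0 + Q * snd st)) _ _ (G2 (q * n))).
        * apply Hr2'. assert (q * (Y / q) <= Y) by (apply Z.mul_div_le; lia). nia.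
        * intros st [[_ [x Hx]] Hn']. rewrite Hx, Z.div_mul in Hn' by lia.
          transitivity (val st); [reflexivity|]. rewrite Hx, Hn'. ring.
        * intros [s t] [s' t'] _ _ E. cbn [fst snd] in E. injection E; intros.
          f_equal; apply Z.mul_reg_l with Q; lia.
    - unfold E2. rewrite <- !Z.pow_add_r by nia. apply Z.pow_le_mono_r; [lia|]. nia. }
  rewrite (zr_split J i m), zsum_app in Htot by (unfold m; lia).
  assert (S1 : zsum (fun j => zsum g (sel (cls p) (zr (A j + 1) (A (j + 1) + 1)))) (zr J i) <= 2 ^ (2 * i * k + k + 2 - J)).
  { eapply Z.le_trans; [apply (zsum_le _ (fun j => 2 ^ (2 * i * k + k + 1 - j)))|].
    - intros j Hj; apply in_zr in Hj. apply Hsmall; lia.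
    - eapply Z.le_trans; [apply geo_sum; nia|].
      assert (0 <= 2 ^ (2 * i * k + k + 1 - i + 1)) by (apply Z.pow_nonneg; lia).
      replace (2 * i * k + k + 2 - J) with (2 * i * k + k + 1 - J + 1) by lia. lia. }
  assert (S2 : zsum (fun j => zsum g (sel (cls p) (zr (A j + 1) (A (j + 1) + 1)))) (zr i m) <= 2 ^ (i' + 2 * i * k + c0 + k - i)).
  { eapply Z.le_trans; [apply (zsum_le _ (fun j => 2 ^ (i' + 2 * i * k + c0 + k - 1 - j)))|].
    - intros j Hj; apply in_zr in Hj. apply Hlarge; lia.
    - assert (Hm' : m <= i' + 2 * i * k + c0 + k - 1 + 1) by (unfold m; assert (c1 <= c0) by (unfold c0; nia); nia).
      eapply Z.le_trans; [apply geo_sum; unfold m in *; lia|].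
      assert (0 <= 2 ^ (i' + 2 * i * k + c0 + k - 1 - m + 1)) by (apply Z.pow_nonneg; lia).
      replace (i' + 2 * i * k + c0 + k - i) with (i' + 2 * i * k + c0 + k - 1 - i + 1) by lia. lia. }
  assert (S1' : 2 ^ (2 * i * k + k + 2 - J) <= 2 ^ (2 * i * k - 2)) by (apply Z.pow_le_mono_r; unfold J; lia).
  assert (S2' : 2 ^ (i' + 2 * i * k + c0 + k - i) <= 2 ^ (2 * i * k - 2))
    by (apply Z.pow_le_mono_r; [lia|]; unfold i, i', J; lia).
  assert (ET : T * T = 4 * 2 ^ (2 * i * k - 2)).
  { unfold T, A. replace 4 with (2 ^ 2) by reflexivity. rewrite <- !Z.pow_add_r by nia. f_equal. ring. }
  assert (0 < 2 ^ (2 * i * k - 2)) by (apply Z.pow_pos_nonneg; nia). lia.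
Qed.

(** * Lower bounds for representations by three squares *)

Definition R3 (n : Z) (v : quat) : Prop := x0 v = 0 /\ qnorm v = n.

Definition qprimitive (v : quat) : Prop := forall r, prime r -> ~ qdvd r v.

Lemma pure_conj_sandwich a v : x0 v = 0 -> x0 (qmul (qconj a) (qmul v a)) = 0.
Proof. intro H. destruct a, v; cbn [Defs.x0] in H; subst; unfold qmul, qconj; cbn [Defs.x0 Defs.x1 Defs.x2 Defs.x3]; ring. Qed.

(** The quaternion [y + v] has norm [y^2 + N(v)] and factors as [a * u] with [N(a) = l]. Conjugated
    by its left factor it becomes [u * a = y + v'], which is integral. *)
Lemma transport v l y : prime l -> Z.odd l = true -> x0 v = 0 -> ~ qdvd l v -> (l | y * y + qnorm v) ->
  exists a v', qnorm a = l /\ R3 (qnorm v) v' /\ qmul v a = qmul a v'.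
Proof.
  intros Hl Ho Hv Hd Hy. pose proof (prime_ge_2 l Hl).
  set (x := Quat y (x1 v) (x2 v) (x3 v)).
  destruct (quat_factor l x) as (a & u & Hx & Na); auto.
  - replace (qnorm x) with (y * y + qnorm v); auto. unfold qnorm, x; cbn [Defs.x0 Defs.x1 Defs.x2 Defs.x3]. rewrite Hv; ring.
  - intro h. apply Hd, qdvd_comp. apply qdvd_comp in h. cbn in h. rewrite Hv. repeat split; try tauto. apply Z.divide_0_r.
  - set (v' := Quat (x0 (qmul u a) - y) (x1 (qmul u a)) (x2 (qmul u a)) (x3 (qmul u a))).
    assert (E : qmul v a = qmul a v').
    { assert (E1 : qmul x a = qmul a (qmul u a)) by (rewrite Hx, <- qmulA; auto).
      assert (F0 := f_equal x0 E1); assert (F1 := f_equal x1 E1);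
      assert (F2 := f_equal x2 E1); assert (F3 := f_equal x3 E1).
      clear - F0 F1 F2 F3 Hv. subst v'. generalize dependent (qmul u a). intros w F0 F1 F2 F3.
      unfold x in *; clear x. destruct v, a, w; unfold qmul in *; cbn [Defs.x0 Defs.x1 Defs.x2 Defs.x3] in *.
      subst. f_equal; lia. }
    assert (E2 : qmul (qconj a) (qmul v a) = qscale l v') by (rewrite E, qmul_conj_l, Na; auto).
    exists a, v'; split; [auto | split; [split|]]; auto.
    + assert (F := pure_conj_sandwich a v Hv). rewrite E2 in F. cbn [qscale Defs.x0] in F. nia.
    + assert (F := f_equal qnorm E). rewrite !qnorm_mul, Na in F. nia.
Qed.

Lemma pure_conj v : x0 v = 0 -> qconj v = qscale (-1) v.
Proof. intro H; apply quat_eq; cbn [qconj qscale Defs.x0 Defs.x1 Defs.x2 Defs.x3]; lia. Qed.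

Lemma commute_parallel v t : qmul v t = qmul t v ->
  x2 v * x3 t = x3 v * x2 t /\ x3 v * x1 t = x1 v * x3 t /\ x1 v * x2 t = x2 v * x1 t.
Proof.
  intro E. assert (F1 := f_equal x1 E); assert (F2 := f_equal x2 E); assert (F3 := f_equal x3 E).
  destruct v, t; unfold qmul in *; cbn [Defs.x0 Defs.x1 Defs.x2 Defs.x3] in *. lia.
Qed.

Lemma bezout3 a b c : (forall r, prime r -> ~ ((r | a) /\ (r | b) /\ (r | c))) ->
  exists u v w, u * a + v * b + w * c = 1.
Proof.
  intro H. destruct (Zis_gcd_bezout a b (Z.gcd a b) (Zgcd_is_gcd a b)) as [u v E].
  assert (Hr : rel_prime (Z.gcd a b) c).
  { destruct (Zgcd_is_gcd (Z.gcd a b) c) as [G1 G2 G3]. set (g := Z.gcd (Z.gcd a b) c) in *.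
    destruct (Z.eq_dec g 1) as [Eg|Hg]; [unfold rel_prime; pose proof (Zgcd_is_gcd (Z.gcd a b) c) as HG; fold g in HG; rewrite Eg in HG; exact HG|]. exfalso.
    assert (0 <= g) by apply Z.gcd_nonneg.
    assert (exists r, prime r /\ (r | g)) as [r [Hr Hrg]].
    { destruct (Z.eq_dec g 0) as [->|]; [exists 2; split; [apply prime_2 | apply Z.divide_0_r]|].
      apply prime_factor; lia. }
    apply (H r Hr). assert (Hab : (r | Z.gcd a b)) by (eapply Z.divide_trans; [exact Hrg | apply Z.gcd_divide_l]).
    split; [|split].
    - eapply Z.divide_trans; [exact Hab | apply Z.gcd_divide_l].
    - eapply Z.divide_trans; [exact Hab | apply Z.gcd_divide_r].
    - eapply Z.divide_trans; [exact Hrg | apply Z.gcd_divide_r]. }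
  apply rel_prime_bezout in Hr. destruct Hr as [x y Exy].
  exists (x * u), (x * v), y. transitivity (x * (u * a + v * b) + y * c); [ring|]. rewrite E. exact Exy.
Qed.

(** The commutant of a primitive pure [v] is [Z + Z v], so a commuting [t] of norm less than
    [N(v)] is a scalar. *)
Lemma commute_small v t : x0 v = 0 -> qprimitive v -> qmul v t = qmul t v -> qnorm t < qnorm v ->
  qnorm t = x0 t * x0 t.
Proof.
  intros Hv Hp Hc Hn. destruct (commute_parallel v t Hc) as (A & B & C).
  destruct (bezout3 (x1 v) (x2 v) (x3 v)) as (u1 & u2 & u3 & E).
  { intros r Hr (h1 & h2 & h3). apply (Hp r Hr), qdvd_comp. rewrite Hv. auto using Z.divide_0_r. }
  set (c := u1 * x1 t + u2 * x2 t + u3 * x3 t).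
  assert (E1 : x1 t = c * x1 v).
  { transitivity ((u1 * x1 v + u2 * x2 v + u3 * x3 v) * x1 t); [rewrite E; ring|].
    unfold c. replace ((u1 * x1 v + u2 * x2 v + u3 * x3 v) * x1 t) with
      (u1 * x1 v * x1 t + u2 * (x2 v * x1 t) + u3 * (x3 v * x1 t)) by ring. rewrite B, <- C. ring. }
  assert (E2 : x2 t = c * x2 v).
  { transitivity ((u1 * x1 v + u2 * x2 v + u3 * x3 v) * x2 t); [rewrite E; ring|].
    unfold c. replace ((u1 * x1 v + u2 * x2 v + u3 * x3 v) * x2 t) with
      (u1 * (x1 v * x2 t) + u2 * x2 v * x2 t + u3 * (x3 v * x2 t)) by ring. rewrite C, <- A. ring. }
  assert (E3 : x3 t = c * x3 v).
  { transitivity ((u1 * x1 v + u2 * x2 v + u3 * x3 v) * x3 t); [rewrite E; ring|].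
    unfold c. replace ((u1 * x1 v + u2 * x2 v + u3 * x3 v) * x3 t) with
      (u1 * (x1 v * x3 t) + u2 * (x2 v * x3 t) + u3 * x3 v * x3 t) by ring. rewrite <- B, A. ring. }
  assert (F : qnorm t = x0 t * x0 t + c * c * qnorm v).
  { unfold qnorm. rewrite E1, E2, E3, Hv. ring. }
  pose proof (Z.square_nonneg (x0 t)). pose proof (qnorm_nonneg v).
  destruct (Z.eq_dec c 0) as [Ec|Ec]; [rewrite F, Ec; ring|]. exfalso.
  assert (1 <= c * c) by (clear - Ec; nia). pose proof (Z.mul_le_mono_nonneg_r 1 (c * c) (qnorm v)). lia.
Qed.

(** The second step applies because [l2] does not divide [v']: [l1 v = a v' conj a], and [l1] is
    prime to [l2]. *)
Lemma transport_twice v l1 l2 y1 y2 : prime l1 -> prime l2 -> Z.odd l1 = true -> Z.odd l2 = true ->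
  l1 <> l2 -> x0 v = 0 -> ~ qdvd l1 v -> ~ qdvd l2 v ->
  (l1 | y1 * y1 + qnorm v) -> (l2 | y2 * y2 + qnorm v) ->
  exists a v', qnorm a = l1 * l2 /\ R3 (qnorm v) v' /\ qmul v a = qmul a v'.
Proof.
  intros P1 P2 O1 O2 Hne Hv D1 D2 Y1 Y2.
  destruct (transport v l1 y1 P1 O1 Hv D1 Y1) as (a & v' & Na & [Hv' Nv'] & E).
  assert (D2' : ~ qdvd l2 v').
  { intro h. apply D2. apply (qdvd_gauss l2 l1).
    - apply prime_rel_prime; auto. intro hd. apply Hne. symmetry.
      pose proof (prime_ge_2 l1 P1); pose proof (prime_ge_2 l2 P2).
      destruct (prime_divisors l1 P1 l2 hd) as [|[|[|]]]; lia.
    - rewrite <- Na. replace (qscale (qnorm a) v) with (qmul (qmul v a) (qconj a)).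
      + apply qdvd_mul_r. rewrite E. apply qdvd_mul_l; auto.
      + clear. qring. }
  rewrite <- Nv' in Y2.
  destruct (transport v' l2 y2 P2 O2 Hv' D2' Y2) as (b & w & Nb & [Hw Nw] & E').
  exists (qmul a b), w. split; [|split; [split|]].
  - rewrite qnorm_mul, Na, Nb; auto.
  - auto.
  - congruence.
  - rewrite qmulA, E, <- qmulA, E', qmulA; auto.
Qed.

Lemma prime_dvd_eq p q : prime p -> prime q -> (p | q) -> p = q.
Proof.
  intros Hp Hq Hd. pose proof (prime_ge_2 p Hp). pose proof (prime_ge_2 q Hq).
  destruct (prime_divisors q Hq p Hd) as [|[|[|]]]; lia.
Qed.

Lemma square_product_prime l a b c t : prime l -> prime a -> prime b -> prime c -> l <> a -> l <> b ->
  l * a * (b * c) = t * t -> l = c.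
Proof.
  intros Hl Ha Hb Hc Hla Hlb E. pose proof (prime_ge_2 l Hl).
  assert (Hd : (l | t)) by (apply sq_dvd_prime; auto; exists (a * (b * c)); lia).
  destruct Hd as [s ->]. assert (E2 : a * (b * c) = s * s * l) by nia.
  assert (Hd : (l | a * (b * c))) by (exists (s * s); auto).
  apply prime_mult in Hd; auto. destruct Hd as [Hd|Hd]; [exfalso; apply Hla, prime_dvd_eq; auto|].
  apply prime_mult in Hd; auto. destruct Hd as [Hd|Hd]; [exfalso; apply Hlb, prime_dvd_eq; auto|].
  apply prime_dvd_eq; auto.
Qed.

Definition usable (n l : Z) : Prop := prime l /\ Z.odd l = true /\ exists y, (l | y * y + n).

(** Conjugating one primitive representation by the quaternions attached to products of two
    usable primes gives pairwise distinct representations. *)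
Lemma r3_lower v A U1 U2 : x0 v = 0 -> qprimitive v -> NoDup U1 -> NoDup U2 ->
  (forall l, In l U1 -> usable (qnorm v) l /\ l <= A) -> (forall l, In l U2 -> usable (qnorm v) l /\ l <= A) ->
  (forall l, In l U1 -> ~ In l U2) -> A * A * (A * A) < qnorm v ->
  atleast (zlen U1 * zlen U2) (R3 (qnorm v)).
Proof.
  intros Hv Hp N1 N2 H1 H2 Hdis HA.
  set (f := fun lm : Z * Z => epsilon (inhabits q1) (fun v' => exists a, qnorm a = fst lm * snd lm /\
     R3 (qnorm v) v' /\ qmul v a = qmul a v')).
  assert (Hf : forall lm, In lm (list_prod U1 U2) -> exists a, qnorm a = fst lm * snd lm /\
     R3 (qnorm v) (f lm) /\ qmul v a = qmul a (f lm)).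
  { intros [l m] Hlm. apply in_prod_iff in Hlm. destruct Hlm as [Hl Hm]. unfold f. apply epsilon_spec.
    destruct (H1 l Hl) as [(P1 & O1 & y1 & Y1) _]. destruct (H2 m Hm) as [(P2 & O2 & y2 & Y2) _].
    destruct (transport_twice v l m y1 y2) as (a & v' & Ha); auto.
    - intros ->. apply (Hdis m); auto.
    - exists v', a; auto. }
  apply (atleast_inj f _ (fun lm => In lm (list_prod U1 U2))).
  - exists (list_prod U1 U2). repeat split; auto; [apply nodup_prod; auto | rewrite pair_list; lia].
  - intros lm Hlm. destruct (Hf lm Hlm) as (a & _ & Ha & _); auto.
  - intros [l m] [l' m'] Hx Hy E.
    destruct (Hf _ Hx) as (a & Na & Ra & Ea). destruct (Hf _ Hy) as (b & Nb & Rb & Eb).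
    rewrite <- E in Eb. cbn [fst snd] in *. set (w := f (l, m)) in *. destruct Ra as [Hw _].
    apply in_prod_iff in Hx, Hy.
    (* If two pairs give the same [w], then [a * conj b] commutes with [v]. Its norm [l m l' m'] is
       below [N(v)], so it is scalar and this norm is a square, which matches the primes. *)
    assert (Ec : qmul v (qmul a (qconj b)) = qmul (qmul a (qconj b)) v).
    { assert (Eb' : qmul (qconj b) v = qmul w (qconj b)).
      { apply (qscale_inj (-1)); [lia|]. apply (f_equal qconj) in Eb. rewrite !qconj_mul, (pure_conj v Hv), (pure_conj w Hw) in Eb.
        rewrite qmul_scale_r, qmul_scale_l in Eb. exact Eb. }
      rewrite qmulA, Ea, <- !qmulA, Eb'; auto. }
    destruct (H1 l (proj1 Hx)) as [(P1 & _) A1]. destruct (H2 m (proj2 Hx)) as [(P2 & _) A2].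
    destruct (H1 l' (proj1 Hy)) as [(P1' & _) A1']. destruct (H2 m' (proj2 Hy)) as [(P2' & _) A2'].
    assert (Nt : qnorm (qmul a (qconj b)) = l * m * (l' * m')) by (rewrite qnorm_mul, qnorm_conj, Na, Nb; auto).
    pose proof (prime_ge_2 _ P1); pose proof (prime_ge_2 _ P2); pose proof (prime_ge_2 _ P1'); pose proof (prime_ge_2 _ P2').
    assert (Hsm : l * m * (l' * m') <= A * A * (A * A)).
    { apply Z.mul_le_mono_nonneg; try nia; apply Z.mul_le_mono_nonneg; lia. }
    pose proof (commute_small v _ Hv Hp Ec ltac:(lia)) as Hs. rewrite Nt in Hs.
    f_equal.
    + apply (square_product_prime l m m' l' (x0 (qmul a (qconj b)))); auto; try lia.
      * intros ->. apply (Hdis m); tauto.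
      * intros ->. apply (Hdis m'); tauto.
    + apply (square_product_prime m l l' m' (x0 (qmul a (qconj b)))); auto; try lia.
      * intros <-. apply (Hdis m); tauto.
      * intros ->. apply (Hdis l'); tauto.
Qed.

(** * Removal of odd content from a pure quaternion *)

Lemma sum_squares_m1 l : prime l -> Z.odd l = true -> exists a b, (l | 1 + a * a + b * b).
Proof.
  intros Hl Ho. pose proof (prime_ge_2 l Hl). apply NNPP; intro Hno.
  apply Z.odd_spec in Ho. destruct Ho as [h Hh].
  set (L1 := map (fun a => (a * a) mod l) (zr 0 (h + 1))).
  set (L2 := map (fun b => (-1 - b * b) mod l) (zr 0 (h + 1))).
  assert (Hm : forall x y, x mod l = y mod l -> (l | x - y)).
  { intros x y E. exists (x / l - y / l). pose proof (Z_div_mod_eq_full x l). pose proof (Z_div_mod_eq_full y l). nia. }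
  assert (Hsq : forall x y, 0 <= x < h + 1 -> 0 <= y < h + 1 -> (l | x * x - y * y) -> x = y).
  { intros x y Hx Hy Hd. replace (x * x - y * y) with ((x - y) * (x + y)) in Hd by ring.
    apply prime_mult in Hd; auto. destruct Hd as [[c Hc]|[c Hc]].
    - assert (c = 0) by nia. lia.
    - assert (c = 0) by nia. lia. }
  assert (HN : NoDup (L1 ++ L2)).
  { apply NoDup_app.
    - apply nodup_map_inj; [apply nodup_zr|]. intros x y Hx Hy E. apply in_zr in Hx, Hy. apply Hsq; auto.
    - apply nodup_map_inj; [apply nodup_zr|]. intros x y Hx Hy E. apply in_zr in Hx, Hy. apply Hsq; auto.
      destruct (Hm _ _ E) as [k Hk]. exists (- k). lia.
    - intros z Hz1 Hz2. apply in_map_iff in Hz1, Hz2. destruct Hz1 as [a [<- _]]. destruct Hz2 as [b [E _]].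
      apply Hno. exists a, b. destruct (Hm _ _ E) as [k Hk]. exists (- k). lia. }
  assert (Hc : zlen (L1 ++ L2) <= zlen (zr 0 l)).
  { unfold zlen. apply inj_le, NoDup_incl_length; auto. intros z Hz. apply in_zr.
    apply in_app_or in Hz. destruct Hz as [Hz|Hz]; apply in_map_iff in Hz; destruct Hz as [a [<- _]]; apply Z.mod_pos_bound; lia. }
  unfold L1, L2 in Hc. rewrite zlen_app, !zlen_map, !zlen_zr in Hc by lia. lia.
Qed.

(** With [1 + a^2 + b^2 = 0] modulo [l], a vector orthogonal to [(1, a, b)] and [(-1, a, b)] has
    [2 w1 = 0]; the permuted vectors deal with the other coordinates. *)
Lemma isotropic_not_orthogonal l w1 w2 w3 : prime l -> Z.odd l = true -> ~ ((l | w1) /\ (l | w2) /\ (l | w3)) ->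
  exists u1 u2 u3, (l | u1 * u1 + u2 * u2 + u3 * u3) /\ ~ (l | u1 * w1 + u2 * w2 + u3 * w3) /\
    ~ ((l | u1) /\ (l | u2) /\ (l | u3)).
Proof.
  intros Hl Ho Hw. pose proof (prime_ge_2 l Hl). destruct (sum_squares_m1 l Hl Ho) as (a & b & Hab).
  assert (N1 : forall s, s = 1 \/ s = -1 -> ~ (l | s)).
  { intros s Hs Hd. assert (Hd1 : (l | 1)) by (destruct Hs as [-> | ->]; auto; apply Z.divide_opp_r in Hd; auto).
    apply Z.divide_1_r_nonneg in Hd1; lia. }
  assert (G2 : forall x, (l | 2 * x) -> (l | x)).
  { intros x Hd. apply Gauss with 2; auto. apply prime_rel_prime; auto. intro h.
    apply prime_dvd_eq in h; auto using prime_2. subst l; discriminate. }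
  apply NNPP; intro Hno.
  assert (Hall : forall u1 u2 u3, (l | u1 * u1 + u2 * u2 + u3 * u3) -> ~ ((l | u1) /\ (l | u2) /\ (l | u3)) ->
    (l | u1 * w1 + u2 * w2 + u3 * w3)).
  { intros u1 u2 u3 h1 h2. apply NNPP; intro h3. apply Hno; exists u1, u2, u3; auto. }
  destruct Hab as [k Hk]. apply Hw. split; [|split]; apply G2.
  - assert (A : (l | 1 * w1 + a * w2 + b * w3)) by (apply Hall; [exists k; lia | intros (h & _); revert h; apply N1; auto]).
    assert (B : (l | -1 * w1 + a * w2 + b * w3)) by (apply Hall; [exists k; lia | intros (h & _); revert h; apply N1; auto]).
    replace (2 * w1) with ((1 * w1 + a * w2 + b * w3) - (-1 * w1 + a * w2 + b * w3)) by ring. apply Z.divide_sub_r; auto.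
  - assert (A : (l | a * w1 + 1 * w2 + b * w3)) by (apply Hall; [exists k; lia | intros (_ & h & _); revert h; apply N1; auto]).
    assert (B : (l | a * w1 + -1 * w2 + b * w3)) by (apply Hall; [exists k; lia | intros (_ & h & _); revert h; apply N1; auto]).
    replace (2 * w2) with ((a * w1 + 1 * w2 + b * w3) - (a * w1 + -1 * w2 + b * w3)) by ring. apply Z.divide_sub_r; auto.
  - assert (A : (l | a * w1 + b * w2 + 1 * w3)) by (apply Hall; [exists k; lia | intros (_ & _ & h); revert h; apply N1; auto]).
    assert (B : (l | a * w1 + b * w2 + -1 * w3)) by (apply Hall; [exists k; lia | intros (_ & _ & h); revert h; apply N1; auto]).
    replace (2 * w3) with ((a * w1 + b * w2 + 1 * w3) - (a * w1 + b * w2 + -1 * w3)) by ring. apply Z.divide_sub_r; auto.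
Qed.

(** For an isotropic pure [u] not orthogonal to [w], [conj u * w * u] is a nonzero multiple of [u]
    modulo [l], by [sandwich]. With [u = a * b], nondivisibility passes to [conj a * w * a]. *)
Lemma conj_not_divisible l w : prime l -> Z.odd l = true -> x0 w = 0 -> ~ qdvd l w ->
  exists a, qnorm a = l /\ ~ qdvd l (qmul (qconj a) (qmul w a)).
Proof.
  intros Hl Ho Hw Hd.
  destruct (isotropic_not_orthogonal l (x1 w) (x2 w) (x3 w) Hl Ho) as (u1 & u2 & u3 & H1 & H2 & H3).
  { intros (h1 & h2 & h3). apply Hd, qdvd_comp. rewrite Hw. auto using Z.divide_0_r. }
  set (u := Quat 0 u1 u2 u3).
  destruct (quat_factor l u) as (a & b & Hu & Na); auto.
  - intro h. apply qdvd_comp in h. apply H3; cbn in h; tauto.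
  - exists a; split; auto. intro h.
    assert (Hdu : qdvd l (qmul (qconj u) (qmul w u))).
    { rewrite Hu, qconj_mul. replace (qmul _ _) with (qmul (qconj b) (qmul (qmul (qconj a) (qmul w a)) b))
        by (rewrite !qmulA; auto). apply qdvd_mul_l, qdvd_mul_r; auto. }
    apply qdvd_comp in Hdu. destruct H1 as [k Hk].
    assert (E : forall i wi, (l | 2 * (u1 * x1 w + u2 * x2 w + u3 * x3 w) * i - (u1 * u1 + u2 * u2 + u3 * u3) * wi) -> (l | i)).
    { intros i wi [c Hc]. rewrite Hk in Hc.
      assert (Hi : (l | 2 * (u1 * x1 w + u2 * x2 w + u3 * x3 w) * i)) by (exists (c + k * wi); lia).
      apply prime_mult in Hi; auto. destruct Hi as [Hi|Hi]; auto. exfalso.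
      apply prime_mult in Hi; auto. destruct Hi as [Hi|Hi]; auto.
      pose proof (prime_dvd_eq l 2 Hl prime_2 Hi) as El. rewrite El in Ho; discriminate Ho. }
    apply H3. destruct Hdu as (_ & D1 & D2 & D3). destruct w as [w0 w1 w2 w3].
    unfold u, qconj, qmul in D1, D2, D3. cbn [Defs.x0 Defs.x1 Defs.x2 Defs.x3] in *. subst w0.
    split; [apply (E u1 w1) | split; [apply (E u2 w2) | apply (E u3 w3)]].
    + match type of D1 with (_ | ?X) => match goal with |- (_ | ?Y) => replace Y with X by ring end end; auto.
    + match type of D2 with (_ | ?X) => match goal with |- (_ | ?Y) => replace Y with X by ring end end; auto.
    + match type of D3 with (_ | ?X) => match goal with |- (_ | ?Y) => replace Y with X by ring end end; auto.
Qed.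

Definition content (v : quat) : Z := Z.gcd (x1 v) (Z.gcd (x2 v) (x3 v)).

Lemma content_dvd v d : x0 v = 0 -> (qdvd d v <-> (d | content v)).
Proof.
  intro Hv. rewrite qdvd_comp, Hv. unfold content. split.
  - intros (_ & H1 & H2 & H3). repeat apply Z.gcd_greatest; auto.
  - intro H. assert (H' : (d | Z.gcd (x2 v) (x3 v))) by (eapply Z.divide_trans; [exact H | apply Z.gcd_divide_r]).
    split; [apply Z.divide_0_r | split; [|split]].
    + eapply Z.divide_trans; [exact H | apply Z.gcd_divide_l].
    + eapply Z.divide_trans; [exact H' | apply Z.gcd_divide_l].
    + eapply Z.divide_trans; [exact H' | apply Z.gcd_divide_r].
Qed.

Lemma qdvd_pow_decomp l v : prime l -> x0 v = 0 -> 0 < qnorm v ->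
  exists (k : nat) w, v = qscale (l ^ Z.of_nat k) w /\ ~ qdvd l w.
Proof.
  intros Hl Hv Hn. pose proof (prime_ge_2 l Hl).
  remember (Z.to_nat (qnorm v)) as N eqn:EN. revert v Hv Hn EN.
  induction N as [N IH] using lt_wf_ind. intros v Hv Hn EN.
  destruct (classic (qdvd l v)) as [[w Hw]|h].
  - assert (x0 w = 0) by (rewrite Hw in Hv; cbn [qscale Defs.x0] in Hv; clear - Hv H; nia).
    assert (E := qnorm_scale l w). rewrite <- Hw in E. pose proof (qnorm_nonneg w) as H1.
    assert (H4 : 4 <= l * l) by (clear - H; nia). pose proof (Z.mul_le_mono_nonneg_r 4 (l * l) (qnorm w) H1 H4).
    assert (Hlt : qnorm w < qnorm v) by lia.
    assert (Hpos : 0 < qnorm w) by (destruct (Z.eq_dec (qnorm w) 0) as [E0|]; [rewrite E0 in E|]; lia).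
    destruct (IH (Z.to_nat (qnorm w)) ltac:(lia) w H0 Hpos eq_refl) as (n & w' & E' & Hd).
    exists (S n), w'; split; auto. rewrite Hw, E', qscale_scale, Nat2Z.inj_succ, Z.pow_succ_r by lia. auto.
  - exists 0%nat, v; split; auto. cbn [Z.of_nat]. rewrite Z.pow_0_r, qscale_1; auto.
Qed.

(** Odd content is removed one prime at a time by conjugation. *)
Lemma odd_primitive_rep v : x0 v = 0 -> 0 < qnorm v ->
  exists (a : nat) w, x0 w = 0 /\ qprimitive w /\ qnorm v = 4 ^ Z.of_nat a * qnorm w.
Proof.
  intros Hv Hn. remember (Z.to_nat (content v)) as C eqn:EC. revert v Hv Hn EC.
  induction C as [C IH] using lt_wf_ind. intros v Hv Hn EC.
  assert (Hc0 : 0 < content v).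
  { assert (0 <= content v) by apply Z.gcd_nonneg.
    destruct (Z.eq_dec (content v) 0) as [E|]; [|lia]. exfalso.
    assert (Hd : qdvd 0 v) by (apply content_dvd; auto; rewrite E; apply Z.divide_refl).
    destruct Hd as [y Hy]. rewrite Hy, qnorm_scale in Hn. lia. }
  destruct (classic (exists l, prime l /\ Z.odd l = true /\ qdvd l v)) as [(l & Hl & Ho & Hd)|Hno].
  - pose proof (prime_ge_2 l Hl). destruct (qdvd_pow_decomp l v Hl Hv Hn) as (k & w & Ew & Hdw).
    destruct k as [|k].
    { exfalso. cbn [Z.of_nat] in Ew. rewrite Z.pow_0_r, qscale_1 in Ew. subst; auto. }
    assert (Hlk : 0 < l ^ Z.of_nat k) by (apply Z.pow_pos_nonneg; lia).
    assert (Hw : x0 w = 0).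
    { rewrite Ew in Hv; cbn [qscale Defs.x0] in Hv. rewrite Nat2Z.inj_succ, Z.pow_succ_r in Hv by lia. nia. }
    destruct (conj_not_divisible l w Hl Ho Hw Hdw) as (a & Na & Hda).
    (* [t] has the norm of [l * w] without being divisible by [l]. Its content divides that of [w]
       because [a t conj a = l^2 w], so replacing [l * w] by [t] lowers the content. *)
    set (t := qmul (qconj a) (qmul w a)) in *. assert (Ht : x0 t = 0) by (apply pure_conj_sandwich; auto).
    set (v' := qscale (l ^ Z.of_nat k) t).
    assert (Hv' : x0 v' = 0) by (unfold v'; cbn [qscale Defs.x0]; rewrite Ht; lia).
    assert (Nv' : qnorm v' = qnorm v).
    { unfold v', t. rewrite Ew, !qnorm_scale, !qnorm_mul, qnorm_conj, Na, Nat2Z.inj_succ, Z.pow_succ_r by lia. ring. }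
    assert (Hct : (content t | content w)).
    { apply content_dvd; auto. apply (qdvd_gauss (content t) (l * l)).
      - apply rel_prime_sym, rel_prime_mul; apply prime_rel_prime; auto; intro h; apply Hda, content_dvd; auto.
      - replace (qscale (l * l) w) with (qmul (qmul a t) (qconj a)).
        + apply qdvd_mul_r, qdvd_mul_l, content_dvd; auto. apply Z.divide_refl.
        + unfold t. rewrite qmul_conj_r, Na. rewrite qmul_scale_l, <- qscale_scale. f_equal.
          rewrite <- Na. clear. qring. }
    assert (Cs : forall c u, 0 <= c -> content (qscale c u) = c * content u).
    { intros c u Hc. unfold content; cbn [qscale Defs.x1 Defs.x2 Defs.x3].
      rewrite Z.gcd_mul_mono_l_nonneg, Z.gcd_mul_mono_l_nonneg by auto; auto. }
    assert (Hcw : 0 < content w).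
    { rewrite Ew, Cs in Hc0 by (apply Z.pow_nonneg; lia).
      rewrite Nat2Z.inj_succ, Z.pow_succ_r in Hc0 by lia. apply Z.mul_pos_cancel_l in Hc0; auto. apply Z.mul_pos_pos; lia. }
    assert (Hlt : content v' < content v).
    { unfold v'. rewrite Ew, !Cs by (try apply Z.pow_nonneg; lia). rewrite Nat2Z.inj_succ, Z.pow_succ_r by lia.
      apply Z.divide_pos_le in Hct; auto.
      apply Z.le_lt_trans with (l ^ Z.of_nat k * content w); [apply Z.mul_le_mono_nonneg_l; lia|].
      apply Z.mul_lt_mono_pos_r; auto. rewrite <- (Z.mul_1_l (l ^ Z.of_nat k)) at 1. apply Z.mul_lt_mono_pos_r; lia. }
    assert (0 <= content v') by apply Z.gcd_nonneg.
    destruct (IH (Z.to_nat (content v')) ltac:(lia) v' Hv' ltac:(lia) eq_refl) as (b & u & Hu).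
    exists b, u. rewrite <- Nv'. auto.
  - destruct (qdvd_pow_decomp 2 v prime_2 Hv Hn) as (k & w & Ew & Hdw).
    assert (0 < 2 ^ Z.of_nat k) by (apply Z.pow_pos_nonneg; lia).
    exists k, w. split; [|split].
    + rewrite Ew in Hv; cbn [qscale Defs.x0] in Hv. nia.
    + intros r Hr Hdr. destruct (Z.odd r) eqn:Er.
      * apply Hno. exists r; split; [exact Hr | split; [exact Er|]]. rewrite Ew. apply qdvd_scale_mono; auto.
      * assert (He : Z.even r = true) by (rewrite <- Z.negb_odd, Er; auto). apply Z.even_spec in He.
        destruct He as [c Hc]. assert (r = 2).
        { symmetry; apply prime_dvd_eq; auto using prime_2. exists c; lia. } apply Hdw. congruence.
    + rewrite Ew, qnorm_scale. f_equal. replace 4 with (2 * 2) by lia. rewrite Z.pow_mul_l. auto.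
Qed.

(** * A variance estimate *)

Definition periodic (N : Z) (f : Z -> Z) : Prop := forall x y, (N | x - y) -> f x = f y.

Lemma zr_shift a m : 0 <= m -> zr a (a + m) = map (fun i => i + a) (zr 0 m).
Proof.
  intro Hm. unfold zr. rewrite map_map. replace (a + m - a) with (m - 0) by lia.
  apply map_ext; intro; lia.
Qed.

Lemma zsum_blocks (f : Z -> Z) m (n : nat) : 0 <= m -> zsum f (zr 0 (m * Z.of_nat n)) =
  zsum (fun t => zsum (fun i => f (i + m * t)) (zr 0 m)) (zr 0 (Z.of_nat n)).
Proof.
  intro Hm. induction n as [|n IH].
  - replace (m * Z.of_nat 0) with 0 by lia. reflexivity.
  - replace (Z.of_nat (S n)) with (Z.of_nat n + 1) by lia.
    rewrite zr_snoc, zsum_app, <- IH by lia. cbn [zsum].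
    rewrite (zr_split 0 (m * Z.of_nat n)), zsum_app by nia.
    replace (m * (Z.of_nat n + 1)) with (m * Z.of_nat n + m) by ring.
    rewrite zr_shift, zsum_map by auto. rewrite Z.add_0_r; auto.
Qed.

Lemma zsum_affine d N u g : 0 < N -> rel_prime d N -> periodic N g ->
  zsum (fun t => g (d * t + u)) (zr 0 N) = zsum g (zr 0 N).
Proof.
  intros HN Hr Hg.
  rewrite (zsum_ext _ (fun t => g ((d * t + u) mod N))).
  2:{ intros x _. apply Hg. exists ((d * x + u) / N). pose proof (Z_div_mod_eq_full (d * x + u) N). lia. }
  rewrite <- (zsum_map g (fun t => (d * t + u) mod N)). apply zsum_perm, NoDup_Permutation_bis.
  - apply nodup_map_inj; [apply nodup_zr|]. intros x y Hx Hy E. apply in_zr in Hx, Hy.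
    assert (Hd : (N | d * (x - y))).
    { exists ((d * x + u) / N - (d * y + u) / N).
      pose proof (Z_div_mod_eq_full (d * x + u) N). pose proof (Z_div_mod_eq_full (d * y + u) N).
      rewrite E in *. lia. }
    apply Gauss in Hd; [|apply rel_prime_sym; auto]. destruct Hd as [c Hc]. assert (c = 0) by nia. lia.
  - rewrite length_map; auto.
  - intros z Hz. apply in_map_iff in Hz. destruct Hz as (t & <- & _). apply in_zr, Z.mod_pos_bound; auto.
Qed.

Lemma zsum_crt m n f g : 0 < m -> 0 < n -> rel_prime m n -> periodic m f -> periodic n g ->
  zsum (fun x => f x * g x) (zr 0 (m * n)) = zsum f (zr 0 m) * zsum g (zr 0 n).
Proof.
  intros Hm Hn Hr Hf Hg. rewrite <- (Z2Nat.id n) at 1 by lia. rewrite zsum_blocks, Z2Nat.id by lia.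
  rewrite zsum_swap, Z.mul_comm, <- zsum_scale. apply zsum_ext. intros i _.
  rewrite (zsum_ext _ (fun t => f i * g (m * t + i))).
  - rewrite zsum_scale, zsum_affine by auto. ring.
  - intros t _. rewrite (Z.add_comm i). f_equal. apply Hf. exists t. lia.
Qed.

Lemma periodic_sum_le f N X : 0 < N -> 0 <= X -> periodic N f -> (forall x, f x <= 1) ->
  zsum f (zr 0 N) = 1 -> zsum f (zr 0 X) <= X / N + N.
Proof.
  intros HN HX Hp Hb H1. pose proof (Z_div_mod_eq_full X N). pose proof (Z.mod_pos_bound X N HN).
  assert (0 <= X / N) by (apply Z.div_pos; lia).
  rewrite (zr_split 0 (N * (X / N))), zsum_app by nia.
  assert (E : zsum f (zr 0 (N * (X / N))) = X / N).
  { rewrite <- (Z2Nat.id (X / N)) at 1 by lia. rewrite zsum_blocks, Z2Nat.id by lia.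
    rewrite (zsum_ext _ (fun _ => 1)).
    - rewrite zsum_const, zlen_zr; lia.
    - intros t _. rewrite <- H1. apply zsum_ext. intros i _. apply Hp. exists t. lia. }
  rewrite E. pose proof (zsum_bound f 1 (zr (N * (X / N)) X) ltac:(auto)) as HT.
  rewrite zlen_zr in HT by lia. lia.
Qed.

(** The number of [y] modulo [l] with [y^2 = a^2 - c], where [a = m x] and [c = m P]. *)
Definition rho (m P l x : Z) : Z := cnt (fun y => (l | y * y + (m * P - m * m * (x * x)))) (zr 0 l).

Lemma rho_periodic m P l : periodic l (rho m P l).
Proof.
  intros x y [c Hc]. apply cnt_iff. intros z _.
  replace (z * z + (m * P - m * m * (x * x))) with
    (z * z + (m * P - m * m * (y * y)) - (m * m * (x + y) * c) * l) by (replace x with (y + c * l) by lia; ring).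
  split; intro H.
  - apply Z.divide_add_cancel_r with (- (m * m * (x + y) * c) * l); [apply Z.divide_factor_r|].
    replace (- (m * m * (x + y) * c) * l + _) with (z * z + (m * P - m * m * (y * y)) - (m * m * (x + y) * c) * l) by ring; auto.
  - apply Z.divide_sub_r; auto. apply Z.divide_factor_r.
Qed.

Lemma rho_le_2 m P l x : prime l -> rho m P l x <= 2.
Proof.
  intro Hl. apply cnt_atmost; [apply nodup_zr|]. apply atmost_2.
  intros a b c [Ha Ea] [Hb Eb] [Hc Ec]. apply in_zr in Ha, Hb, Hc.
  assert (D : forall u v n, 0 <= u < l -> 0 <= v < l -> (l | u * u + n) -> (l | v * v + n) -> u = v \/ u + v = l \/ u = v).
  { intros u v n Hu Hv Du Dv. assert (Hd : (l | (u - v) * (u + v))).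
    { replace ((u - v) * (u + v)) with (u * u + n - (v * v + n)) by ring. apply Z.divide_sub_r; auto. }
    apply prime_mult in Hd; auto. destruct Hd as [[k Hk]|[k Hk]].
    - left. assert (k = 0) by nia. lia.
    - assert (k = 0 \/ k = 1) by nia. destruct H as [-> | ->]; lia. }
  destruct (D a b _ Ha Hb Ea Eb) as [|[|]]; auto. destruct (D b c _ Hb Hc Eb Ec) as [|[|]]; auto. lia.
Qed.

(** Substituting [y + m x] for [y] cancels [m^2 x^2] and leaves [2 m y x = -(y^2 + m P)], linear in
    [x]: one solution for each [y] other than 0, none for [y = 0]. *)
Lemma rho_sum m P l : prime l -> Z.odd l = true -> ~ (l | m * P) -> zsum (rho m P l) (zr 0 l) = l - 1.
Proof.
  intros Hl Ho Hd. pose proof (prime_ge_2 l Hl).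
  assert (Hm : rel_prime (2 * m) l).
  { apply rel_prime_mul; apply rel_prime_sym, prime_rel_prime; auto; intro h.
    - apply prime_dvd_eq in h; auto using prime_2. subst l; discriminate.
    - apply Hd, Z.divide_mul_l; auto. }
  rewrite (zsum_ext _ (fun x => zsum (fun y => b2z (l | 2 * m * y * x - (- (y * y + m * P)))) (zr 0 l))).
  2:{ intros x _. unfold rho, cnt.
      rewrite <- (zsum_affine 1 l (m * x) (fun y => b2z (l | y * y + (m * P - m * m * (x * x))))); try lia.
      - apply zsum_ext; intros y _. f_equal. f_equal. ring.
      - apply rel_prime_1.
      - intros y z [c Hc]. apply b2z_iff. replace y with (z + c * l) by lia.
        replace ((z + c * l) * (z + c * l) + (m * P - m * m * (x * x))) with
          (z * z + (m * P - m * m * (x * x)) + (2 * z * c + c * c * l) * l) by ring.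
        split; intro h.
        + apply Z.divide_add_cancel_r with ((2 * z * c + c * c * l) * l); [apply Z.divide_factor_r|].
          rewrite Z.add_comm; auto.
        + apply Z.divide_add_r; auto. apply Z.divide_factor_r. }
  rewrite zsum_swap. match goal with |- zsum ?f _ = _ => set (F := f) end. rewrite (zr_split 0 1) by lia. rewrite zsum_app.
  replace (zr 0 1) with [0] by reflexivity. cbn [zsum].
  assert (F0 : F 0 = 0); [unfold F; apply zsum_zero|rewrite F0, (zsum_ext _ (fun _ => 1))].
  - intros x _. apply b2z_false. intro h. apply Hd.
    replace (m * P) with (2 * m * 0 * x - - (0 * 0 + m * P)) by ring. auto.
  - rewrite zsum_const, zlen_zr by lia. lia.
  - intros y Hy. apply in_zr in Hy. apply (ap_full (2 * m * y) l (- (y * y + m * P)) 0); [lia|].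
    apply rel_prime_mul; auto. apply rel_prime_sym, prime_rel_prime; auto. intros [c Hc].
    assert (c = 0 \/ 1 <= c \/ c <= -1) by lia. nia.
Qed.

Lemma rho_nonneg m P l x : 0 <= rho m P l x.
Proof. apply cnt_nonneg. Qed.

(** The quantities [rho - 1] for distinct primes are nearly uncorrelated: over a full period their
    product sums to [(-1) * (-1)]. *)
Lemma second_moment m P L A B X : NoDup L -> 0 < B -> 0 <= X ->
  (forall l, In l L -> prime l /\ Z.odd l = true /\ B < l <= A /\ ~ (l | m * P)) ->
  zsum (fun x => zsum (fun l => rho m P l x - 1) L * zsum (fun l => rho m P l x - 1) L) (zr 0 X) <=
  zlen L * X + zlen L * zlen L * (X / (B * B) + A * A).
Proof.
  intros HN HB HX HL.
  assert (Hb : forall l x, In l L -> -1 <= rho m P l x - 1 <= 1).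
  { intros l x Hl. pose proof (rho_le_2 m P l x (proj1 (HL l Hl))). pose proof (rho_nonneg m P l x). lia. }
  assert (Hb2 : forall l l' x, In l L -> In l' L -> (rho m P l x - 1) * (rho m P l' x - 1) <= 1).
  { intros l l' x H1 H2. pose proof (Hb l x H1). pose proof (Hb l' x H2).
    generalize dependent (rho m P l x - 1). generalize dependent (rho m P l' x - 1). intros; nia. }
  set (C := X / (B * B) + A * A). assert (HC : 0 <= C) by (unfold C; pose proof (Z.div_pos X (B * B)); nia).
  assert (Hpair : forall l l', In l L -> In l' L ->
    zsum (fun x => (rho m P l x - 1) * (rho m P l' x - 1)) (zr 0 X) <= b2z (l = l') * X + C).
  { intros l l' Hl Hl'. destruct (classic (l = l')) as [E|E].
    - rewrite b2z_true by auto. pose proof (zsum_bound (fun x => (rho m P l x - 1) * (rho m P l' x - 1)) 1 (zr 0 X)) as Hs.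
      rewrite zlen_zr in Hs by lia. specialize (Hs (fun x _ => Hb2 l l' x Hl Hl')). lia.
    - rewrite b2z_false by auto. destruct (HL l Hl) as (Pl & Ol & Bl & Dl). destruct (HL l' Hl') as (Pl' & Ol' & Bl' & Dl').
      assert (P1 : forall k, periodic k (fun x => rho m P k x - 1)).
      { intros k x y h. rewrite (rho_periodic m P k x y h); auto. }
      assert (S1 : forall k, prime k -> Z.odd k = true -> ~ (k | m * P) -> zsum (fun x => rho m P k x - 1) (zr 0 k) = -1).
      { intros k Hk Ok Dk. pose proof (prime_ge_2 k Hk). rewrite zsum_sub, rho_sum, zsum_const, zlen_zr by (auto; lia). lia. }
      assert (Hs : zsum (fun x => (rho m P l x - 1) * (rho m P l' x - 1)) (zr 0 X) <= X / (l * l') + l * l').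
      { apply periodic_sum_le; try nia.
        - intros x y h. f_equal; apply (P1 _); eapply Z.divide_trans; try exact h;
            [apply Z.divide_factor_l | apply Z.divide_factor_r].
        - intro x. auto.
        - rewrite (zsum_crt l l' (fun x => rho m P l x - 1) (fun x => rho m P l' x - 1)) by (try lia; auto using prime_distinct_rel).
          rewrite !S1; auto. }
      assert (B * B <= l * l') by (apply Z.mul_le_mono_nonneg; lia).
      assert (l * l' <= A * A) by (apply Z.mul_le_mono_nonneg; lia).
      assert (X / (l * l') <= X / (B * B)) by (apply Z.div_le_compat_l; nia). unfold C. lia. }
  rewrite (zsum_ext _ (fun x => zsum (fun l => zsum (fun l' => (rho m P l x - 1) * (rho m P l' x - 1)) L) L)).
  2:{ intros x _. rewrite <- zsum_scale. apply zsum_ext; intros l _. rewrite zsum_scale. ring. }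
  rewrite zsum_swap. rewrite (zsum_ext _ (fun l => zsum (fun l' => zsum (fun x => (rho m P l x - 1) * (rho m P l' x - 1)) (zr 0 X)) L))
    by (intros; apply zsum_swap).
  apply Z.le_trans with (zsum (fun l => X + zlen L * C) L).
  - apply zsum_le. intros l Hl. apply Z.le_trans with (zsum (fun l' => b2z (l = l') * X + C) L).
    + apply zsum_le; auto.
    + rewrite zsum_add, zsum_const. assert (cnt (fun l' => l = l') L <= 1).
      { apply cnt_atmost; auto. apply atmost_1. intros x y [_ ?] [_ ?]; congruence. }
      rewrite (zsum_ext _ (fun l' => X * b2z (l = l'))) by (intros; ring). rewrite zsum_scale. unfold cnt in H. nia.
  - rewrite zsum_const. nia.
Qed.

(** Chebyshev's inequality. At a bad [x] fewer than a quarter of the terms [rho] are nonzero and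
    none exceeds 2, so the sum of [rho - 1] lies below [-zlen L / 2]. *)
Lemma few_usable m P L A B X : NoDup L -> 0 < B -> 0 <= X -> 0 < zlen L ->
  (forall l, In l L -> prime l /\ Z.odd l = true /\ B < l <= A /\ ~ (l | m * P)) ->
  cnt (fun x => 4 * cnt (fun l => 1 <= rho m P l x) L < zlen L) (zr 0 X) * zlen L <=
  4 * (X + zlen L * (X / (B * B) + A * A)).
Proof.
  intros HN HB HX HL0 HL. pose proof (second_moment m P L A B X HN HB HX HL) as HS.
  set (n := zlen L) in *. set (F := fun x => zsum (fun l => rho m P l x - 1) L) in *.
  set (bad := fun x => 4 * cnt (fun l => 1 <= rho m P l x) L < n).
  assert (HF : zsum (fun x => n * n * b2z (bad x)) (zr 0 X) <= zsum (fun x => 4 * (F x * F x)) (zr 0 X)).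
  { apply zsum_le. intros x _. destruct (classic (bad x)) as [Hb|Hb]; [|rewrite b2z_false by auto; nia].
    rewrite b2z_true by auto. assert (Fx : F x <= 2 * cnt (fun l => 1 <= rho m P l x) L - n).
    { unfold F, cnt, n. rewrite <- (Z.mul_1_l (zlen L)), <- zsum_const, <- zsum_scale, <- zsum_sub. apply zsum_le.
      intros l Hl. pose proof (rho_le_2 m P l x (proj1 (HL l Hl))). pose proof (rho_nonneg m P l x).
      destruct (classic (1 <= rho m P l x)); [rewrite b2z_true | rewrite b2z_false]; auto; lia. }
    unfold bad in Hb. nia. }
  rewrite !zsum_scale in HF. change (zsum (fun x => b2z (bad x)) (zr 0 X)) with (cnt bad (zr 0 X)) in HF.
  change (zsum (fun x => F x * F x) (zr 0 X) <= n * X + n * n * (X / (B * B) + A * A)) in HS.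
  apply Z.mul_le_mono_pos_l with n; auto.
  replace (n * (cnt bad (zr 0 X) * n)) with (n * n * cnt bad (zr 0 X)) by ring.
  replace (n * (4 * (X + n * (X / (B * B) + A * A)))) with (4 * (n * X + n * n * (X / (B * B) + A * A))) by ring. lia.
Qed.

(** * Sparse sets of integers, powers of 2, and the exceptional values *)

Lemma atmost_diam d (P : Z -> Prop) : 0 <= d -> (forall x y, P x -> P y -> y - x < d) -> atmost (2 * d) P.
Proof.
  intros Hd H. destruct (classic (exists x, P x)) as [[a Ha]|Hno].
  - apply (atmost_le ((a + d) - (a - d)) _ (fun x => a - d <= x < a + d)); [apply atmost_interval; lia | lia |].
    intros x Hx. pose proof (H a x Ha Hx). pose proof (H x a Hx Ha). lia.
  - intros [|x l] _ Hl; [unfold zlen; cbn [length]; lia|]. exfalso; apply Hno; exists x; apply Hl; left; auto.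
Qed.

Lemma atmost_ap M a X : 0 < M -> 0 <= X -> atmost (X / M + 1) (fun x => 0 <= x < X /\ (M | x - a)).
Proof.
  intros HM HX. assert (0 <= X / M) by (apply Z.div_pos; auto).
  apply (atmost_inj (fun x => x / M) _ _ (fun x => 0 <= x < X / M + 1)).
  - replace (X / M + 1) with (X / M + 1 - 0) at 1 by lia. apply atmost_interval; lia.
  - intros x [Hx _]. split; [apply Z.div_pos; lia|]. pose proof (Z.div_le_mono x X M). lia.
  - intros x y [_ [c Hc]] [_ [d Hd]] E.
    pose proof (Z_div_mod_eq_full x M). pose proof (Z_div_mod_eq_full y M).
    pose proof (Z.mod_pos_bound x M HM). pose proof (Z.mod_pos_bound y M HM). rewrite E in *.
    assert (x - y = (c - d) * M) by lia. assert (c - d = 0) by nia. lia.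
Qed.

Lemma pow2_gauss a e u' v : ~ (2 | u') -> 0 <= e <= a -> (2 ^ a | 2 ^ e * u' * v) -> (2 ^ (a - e) | v).
Proof.
  intros Hu He [c Hc]. replace a with (e + (a - e)) in Hc by lia. rewrite Z.pow_add_r in Hc by lia.
  assert (0 < 2 ^ e) by (apply Z.pow_pos_nonneg; lia).
  apply Gauss with u'.
  - exists c. apply Z.mul_cancel_l with (2 ^ e); lia.
  - assert (Hp : forall t, 0 <= t -> rel_prime (2 ^ t) u').
    { apply natlike_ind.
      - rewrite Z.pow_0_r. apply rel_prime_1.
      - intros t Ht IH. rewrite Z.pow_succ_r by auto. apply rel_prime_mul; auto. apply prime_rel_prime; auto using prime_2. }
    apply Hp. lia.
Qed.

Lemma pow2_cancel a b u v : 0 <= a -> 0 <= b -> 0 < u <= 2 ^ a -> (2 ^ (a + b) | u * v) -> (2 ^ b | v).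
Proof.
  intros Ha Hb Hu Hd. destruct (val_decomp 2 u prime_2) as (e & u' & -> & Hu' & Hn); [lia|].
  assert (Z.of_nat e <= a).
  { destruct (Z.le_gt_cases (Z.of_nat e) a); auto. assert (2 ^ a < 2 ^ Z.of_nat e) by (apply Z.pow_lt_mono_r; lia). nia. }
  apply pow2_gauss in Hd; auto; [|lia]. eapply Z.divide_trans; [|exact Hd].
  exists (2 ^ (a - Z.of_nat e)). rewrite <- Z.pow_add_r by lia. f_equal; lia.
Qed.

Lemma pow2_split a u v : 0 <= a -> (2 ^ (2 * a) | u * v) -> (2 ^ a | u) \/ (2 ^ a | v).
Proof.
  intros Ha Hd. destruct (Z.eq_dec u 0) as [->|Hu]; [left; apply Z.divide_0_r|].
  destruct (val_decomp 2 (Z.abs u) prime_2) as (e & u' & Eu & Hu' & Hn); [lia|].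
  destruct (Z.le_gt_cases a (Z.of_nat e)).
  - left. apply Z.divide_abs_r. rewrite Eu. apply Z.divide_mul_l. exists (2 ^ (Z.of_nat e - a)).
    rewrite <- Z.pow_add_r by lia. f_equal; lia.
  - right. assert (Hd' : (2 ^ (2 * a) | Z.abs u * v)).
    { destruct (Z.abs_eq_or_opp u) as [-> | ->]; auto. rewrite Z.mul_opp_l. apply Z.divide_opp_r; auto. }
    rewrite Eu in Hd'. apply pow2_gauss in Hd'; auto; [|lia]. eapply Z.divide_trans; [|exact Hd'].
    exists (2 ^ (a - Z.of_nat e)). rewrite <- Z.pow_add_r by lia. f_equal; lia.
Qed.

Lemma R3_scale b (a : nat) n : atleast b (R3 n) -> atleast b (R3 (4 ^ Z.of_nat a * n)).
Proof.
  intro H. assert (0 < 2 ^ Z.of_nat a) by (apply Z.pow_pos_nonneg; lia).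
  apply (atleast_inj (qscale (2 ^ Z.of_nat a)) b (R3 n)); auto.
  - intros v [Hv Hn]. split.
    + cbn [qscale Defs.x0]. rewrite Hv; lia.
    + rewrite qnorm_scale, Hn. f_equal. replace 4 with (2 * 2) by lia. rewrite Z.pow_mul_l. auto.
  - intros v w _ _ E. apply qscale_inj in E; auto. lia.
Qed.

Lemma usable_scale (a : nat) n l : usable (4 ^ Z.of_nat a * n) l -> usable n l.
Proof.
  intros (Hl & Ho & y & Hy). split; [auto|split; auto].
  assert (Hr : forall t, 0 <= t -> rel_prime (2 ^ t) l).
  { apply natlike_ind.
    - rewrite Z.pow_0_r. apply rel_prime_1.
    - intros t Ht IH. rewrite Z.pow_succ_r by auto. apply rel_prime_mul; auto.
      apply rel_prime_sym, prime_rel_prime; auto. intro h. apply prime_dvd_eq in h; auto using prime_2. subst l; discriminate. }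
  destruct (bezout_solve (2 ^ Z.of_nat a) l y) as [x [c Hx]]; [apply Hr; lia|].
  exists x. apply Gauss with (2 ^ Z.of_nat a); [|apply rel_prime_sym, Hr; lia].
  apply Gauss with (2 ^ Z.of_nat a); [|apply rel_prime_sym, Hr; lia].
  replace 4 with (2 * 2) in Hy by lia. rewrite Z.pow_mul_l in Hy.
  set (P := 2 ^ Z.of_nat a) in *.
  replace (P * (P * (x * x + n))) with (y * y + P * P * n + (c * (2 * y + c * l)) * l).
  - apply Z.divide_add_r; auto. apply Z.divide_factor_r.
  - replace (P * (P * (x * x + n))) with ((P * x) * (P * x) + P * P * n) by ring.
    replace (P * x) with (y + c * l) by lia. ring.
Qed.

Lemma halves {T} (U : list T) : NoDup U -> exists U1 U2, NoDup U1 /\ NoDup U2 /\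
  (forall x, In x U1 -> In x U /\ ~ In x U2) /\ (forall x, In x U2 -> In x U) /\
  zlen U / 2 <= zlen U1 /\ zlen U / 2 <= zlen U2.
Proof.
  intro HN. set (h := Nat.div2 (length U)). exists (firstn h U), (skipn h U).
  rewrite <- (firstn_skipn h U) in HN. pose proof (Nat.div2_odd (length U)) as Hd. fold h in Hd.
  assert (Z.of_nat (length U) / 2 = Z.of_nat h).
  { symmetry. apply (Z.div_unique _ _ _ (Z.of_nat (Nat.b2n (Nat.odd (length U))))); [|lia].
    destruct (Nat.odd (length U)); cbn [Nat.b2n]; lia. }
  split; [eapply NoDup_app_remove_r; eauto|]. split; [eapply NoDup_app_remove_l; eauto|]. split; [|split; [|split]].
  - intros x Hx. split.
    + rewrite <- (firstn_skipn h U). apply in_or_app; auto.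
    + clear - HN Hx. revert HN Hx. generalize (skipn h U) as m, (firstn h U) as l. intros m l. induction l as [|y l IH]; cbn.
      * tauto.
      * intros HN [-> | Hx] Hm; inversion HN; subst; [apply H1; apply in_or_app; auto | apply IH; auto].
  - intros x Hx. rewrite <- (firstn_skipn h U). apply in_or_app; auto.
  - unfold zlen. rewrite length_firstn. destruct (Nat.odd (length U)); cbn [Nat.b2n] in Hd; lia.
  - unfold zlen. rewrite length_skipn. destruct (Nat.odd (length U)); cbn [Nat.b2n] in Hd; lia.
Qed.

(** [r3_lower] needs a primitive vector, and passing to one costs a power of 4, which [T] bounds.
    The usable primes are cut into two halves to supply disjoint lists. *)
Lemma rich_level v A T U : x0 v = 0 -> 0 < qnorm v -> 0 <= A -> 0 < T ->
  (forall a : nat, (4 ^ Z.of_nat a | qnorm v) -> 4 ^ Z.of_nat a <= T) ->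
  A * A * (A * A) * T < qnorm v -> NoDup U -> (forall l, In l U -> usable (qnorm v) l /\ l <= A) ->
  atleast ((zlen U / 2) * (zlen U / 2)) (R3 (qnorm v)).
Proof.
  intros Hv Hn HA HT H4 Hbig HN HU.
  destruct (odd_primitive_rep v Hv Hn) as (a & w & Hw & Hp & E). rewrite E in *.
  assert (H4a : 0 < 4 ^ Z.of_nat a) by (apply Z.pow_pos_nonneg; lia).
  assert (Hle : 4 ^ Z.of_nat a <= T) by (apply H4, Z.divide_factor_l).
  assert (Hw0 : 0 < qnorm w) by (apply Z.mul_pos_cancel_l in Hn; auto).
  assert (HAw : A * A * (A * A) < qnorm w).
  { apply Z.mul_lt_mono_pos_r with T; auto. apply (Z.lt_le_trans _ _ _ Hbig). rewrite Z.mul_comm.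
    apply Z.mul_le_mono_nonneg_l; lia. }
  apply R3_scale. destruct (halves U HN) as (U1 & U2 & N1 & N2 & H1 & H2 & L1 & L2).
  assert (Hh : 0 <= zlen U / 2) by (apply Z.div_pos; [apply zlen_nonneg | lia]).
  destruct (r3_lower w A U1 U2) as (l & Nl & Hl & Hc); auto.
  - intros l Hl. destruct (HU l (proj1 (H1 l Hl))). split; auto. apply usable_scale in H; auto.
  - intros l Hl. destruct (HU l (H2 l Hl)). split; auto. apply usable_scale in H; auto.
  - intros l Hl. apply H1; auto.
  - exists l. split; [auto | split; [auto|]]. apply Z.le_trans with (zlen U1 * zlen U2); auto.
    apply Z.mul_le_mono_nonneg; auto.
Qed.

Definition level (P m x : Z) : Z := m * (P - m * (x * x)).

(** [E] is the unit of precision: sizes are compared up to bounded powers of [E]. The primes of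
    [L] have fourth powers well below [level P m x], as [r3_lower] requires, and there are enough
    of them to give almost [X] representations. *)
Lemma few_bad (j : nat) E A B L P m X : E = 2 ^ Z.of_nat j -> 256 <= E -> A = B * (E * E) -> E ^ 30 <= A ->
  X = E ^ 20 * (A * A) -> NoDup L -> A <= E * zlen L -> 0 < P -> 1 <= m <= E ->
  (forall l, In l L -> prime l /\ Z.odd l = true /\ B < l <= A /\ ~ (l | m * P)) ->
  atmost (A * A * E ^ 15) (fun x => 0 <= x < X /\ X <= E * E * x /\ 0 < P - m * (x * x) /\
    (exists v, R3 (level P m x) v) /\ ~ atleast (B * B) (R3 (level P m x))).
Proof.
  intros HE HE2 HAB HA HX HN HLn HP Hm HL.
  assert (Ep : forall t, 0 <= t -> 0 < E ^ t) by (intros; apply Z.pow_pos_nonneg; lia).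
  assert (HA0 : 0 < A) by (pose proof (Ep 30); lia).
  assert (HB0 : 0 < B) by nia. assert (HX0 : 0 < X) by (subst X; pose proof (Ep 20); nia).
  assert (HL0 : 0 < zlen L) by nia.
  (* Too few usable primes. Of the 9, one comes from [4 X <= A^2 * zlen L], four from the term
     [A * A] and four from [X / (B * B) = E^24 <= A * A]. *)
  assert (Hb1 : atmost (9 * (A * A)) (fun x => In x (zr 0 X) /\ 4 * cnt (fun l => 1 <= rho m P l x) L < zlen L)).
  { apply (atmost_le (zlen (sel (fun x => 4 * cnt (fun l => 1 <= rho m P l x) L < zlen L) (zr 0 X))) _
      (fun x => In x (zr 0 X) /\ 4 * cnt (fun l => 1 <= rho m P l x) L < zlen L)); [| |auto].
    - apply atmost_list. intros x Hx. apply in_sel; auto.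
    - rewrite <- cnt_sel. pose proof (few_usable m P L A B X HN HB0 ltac:(lia) HL0 HL) as HF.
      set (c := cnt _ _) in *. apply Z.mul_le_mono_pos_r with (zlen L); auto. apply (Z.le_trans _ _ _ HF).
      assert (EB : X / (B * B) = E ^ 24).
      { rewrite HX, HAB. replace (E ^ 20 * (B * (E * E) * (B * (E * E)))) with (E ^ 24 * (B * B)) by ring.
        apply Z.div_mul. nia. }
      rewrite EB. assert (E ^ 24 <= E ^ 30) by (apply Z.pow_le_mono_r; lia).
      assert (H24 : E ^ 24 <= A * A) by (pose proof (Ep 30); nia).
      assert (HXL : X <= E ^ 21 * A * zlen L).
      { rewrite HX. replace (E ^ 20 * (A * A)) with (E ^ 20 * A * A) by ring.
        replace (E ^ 21 * A * zlen L) with (E ^ 20 * A * (E * zlen L)) by ring.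
        apply Z.mul_le_mono_nonneg_l; auto. pose proof (Ep 20); nia. }
      assert (H21 : 4 * E ^ 21 <= A).
      { apply Z.le_trans with (E ^ 30); auto. replace (E ^ 30) with (E ^ 9 * E ^ 21) by ring.
        apply Z.mul_le_mono_nonneg_r; [pose proof (Ep 21); lia|].
        apply Z.le_trans with (E ^ 1); [rewrite Z.pow_1_r; lia | apply Z.pow_le_mono_r; lia]. }
      assert (4 * X <= A * A * zlen L).
      { apply Z.le_trans with (4 * E ^ 21 * A * zlen L); [lia|]. apply Z.mul_le_mono_nonneg_r; [lia|].
        apply Z.mul_le_mono_nonneg_r; lia. }
      assert (zlen L * E ^ 24 <= zlen L * (A * A)) by (apply Z.mul_le_mono_nonneg_l; lia). lia. }
  (* Level too small: [m * x^2] lies within [A^4 * E^30] of [P]. As [x >= E^18 * A^2], two such [x]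
     differ by less than [D2]. *)
  set (D2 := E ^ 12 * (A * A)).
  assert (Hb2 : atmost (2 * D2) (fun x => 0 <= x < X /\ X <= E * E * x /\ 0 < P - m * (x * x) <= A * A * (A * A) * E ^ 30)).
  { apply atmost_diam; [unfold D2; pose proof (Ep 12); nia|]. intros x y (Hx & Hx2 & Hx3) (Hy & Hy2 & Hy3).
    assert (H1 : m * (y * y) - m * (x * x) < A * A * (A * A) * E ^ 30) by lia.
    destruct (Z.le_gt_cases D2 (y - x)) as [Hle|]; auto. exfalso.
    assert (HD2 : 0 < D2) by (unfold D2; pose proof (Ep 12); nia).
    assert (HX2 : E ^ 18 * (A * A) <= x).
    { apply Z.mul_le_mono_pos_l with (E * E); [nia|]. rewrite HX in Hx2.
      replace (E * E * (E ^ 18 * (A * A))) with (E ^ 20 * (A * A)) by ring. auto. }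
    assert (HX3 : E ^ 18 * (A * A) <= y + x) by lia.
    assert (D2 * (E ^ 18 * (A * A)) <= (y - x) * (y + x)).
    { apply Z.mul_le_mono_nonneg; auto; [lia|]. pose proof (Ep 18); nia. }
    assert (E1 : D2 * (E ^ 18 * (A * A)) = A * A * (A * A) * E ^ 30) by (unfold D2; ring).
    assert (HD3 : 0 <= (y - x) * (y + x)) by (clear - Hx Hy HD2 Hle; apply Z.mul_nonneg_nonneg; lia).
    assert (Hm1 : 1 <= m) by lia. pose proof (Z.mul_le_mono_nonneg_r 1 m _ HD3 Hm1) as Hm2.
    replace (m * ((y - x) * (y + x))) with (m * (y * y) - m * (x * x)) in Hm2 by ring. clear - H1 H E1 Hm2. lia. }
  (* Level divisible by a large power of 2. If [a] is one such [x], [E^14] divides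
     [m^2 (a - x)(a + x)] for every other; [m^2 <= E^2] leaves [E^12] for the product, and [E] being
     a power of 2, one factor receives [E^6]. *)
  set (M := E ^ 6). assert (HM0 : 0 < M) by (apply Ep; lia).
  assert (Epow : forall t, 0 <= t -> E ^ t = 2 ^ (Z.of_nat j * t)) by (intros; rewrite HE, Z.pow_mul_r by lia; auto).
  assert (Hb3 : atmost (X / M + 1 + (X / M + 1)) (fun x => 0 <= x < X /\ (E ^ 14 | level P m x))).
  { destruct (classic (exists x, 0 <= x < X /\ (E ^ 14 | level P m x))) as [(a & Ha & Da)|Hno].
    - apply (atmost_union _ _ (fun x => 0 <= x < X /\ (M | x - a)) (fun x => 0 <= x < X /\ (M | x - (- a)))).
      + apply atmost_ap; lia.
      + apply atmost_ap; lia.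
      + intros x [Hx Dx]. assert (Hd : (E ^ 14 | m * m * ((a - x) * (a + x)))).
        { replace (m * m * ((a - x) * (a + x))) with (level P m x - level P m a) by (unfold level; ring).
          apply Z.divide_sub_r; auto. }
        assert (Hd2 : (E ^ 12 | (a - x) * (a + x))).
        { rewrite Epow in * by lia. apply (pow2_cancel (Z.of_nat j * 2) (Z.of_nat j * 12) (m * m)); try lia.
          - rewrite <- (Epow 2) by lia. replace (E ^ 2) with (E * E) by ring. nia.
          - replace (Z.of_nat j * 2 + Z.of_nat j * 12) with (Z.of_nat j * 14) by ring. auto. }
        rewrite Epow in Hd2 by lia. replace (Z.of_nat j * 12) with (2 * (Z.of_nat j * 6)) in Hd2 by ring.
        apply pow2_split in Hd2; [|lia]. rewrite <- Epow in Hd2 by lia. fold M in Hd2.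
        destruct Hd2 as [h|h]; [left | right]; split; auto.
        * replace (x - a) with (- (a - x)) by ring. apply Z.divide_opp_r; auto.
        * replace (x - - a) with (a + x) by ring; auto.
    - apply (atmost_le 0 _ (fun _ => False)).
      + intros [|x l] _ Hl; [unfold zlen; cbn [length]; lia | exfalso; apply (Hl x); left; auto].
      + pose proof (Z.div_pos X M); lia.
      + intros x Hx; apply Hno; exists x; auto. }
  pose proof (atmost_union _ _ _ _ (fun x => _ \/ _) Hb2 Hb3 (fun x h => h)) as Hb23.
  pose proof (atmost_union _ _ _ _ (fun x => _ \/ _) Hb1 Hb23 (fun x h => h)) as Hall.
  apply (atmost_le _ _ _ _ Hall).
  - assert (EM : X / M = E ^ 14 * (A * A)).
    { unfold M. rewrite HX. replace (E ^ 20 * (A * A)) with (E ^ 14 * (A * A) * E ^ 6) by ring. apply Z.div_mul. pose proof (Ep 6); lia. }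
    rewrite EM. unfold D2. replace (E ^ 15) with (E * E ^ 14) by ring.
    assert (E ^ 12 <= E ^ 14) by (apply Z.pow_le_mono_r; lia). assert (1 <= E ^ 14) by (pose proof (Ep 14); lia).
    assert (0 < A * A) by nia. set (W := E ^ 14) in *. set (W2 := E ^ 12) in *. set (Q := A * A) in *.
    assert (2 * (W2 * Q) <= 2 * (W * Q)) by nia. assert (9 * Q <= 9 * (W * Q)) by nia.
    assert (256 * (W * Q) <= Q * (E * W)) by nia. assert (1 <= W * Q) by nia. lia.
  - intros x (Hx & Hx2 & Hx3 & [v [Hv Nv]] & Hnot). cbn beta.
    destruct (classic (4 * cnt (fun l => 1 <= rho m P l x) L < zlen L)) as [h|h]; [left; split; auto; apply in_zr; auto|].
    destruct (Z.le_gt_cases (P - m * (x * x)) (A * A * (A * A) * E ^ 30)) as [h2|h2]; [right; left; auto|].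
    destruct (classic (E ^ 14 | level P m x)) as [h3|h3]; [right; right; auto|]. exfalso. apply Hnot.
    set (U := sel (fun l => 1 <= rho m P l x) L).
    assert (Hpos : P - m * (x * x) <= level P m x) by (unfold level; nia).
    assert (HU : zlen L <= 4 * zlen U) by (unfold U; rewrite <- cnt_sel; lia).
    assert (Hv0 : 0 < qnorm v) by (rewrite Nv; clear - Hx3 Hpos; lia).
    destruct (rich_level v A (E ^ 14) U Hv Hv0 (Z.lt_le_incl _ _ HA0) (Ep 14 ltac:(discriminate))) as (l & Nl & Hl & Hc).
    + intros a Ha. rewrite Nv in Ha. replace 4 with (2 ^ 2) in * by reflexivity.
      rewrite <- Z.pow_mul_r in * by lia. rewrite Epow in * by lia.
      destruct (Z.le_gt_cases (Z.of_nat j * 14) (2 * Z.of_nat a)).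
      * exfalso. apply h3. eapply Z.divide_trans; [|exact Ha]. exists (2 ^ (2 * Z.of_nat a - Z.of_nat j * 14)).
        rewrite <- Z.pow_add_r by lia. f_equal; lia.
      * apply Z.pow_le_mono_r; lia.
    + rewrite Nv. assert (E ^ 14 <= E ^ 30) by (apply Z.pow_le_mono_r; lia).
      assert (A * A * (A * A) * E ^ 14 <= A * A * (A * A) * E ^ 30) by (apply Z.mul_le_mono_nonneg_l; [clear - HA0; nia | auto]). clear - H0 h2 Hpos; lia.
    + apply nodup_sel; auto.
    + intros l Hl. apply in_sel in Hl. destruct Hl as [Hl Hr]. destruct (HL l Hl) as (Pl & Ol & Bl & Dl).
      split; [|lia]. split; [auto|split; [auto|]]. rewrite Nv. apply NNPP. intro Hno.
      assert (rho m P l x = 0).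
      { apply cnt_zero. intros y _ hy. apply Hno. exists y. unfold level.
        replace (y * y + m * (P - m * (x * x))) with (y * y + (m * P - m * m * (x * x))) by ring. auto. }
      lia.
    + exists l. rewrite Nv in Hl. split; [auto|split; [auto|]]. apply Z.le_trans with (zlen U / 2 * (zlen U / 2)); auto.
      assert (B <= zlen U / 2).
      { apply Z.div_le_lower_bound; [lia|].
        assert (B * (E * E) <= E * (4 * zlen U)) by nia. assert (B * E <= 4 * zlen U) by nia. nia. }
      nia.
Qed.

(** * Chebyshev's lower bound *)

Module CentralBinomial.
Import ssreflect ssrfun ssrbool eqtype ssrnat seq div prime bigop binomial path.
Local Open Scope nat_scope.

Lemma bin2n_ge n : 2 ^ n <= 'C(n.*2, n).
Proof.
elim: n => // n IH; rewrite doubleS expnS binS binS.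
have h : 'C(n.*2, n) <= 'C((n.*2).+1, n).
  by case: n {IH} => // n; rewrite [X in _ <= X]binS leq_addr.
by rewrite mul2n -addnn leq_add // (leq_trans IH) // ?leq_addl // -binS.
Qed.

(** By Legendre's formula the exponent is the sum of [floor (2n / p^k) - 2 floor (n / p^k)], where
    each term is 0 or 1 and vanishes once [p^k > 2n]. *)
Lemma pfactor_bin_le p n : prime p -> 0 < n -> p ^ logn p 'C(n.*2, n) <= n.*2.
Proof.
move=> pp n0; set t := trunc_log p n.*2.
have C0 : 0 < 'C(n.*2, n) by rewrite bin_gt0 -addnn leq_addr.
suff: logn p 'C(n.*2, n) <= t.
  move=> h; apply: leq_trans (trunc_logP (prime_gt1 pp) _); last by rewrite double_gt0.
  by rewrite leq_pexp2l // prime_gt0.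
have E : logn p (n.*2)`! = logn p 'C(n.*2, n) + (logn p n`! + logn p n`!).
  rewrite -(@bin_fact n.*2 n) ?lognM ?muln_gt0 ?fact_gt0 //; last by rewrite -addnn leq_addr.
  by rewrite -addnn addnK.
have F : logn p n`! = \sum_(1 <= k < (n.*2).+1) n %/ p ^ k.
  rewrite logn_fact // (@big_cat_nat _ _ _ n.+1 1 (n.*2).+1) //=; last by rewrite ltnS -addnn leq_addr.
  rewrite [X in _ + X]big_nat_cond [X in _ + X]big1 ?addn0 // => k; rewrite andbT => /andP[hk _].
  by rewrite divn_small // (leq_trans hk) // ltnW // ltn_expl // prime_gt1.
rewrite logn_fact // in E.
have {E} -> : logn p 'C(n.*2, n) = \sum_(1 <= k < (n.*2).+1) (n.*2 %/ p ^ k - (n %/ p ^ k).*2).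
  rewrite sumnB => [|k _]; last by rewrite leq_divRL ?expn_gt0 ?prime_gt0 // -muln2 mulnAC muln2 leq_double leq_divM.
  rewrite E F -big_split /=. under [X in _ = _ - X]eq_bigr => k _ do rewrite -addnn. by rewrite addnK.
apply: leq_trans (_ : \sum_(1 <= k < (n.*2).+1) (k <= t) <= _).
  apply: leq_sum => k _; case: (leqP k t) => hk; last first.
    rewrite divn_small // ltnNge; apply/negP => h.
    by move: (trunc_log_max (prime_gt1 pp) h); rewrite leqNgt hk.
  have pk : 0 < p ^ k by rewrite expn_gt0 prime_gt0.
  by rewrite leq_subLR -ltnS ltn_divLR // addn1 -doubleS -doubleMl ltn_double ltn_ceil.
have ht : t <= n.*2.
  by apply: (leq_trans _ (trunc_logP (prime_gt1 pp) _)); rewrite ?double_gt0 // ltnW // ltn_expl // prime_gt1.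
rewrite (@big_cat_nat _ _ _ t.+1 1 (n.*2).+1) //=.
rewrite [X in _ + X]big_nat_cond [X in _ + X]big1 ?addn0; last first.
  by move=> k; rewrite andbT => /andP[hk _]; rewrite leqNgt hk.
apply: leq_trans (_ : \sum_(1 <= k < t.+1) 1 <= _); first by apply: leq_sum => k _; exact: leq_b1.
by rewrite sum_nat_const_nat subn1 muln1.
Qed.

(** Each prime power in the central binomial coefficient is at most [2n], so the coefficient is at
    most [2n] to the number of its primes. *)
Lemma chebyshev n : 0 < n -> 2 ^ n <= n.*2 ^ size (primes 'C(n.*2, n)).
Proof.
move=> n0; apply: leq_trans (bin2n_ge n) _.
have C0 : 0 < 'C(n.*2, n) by rewrite bin_gt0 -addnn leq_addr.
rewrite {1}(prod_prime_decomp C0) prime_decompE big_map /=.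
have : all prime (primes 'C(n.*2, n)) by apply/allP => p; rewrite mem_primes => /and3P[].
elim: (primes _) => [|p s IH] /=; first by rewrite big_nil.
move=> /andP[pp /IH {}IH]; rewrite big_cons expnS leq_mul // pfactor_bin_le //.
Qed.

Lemma prime_bound n p : 0 < n -> p \in primes 'C(n.*2, n) -> prime p && (p <= n.*2).
Proof.
move=> n0; rewrite mem_primes => /and3P[pp C0 hd]; rewrite pp /=.
apply: leq_trans (pfactor_bin_le p n pp n0).
have : 0 < logn p 'C(n.*2, n) by rewrite -pfactor_dvdn // expn1.
by case: logn => // k _; rewrite expnS leq_pmulr // expn_gt0 prime_gt0.
Qed.

Lemma prime_Znumtheory p : prime p -> Znumtheory.prime (Z.of_nat p).
Proof.
move=> pp; apply Znumtheory.prime_alt; split.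
  by have /ltP := prime_gt1 pp; lia.
move=> m hm [k hk]; have {}hk : (Z.to_nat k * Z.to_nat m)%coq_nat = p by nia.
have hd : Z.to_nat m %| p by apply/dvdnP; exists (Z.to_nat k).
move/primeP: pp => [_ /(_ _ hd)] /orP[] /eqP; lia.
Qed.

Lemma in_list (s : list nat) x : In x s -> x \in s.
Proof. by elim: s => //= y s IH [->|/IH h]; rewrite inE ?eqxx ?h ?orbT. Qed.

Lemma uniq_nodup (s : list nat) : uniq s -> NoDup s.
Proof.
elim: s => [|y s IH] /=; first by constructor.
by move=> /andP[/negP h /IH]; constructor => // /in_list.
Qed.

Lemma expn_Z m n : Z.of_nat (m ^ n) = (Z.of_nat m ^ Z.of_nat n)%Z.
Proof.
elim: n => // n IH; rewrite expnS Nat2Z.inj_succ Z.pow_succ_r; last by lia.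
by rewrite -IH -Nat2Z.inj_mul.
Qed.
End CentralBinomial.

Lemma chebyshev_primes n : 0 < n -> exists l, NoDup l /\
  (forall x, In x l -> prime x /\ 1 <= x <= 2 * n) /\ 2 ^ n <= (2 * n) ^ zlen l.
Proof.
  intro Hn. set (m := Z.to_nat n). assert (Hm : ssrnat.leq 1 m = true) by (apply (ssrbool.introT ssrnat.leP); lia).
  set (s := prime.primes (binomial.binomial (ssrnat.double m) m)).
  assert (Hd : Z.of_nat (ssrnat.double m) = 2 * n).
  { rewrite <- ssrnat.addnn. change (ssrnat.addn m m) with (m + m)%nat. lia. }
  exists (map Z.of_nat s). split; [|split].
  - apply FinFun.Injective_map_NoDup; [intros x y; lia|]. apply CentralBinomial.uniq_nodup, prime.primes_uniq.
  - intros x Hx. apply in_map_iff in Hx. destruct Hx as [y [<- Hy]].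
    apply CentralBinomial.in_list in Hy. apply CentralBinomial.prime_bound in Hy; auto.
    apply andb_prop in Hy. destruct Hy as [Hy1 Hy2]. apply CentralBinomial.prime_Znumtheory in Hy1.
    split; auto. apply prime_ge_2 in Hy1. apply (ssrbool.elimT ssrnat.leP) in Hy2. lia.
  - pose proof (CentralBinomial.chebyshev m Hm) as H. apply (ssrbool.elimT ssrnat.leP) in H.
    apply inj_le in H. rewrite !CentralBinomial.expn_Z, Hd in H.
    rewrite zlen_map. unfold zlen. replace (Z.of_nat m) with n in H by lia. exact H.
Qed.

(** * The choice of q *)

Lemma linear_le_pow2 c j : 0 <= c -> 4 * c <= j -> c * j <= 2 ^ j.
Proof.
  intros Hc Hj. set (i := j / 2). pose proof (Z_div_mod_eq_full j 2). pose proof (Z.mod_pos_bound j 2).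
  assert (0 <= i) by (apply Z.div_pos; lia).
  assert (H2 : (i + 1) * (i + 1) <= 2 ^ j).
  { apply Z.le_trans with (2 ^ (i + i)).
    - rewrite Z.pow_add_r by auto. pose proof (pow2_ge i H1). apply Z.mul_le_mono_nonneg; lia.
    - apply Z.pow_le_mono_r; subst i; lia. }
  fold i in H. nia.
Qed.

Lemma prime_dvd_pow l p h : prime l -> 0 <= h -> (l | p ^ h) -> (l | p).
Proof.
  intros Hl Hh. revert h Hh. apply (natlike_ind (fun h => (l | p ^ h) -> (l | p))).
  - rewrite Z.pow_0_r. intro H. apply Z.divide_1_r_nonneg in H; pose proof (prime_ge_2 l Hl); lia.
  - intros h Hh IH H. rewrite Z.pow_succ_r in H by auto. apply prime_mult in H; auto. tauto.
Qed.

(** Chebyshev's bound loses a factor [j * a], the logarithm of [E^a]; [4 (j a) <= E] absorbs it,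
    leaving room to discard the primes up to [E^(a - 2)]. *)
Lemma primes_block E j a : E = 2 ^ j -> 1 <= j -> 2 <= a -> 4 * (j * a) <= E ->
  exists L, NoDup L /\ E ^ a <= E * zlen L /\ forall l, In l L -> prime l /\ E ^ (a - 2) < l <= E ^ a.
Proof.
  intros HE Hj Ha Hja.
  assert (Ep : forall t, 0 <= t -> 0 < E ^ t) by (intros; apply Z.pow_pos_nonneg; nia).
  assert (E1 : E ^ a = 2 * 2 ^ (j * a - 1)).
  { rewrite HE, <- Z.pow_mul_r, <- (Z.pow_succ_r 2) by nia. f_equal; lia. }
  set (n := 2 ^ (j * a - 1)) in *. assert (Hn : 0 < n) by (apply Z.pow_pos_nonneg; nia).
  destruct (chebyshev_primes n Hn) as (l & Nl & Hl & Hc). rewrite <- E1 in *.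
  assert (Hlen : n <= j * a * zlen l).
  { pose proof (zlen_nonneg l). assert (0 <= j * a) by nia.
    rewrite HE, <- (Z.pow_mul_r 2 j a), <- Z.pow_mul_r in Hc by lia. apply Z.pow_le_mono_r_iff in Hc; auto; nia. }
  exists (sel (fun x => E ^ (a - 2) < x) l). split; [apply nodup_sel; auto|]. split.
  - set (L := sel (fun x => E ^ (a - 2) < x) l).
    assert (HB : zlen l <= zlen L + E ^ (a - 2)).
    { assert (H1 : zlen (sel (fun x => ~ E ^ (a - 2) < x) l) <= E ^ (a - 2)).
      { pose proof (atmost_interval 1 (E ^ (a - 2) + 1) ltac:(pose proof (Ep (a - 2)); lia)) as HI.
        apply Z.le_trans with (E ^ (a - 2) + 1 - 1); [apply HI | lia].
        - apply nodup_sel; auto.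
        - intros x Hx. apply in_sel in Hx. destruct Hx as [Hx Hx2]. pose proof (Hl x Hx). lia. }
      unfold L. rewrite <- cnt_sel in *. unfold cnt in *.
      assert (H2 : zsum (fun x => b2z (E ^ (a - 2) < x) + b2z (~ E ^ (a - 2) < x)) l = zlen l).
      { rewrite (zsum_ext _ (fun _ => 1)); [rewrite zsum_const; lia|]. intros x _.
        destruct (classic (E ^ (a - 2) < x)); [rewrite b2z_true, b2z_false | rewrite b2z_false, b2z_true]; auto. }
      rewrite zsum_add in H2. lia. }
    assert (E2 : E ^ a = E * E * E ^ (a - 2)).
    { replace a with (1 + (1 + (a - 2))) at 1 by lia. rewrite !Z.pow_add_r, Z.pow_1_r by lia. ring. }
    pose proof (Ep (a - 2)). set (b := E ^ (a - 2)) in *. clearbody b L n. clear - E1 E2 Hlen HB Hja Hj Ha H.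
    assert (E * n <= E * (j * a) * zlen l) by (assert (0 < j * a) by nia; assert (0 <= E) by nia; nia).
    pose proof (zlen_nonneg l). set (c := j * a) in *. assert (0 < c) by nia.
    assert (4 * c * n <= c * (E * zlen l)) by nia.
    assert (4 * n <= E * zlen l) by nia. assert (4 <= E) by nia.
    assert (E * b <= 2 * n) by nia. nia.
  - intros x Hx. apply in_sel in Hx. destruct Hx as [Hx Hx2]. destruct (Hl x Hx). split; [auto | lia].
Qed.

(** The exceptional sets of [few_bad] are united over all [h] and [m] up to [E], so that one [q]
    serves whatever the girth turns out to be. The lower bound on [q] supplies [X <= E * E * q]. *)
Lemma good_q p a J0 : prime p -> p mod 4 = 1 -> 30 <= a -> 0 <= J0 -> exists (j : nat) q E,
  J0 <= Z.of_nat j /\ E = 2 ^ Z.of_nat j /\ cls p q /\ E ^ (18 + 2 * a) <= q < E ^ (20 + 2 * a) /\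
  forall h m, 0 <= h -> 1 <= m <= E -> p ^ h <= E * (q * q) -> 0 < p ^ h - m * (q * q) ->
  (exists v, R3 (level (p ^ h) m q) v) -> atleast (E ^ (2 * a - 4)) (R3 (level (p ^ h) m q)).
Proof.
  intros Hp Hp4 Ha HJ. pose proof (prime_ge_2 p Hp).
  set (k := 20 + 2 * a).
  destruct (class_primes_many p k (J0 + 16 * (2 * k + 1) + p) Hp Hp4) as (j & Hj & Hcls); [lia | lia |].
  set (E := 2 ^ j) in *.
  assert (Hk : 80 <= k) by lia.
  assert (HE1 : (2 * k + 1) * j <= E) by (apply linear_le_pow2; lia).
  assert (HE2 : 4 * (j * a) <= E) by nia.
  assert (HEp : p < E) by (pose proof (pow2_ge j ltac:(lia)); fold E in H0; lia).
  assert (HE256 : 256 <= E) by nia.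
  assert (Ep : forall t, 0 <= t -> 0 < E ^ t) by (intros; apply Z.pow_pos_nonneg; lia).
  assert (Epow : forall t, 0 <= t -> E ^ t = 2 ^ (j * t)) by (intros; unfold E; rewrite Z.pow_mul_r by lia; auto).
  destruct (primes_block E j a eq_refl ltac:(lia) ltac:(lia) HE2) as (L & NL & HL1 & HL2).
  set (A := E ^ a) in *. set (B := E ^ (a - 2)) in *.
  assert (HAB : A = B * (E * E)).
  { unfold A, B. replace a with (a - 2 + (1 + 1)) at 1 by lia. rewrite !Z.pow_add_r, Z.pow_1_r by lia. ring. }
  assert (HA30 : E ^ 30 <= A) by (apply Z.pow_le_mono_r; lia).
  set (X := E ^ 20 * (A * A)).
  assert (HX : X = E ^ k).
  { unfold X, A, k. rewrite <- !Z.pow_add_r by lia. f_equal; lia. }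
  assert (HBE : E < B).
  { apply Z.lt_le_trans with (E ^ 2); [|apply Z.pow_le_mono_r; lia]. clear - HE256. nia. }
  set (bad := fun h m x => 0 <= x < X /\ X <= E * E * x /\ 0 < p ^ h - m * (x * x) /\
    (exists v, R3 (level (p ^ h) m x) v) /\ ~ atleast (B * B) (R3 (level (p ^ h) m x))).
  assert (Hbad : forall h m, 0 <= h -> 1 <= m <= E -> atmost (A * A * E ^ 15) (bad h m)).
  { intros h m Hh Hm. apply (few_bad (Z.to_nat j) E A B L (p ^ h) m X); auto.
    - rewrite Z2Nat.id by lia; auto.
    - apply Z.pow_pos_nonneg; lia.
    - intros l Hl. destruct (HL2 l Hl) as [Pl Bl]. split; [auto|]. split; [|split; [auto|]].
      + destruct (Z.odd l) eqn:El; auto. exfalso.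
        assert (He : Z.even l = true) by (rewrite <- Z.negb_odd, El; auto). apply Z.even_spec in He. destruct He as [c Hc].
        assert (2 = l) by (apply prime_dvd_eq; auto using prime_2; exists c; lia). lia.
      + intro h1. apply prime_mult in h1; auto. destruct h1 as [h1|h1].
        * apply Z.divide_pos_le in h1; lia.
        * apply prime_dvd_pow in h1; auto. apply Z.divide_pos_le in h1; lia. }
  set (LL := list_prod (zr 0 (E + 1)) (zr 1 (E + 1))).
  assert (Hall : atmost (zsum (fun _ => A * A * E ^ 15) LL) (fun x => exists hm, In hm LL /\ bad (fst hm) (snd hm) x)).
  { apply (atmost_cover LL _ (fun hm => bad (fst hm) (snd hm))); auto.
    intros [h m] Hhm. apply in_prod_iff in Hhm. destruct Hhm as [h1 h2]. apply in_zr in h1, h2. apply Hbad; cbn [fst snd]; lia. }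
  rewrite zsum_const in Hall. unfold LL in Hall at 1. rewrite pair_list, !zlen_zr in Hall by lia.
  assert (Hsmall : atmost (E ^ (18 + 2 * a) + 1) (fun x => 0 <= x < E ^ (18 + 2 * a) + 1)).
  { pose proof (atmost_interval 0 (E ^ (18 + 2 * a) + 1)) as h. rewrite Z.sub_0_r in h. apply h. pose proof (Ep (18 + 2 * a) ltac:(lia)); lia. }
  pose proof (atmost_union _ _ _ _ (fun x => _ \/ _) Hsmall Hall (fun x h => h)) as Hex.
  (* In powers of [E]: the exceptions number about [E^(17 + 2 a)], the small [x] about
     [E^(18 + 2 a)], and the class primes at least [E^(k - 1) = E^(19 + 2 a)]. The last 1 removes
     the endpoint [E^k]. *)
  assert (Hnum : E ^ (18 + 2 * a) + 1 + A * A * E ^ 15 * ((E + 1 - 0) * (E + 1 - 1)) + 1 < 2 ^ (j * (k - 1))).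
  { rewrite <- Epow by lia. replace (E ^ (k - 1)) with (E * E ^ (18 + 2 * a)).
    2:{ rewrite <- Z.pow_succ_r by lia. f_equal; lia. }
    replace (A * A * E ^ 15) with (E ^ (15 + 2 * a)).
    2:{ unfold A. rewrite <- !Z.pow_add_r by lia. f_equal; lia. }
    replace (E ^ (18 + 2 * a)) with (E * E * E * E ^ (15 + 2 * a)).
    2:{ replace (18 + 2 * a) with (1 + (1 + (1 + (15 + 2 * a)))) by lia. rewrite !Z.pow_add_r, Z.pow_1_r by lia. ring. }
    pose proof (Ep (15 + 2 * a) ltac:(lia)) as H0. set (W := E ^ (15 + 2 * a)) in *. clearbody W. clearbody E. clear - H0 HE256 HE1.
    assert (0 < W * (E * E)) by (apply Z.mul_pos_pos; nia).
    replace (E * E * E * W) with (E * (W * (E * E))) by ring. replace (W * ((E + 1 - 0) * (E + 1 - 1))) with (W * (E * E) + W * E) by ring.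
    assert (W * E <= W * (E * E)) by nia. assert (1 <= W * (E * E)) by lia. set (V := W * (E * E)) in *. clearbody V.
    assert (256 * V <= E * V) by nia. assert (256 * (E * V) <= E * (E * V)) by nia. lia. }
  assert (Hq : exists q, cls p q /\ 1 <= q < 2 ^ (j * k) + 1 /\
     ~ ((0 <= q < E ^ (18 + 2 * a) + 1 \/ exists hm, In hm LL /\ bad (fst hm) (snd hm) q) \/ q = E ^ k)).
  { apply NNPP. intro Hno. assert (Hex2 := atmost_union _ 1 _ (fun x => x = E ^ k) (fun x => _ \/ _) Hex ltac:(apply atmost_1; intros; congruence) (fun x h => h)).
    apply (Z.lt_irrefl (2 ^ (j * (k - 1)))). apply (Z.le_lt_trans _ _ _ Hcls). apply Z.le_lt_trans with (2 := Hnum).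
    apply cnt_atmost; [apply nodup_zr|]. apply (atmost_le _ _ _ _ Hex2); [lia|]. intros x [Hx1 Hx2]. apply in_zr in Hx1.
    apply NNPP. intro h. apply Hno. exists x. auto. }
  destruct Hq as (q & Hqc & Hq1 & Hq2). exists (Z.to_nat j), q, E. rewrite Z2Nat.id by lia.
  rewrite <- Epow in Hq1 by lia. fold k.
  assert (Hqlo : E ^ (18 + 2 * a) <= q) by lia.
  assert (Hqhi : q < E ^ k) by (assert (q <> E ^ k) by tauto; lia).
  split; [lia|]. split; [auto|]. split; [auto|]. split; [auto|].
  intros h m Hh Hm Hph Hpos Hv. replace (E ^ (2 * a - 4)) with (B * B).
  2:{ unfold B. rewrite <- Z.pow_add_r by lia. f_equal; lia. }
  apply NNPP. intro Hna. apply Hq2. left. right. exists (h, m). split.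
  - apply in_prod_iff. split; apply in_zr; [split; [auto|] | lia].
    (* From [2^h <= p^h <= E q^2 < E^(2 k + 1) = 2^((2 k + 1) j)] it follows that [h] is at most
       [E], so the pair [(h, m)] was among those excluded. *)
    apply Z.lt_le_trans with ((2 * k + 1) * j); [|clear - HE1; lia].
    assert (Hkj : 0 <= (2 * k + 1) * j) by (clear - Hk HJ Hj H; apply Z.mul_nonneg_nonneg; lia).
    apply (Z.pow_lt_mono_r_iff 2); [reflexivity | exact Hkj |].
    apply Z.le_lt_trans with (p ^ h); [apply Z.pow_le_mono_l; clear - H; lia|]. apply (Z.le_lt_trans _ _ _ Hph).
    replace ((2 * k + 1) * j) with (j * (1 + (k + k))) by ring. rewrite <- Epow, !Z.pow_add_r, Z.pow_1_r by (clear - Hk; lia).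
    apply Z.mul_lt_mono_pos_l; [clear - HE256; lia|]. pose proof (Ep (18 + 2 * a) ltac:(clear - Ha; lia)) as H18. apply Z.mul_lt_mono_nonneg; clear - H18 Hqlo Hqhi; lia.
  - cbn [fst snd]. unfold bad. rewrite HX. split; [lia|]. split; [|auto].
    assert (Ek : E ^ k = E * E * E ^ (18 + 2 * a)).
    { replace k with (1 + (1 + (18 + 2 * a))) by (unfold k; ring).
      rewrite (Z.pow_add_r E 1), (Z.pow_add_r E 1), Z.pow_1_r by (clear - Ha; lia). ring. }
    rewrite Ek. apply Z.mul_le_mono_nonneg_l; [clear - HE256; nia | exact Hqlo].
Qed.

(** * Primitive elements of the congruence subgroup *)

(** The congruence of [inL2q] for a single representative. Scalars prime to [2 q] do not affect it,
    so any representative of the class may be tested. *)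
Definition Lam (q : Z) (x : quat) : Prop := (2 * q | x1 x) /\ (2 * q | x2 x) /\ (2 * q | x3 x).

(** For words in [S], primitivity of the product is equivalent to being reduced ([reduced_prim],
    [prim_reduced]); these are the reduced words of length [g] whose product lies in
    [Lambda(2q)]. *)
Definition gw (p q : Z) (g : nat) (ws : list quat) : Prop :=
  Forall (inS p) ws /\ length ws = g /\ ~ qdvd p (wprod ws) /\ Lam q (wprod ws).

Lemma Lam_scale q c x : Lam q x -> Lam q (qscale c x).
Proof. intros (h1 & h2 & h3). split; [|split]; cbn [qscale Defs.x1 Defs.x2 Defs.x3]; apply Z.divide_mul_r; auto. Qed.

Lemma Lam_scale_inv q c x : rel_prime c (2 * q) -> Lam q (qscale c x) -> Lam q x.
Proof.
  intros Hr (h1 & h2 & h3). cbn [qscale Defs.x1 Defs.x2 Defs.x3] in *. apply rel_prime_sym in Hr.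
  split; [|split]; eapply Gauss; eauto.
Qed.

Lemma Lam_conj q x : Lam q x -> Lam q (qconj x).
Proof. intros (h1 & h2 & h3). split; [|split]; cbn [qconj Defs.x1 Defs.x2 Defs.x3]; apply Z.divide_opp_r; auto. Qed.

Lemma Lam_mul q x y : Lam q x -> Lam q y -> Lam q (qmul x y).
Proof.
  intros ([a Ha] & [b Hb] & [c Hc]) ([a' Ha'] & [b' Hb'] & [c' Hc']).
  destruct x as [s u v w], y as [s' u' v' w']; cbn [Defs.x0 Defs.x1 Defs.x2 Defs.x3] in *. subst.
  unfold qmul. split; [|split]; cbn [Defs.x0 Defs.x1 Defs.x2 Defs.x3].
  - exists (s * a' + a * s' + 2 * q * (b * c' - c * b')). ring.
  - exists (s * b' + b * s' + 2 * q * (c * a' - a * c')). ring.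
  - exists (s * c' + c * s' + 2 * q * (a * b' - b * a')). ring.
Qed.

(** The normality of [Lambda(2q)]: conjugation acts on the pure part by an integral matrix, [N(y)]
    times a rotation, whose rows give the witnesses. *)
Lemma Lam_sandwich q x y : Lam q x -> Lam q (qmul y (qmul x (qconj y))).
Proof.
  intros ([a Ha] & [b Hb] & [c Hc]). destruct x as [s u v w], y as [y0 y1 y2 y3]; cbn [Defs.x0 Defs.x1 Defs.x2 Defs.x3] in *. subst.
  unfold qmul, qconj. split; [|split]; cbn [Defs.x0 Defs.x1 Defs.x2 Defs.x3].
  - eexists. instantiate (1 := (y0*y0+y1*y1-y2*y2-y3*y3)*a + 2*(y1*y2-y0*y3)*b + 2*(y1*y3+y0*y2)*c). ring.
  - eexists. instantiate (1 := 2*(y1*y2+y0*y3)*a + (y0*y0-y1*y1+y2*y2-y3*y3)*b + 2*(y2*y3-y0*y1)*c). ring.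
  - eexists. instantiate (1 := 2*(y1*y3-y0*y2)*a + 2*(y2*y3+y0*y1)*b + (y0*y0-y1*y1-y2*y2+y3*y3)*c). ring.
Qed.

Lemma rel_prime_pow p n (k : nat) : rel_prime p n -> rel_prime (p ^ Z.of_nat k) n.
Proof.
  intro H. induction k as [|k IH].
  - rewrite Z.pow_0_r. apply rel_prime_1.
  - rewrite Nat2Z.inj_succ, Z.pow_succ_r by lia. apply rel_prime_mul; auto.
Qed.

Lemma rel_prime_2q p q : prime p -> prime q -> Z.odd p = true -> p <> q -> rel_prime p (2 * q).
Proof.
  intros Hp Hq Ho Hne. apply rel_prime_sym, rel_prime_mul; apply prime_distinct_rel; auto using prime_2.
  intro E; subst p; discriminate.
Qed.

(** Up to sign, the primitive elements of [Lambda(2q)] of norm [P^2] all have this form. *)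
Definition zlev (P m q : Z) (v : quat) : quat :=
  Quat (P - 2 * m * (q * q)) (2 * q * x1 v) (2 * q * x2 v) (2 * q * x3 v).

Lemma zlev_norm P m q v : R3 (level P m q) v -> qnorm (zlev P m q v) = P * P.
Proof.
  intros [Hv Hn]. unfold level in Hn. unfold qnorm in *. rewrite Hv in Hn.
  unfold zlev; cbn [Defs.x0 Defs.x1 Defs.x2 Defs.x3].
  transitivity (P * P - 4 * m * (q * q) * (P - m * (q * q)) + 4 * (q * q) * (0 * 0 + x1 v * x1 v + x2 v * x2 v + x3 v * x3 v)); [ring|].
  rewrite Hn. ring.
Qed.

Lemma zlev_odd1 P m q v : Z.odd P = true -> odd1 (zlev P m q v).
Proof.
  intro HP. unfold odd1, zlev; cbn [Defs.x0 Defs.x1 Defs.x2 Defs.x3]. split; [|split; [|split]].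
  - rewrite Z.odd_sub, HP, !Z.odd_mul. reflexivity.
  - exists (q * x1 v); ring.
  - exists (q * x2 v); ring.
  - exists (q * x3 v); ring.
Qed.

Lemma zlev_Lam P m q v : Lam q (zlev P m q v).
Proof. split; [|split]; cbn [zlev Defs.x1 Defs.x2 Defs.x3]; apply Z.divide_factor_l. Qed.

Lemma pow_odd p (h : nat) : Z.odd p = true -> Z.odd (p ^ Z.of_nat h) = true.
Proof. intro H. destruct h; [reflexivity|]. rewrite Z.odd_pow; auto. lia. Qed.

(** Modulo [q] the norm is [x0^2], and an odd power of [p] would make [p] a square. *)
Lemma norm_even q p x (g : nat) : prime p -> prime q -> p <> q -> (forall t, ~ (q | t * t - p)) ->
  Lam q x -> qnorm x = p ^ Z.of_nat g -> exists h : nat, g = (2 * h)%nat.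
Proof.
  intros Hp Hq Hne Hleg ([a Ha] & [b Hb] & [c Hc]) Hn.
  destruct (Nat.even g) eqn:Eg; [apply Nat.even_spec in Eg; exact Eg|]. exfalso.
  assert (Og : Nat.odd g = true) by (rewrite <- Nat.negb_even, Eg; auto). apply Nat.odd_spec in Og. destruct Og as [h Hh].
  set (P := p ^ Z.of_nat h). assert (HP : p ^ Z.of_nat g = p * (P * P)).
  { unfold P. rewrite <- Z.pow_add_r, <- Z.pow_succ_r by lia. f_equal; lia. }
  destruct (bezout_solve P q (x0 x)) as [t [d Ht]].
  { apply rel_prime_pow, prime_distinct_rel; auto. }
  apply (Hleg t). apply Gauss with (P * P).
  - assert (E : P * P * (t * t - p) = (P * t) * (P * t) - qnorm x) by (rewrite Hn, HP; ring).
    rewrite E. replace (P * t) with (x0 x + d * q) by lia. unfold qnorm. rewrite Ha, Hb, Hc.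
    exists (2 * x0 x * d + d * d * q - 4 * q * (a * a + b * b + c * c)). ring.
  - apply rel_prime_sym, rel_prime_mul; apply rel_prime_pow, prime_distinct_rel; auto.
Qed.

(** In [(P - x0)(P + x0) = 4 q^2 N] the factors add up to [2 P], so [q] divides at most one of them
    and [q^2] divides it; the sign [e] selects that factor. [m = 0] would make [x] the scalar [P] up
    to sign, which is divisible by [p]. *)
Lemma level_structure p q x (h : nat) : prime p -> prime q -> p <> q -> Z.odd p = true -> Z.odd q = true ->
  odd1 x -> ~ qdvd p x -> Lam q x -> qnorm x = p ^ Z.of_nat (2 * h) -> (1 <= h)%nat ->
  exists e m v, (e = 1 \/ e = -1) /\ 1 <= m /\ 0 < p ^ Z.of_nat h - m * (q * q) /\
    R3 (level (p ^ Z.of_nat h) m q) v /\ qscale e x = zlev (p ^ Z.of_nat h) m q v.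
Proof.
  intros Hp Hq Hne Op Oq Hx Hprim ([a Ha] & [b Hb] & [c Hc]) Hn Hh.
  pose proof (prime_ge_2 p Hp). pose proof (prime_ge_2 q Hq).
  set (P := p ^ Z.of_nat h). assert (HP0 : 0 < P) by (apply Z.pow_pos_nonneg; lia).
  assert (HP : qnorm x = P * P).
  { rewrite Hn. unfold P. rewrite <- Z.pow_add_r by lia. f_equal; lia. }
  assert (OP : Z.odd P = true) by (apply pow_odd; auto).
  assert (RP : rel_prime P q) by (apply rel_prime_pow, prime_distinct_rel; auto).
  assert (R2 : rel_prime 2 q) by (apply prime_distinct_rel; auto using prime_2; intros <-; discriminate).
  set (N := a * a + b * b + c * c).
  assert (E : (P - x0 x) * (P + x0 x) = 4 * (q * q) * N).
  { replace ((P - x0 x) * (P + x0 x)) with (qnorm x - x0 x * x0 x) by (rewrite HP; ring).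
    unfold qnorm, N. rewrite Ha, Hb, Hc. ring. }
  assert (Hsign : exists e, (e = 1 \/ e = -1) /\ (q * q | P - e * x0 x)).
  { assert (G : forall u w, u * w = 4 * (q * q) * N -> u + w = 2 * P -> ~ (q | w) -> (q * q | u)).
    { intros u w Euw Es Hw. assert (Hr : rel_prime q w) by (apply prime_rel_prime; auto).
      apply Gauss with w; [exists (4 * N); rewrite Z.mul_comm, Euw; ring|]. apply rel_prime_mul; auto. }
    destruct (classic (q | P + x0 x)) as [Hd|Hd].
    - exists (-1); split; auto. replace (P - -1 * x0 x) with (P + x0 x) by ring. apply (G _ (P - x0 x)).
      + rewrite <- E; ring.
      + ring.
      + intro Hd2. assert (Hd3 : (q | P * 2)) by (replace (P * 2) with ((P - x0 x) + (P + x0 x)) by ring; apply Z.divide_add_r; auto).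
        apply Gauss in Hd3; [|apply rel_prime_sym; auto]. apply prime_dvd_eq in Hd3; auto using prime_2. subst q; discriminate.
    - exists 1; split; auto. replace (P - 1 * x0 x) with (P - x0 x) by ring. apply (G _ (P + x0 x)); auto. ring. }
  destruct Hsign as (e & He & Hd).
  assert (He2 : e * e = 1) by (destruct He; subst; reflexivity).
  assert (Oe : Z.odd e = true) by (destruct He; subst; reflexivity).
  assert (Hd2 : (2 | P - e * x0 x)).
  { assert (Hev : Z.even (P - e * x0 x) = true)
      by (rewrite Z.even_sub, Z.even_mul, <- !Z.negb_odd, OP, Oe, (proj1 Hx); reflexivity).
    apply Z.even_spec in Hev. destruct Hev as [t Ht]. exists t; lia. }
  assert (Hd4 : (2 * (q * q) | P - e * x0 x)).
  { destruct Hd as [t Ht]. rewrite Ht in *. rewrite Z.mul_comm in Hd2. apply Gauss in Hd2.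
    - destruct Hd2 as [s ->]. exists s; ring.
    - apply rel_prime_sym, rel_prime_mul; apply rel_prime_sym; auto. }
  destruct Hd4 as [m Hm]. set (v := Quat 0 (e * a) (e * b) (e * c)).
  assert (Ex0 : e * x0 x = P - 2 * m * (q * q)) by lia.
  assert (Ev : qscale e x = zlev P m q v).
  { apply quat_eq; cbn [qscale zlev v Defs.x0 Defs.x1 Defs.x2 Defs.x3]; auto; [rewrite Ha | rewrite Hb | rewrite Hc]; ring. }
  assert (Qq : 0 < q * q) by (apply Z.mul_pos_pos; lia).
  assert (EN : N = m * (P - m * (q * q))).
  { assert (E4 : 4 * (q * q) * N = 4 * (q * q) * (m * (P - m * (q * q)))).
    { rewrite <- E. replace ((P - x0 x) * (P + x0 x)) with (P * P - (e * x0 x) * (e * x0 x)).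
      - rewrite Ex0. ring.
      - replace ((e * x0 x) * (e * x0 x)) with ((e * e) * (x0 x * x0 x)) by ring. rewrite He2. ring. }
    apply Z.mul_reg_l in E4; auto. lia. }
  assert (HN0 : 0 <= N) by (unfold N; clear; nia).
  assert (Hxb : x0 x * x0 x <= P * P) by (rewrite <- HP; unfold qnorm; clear; nia).
  assert (Hm0 : 0 <= m).
  { assert (e * x0 x <= P); [|nia]. assert ((e * x0 x) * (e * x0 x) <= P * P).
    { replace ((e * x0 x) * (e * x0 x)) with ((e * e) * (x0 x * x0 x)) by ring. rewrite He2. lia. }
    clear - H1 HP0. nia. }
  assert (Hm1 : m <> 0).
  { intros ->. rewrite Z.mul_0_l in EN. assert (a = 0 /\ b = 0 /\ c = 0) as (-> & -> & ->) by (unfold N in EN; clear - EN; nia).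
    apply Hprim. apply qdvd_comp. assert (Hpe : (p | e * x0 x)).
    { rewrite Ex0. rewrite Z.mul_0_r, Z.mul_0_l, Z.sub_0_r. unfold P. exists (p ^ Z.of_nat (h - 1)).
      rewrite Z.mul_comm, <- Z.pow_succ_r by lia. f_equal; lia. }
    rewrite Ha, Hb, Hc. split; [|split; [|split]]; try (rewrite Z.mul_0_l; apply Z.divide_0_r).
    replace (x0 x) with (e * (e * x0 x)) by (rewrite Z.mul_assoc, He2; ring). apply Z.divide_mul_r; auto. }
  exists e, m, v. split; [auto|split; [lia|split; [|split; [split; [reflexivity|]|auto]]]].
  - fold P. assert (P - m * (q * q) <> 0).
    { intro h0. assert (Hqp : (q | P)) by (exists (m * q); lia).
      assert (h1 : (q | 1)) by (apply Gauss with P; [rewrite Z.mul_1_r; auto | apply rel_prime_sym; auto]).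
      apply Z.divide_1_r_nonneg in h1; lia. }
    rewrite EN in HN0. assert (0 <= P - m * (q * q)); [|lia]. apply Z.mul_nonneg_cancel_l in HN0; lia.
  - fold P. unfold level. rewrite <- EN. unfold v, qnorm, N; cbn [Defs.x0 Defs.x1 Defs.x2 Defs.x3].
    transitivity ((e * e) * (a * a + b * b + c * c)); [ring | rewrite He2; ring].
Qed.

Lemma prim_part p : prime p -> Z.odd p = true -> forall (g : nat) x, odd1 x -> qnorm x = p ^ Z.of_nat g ->
  exists (c g' : nat) y, x = qscale (p ^ Z.of_nat c) y /\ odd1 y /\ ~ qdvd p y /\ qnorm y = p ^ Z.of_nat g' /\
    g = (2 * c + g')%nat.
Proof.
  intros Hp Op g. pose proof (prime_ge_2 p Hp). induction g as [g IH] using lt_wf_ind. intros x Hx Hn.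
  destruct (classic (qdvd p x)) as [[y Hy]|Hd].
  2:{ exists 0%nat, g, x. cbn [Z.of_nat]. rewrite Z.pow_0_r, qscale_1. auto. }
  assert (Hy1 : odd1 y) by (apply (odd1_scale_inv p); auto; rewrite <- Hy; auto).
  rewrite Hy, qnorm_scale in Hn.
  destruct g as [|[|g]].
  - rewrite Z.pow_0_r in Hn. exfalso. assert (h : (p | 1)) by (exists (p * qnorm y); lia).
    apply Z.divide_1_r_nonneg in h; lia.
  - cbn [Z.of_nat Pos.of_succ_nat] in Hn. rewrite Z.pow_1_r in Hn. exfalso.
    assert (p * qnorm y = 1) by nia. assert (h : (p | 1)) by (exists (qnorm y); lia).
    apply Z.divide_1_r_nonneg in h; lia.
  - assert (Ny : qnorm y = p ^ Z.of_nat g).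
    { rewrite !Nat2Z.inj_succ, !Z.pow_succ_r in Hn by lia. apply Z.mul_reg_l with (p * p); nia. }
    destruct (IH g ltac:(lia) y Hy1 Ny) as (c & g' & z & Ez & Oz & Dz & Nz & Eg).
    exists (S c), g', z. split; [|split; [auto|split; [auto|split; [auto|lia]]]].
    rewrite Hy, Ez, qscale_scale, Nat2Z.inj_succ, Z.pow_succ_r by lia. auto.
Qed.

Lemma word_eq p q g ws ws' e e' : prime p -> p mod 4 = 1 -> gw p q g ws -> gw p q g ws' ->
  (e = 1 \/ e = -1) -> (e' = 1 \/ e' = -1) -> qscale e (wprod ws) = qscale e' (wprod ws') -> ws = ws'.
Proof.
  intros Hp Hp4 (F & L & D & _) (F' & L' & _) He He' E. apply (word_unique p Hp Hp4 ws ws' e e'); auto. congruence.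
Qed.

(** There are two signs and at most [P / q^2] values of [m]. Each level [n] satisfies
    [n q^2 <= P^2], so it has at most [(2 P / q + 1) * F] representations by [r3_upper]. *)
Lemma gw_upper p q (j : nat) F : prime p -> p mod 4 = 1 -> prime q -> Z.odd q = true -> p <> q -> (1 <= j)%nat ->
  (forall n, n <= p ^ Z.of_nat j * p ^ Z.of_nat j -> atmost F (G2 n)) ->
  exists c, atmost c (gw p q (2 * j)) /\ c * (q * (q * q)) <= 6 * F * (p ^ Z.of_nat j * p ^ Z.of_nat j).
Proof.
  intros Hp Hp4 Hq Oq Hne Hj HF. pose proof (prime_ge_2 q Hq) as Hq2. pose proof (prime_ge_2 p Hp) as Hp2.
  set (P := p ^ Z.of_nat j) in *. assert (HP : 0 < P) by (apply Z.pow_pos_nonneg; lia).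
  assert (Qq : 0 < q * q) by (apply Z.mul_pos_pos; lia).
  assert (HF0 : 0 <= F) by (apply (atmost_nonneg F (G2 0)), HF; nia).
  set (I := list_prod [1; -1] (zr 1 (P / (q * q) + 1))).
  assert (HPq : 0 <= P / (q * q)) by (apply Z.div_pos; lia). assert (HPq2 : 0 <= P / q) by (apply Z.div_pos; lia).
  set (Q := fun em ws => gw p q (2 * j) ws /\ exists v, R3 (level P (snd em) q) v /\
    qscale (fst em) (wprod ws) = zlev P (snd em) q v).
  exists (zsum (fun _ => (2 * (P / q) + 1) * F) I). split.
  - apply (atmost_cover I _ Q).
    + intros ws Hws. assert (Hw := Hws). destruct Hw as (Fw & Lw & Dw & Mw).
      destruct (level_structure p q (wprod ws) j) as (e & m & v & He & Hm & Hpos & Hv & Hz); auto.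
      { apply prime1_odd; auto. } { apply (wprod_odd1 p); auto. } { rewrite (wprod_norm p), Lw by auto. auto. }
      exists (e, m). split; [|split; [auto|exists v; auto]].
      apply in_prod_iff. split; [cbn; destruct He; auto|]. apply in_zr. split; auto. fold P in Hpos.
      assert (m <= P / (q * q)) by (apply Z.div_le_lower_bound; lia). lia.
    + intros [e m] Hem. apply in_prod_iff in Hem. destruct Hem as [He Hm]. apply in_zr in Hm.
      assert (He' : e = 1 \/ e = -1) by (cbn in He; destruct He as [|[|[]]]; auto).
      assert (Hmq : m * (q * q) <= P).
      { assert (m <= P / (q * q)) by lia. pose proof (Z.mul_div_le P (q * q) Qq). nia. }
      set (n := level P m q). assert (Hn : 0 <= n) by (unfold n, level; apply Z.mul_nonneg_nonneg; lia).
      assert (Hn2 : n * (q * q) <= P * P).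
      { unfold n, level. replace (m * (P - m * (q * q)) * (q * q)) with (m * (q * q) * (P - m * (q * q))) by ring.
        apply Z.mul_le_mono_nonneg; nia. }
      assert (Hnn : n <= P * P) by nia.
      assert (Hs : Z.sqrt n <= P / q).
      { apply Z.div_le_lower_bound; [lia|]. rewrite Z.mul_comm. pose proof (Z.sqrt_spec n Hn). pose proof (Z.sqrt_nonneg n).
        apply Z.square_le_simpl_nonneg; [lia|]. apply Z.le_trans with (n * (q * q)); auto.
        replace (Z.sqrt n * q * (Z.sqrt n * q)) with (Z.sqrt n * Z.sqrt n * (q * q)) by ring. apply Z.mul_le_mono_nonneg_r; lia. }
      apply (atmost_le ((2 * Z.sqrt n + 1) * F) _ (Q (e, m))); [|apply Z.mul_le_mono_nonneg_r; lia | auto].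
      set (f := fun ws => let z := qscale e (wprod ws) in (x1 z / (2 * q), x2 z / (2 * q), x3 z / (2 * q))).
      assert (Hf : forall ws v, qscale e (wprod ws) = zlev P m q v -> f ws = (x1 v, x2 v, x3 v)).
      { intros ws v E. unfold f. rewrite E. cbn [zlev Defs.x1 Defs.x2 Defs.x3]. rewrite !(Z.mul_comm (2 * q)), !Z.div_mul by lia. auto. }
      apply (atmost_inj f _ _ (G3 n)).
      * apply r3_upper; auto. intros k Hk. apply HF. lia.
      * intros ws (_ & v & [Hv Nv] & E). cbn [fst snd] in *. rewrite (Hf _ _ E). unfold G3; cbn [fst snd]. fold n in Nv.
        rewrite <- Nv. unfold qnorm. rewrite Hv. ring.
      * intros ws ws' (G1 & v & [Hv Nv] & E) (G2' & v' & [Hv' Nv'] & E') Ef. cbn [fst snd] in *.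
        rewrite (Hf _ _ E), (Hf _ _ E') in Ef. injection Ef; intros. assert (v = v') by (apply quat_eq; congruence). subst v'.
        apply (word_eq p q (2 * j) ws ws' e e); auto. congruence.
  - rewrite zsum_const. unfold I. rewrite pair_list, zlen_zr by lia.
    change (zlen [1; -1]) with 2. replace (P / (q * q) + 1 - 1) with (P / (q * q)) by ring.
    destruct (Z.le_gt_cases (q * q) P) as [Hle|Hlt]; [|rewrite (Z.div_small P (q * q)), (Z.mul_0_r 2), Z.mul_0_r, Z.mul_0_l by lia; apply Z.mul_nonneg_nonneg; nia].
    pose proof (Z.mul_div_le P (q * q) Qq) as M1. pose proof (Z.mul_div_le P q ltac:(lia)) as M2.
    set (a := P / (q * q)) in *. set (b := P / q) in *. clearbody a b. clearbody P.
    assert (M3 : (2 * b + 1) * q <= 3 * P) by nia.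
    replace ((2 * b + 1) * F * (2 * a) * (q * (q * q))) with (2 * F * ((q * q * a) * ((2 * b + 1) * q))) by ring.
    replace (6 * F * (P * P)) with (2 * F * (P * (3 * P))) by ring. apply Z.mul_le_mono_nonneg_l; [lia|].
    apply Z.mul_le_mono_nonneg; nia.
Qed.

Lemma rel_prime_opp1 n : rel_prime (-1) n.
Proof. apply bezout_rel_prime. apply (Bezout_intro _ _ _ (-1) 0). ring. Qed.

(** [zlev] may be divisible by powers of [p], and removing them shortens the word. The word is not
    empty, because a positive level gives a nonzero pure part. *)
Lemma zlev_word p q (h : nat) m v : prime p -> p mod 4 = 1 -> prime q -> Z.odd q = true -> p <> q -> 1 <= m ->
  0 < p ^ Z.of_nat h - m * (q * q) -> R3 (level (p ^ Z.of_nat h) m q) v ->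
  exists (c g : nat) ws e, gw p q g ws /\ (e = 1 \/ e = -1) /\ (1 <= g)%nat /\ (2 * h = 2 * c + g)%nat /\
    zlev (p ^ Z.of_nat h) m q v = qscale (p ^ Z.of_nat c) (qscale e (wprod ws)).
Proof.
  intros Hp Hp4 Hq Oq Hne Hm Hpos Hv. pose proof (prime_ge_2 q Hq) as Hq2. pose proof (prime_ge_2 p Hp) as Hp2.
  assert (Op : Z.odd p = true) by (apply prime1_odd; auto).
  set (P := p ^ Z.of_nat h) in *. assert (Nz := zlev_norm P m q v Hv).
  assert (Nz2 : qnorm (zlev P m q v) = p ^ Z.of_nat (2 * h)).
  { rewrite Nz. unfold P. rewrite <- Z.pow_add_r by lia. f_equal; lia. }
  assert (Oz : odd1 (zlev P m q v)) by (apply zlev_odd1, pow_odd; auto).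
  destruct (prim_part p Hp Op (2 * h) _ Oz Nz2) as (c & g & y & Ey & Oy & Dy & Ny & Eg).
  assert (Ly : Lam q y).
  { apply (Lam_scale_inv q (p ^ Z.of_nat c)); [apply rel_prime_pow, rel_prime_2q; auto|]. rewrite <- Ey. apply zlev_Lam. }
  destruct (word_exists p Hp Hp4 g y Oy Ny Dy) as (ws & e & Lw & Fw & He & Ew).
  exists c, g, ws, e. split; [|split; [auto|split; [|split; [auto|congruence]]]].
  - split; [auto|split; [auto|split]].
    + intro h0. apply Dy. rewrite Ew. apply qdvd_scale_mono; auto.
    + apply (Lam_scale_inv q e); [|rewrite <- Ew; auto].
      destruct He as [-> | ->]; [apply rel_prime_1 | apply rel_prime_opp1].
  - destruct g as [|g]; [exfalso|lia]. rewrite Z.pow_0_r in Ny. destruct (odd1_norm1 y Oy Ny) as (e' & He' & Ey').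
    rewrite Ey' in Ey. assert (F1 := f_equal x1 Ey); assert (F2 := f_equal x2 Ey); assert (F3 := f_equal x3 Ey).
    cbn [zlev qscale q1 Defs.x1 Defs.x2 Defs.x3] in F1, F2, F3. rewrite !Z.mul_0_r in F1, F2, F3.
    destruct Hv as [V0 NV]. unfold qnorm in NV. assert (x1 v = 0) by nia. assert (x2 v = 0) by nia. assert (x3 v = 0) by nia.
    rewrite V0, H, H0, H1 in NV. unfold level in NV. nia.
Qed.

(** Minimality of [2 h] forbids any factor [p], so each [v] yields a word of full length. The sign
    in front of the word is determined: opposite signs would give [P = 2 m q^2], although [P] is
    odd. *)
Lemma gw_lower p q (h : nat) m b : prime p -> p mod 4 = 1 -> prime q -> Z.odd q = true -> p <> q -> 1 <= m ->
  0 < p ^ Z.of_nat h - m * (q * q) -> (forall g ws, (1 <= g < 2 * h)%nat -> ~ gw p q g ws) ->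
  atleast b (R3 (level (p ^ Z.of_nat h) m q)) -> atleast b (gw p q (2 * h)).
Proof.
  intros Hp Hp4 Hq Oq Hne Hm Hpos Hmin Hb. pose proof (prime_ge_2 q Hq) as Hq2.
  set (P := p ^ Z.of_nat h) in *. assert (OP : Z.odd P = true) by (apply pow_odd, prime1_odd; auto).
  set (f := fun v => epsilon (inhabits (@nil quat)) (fun ws => gw p q (2 * h) ws /\
     exists e, (e = 1 \/ e = -1) /\ zlev P m q v = qscale e (wprod ws))).
  assert (Hf : forall v, R3 (level P m q) v -> gw p q (2 * h) (f v) /\
     exists e, (e = 1 \/ e = -1) /\ zlev P m q v = qscale e (wprod (f v))).
  { intros v Hv. unfold f. apply epsilon_spec.
    destruct (zlev_word p q h m v) as (c & g & ws & e & G & He & Hg & Eg & Ez); auto.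
    assert (g = 2 * h)%nat.
    { destruct (Nat.eq_dec g (2 * h)); auto. exfalso. apply (Hmin g ws); auto. lia. }
    assert (c = 0)%nat by lia. subst g c. exists ws. split; auto. exists e; split; auto.
    cbn [Z.of_nat] in Ez. rewrite Z.pow_0_r, qscale_1 in Ez. auto. }
  apply (atleast_inj f b (R3 (level P m q))); auto.
  - intros v Hv. apply Hf; auto.
  - intros v v' Hv Hv' E. destruct (Hf v Hv) as (_ & e & He & Ez). destruct (Hf v' Hv') as (_ & e' & He' & Ez').
    rewrite <- E in Ez'. assert (Ee : e = e').
    { destruct (Z.eq_dec e e') as [|Hn]; auto. exfalso. assert (e = - e') by lia.
      assert (F : x0 (zlev P m q v) = - x0 (zlev P m q v')) by (rewrite Ez, Ez'; cbn [qscale Defs.x0]; rewrite H; ring).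
      cbn [zlev Defs.x0] in F. assert (P = 2 * (m * (q * q))) by lia. rewrite H0, Z.odd_mul in OP. discriminate. }
    assert (EE : zlev P m q v = zlev P m q v') by congruence.
    assert (F1 := f_equal x1 EE); assert (F2 := f_equal x2 EE); assert (F3 := f_equal x3 EE).
    cbn [zlev Defs.x1 Defs.x2 Defs.x3] in F1, F2, F3.
    destruct Hv as [V0 _], Hv' as [V0' _]. apply quat_eq; [congruence | | |]; nia.
Qed.

(** Taking [m = 4 m'], with [m' = 7] if [P = 1] and [m' = 3] if [P = 5] modulo 8, makes
    [m' (P - 4 m' q^2)] congruent to 3 modulo 8, hence a sum of three squares; [v] is twice the
    resulting vector. The constant [28 = 4 * 7] keeps this number positive. *)
Lemma gw_exists p q (h : nat) : prime p -> p mod 4 = 1 -> prime q -> Z.odd q = true -> p <> q ->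
  28 * (q * q) < p ^ Z.of_nat h -> exists g ws, (1 <= g <= 2 * h)%nat /\ gw p q g ws.
Proof.
  intros Hp Hp4 Hq Oq Hne Hbig. pose proof (prime_ge_2 q Hq) as Hq2. set (P := p ^ Z.of_nat h) in *.
  assert (P4 : P mod 4 = 1).
  { unfold P. clear Hbig P. induction h as [|h IH]; [reflexivity|].
    rewrite Nat2Z.inj_succ, Z.pow_succ_r, Z.mul_mod, IH, Hp4 by lia. reflexivity. }
  assert (Q8 : exists s, q * q = 8 * s + 1).
  { apply Z.odd_spec in Oq. destruct Oq as [u ->].
    assert (exists t, u * (u + 1) = 2 * t) as [t Ht].
    { destruct (Z.Even_or_Odd u) as [[t ->]|[t ->]]; [exists (t * (2 * t + 1)) | exists ((2 * t + 1) * (t + 1))]; ring. }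
    exists t. nia. }
  destruct Q8 as [s Hs].
  assert (H3 : exists m', (m' = 3 \/ m' = 7) /\ (m' * (P - 4 * m' * (q * q))) mod 8 = 3).
  { pose proof (Z_div_mod_eq_full P 8). pose proof (Z.mod_pos_bound P 8 ltac:(lia)).
    pose proof (Z_div_mod_eq_full P 4).
    assert (P mod 8 = 1 \/ P mod 8 = 5) as [E|E] by lia.
    - exists 7; split; auto. rewrite Hs. symmetry. apply (Z.mod_unique _ _ (7 * (P / 8) - 196 * s - 24)); [lia|]. lia.
    - exists 3; split; auto. rewrite Hs. symmetry. apply (Z.mod_unique _ _ (3 * (P / 8) - 36 * s - 3)); [lia|]. lia. }
  destruct H3 as (m' & Hm' & H8).
  assert (Hpos : 0 < P - 4 * m' * (q * q)) by (destruct Hm'; subst m'; lia).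
  destruct (sum3_mod8 (m' * (P - 4 * m' * (q * q)))) as (a & b & c & E); auto.
  { apply Z.mul_pos_pos; lia. }
  destruct (zlev_word p q h (4 * m') (Quat 0 (2 * a) (2 * b) (2 * c))) as (c0 & g & ws & e & G & _ & Hg & Eg & _); auto; try lia.
  - split; [reflexivity|]. unfold level, qnorm; cbn [Defs.x0 Defs.x1 Defs.x2 Defs.x3]. fold P.
    replace (4 * m' * (P - 4 * m' * (q * q))) with (4 * (m' * (P - 4 * m' * (q * q)))) by ring. rewrite E. ring.
  - exists g, ws. split; auto. lia.
Qed.

(** * The number of vertices *)

Lemma even_root_m1 p : prime p -> p mod 4 = 1 -> exists r, (p | 1 + (2 * r) * (2 * r)).
Proof.
  intros Hp Hp4. pose proof (prime_ge_2 p Hp). assert (Op := prime1_odd p Hp4).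
  destruct (jac_prime_square p (-1)) as [x [c Hx]]; auto.
  - apply rel_prime_opp1.
  - rewrite jac_m1 by (auto; lia). pose proof (Z_div_mod_eq_full p 4).
    replace ((p - 1) / 2) with (2 * (p / 4)).
    + unfold par. rewrite Z.odd_mul. reflexivity.
    + apply (Z.div_unique_exact (p - 1) 2 (2 * (p / 4))); lia.
  - destruct (Z.Even_or_Odd x) as [[r ->]|[r ->]].
    + exists r, c. lia.
    + apply Z.odd_spec in Op. destruct Op as [u Hu]. exists (r + u + 1).
      exists (c + 2 * (2 * r + 1) + p). rewrite Hu in *. nia.
Qed.

Lemma dvd_eq p a b : (p | a) -> b = a -> (p | b).
Proof. intros H ->; auto. Qed.

(** With [w = conj s], independence of the two coefficient pairs shows that [w (1 + r i)] and
    [w j (1 + r i) = w (1 - r i) j] vanish modulo [p]. Hence so does [2 w]. *)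
Lemma isotropic_line_separates p s c d c' d' r : prime p -> Z.odd p = true ->
  ~ (p | c * d' - c' * d) ->
  qdvd p (qmul (qconj s) (qmul (Quat c 0 d 0) (Quat 1 r 0 0))) ->
  qdvd p (qmul (qconj s) (qmul (Quat c' 0 d' 0) (Quat 1 r 0 0))) -> qdvd p s.
Proof.
  intros Hp Op Hd HA HB. rewrite <- (qconjK s). set (w := qconj s) in *. clearbody w. apply qdvd_conj.
  assert (RD : rel_prime p (c * d' - c' * d)) by (apply prime_rel_prime; auto).
  assert (R2 : rel_prime p 2) by (apply prime_distinct_rel; auto using prime_2; intros ->; discriminate).
  assert (L : forall a b, (p | c * a + d * b) -> (p | c' * a + d' * b) -> (p | a) /\ (p | b)).
  { intros a b h h'. split; apply Gauss with (c * d' - c' * d); auto.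
    - replace ((c * d' - c' * d) * a) with (d' * (c * a + d * b) - d * (c' * a + d' * b)) by ring.
      apply Z.divide_sub_r; apply Z.divide_mul_r; auto.
    - replace ((c * d' - c' * d) * b) with (c * (c' * a + d' * b) - c' * (c * a + d * b)) by ring.
      apply Z.divide_sub_r; apply Z.divide_mul_r; auto. }
  apply qdvd_comp in HA, HB. destruct w as [w0 w1 w2 w3]. unfold qmul in *. cbn [Defs.x0 Defs.x1 Defs.x2 Defs.x3] in *.
  destruct HA as (A0 & A1 & A2 & A3), HB as (B0 & B1 & B2 & B3).
  destruct (L (w0 - r * w1) (- w2 + r * w3)) as [P0 N0]; [eapply dvd_eq; [exact A0 | ring] | eapply dvd_eq; [exact B0 | ring] |].
  destruct (L (w1 + r * w0) (- w3 - r * w2)) as [P1 N1]; [eapply dvd_eq; [exact A1 | ring] | eapply dvd_eq; [exact B1 | ring] |].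
  destruct (L (w2 + r * w3) (w0 + r * w1)) as [P2 N2]; [eapply dvd_eq; [exact A2 | ring] | eapply dvd_eq; [exact B2 | ring] |].
  destruct (L (w3 - r * w2) (w1 - r * w0)) as [P3 N3]; [eapply dvd_eq; [exact A3 | ring] | eapply dvd_eq; [exact B3 | ring] |].
  apply qdvd_comp; cbn [Defs.x0 Defs.x1 Defs.x2 Defs.x3].
  split; [|split; [|split]]; apply Gauss with 2; auto.
  - eapply dvd_eq; [exact (Z.divide_add_r _ _ _ P0 N2) | ring].
  - eapply dvd_eq; [exact (Z.divide_add_r _ _ _ P1 N3) | ring].
  - eapply dvd_eq; [exact (Z.divide_sub_r _ _ _ P2 N0) | ring].
  - eapply dvd_eq; [exact (Z.divide_sub_r _ _ _ P3 N1) | ring].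
Qed.

(** The [p + 1] isotropic quaternions [(1 + 2tj)(1 + 2ri)] and [(p + 2j)(1 + 2ri)], where
    [(2r)^2 = -1] modulo [p], have distinct left factors of norm [p]. *)
Lemma S_atleast p : prime p -> p mod 4 = 1 -> atleast (p + 1) (inS p).
Proof.
  intros Hp Hp4. pose proof (prime_ge_2 p Hp). assert (Op := prime1_odd p Hp4).
  destruct (even_root_m1 p Hp Hp4) as [r Hr]. set (u := Quat 1 (2 * r) 0 0).
  set (y := fun t => if t =? p then Quat p 0 2 0 else Quat 1 0 (2 * t) 0).
  assert (N2 : ~ (p | 2)) by (intro h; apply prime_dvd_eq in h; auto using prime_2; subst p; discriminate).
  assert (N1 : ~ (p | 1)) by (intro h; apply Z.divide_1_r_nonneg in h; lia).
  assert (Hy : forall t, odd1 (qmul (y t) u) /\ (p | qnorm (qmul (y t) u)) /\ ~ qdvd p (qmul (y t) u)).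
  { intro t. split; [|split].
    - apply odd1_mul.
      + unfold y. destruct (t =? p).
        * split; [auto|]. split; [exists 0; reflexivity|]. split; [exists 1; reflexivity | exists 0; reflexivity].
        * split; [auto|]. split; [exists 0; reflexivity|]. split; [exists t; cbn [Defs.x2]; ring | exists 0; reflexivity].
      + split; [auto|]. split; [exists r; cbn [u Defs.x1]; ring|]. split; exists 0; reflexivity.
    - rewrite qnorm_mul. apply Z.divide_mul_r. eapply dvd_eq; [exact Hr|]. unfold qnorm, u; cbn [Defs.x0 Defs.x1 Defs.x2 Defs.x3]. ring.
    - intro h. apply qdvd_comp in h. unfold y in h. destruct (t =? p).
      + destruct h as (_ & _ & h & _). apply N2. eapply dvd_eq; [exact h|]. unfold qmul, u; cbn [Defs.x0 Defs.x1 Defs.x2 Defs.x3]. ring.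
      + destruct h as (h & _). apply N1. eapply dvd_eq; [exact h|]. unfold qmul, u; cbn [Defs.x0 Defs.x1 Defs.x2 Defs.x3]. ring. }
  set (f := fun t => epsilon (inhabits q1) (fun s => inS p s /\ qdvd p (qmul (qconj s) (qmul (y t) u)))).
  assert (Hf : forall t, inS p (f t) /\ qdvd p (qmul (qconj (f t)) (qmul (y t) u))).
  { intro t. unfold f. apply epsilon_spec. destruct (Hy t) as (H1 & H2 & H3).
    destruct (S_factor p _ Hp Hp4 H1 H2 H3) as (s & v & Hs & _ & E). exists s. split; auto.
    rewrite E, qmul_conj_l, (inS_norm _ _ Hs). apply qdvd_scale. }
  apply (atleast_inj f (p + 1) (fun t => In t (zr 0 (p + 1)))).
  - exists (zr 0 (p + 1)). split; [apply nodup_zr|]. split; [auto|]. rewrite zlen_zr; lia.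
  - intros t _. apply Hf.
  - intros t t' Ht Ht' E. apply in_zr in Ht, Ht'. destruct (Z.eq_dec t t') as [|Hne]; auto. exfalso.
    destruct (Hf t) as [Hs D1]. destruct (Hf t') as [_ D2]. rewrite <- E in D2.
    apply (S_not_qdvd p (f t) Hp Hs). unfold y in D1, D2.
    destruct (Z.eqb_spec t p) as [Et|Et], (Z.eqb_spec t' p) as [Et'|Et']; [lia | | |].
    + apply (isotropic_line_separates p (f t) p 2 1 (2 * t') (2 * r)); auto.
      intro h. apply N2. eapply dvd_eq; [exact (Z.divide_sub_r _ _ _ (Z.divide_factor_l p (2 * t')) h) | ring].
    + apply (isotropic_line_separates p (f t) 1 (2 * t) p 2 (2 * r)); auto.
      intro h. apply N2. eapply dvd_eq; [exact (Z.divide_add_r _ _ _ (Z.divide_factor_l p (2 * t)) h) | ring].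
    + apply (isotropic_line_separates p (f t) 1 (2 * t) 1 (2 * t') (2 * r)); auto.
      intro h. assert (h2 : (p | 2 * (t' - t))) by (eapply dvd_eq; [exact h | ring]).
      apply prime_mult in h2; auto. destruct h2 as [h2|[c Hc]]; auto. assert (c = 0) by nia. lia.
Qed.

(** * Counting reduced words *)

Lemma zsum_prod {A B} (f : A * B -> Z) l m : zsum f (list_prod l m) = zsum (fun x => zsum (fun y => f (x, y)) m) l.
Proof.
  induction l as [|x l IH]; cbn [list_prod zsum]; auto. rewrite zsum_app, zsum_map, IH. auto.
Qed.

Definition okcons (sw : quat * list quat) : Prop :=
  match snd sw with [] => True | t :: _ => t <> qconj (fst sw) end.

Fixpoint Bl (SL : list quat) (k : nat) : list (list quat) :=
  match k with
  | O => [[]]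
  | S k => map (fun sw => fst sw :: snd sw) (sel okcons (list_prod SL (Bl SL k)))
  end.

Lemma Bl_spec p SL k w : (forall s, In s SL -> inS p s) -> In w (Bl SL k) ->
  Forall (inS p) w /\ length w = k /\ reduced w.
Proof.
  intro HS. revert w. induction k as [|k IH]; intros w Hw; cbn [Bl] in Hw.
  - destruct Hw as [<-|[]]. cbn. auto.
  - apply in_map_iff in Hw. destruct Hw as ([s w'] & <- & Hw). apply in_sel in Hw. destruct Hw as [Hw Ho].
    apply in_prod_iff in Hw. destruct Hw as [Hs Hw]. destruct (IH w' Hw) as (F & L & R). cbn [fst snd].
    split; [constructor; auto|]. split; [cbn; lia|]. split; auto.
Qed.

Lemma Bl_nodup SL k : NoDup SL -> NoDup (Bl SL k).
Proof.
  intro HN. induction k as [|k IH]; cbn [Bl].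
  - constructor; [intros [] | constructor].
  - apply nodup_map_inj; [apply nodup_sel, nodup_prod; auto|].
    intros [s w] [s' w'] _ _ E. cbn [fst snd] in E. congruence.
Qed.

Lemma Bl_suffix SL k : forall x t, In (x ++ t) (Bl SL k) -> In t (Bl SL (length t)).
Proof.
  induction k as [|k IH]; intros x t H; cbn [Bl] in H.
  - destruct H as [H|[]]. symmetry in H. apply app_eq_nil in H. destruct H as [-> ->]. left; auto.
  - destruct x as [|s x].
    + assert (L : length t = S k).
      { clear - H. cbn [app] in H. assert (G : forall k w, In w (Bl SL k) -> length w = k).
        { induction k0 as [|k0 IH]; intros w Hw; cbn [Bl] in Hw; [destruct Hw as [<-|[]]; auto|].
          apply in_map_iff in Hw. destruct Hw as ([s w'] & <- & Hw). apply in_sel in Hw. destruct Hw as [Hw _].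
          apply in_prod_iff in Hw. cbn. f_equal. apply IH. tauto. }
        apply (G (S k)). exact H. }
      rewrite L. exact H.
    + apply in_map_iff in H. destruct H as ([s' w'] & E & Hw). cbn [fst snd app] in E. injection E; intros E2 _.
      apply in_sel in Hw. destruct Hw as [Hw _]. apply in_prod_iff in Hw. apply (IH x t). rewrite <- E2. tauto.
Qed.

(** Only one letter is forbidden in front of a given word, the conjugate of its first letter. *)
Lemma Bl_grow p SL k : NoDup SL -> p + 1 <= zlen SL -> p * zlen (Bl SL k) <= zlen (Bl SL (S k)).
Proof.
  intros HN HL. cbn [Bl]. rewrite zlen_map, <- cnt_sel. unfold cnt. rewrite zsum_prod, zsum_swap, <- zsum_const.
  apply zsum_le. intros w _.
  assert (H1 : zsum (fun s => 1 - b2z (okcons (s, w))) SL <= 1).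
  { destruct w as [|t w].
    - rewrite zsum_zero; [lia|]. intros s _. unfold okcons; cbn [snd]. rewrite b2z_true by auto. lia.
    - rewrite (zsum_ext _ (fun s => b2z (s = qconj t))).
      + apply (cnt_atmost (fun s => s = qconj t)); auto. apply atmost_1. intros x y [_ ?] [_ ?]; congruence.
      + intros s _. unfold okcons; cbn [fst snd]. destruct (classic (s = qconj t)) as [E|E].
        * rewrite (b2z_true (s = _)), b2z_false by (auto; rewrite E, qconjK; tauto). lia.
        * rewrite (b2z_false (s = _)), b2z_true by (auto; intros ->; apply E; rewrite qconjK; auto). lia. }
  rewrite zsum_sub, zsum_const in H1. lia.
Qed.

Lemma Bl_grow_pow p SL k (j : nat) : 0 <= p -> NoDup SL -> p + 1 <= zlen SL ->
  p ^ Z.of_nat j * zlen (Bl SL k) <= zlen (Bl SL (j + k)).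
Proof.
  intros Hp HN HL. induction j as [|j IH].
  - cbn [Z.of_nat]. rewrite Z.pow_0_r. cbn [plus]. lia.
  - rewrite Nat2Z.inj_succ, Z.pow_succ_r by lia. apply Z.le_trans with (p * zlen (Bl SL (j + k))); [|apply (Bl_grow p); auto].
    rewrite <- Z.mul_assoc. apply Z.mul_le_mono_nonneg_l; auto.
Qed.

(** * Cosets of the congruence subgroup and systems of representatives *)

Definition ceq (q : Z) (x y : quat) : Prop := Lam q (qmul (qconj y) x).

Lemma coset_eq_iff p q x y : rel_prime p (2 * q) -> (coset_eq p q x y <-> ceq q x y).
Proof.
  intro Hr. unfold coset_eq, ceq, inL2q. set (z := qmul (qconj y) x). split.
  - intros (w & (a & b & e & He & E) & Hw). apply (Lam_scale_inv q (e * p ^ Z.of_nat b)).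
    + apply rel_prime_mul; [destruct He as [-> | ->]; [apply rel_prime_1 | apply rel_prime_opp1] | apply rel_prime_pow; auto].
    + rewrite <- E. apply Lam_scale. exact Hw.
  - intro Hz. exists z. split; [|exact Hz]. exists 0%nat, 0%nat, 1. auto.
Qed.

Lemma ceq_refl q x : ceq q x x.
Proof.
  unfold ceq. destruct x as [a b c d]. unfold qmul, qconj.
  split; [|split]; cbn [Defs.x0 Defs.x1 Defs.x2 Defs.x3]; exists 0; ring.
Qed.

Lemma ceq_sym q x y : ceq q x y -> ceq q y x.
Proof. intro H. unfold ceq in *. apply Lam_conj in H. rewrite qconj_mul, qconjK in H. auto. Qed.

Lemma ceq_trans p q x y z : rel_prime p (2 * q) -> inL2 p y -> ceq q x y -> ceq q y z -> ceq q x z.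
Proof.
  intros Hr Hy H1 H2. unfold ceq in *. destruct Hy as (_ & _ & _ & _ & m & Nm).
  apply (Lam_scale_inv q (qnorm y)); [rewrite Nm; apply rel_prime_pow; auto|].
  replace (qscale (qnorm y) (qmul (qconj z) x)) with (qmul (qmul (qconj z) y) (qmul (qconj y) x)).
  - apply Lam_mul; auto.
  - rewrite <- qmulA, qmul_conj_r, qmul_scale_r. auto.
Qed.

Lemma ceq_mul_r q x y t : ceq q x y -> ceq q (qmul x t) (qmul y t).
Proof.
  unfold ceq. intro H. rewrite qconj_mul, <- qmulA. rewrite (qmulA (qconj y)). pose proof (Lam_sandwich q _ (qconj t) H) as L. rewrite qconjK in L. exact L.
Qed.

Definition indep {A} (R : A -> A -> Prop) (l : list A) : Prop :=
  NoDup l /\ forall x y, In x l -> In y l -> R x y -> x = y.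

(** A bound on lists of inequivalent elements provides a list that cannot be extended, and such a
    list meets every class. *)
Lemma max_reps {A} (P : A -> Prop) (R : A -> A -> Prop) (N : nat) :
  (forall x, P x -> R x x) -> (forall x y, R x y -> R y x) ->
  (forall l, indep R l -> (forall x, In x l -> P x) -> (length l <= N)%nat) ->
  exists l, indep R l /\ (forall x, In x l -> P x) /\ forall x, P x -> exists y, In y l /\ R x y.
Proof.
  intros Hr Hs HN.
  assert (G : forall n l, indep R l -> (forall x, In x l -> P x) -> (N - length l <= n)%nat ->
    exists l, indep R l /\ (forall x, In x l -> P x) /\ forall x, P x -> exists y, In y l /\ R x y).
  { induction n as [|n IH]; intros l Hl HP Hn;
      (destruct (classic (forall x, P x -> exists y, In y l /\ R x y)) as [H|H]; [exists l; auto|];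
       apply not_all_ex_not in H; destruct H as [x Hx]; apply imply_to_and in Hx; destruct Hx as [Px Hx];
       assert (Hl' : indep R (x :: l)) by (destruct Hl as [Nl Il]; split;
         [constructor; auto; intro h; apply Hx; exists x; auto |
          intros a b [<-|Ha] [<-|Hb] Hab; auto; exfalso; apply Hx; [exists b; auto | exists a; auto]]);
       assert (HP' : forall a, In a (x :: l) -> P a) by (intros a [<-|Ha]; auto);
       pose proof (HN _ Hl' HP') as HL; cbn [length] in HL).
    - exfalso; lia.
    - apply (IH (x :: l)); auto. cbn [length]. lia. }
  apply (G N []); [split; [constructor | intros x y []] | intros x [] | lia].
Qed.

Lemma indep_nth {A} (R : A -> A -> Prop) (l : list A) d : indep R l -> forall i j, (i < length l)%nat ->
  (j < length l)%nat -> i <> j -> ~ R (nth i l d) (nth j l d).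
Proof.
  intros [HN HI] i j Hi Hj Hne HR. apply Hne. apply (NoDup_nth l d); auto. apply HI; auto using nth_In.
Qed.

Lemma nth_indep_list {A} (R : A -> A -> Prop) (l : list A) d : (forall x, In x l -> R x x) ->
  (forall i j, (i < length l)%nat -> (j < length l)%nat -> i <> j -> ~ R (nth i l d) (nth j l d)) -> indep R l.
Proof.
  intros Hr H. split.
  - apply (NoDup_nth l d). intros i j Hi Hj E. destruct (Nat.eq_dec i j); auto. exfalso.
    apply (H i j); auto. rewrite <- E. apply Hr, nth_In; auto.
  - intros x y Hx Hy HR. destruct (In_nth _ _ d Hx) as (i & Hi & <-). destruct (In_nth _ _ d Hy) as (j & Hj & <-).
    destruct (Nat.eq_dec i j) as [->|Hn]; auto. exfalso. apply (H i j); auto.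
Qed.

(** Coordinates numbered cyclically, so that [i + 1], [i + 2], [i + 3] are the three others for each
    [i <= 3]. *)
Definition cmp (n : nat) (x : quat) : Z :=
  match n with O => x0 x | 1%nat => x1 x | 2%nat => x2 x | 3%nat => x3 x | 4%nat => x0 x | 5%nat => x1 x | _ => x2 x end.

(** [conj y * y] is a scalar, so if [x] is proportional to [y] modulo [q], then [conj y * x] has
    pure part 0 modulo [q]; the factor 2 comes from [odd1]. *)
Lemma proportional_ceq q x y c c' : prime q -> Z.odd q = true -> odd1 x -> odd1 y -> rel_prime c q -> rel_prime c' q ->
  (q | c * x0 x - c' * x0 y) -> (q | c * x1 x - c' * x1 y) -> (q | c * x2 x - c' * x2 y) -> (q | c * x3 x - c' * x3 y) ->
  ceq q x y.
Proof.
  intros Hq Oq Hx Hy Hc Hc' [a0 E0] [a1 E1] [a2 E2] [a3 E3]. unfold ceq.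
  assert (Ho := odd1_mul _ _ (odd1_conj _ Hy) Hx). destruct Ho as (_ & P1 & P2 & P3).
  assert (R2 : rel_prime q 2) by (apply prime_distinct_rel; auto using prime_2; intros ->; discriminate).
  assert (Rc : rel_prime q (c * c')) by (apply rel_prime_sym, rel_prime_mul; auto).
  assert (G : forall z, (2 | z) -> (q | c * c' * z) -> (2 * q | z)).
  { intros z [k ->] h. apply Gauss in h; auto. rewrite Z.mul_comm in h. apply Gauss in h; auto. destruct h as [t ->]. exists t; ring. }
  assert (F0 : c * x0 x = c' * x0 y + a0 * q) by lia. assert (F1 : c * x1 x = c' * x1 y + a1 * q) by lia.
  assert (F2 : c * x2 x = c' * x2 y + a2 * q) by lia. assert (F3 : c * x3 x = c' * x3 y + a3 * q) by lia.
  clear E0 E1 E2 E3 Hx Hy.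
  destruct x as [w0 w1 w2 w3], y as [v0 v1 v2 v3]; unfold qmul, qconj in *; cbn [Defs.x0 Defs.x1 Defs.x2 Defs.x3] in *.
  split; [|split]; cbn [Defs.x0 Defs.x1 Defs.x2 Defs.x3]; apply G; auto.
  - exists (c' * (v0 * a1 - v1 * a0 - v2 * a3 + v3 * a2)).
    transitivity (c' * (v0 * (c * w1) + - v1 * (c * w0) + - v2 * (c * w3) - - v3 * (c * w2))); [ring|]. rewrite F0, F1, F2, F3. ring.
  - exists (c' * (v0 * a2 + v1 * a3 - v2 * a0 - v3 * a1)).
    transitivity (c' * (v0 * (c * w2) - - v1 * (c * w3) + - v2 * (c * w0) + - v3 * (c * w1))); [ring|]. rewrite F0, F1, F2, F3. ring.
  - exists (c' * (v0 * a3 - v1 * a2 + v2 * a1 - v3 * a0)).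
    transitivity (c' * (v0 * (c * w3) + - v1 * (c * w2) - - v2 * (c * w1) + - v3 * (c * w0))); [ring|]. rewrite F0, F1, F2, F3. ring.
Qed.

(** By [proportional_ceq] a coset is determined by a point of projective 3-space modulo [q], covered
    by four affine charts of [q^3] points. Some coordinate is invertible since the norm is a power
    of [p]. *)
Lemma cosets_bound p q l : prime p -> prime q -> p <> q -> Z.odd q = true -> indep (ceq q) l ->
  (forall x, In x l -> inL2 p x) -> zlen l <= 4 * (q * (q * q)).
Proof.
  intros Hp Hq Hne Oq [NL IL] HL. pose proof (prime_ge_2 q Hq) as Hq2.
  set (inv := fun a => epsilon (inhabits 0) (fun c => (q | a * c - 1))).
  assert (Hinv : forall a, ~ (q | a) -> (q | a * inv a - 1)).
  { intros a Ha. unfold inv. apply epsilon_spec. apply (bezout_solve a q 1). apply rel_prime_sym, prime_rel_prime; auto. }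
  set (Q := fun i x => In x l /\ ~ (q | cmp i x)).
  pose proof (atmost_interval 0 q ltac:(lia)) as I1. rewrite Z.sub_0_r in I1.
  pose proof (atmost_prod q (q * q) _ _ I1 (atmost_prod q q _ _ I1 I1)) as I3. cbn beta in I3.
  assert (HQ : forall i, (i <= 3)%nat -> atmost (q * (q * q)) (Q i)).
  { intros i Hi.
    set (f := fun x => let c := inv (cmp i x) in ((c * cmp (i + 1) x) mod q, ((c * cmp (i + 2) x) mod q, (c * cmp (i + 3) x) mod q))).
    apply (atmost_inj f _ _ _ I3).
    - intros x _. unfold f; cbn [fst snd]. split; [|split]; apply Z.mod_pos_bound; lia.
    - intros x y [Hx Dx] [Hy Dy] E. apply IL; auto.
      assert (M : forall a b, a mod q = b mod q -> (q | a - b)).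
      { intros a b h. exists (a / q - b / q). pose proof (Z_div_mod_eq_full a q). pose proof (Z_div_mod_eq_full b q). rewrite h in *. lia. }
      unfold f in E. injection E as E1 E2 E3. apply M in E1, E2, E3.
      set (c := inv (cmp i x)) in *. set (c' := inv (cmp i y)) in *.
      pose proof (Hinv _ Dx) as Ix. pose proof (Hinv _ Dy) as Iy. fold c in Ix. fold c' in Iy.
      assert (Rc : rel_prime c q).
      { destruct Ix as [k Hk]. apply bezout_rel_prime, (Bezout_intro _ _ _ (cmp i x) (- k)). lia. }
      assert (Rc' : rel_prime c' q).
      { destruct Iy as [k Hk]. apply bezout_rel_prime, (Bezout_intro _ _ _ (cmp i y) (- k)). lia. }
      assert (E0 : (q | c * cmp i x - c' * cmp i y)).
      { eapply dvd_eq; [exact (Z.divide_sub_r _ _ _ Ix Iy) | ring]. }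
      assert (Ox := inL2_odd1 _ _ (HL x Hx)). assert (Oy := inL2_odd1 _ _ (HL y Hy)).
      apply (proportional_ceq q x y c c'); auto; destruct i as [|[|[|[|i]]]]; cbn [cmp plus] in *; auto; lia. }
  assert (Hall : atmost (zsum (fun _ => q * (q * q)) (seq 0 4)) (fun x => In x l)).
  { apply (atmost_cover (seq 0 4) _ Q).
    - intros x Hx. destruct (HL x Hx) as (_ & _ & _ & _ & m & Nm).
      apply NNPP. intro Hno.
      assert (D : forall i, In i (seq 0 4) -> (q | cmp i x)).
      { intros i Hi. apply NNPP. intro h. apply Hno. exists i. split; [auto|]. split; auto. }
      assert (Dn : (q | qnorm x)).
      { unfold qnorm. pose proof (D 0%nat ltac:(cbn; tauto)); pose proof (D 1%nat ltac:(cbn; tauto));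
          pose proof (D 2%nat ltac:(cbn; tauto)); pose proof (D 3%nat ltac:(cbn; tauto)). cbn [cmp] in *.
        repeat apply Z.divide_add_r; apply Z.divide_mul_l; auto. }
      rewrite Nm in Dn. apply prime_dvd_pow in Dn; auto; [|lia]. apply Hne. symmetry. apply prime_dvd_eq; auto.
    - intros i Hi. apply in_seq in Hi. apply HQ. lia. }
  rewrite zsum_const in Hall. change (zlen (seq 0 4)) with 4 in Hall. rewrite Z.mul_comm. apply Hall; auto.
Qed.

Lemma nverts_iff p q n : prime p -> prime q -> p <> q -> Z.odd p = true -> Z.odd q = true ->
  (lps_nverts p q n <-> exists l, length l = n /\ indep (ceq q) l /\ (forall x, In x l -> inL2 p x) /\
     forall x, inL2 p x -> exists y, In y l /\ ceq q x y).
Proof.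
  intros Hp Hq Hne Op Oq. assert (Hr := rel_prime_2q p q Hp Hq Op Hne). split.
  - intros (l & Hl & HL & HI & HC). exists l. split; [auto|]. split; [|split; [auto|]].
    + apply (nth_indep_list _ _ (Quat 0 0 0 0)); [intros; apply ceq_refl|]. rewrite Hl. intros i j Hi Hj Hij h.
      apply (HI i j Hi Hj Hij). apply coset_eq_iff; auto.
    + intros x Hx. destruct (HC x Hx) as (y & Hy & E). exists y. split; auto. apply coset_eq_iff in E; auto.
  - intros (l & Hl & HI & HL & HC). exists l. split; [auto|]. split; [auto|]. split.
    + intros i j Hi Hj Hij h. apply coset_eq_iff in h; auto. revert h. apply indep_nth; auto; lia.
    + intros x Hx. destruct (HC x Hx) as (y & Hy & E). exists y. split; auto. apply coset_eq_iff; auto.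
Qed.

Lemma nverts_exists p q : prime p -> prime q -> p <> q -> Z.odd p = true -> Z.odd q = true ->
  exists n, lps_nverts p q n /\ Z.of_nat n <= 4 * (q * (q * q)).
Proof.
  intros Hp Hq Hne Op Oq.
  destruct (max_reps (inL2 p) (ceq q) (Z.to_nat (4 * (q * (q * q))))) as (l & HI & HL & HC).
  - intros; apply ceq_refl.
  - intros; apply ceq_sym; auto.
  - intros l HI HL. pose proof (cosets_bound p q l Hp Hq Hne Oq HI HL). unfold zlen in H. lia.
  - exists (length l). split; [|apply (cosets_bound p q l); auto]. apply nverts_iff; auto. exists l. auto.
Qed.

(** * Pairs of congruent words and the lower bound on the number of cosets *)

Lemma common_suffix {A} (u v : list A) : length u = length v -> exists x y t, u = x ++ t /\ v = y ++ t /\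
  length x = length y /\ ((x = [] /\ y = []) \/ exists x' y' a b, x = x' ++ [a] /\ y = y' ++ [b] /\ a <> b).
Proof.
  revert v. induction u as [|a u IH] using rev_ind; intros v Hl.
  - exists [], [], []. destruct v; [|discriminate]. repeat split; auto.
  - destruct v as [|b v _] using rev_ind; [rewrite length_app in Hl; cbn in Hl; lia|].
    rewrite !length_app in Hl; cbn [length] in Hl. destruct (classic (a = b)) as [<-|Hne].
    + destruct (IH v ltac:(lia)) as (x & y & t & -> & -> & L & H). exists x, y, (t ++ [a]). rewrite !app_assoc. auto.
    + exists (u ++ [a]), (v ++ [b]), []. rewrite !app_nil_r, !length_app. cbn [length]. split; [auto|split; [auto|split; [lia|]]].
      right. exists u, v, a, b. auto.
Qed.

Definition crev (w : list quat) : list quat := map qconj (rev w).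

Lemma wprod_crev w : wprod (crev w) = qconj (wprod w).
Proof.
  induction w as [|s w IH]; [unfold crev; cbn; unfold q1, qconj; cbn; auto|].
  unfold crev in *. cbn [rev wprod]. rewrite map_app, wprod_app, IH, qconj_mul. cbn [map wprod]. rewrite qmul_1_r. auto.
Qed.

Lemma crev_S p w : Forall (inS p) w -> Forall (inS p) (crev w).
Proof.
  intro H. apply Forall_forall. intros s Hs. apply in_map_iff in Hs. destruct Hs as (t & <- & Ht).
  apply in_rev in Ht. apply inS_conj. rewrite Forall_forall in H. auto.
Qed.

Lemma reduced_junction u a c v : reduced (u ++ [a]) -> reduced (c :: v) -> c <> qconj a ->
  reduced ((u ++ [a]) ++ (c :: v)).
Proof.
  induction u as [|s u IH]; intros H1 H2 H3.
  - cbn [app] in *. split; auto.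
  - cbn [app] in *. destruct H1 as [H1 H1']. split; [destruct u; auto | apply IH; auto].
Qed.

Lemma crev_inj u v : crev u = crev v -> u = v.
Proof.
  intro E. unfold crev in E. rewrite <- (rev_involutive u), <- (rev_involutive v). f_equal.
  rewrite <- (map_id (rev u)), <- (map_id (rev v)).
  rewrite <- (map_ext (fun x => qconj (qconj x)) (fun x => x) qconjK (rev u)).
  rewrite <- (map_ext (fun x => qconj (qconj x)) (fun x => x) qconjK (rev v)).
  rewrite <- !(map_map qconj qconj). f_equal. auto.
Qed.

(** Conjugation by the product of the common suffix [t] leaves a congruence between the products of
    [x] and [y]. The word [x ++ crev y] is reduced at the junction because the last letters of [x]
    and [y] differ. *)
Lemma congruent_words p q u v : prime p -> p mod 4 = 1 -> rel_prime p (2 * q) -> Forall (inS p) u -> Forall (inS p) v ->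
  reduced u -> reduced v -> length u = length v -> ceq q (wprod u) (wprod v) ->
  exists x y t, u = x ++ t /\ v = y ++ t /\ length x = length y /\ gw p q (2 * length x) (x ++ crev y).
Proof.
  intros Hp Hp4 Hr Fu Fv Ru Rv Hl Hc. destruct (common_suffix u v Hl) as (x & y & t & -> & -> & L & H).
  exists x, y, t. split; [auto|split; [auto|split; [auto|]]].
  apply Forall_app in Fu, Fv. destruct Fu as [Fx Ft], Fv as [Fy _].
  pose proof (reduced_prim p _ Hp Hp4 (proj2 (Forall_app _ _ _) (conj Fx Ft)) Ru) as Pu.
  pose proof (reduced_prim p _ Hp Hp4 (proj2 (Forall_app _ _ _) (conj Fy Ft)) Rv) as Pv.
  rewrite wprod_app in Pu, Pv. apply prim_factor_l in Pu, Pv.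
  split; [apply Forall_app; split; auto; apply crev_S; auto|]. split; [|split].
  - rewrite length_app. unfold crev. rewrite length_map, length_rev. lia.
  - apply reduced_prim; auto; [apply Forall_app; split; auto; apply crev_S; auto|].
    destruct H as [[-> ->]|(x' & y' & a & b & -> & -> & Hab)]; [exact I|].
    assert (E : crev (y' ++ [b]) = qconj b :: crev y') by (unfold crev; rewrite rev_app_distr; auto).
    rewrite E. apply reduced_junction.
    + apply (prim_reduced p); auto.
    + rewrite <- E. apply (prim_reduced p); [apply crev_S; auto|]. rewrite wprod_crev. intro h. apply Pv.
      apply qdvd_conj in h. rewrite qconjK in h. auto.
    + intro h. apply Hab. rewrite <- (qconjK a), <- (qconjK b). congruence.
  - rewrite wprod_app, wprod_crev. rewrite !wprod_app in Hc. unfold ceq in Hc.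
    set (X := wprod x) in *. set (Y := wprod y) in *. set (T := wprod t) in *.
    assert (NT : qnorm T = p ^ Z.of_nat (length t)) by (apply wprod_norm; auto).
    assert (NY : qnorm Y = p ^ Z.of_nat (length y)) by (apply wprod_norm; auto).
    apply (Lam_sandwich q _ T) in Hc.
    assert (E1 : qmul T (qmul (qmul (qconj (qmul Y T)) (qmul X T)) (qconj T)) =
                 qscale (qnorm T * qnorm T) (qmul (qconj Y) X)).
    { rewrite qconj_mul, <- !qmulA, qmul_conj_r, (qmulA X T), <- qmulA, <- qscale_scale. f_equal.
      rewrite <- qmul_scale_r. f_equal. clear. qring. }
    rewrite E1 in Hc. apply Lam_scale_inv in Hc; [|rewrite NT; apply rel_prime_mul; apply rel_prime_pow; auto].
    apply (Lam_sandwich q _ Y) in Hc. rewrite <- !qmulA, qmul_conj_r in Hc.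
    apply Lam_scale_inv in Hc; auto. rewrite NY. apply rel_prime_pow; auto.
Qed.

Lemma cauchy_schwarz {A} (f : A -> Z) l : zsum f l * zsum f l <= zlen l * zsum (fun x => f x * f x) l.
Proof.
  set (T := zsum f l). set (n := zlen l). pose proof (zlen_nonneg l) as Hn0. fold n in Hn0.
  assert (H : 0 <= zsum (fun x => (n * f x - T) * (n * f x - T)) l) by (apply zsum_nonneg; intros; apply Z.square_nonneg).
  rewrite (zsum_ext _ (fun x => n * n * (f x * f x) - (2 * n * T) * f x + T * T)) in H by (intros; ring).
  rewrite zsum_add, zsum_sub, !zsum_scale, zsum_const in H. fold T n in H.
  destruct (Z.eq_dec n 0) as [E|E].
  - assert (l = []) by (unfold n, zlen in E; destruct l; [auto | cbn in E; lia]). unfold T. subst l. cbn [zsum]. lia.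
  - set (Q := zsum (fun x => f x * f x) l) in *.
    assert (H0 : 0 <= n * (n * Q - T * T)) by (replace (n * (n * Q - T * T)) with (n * n * Q - 2 * n * T * T + T * (T * n)) by ring; exact H).
    apply Z.mul_nonneg_cancel_l in H0; lia.
Qed.

(** Cauchy-Schwarz over the cosets, applied to the reduced words of length [k]: pairs of congruent
    words are counted by their common suffix and the word of [Lambda(2q)] that remains. *)
Lemma nverts_lower p q n F (k : nat) : prime p -> p mod 4 = 1 -> prime q -> Z.odd q = true -> p <> q ->
  lps_nverts p q n -> q * (q * q) <= p ^ Z.of_nat k ->
  (forall m, m <= p ^ Z.of_nat k * p ^ Z.of_nat k -> atmost F (G2 m)) ->
  q * (q * q) <= Z.of_nat n * (1 + 6 * F * Z.of_nat k).
Proof.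
  intros Hp Hp4 Hq Oq Hne Hnv Hk HF. pose proof (prime_ge_2 p Hp) as Hp2. pose proof (prime_ge_2 q Hq) as Hq2.
  assert (Op := prime1_odd p Hp4). assert (Hr := rel_prime_2q p q Hp Hq Op Hne).
  apply nverts_iff in Hnv; auto. destruct Hnv as (l & Hl & [NL IL] & HL & HC).
  destruct (S_atleast p Hp Hp4) as (SL & NS & HS & LS).
  set (B := Bl SL k). assert (NB : NoDup B) by (apply Bl_nodup; auto).
  assert (HB : forall w, In w B -> Forall (inS p) w /\ length w = k /\ reduced w) by (intros w Hw; apply (Bl_spec p SL); auto).
  assert (HB2 : forall w, In w B -> inL2 p (wprod w)).
  { intros w Hw. destruct (HB w Hw) as (Fw & Lw & _). apply (inL2_intro p _ (length w)); [apply (wprod_odd1 p); auto | apply wprod_norm; auto]. }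
  set (Q3 := q * (q * q)) in *. assert (HQ3 : 0 < Q3) by (unfold Q3; nia).
  assert (HF0 : 0 <= F) by (apply (atmost_nonneg F (G2 0)), HF; nia).
  set (c := fun y => cnt (fun w => ceq q (wprod w) y) B).
  assert (Hsum : zlen B <= zsum c l).
  { unfold c, cnt. rewrite zsum_swap. rewrite <- (Z.mul_1_l (zlen B)), <- zsum_const. apply zsum_le. intros w Hw.
    destruct (HC _ (HB2 w Hw)) as (y & Hy & E). rewrite <- (b2z_true _ E) at 1.
    apply (zsum_term (fun y => b2z (ceq q (wprod w) y))); auto. intros; apply b2z_bound. }
  set (pairs := sel (fun ww => ceq q (wprod (fst ww)) (wprod (snd ww))) (list_prod B B)).
  assert (Hsq : zsum (fun y => c y * c y) l <= zlen pairs).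
  { unfold pairs. rewrite <- cnt_sel. unfold cnt. rewrite zsum_prod.
    rewrite (zsum_ext _ (fun y => zsum (fun w => zsum (fun w' => b2z (ceq q (wprod w) y) * b2z (ceq q (wprod w') y)) B) B)).
    2:{ intros y _. unfold c, cnt. rewrite <- zsum_scale. apply zsum_ext. intros w _. rewrite zsum_scale. ring. }
    rewrite zsum_swap. apply zsum_le. intros w Hw. rewrite zsum_swap. apply zsum_le. intros w' Hw'. cbn [fst snd].
    destruct (classic (ceq q (wprod w) (wprod w'))) as [E|E].
    - rewrite (b2z_true _ E). apply Z.le_trans with (cnt (fun y => ceq q (wprod w) y) l).
      + apply zsum_le. intros y _. pose proof (b2z_bound (ceq q (wprod w) y)). pose proof (b2z_bound (ceq q (wprod w') y)). nia.
      + apply cnt_atmost; auto. apply atmost_1. intros y y' [Hy Ey] [Hy' Ey']. apply IL; auto.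
        apply (ceq_trans p q y (wprod w) y'); auto. apply ceq_sym; auto.
    - rewrite b2z_false by auto. rewrite zsum_zero; [lia|]. intros y Hy.
      destruct (classic (ceq q (wprod w) y)) as [E1|E1]; [|rewrite b2z_false by auto; lia].
      destruct (classic (ceq q (wprod w') y)) as [E2|E2]; [|rewrite (b2z_false _ E2); lia].
      exfalso. apply E. apply (ceq_trans p q _ y); auto. apply ceq_sym; auto. }
  assert (HG : forall j : nat, exists g, (1 <= j <= k)%nat -> atmost g (gw p q (2 * j)) /\
     g * Q3 <= 6 * F * (p ^ Z.of_nat j * p ^ Z.of_nat j)).
  { intro j. destruct (Nat.le_gt_cases 1 j) as [H1|H1]; [|exists 0; lia].
    destruct (Nat.le_gt_cases j k) as [H2|H2]; [|exists 0; lia].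
    destruct (gw_upper p q j F Hp Hp4 Hq Oq Hne H1) as (g & Hg1 & Hg2); [|exists g; auto].
    intros m Hm. apply HF. apply (Z.le_trans _ _ _ Hm).
    assert (p ^ Z.of_nat j <= p ^ Z.of_nat k) by (apply Z.pow_le_mono_r; lia).
    assert (0 < p ^ Z.of_nat j) by (apply Z.pow_pos_nonneg; lia). apply Z.mul_le_mono_nonneg; lia. }
  apply choice in HG. destruct HG as [g Hg].
  (* For [j = 0] the remaining word is empty: these are the pairs of equal words. *)
  set (G := fun j => match j with O => 1 | S _ => g j end).
  assert (HGat : forall j, (j <= k)%nat -> atmost (G j) (gw p q (2 * j))).
  { intros [|j] Hj; [|apply Hg; lia]. apply atmost_1. intros x y (_ & Lx & _) (_ & Ly & _).
    destruct x; [|discriminate]. destruct y; [auto|discriminate]. }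
  assert (Hpairs : zlen pairs <= zsum (fun j => zlen (Bl SL (k - j)) * G j) (seq 0 (S k))).
  { set (Q := fun j ww => exists x y t, fst ww = x ++ t /\ snd ww = y ++ t /\ length x = j /\ length y = j /\
      In t (Bl SL (k - j)) /\ gw p q (2 * j) (x ++ crev y)).
    assert (Hat : atmost (zsum (fun j => zlen (Bl SL (k - j)) * G j) (seq 0 (S k))) (fun ww => In ww pairs)).
    { apply (atmost_cover (seq 0 (S k)) _ Q).
      - intros [u v] Huv. apply in_sel in Huv. destruct Huv as [Huv E]. apply in_prod_iff in Huv. destruct Huv as [Hu Hv].
        cbn [fst snd] in E. destruct (HB u Hu) as (Fu & Lu & Ru). destruct (HB v Hv) as (Fv & Lv & Rv).
        destruct (congruent_words p q u v) as (x & y & t & Eu & Ev & L & W); auto; [lia|].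
        assert (Lt : (length x + length t = k)%nat) by (rewrite <- length_app, <- Eu; auto).
        exists (length x). split; [apply in_seq; lia|]. exists x, y, t. cbn [fst snd].
        split; [auto|split; [auto|split; [auto|split; [auto|split; [|auto]]]]].
        replace (k - length x)%nat with (length t) by lia. apply (Bl_suffix SL k x). rewrite <- Eu. exact Hu.
      - intros j Hj. apply in_seq in Hj.
        pose proof (atmost_prod _ _ _ _ (atmost_list (Bl SL (k - j)) (fun t => In t (Bl SL (k - j))) (fun t h => h)) (HGat j ltac:(lia))) as HP.
        assert (K : forall (a b : list quat), length a = j -> skipn j (a ++ b) = b /\ firstn j (a ++ b) = a).
        { intros a b <-. rewrite skipn_app, firstn_app, skipn_all, firstn_all, Nat.sub_diag, skipn_O, firstn_O, app_nil_r. auto. }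
        apply (atmost_inj (fun ww => (skipn j (fst ww), firstn j (fst ww) ++ crev (firstn j (snd ww)))) _ _ _ HP).
        + intros [u v] (x & y & t & Eu & Ev & Lx & Ly & Ht & W). cbn [fst snd] in *. subst u v.
          rewrite (proj1 (K _ _ Lx)), (proj2 (K _ _ Lx)), (proj2 (K _ _ Ly)). auto.
        + intros [u v] [u' v'] (x & y & t & Eu & Ev & Lx & Ly & _) (x' & y' & t' & Eu' & Ev' & Lx' & Ly' & _) E.
          cbn [fst snd] in *. injection E as E1 E2.
          subst u v u' v'. rewrite !(proj1 (K _ _ Lx)), !(proj1 (K _ _ Lx')) in E1.
          rewrite (proj2 (K _ _ Lx)), (proj2 (K _ _ Lx')), (proj2 (K _ _ Ly)), (proj2 (K _ _ Ly')) in E2.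
          assert (Ex : x = x').
          { rewrite <- (proj2 (K x (crev y) Lx)), E2. apply (K x' _ Lx'). }
          subst x'. apply app_inv_head, crev_inj in E2. congruence. }
    apply Hat; [apply nodup_sel, nodup_prod; auto | auto]. }
  assert (Hgrow : forall j, (j <= k)%nat -> p ^ Z.of_nat j * zlen (Bl SL (k - j)) <= zlen B).
  { intros j Hj. pose proof (Bl_grow_pow p SL (k - j) j ltac:(lia) NS LS) as HGr.
    replace (j + (k - j))%nat with k in HGr by lia. exact HGr. }
  assert (HBk : p ^ Z.of_nat k <= zlen B).
  { pose proof (Hgrow k (le_n k)) as h. rewrite Nat.sub_diag in h. cbn [Bl] in h. change (zlen [[]]) with 1 in h. lia. }
  (* There are at most [zlen B / p^j] suffixes, while [G j * Q3 <= 6 F p^(2 j)] for [j >= 1]; each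
     such [j] contributes at most [6 F p^k * zlen B]. *)
  assert (Hterm : zsum (fun j => Q3 * (zlen (Bl SL (k - j)) * G j)) (seq 0 (S k)) <= zlen B * (Q3 + 6 * F * Z.of_nat k * p ^ Z.of_nat k)).
  { cbn [seq zsum G]. rewrite Nat.sub_0_r. fold B.
    assert (H1 : zsum (fun j => Q3 * (zlen (Bl SL (k - j)) * G j)) (seq 1 k) <= (6 * F * p ^ Z.of_nat k * zlen B) * zlen (seq 1 k)).
    { apply zsum_bound. intros j Hj. apply in_seq in Hj. destruct j as [|j]; [lia|].
      destruct (Hg (S j) ltac:(lia)) as [_ Hg2]. specialize (Hgrow (S j) ltac:(lia)). unfold G.
      assert (Pj : 0 < p ^ Z.of_nat (S j)) by (apply Z.pow_pos_nonneg; lia).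
      assert (Pjk : p ^ Z.of_nat (S j) <= p ^ Z.of_nat k) by (apply Z.pow_le_mono_r; lia).
      pose proof (zlen_nonneg (Bl SL (k - S j))) as Hb. set (b := zlen (Bl SL (k - S j))) in *.
      set (P := p ^ Z.of_nat (S j)) in *.
      apply Z.le_trans with (b * (6 * F * (P * P))).
      - replace (Q3 * (b * g (S j))) with (b * (g (S j) * Q3)) by ring. apply Z.mul_le_mono_nonneg_l; auto.
      - replace (b * (6 * F * (P * P))) with (6 * F * (P * (P * b))) by ring.
        replace (6 * F * p ^ Z.of_nat k * zlen B) with (6 * F * (p ^ Z.of_nat k * zlen B)) by ring.
        apply Z.mul_le_mono_nonneg_l; [lia|]. apply Z.mul_le_mono_nonneg; lia. }
    assert (Hz : zlen (seq 1 k) = Z.of_nat k) by (unfold zlen; rewrite length_seq; auto). rewrite Hz in H1. lia. }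
  rewrite zsum_scale in Hterm.
  pose proof (cauchy_schwarz c l) as CS. unfold zlen at 1 in CS. rewrite Hl in CS.
  set (N := Z.of_nat n) in *. assert (HN0 : 0 <= N) by lia. set (b := zlen B) in *. set (P := p ^ Z.of_nat k) in *.
  assert (HP0 : 0 < P) by lia. set (kk := Z.of_nat k) in *. assert (Hkk : 0 <= kk) by lia.
  assert (H1 : b * b <= N * zlen pairs).
  { apply Z.le_trans with (zsum c l * zsum c l); [apply Z.mul_le_mono_nonneg; lia|].
    apply (Z.le_trans _ _ _ CS). apply Z.mul_le_mono_nonneg_l; auto. }
  assert (H2 : Q3 * zlen pairs <= b * (Q3 + 6 * F * kk * P)).
  { apply Z.le_trans with (2 := Hterm). apply Z.mul_le_mono_nonneg_l; lia. }
  assert (H3 : Q3 * (b * b) <= N * (b * (Q3 + 6 * F * kk * P))).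
  { apply Z.le_trans with (N * (Q3 * zlen pairs)).
    - replace (N * (Q3 * zlen pairs)) with (Q3 * (N * zlen pairs)) by ring. apply Z.mul_le_mono_nonneg_l; lia.
    - apply Z.mul_le_mono_nonneg_l; auto. }
  assert (Hb0 : 0 < b) by lia.
  assert (H4 : Q3 * b <= N * (Q3 + 6 * F * kk * P)).
  { apply Z.mul_le_mono_pos_l with b; auto. lia. }
  assert (H5 : Q3 * P <= N * (P + 6 * F * kk * P)).
  { apply Z.le_trans with (Q3 * b); [apply Z.mul_le_mono_nonneg_l; lia|]. apply (Z.le_trans _ _ _ H4).
    apply Z.mul_le_mono_nonneg_l; lia. }
  apply Z.mul_le_mono_pos_r with P; auto. apply (Z.le_trans _ _ _ H5). apply Z.eq_le_incl. ring.
Qed.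

(** * Closed walks *)

Lemma vnth_period w i k : vnth w (i + k * length w) = vnth w i.
Proof. unfold vnth. rewrite Nat.Div0.mod_add. auto. Qed.

Lemma vnth_mod w i : vnth w (Nat.modulo i (length w)) = vnth w i.
Proof. unfold vnth. rewrite Nat.Div0.mod_mod. auto. Qed.

Lemma vnth_mod_S w i k : vnth w (k + Nat.modulo i (length w)) = vnth w (k + i).
Proof. unfold vnth. rewrite Nat.Div0.add_mod_idemp_r. auto. Qed.

Lemma vnth_small w i : (i < length w)%nat -> vnth w i = nth i w (Quat 0 0 0 0).
Proof. intro H. unfold vnth. rewrite Nat.mod_small; auto. Qed.

Lemma vnth_in w i : w <> [] -> In (vnth w i) w.
Proof.
  intro H. apply nth_In, Nat.mod_upper_bound. destruct w; [congruence | discriminate].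
Qed.

Fixpoint walk (x : quat) (s : nat -> quat) (i : nat) : quat :=
  match i with O => x | S i => qmul (walk x s i) (s i) end.

Lemma walk_shift x s i : walk x s (S i) = walk (qmul x (s 0%nat)) (fun n => s (S n)) i.
Proof. revert x. induction i as [|i IH]; intro x; [reflexivity|]. cbn [walk] in *. rewrite IH. auto. Qed.

Lemma walk_wprod ws : forall x s, (forall i, (i < length ws)%nat -> s i = nth i ws (Quat 0 0 0 0)) ->
  walk x s (length ws) = qmul x (wprod ws).
Proof.
  induction ws as [|a ws IH]; intros x s Hs; cbn [length wprod]; [rewrite qmul_1_r; auto|].
  rewrite walk_shift, IH.
  - rewrite (Hs 0%nat) by (cbn; lia). cbn [nth]. rewrite qmulA. auto.
  - intros i Hi. rewrite Hs by (cbn; lia). auto.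
Qed.

Lemma walk_vnth x ws : walk x (vnth ws) (length ws) = qmul x (wprod ws).
Proof. apply walk_wprod. intros; apply vnth_small; auto. Qed.

Lemma inL2_mul p x y : inL2 p x -> inL2 p y -> inL2 p (qmul x y).
Proof.
  intros Hx Hy. pose proof (inL2_odd1 _ _ Hx). pose proof (inL2_odd1 _ _ Hy).
  destruct Hx as (_ & _ & _ & _ & m & Nx), Hy as (_ & _ & _ & _ & n & Ny).
  apply (inL2_intro p _ (m + n)); [apply odd1_mul; auto|]. rewrite qnorm_mul, Nx, Ny, Nat2Z.inj_add, Z.pow_add_r by lia. auto.
Qed.

Lemma walk_inL2 p x s i : inL2 p x -> (forall j, inS p (s j)) -> inL2 p (walk x s i).
Proof.
  intros Hx Hs. induction i as [|i IH]; cbn [walk]; auto. apply inL2_mul; auto. apply Hs.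
Qed.

Lemma walk_ceq q x y s i : ceq q x y -> ceq q (walk x s i) (walk y s i).
Proof. intro H. induction i as [|i IH]; cbn [walk]; auto. apply ceq_mul_r; auto. Qed.

Lemma ceq_scale q c x : ceq q (qscale c x) x.
Proof.
  unfold ceq. rewrite qmul_scale_r. apply Lam_scale. apply (ceq_refl q x).
Qed.

Lemma ceq_mul_Lam q x z : Lam q z -> ceq q (qmul x z) x.
Proof. intro H. unfold ceq. rewrite qmul_conj_l. apply Lam_scale; auto. Qed.

Lemma ceq_mul_Lam_inv p q x z : rel_prime p (2 * q) -> inL2 p x -> ceq q (qmul x z) x -> Lam q z.
Proof.
  intros Hr (_ & _ & _ & _ & m & Nx) H. unfold ceq in H. rewrite qmul_conj_l, Nx in H.
  apply Lam_scale_inv in H; auto. apply rel_prime_pow; auto.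
Qed.

Lemma ceq_mul_both p q x s t : rel_prime p (2 * q) -> inL2 p x -> ceq q (qmul x s) (qmul x t) -> Lam q (qmul (qconj t) s).
Proof.
  intros Hr (_ & _ & _ & _ & m & Nx) H. unfold ceq in H. rewrite qconj_mul, <- qmulA, qmul_conj_l, qmul_scale_r, Nx in H.
  apply Lam_scale_inv in H; auto. apply rel_prime_pow; auto.
Qed.

Lemma walk_period q x ws i : Lam q (wprod ws) -> ceq q (walk x (vnth ws) (i + length ws)) (walk x (vnth ws) i).
Proof.
  intro H. induction i as [|i IH]; cbn [plus walk].
  - rewrite walk_vnth. apply ceq_mul_Lam; auto.
  - rewrite <- (vnth_period ws i 1), Nat.mul_1_l. apply ceq_mul_r; auto.
Qed.

Definition mkwalk (x : quat) (ws : list quat) : list quat := map (walk x (vnth ws)) (seq 0 (length ws)).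

Lemma mkwalk_length x ws : length (mkwalk x ws) = length ws.
Proof. unfold mkwalk. rewrite length_map, length_seq. auto. Qed.

Lemma mkwalk_ceq p q x ws i : rel_prime p (2 * q) -> inL2 p x -> Forall (inS p) ws -> ws <> [] -> Lam q (wprod ws) ->
  ceq q (vnth (mkwalk x ws) i) (walk x (vnth ws) i).
Proof.
  intros Hr Hx Hs Hne HL. unfold vnth at 1. rewrite mkwalk_length.
  assert (Hn : length ws <> 0%nat) by (destruct ws; [congruence | discriminate]).
  pose proof (Nat.mod_upper_bound i _ Hn) as Hm. unfold mkwalk.
  rewrite nth_indep with (d' := walk x (vnth ws) 0) by (rewrite length_map, length_seq; auto).
  rewrite map_nth, seq_nth by auto. cbn [plus].
  rewrite (Nat.div_mod i (length ws) Hn) at 2. rewrite Nat.add_comm, Nat.mul_comm.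
  set (j := Nat.modulo i (length ws)) in *. generalize (Nat.div i (length ws)) as k. induction k as [|k IH].
  - cbn [Nat.mul]. rewrite Nat.add_0_r. apply ceq_refl.
  - replace (j + S k * length ws)%nat with (j + k * length ws + length ws)%nat by lia.
    apply (ceq_trans p q _ (walk x (vnth ws) (j + k * length ws))); auto.
    + apply walk_inL2; auto. intro n. rewrite Forall_forall in Hs. apply Hs, vnth_in; auto.
    + apply ceq_sym, walk_period; auto.
Qed.

Lemma reduced_nth ws : (forall i, (S i < length ws)%nat -> vnth ws (S i) <> qconj (vnth ws i)) -> reduced ws.
Proof.
  intro H. assert (H' : forall i, (S i < length ws)%nat -> nth (S i) ws (Quat 0 0 0 0) <> qconj (nth i ws (Quat 0 0 0 0))).
  { intros i Hi. specialize (H i Hi). rewrite !vnth_small in H by lia. auto. }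
  clear H. induction ws as [|a ws IH]; cbn [reduced]; auto. split.
  - destruct ws as [|b ws]; auto. apply (H' 0%nat). cbn; lia.
  - apply IH. intros i Hi. apply (H' (S i)). cbn; lia.
Qed.

Lemma nth_reduced ws i : reduced ws -> (S i < length ws)%nat -> vnth ws (S i) <> qconj (vnth ws i).
Proof.
  intros Hr Hi. rewrite !vnth_small by lia. revert ws Hr Hi. induction i as [|i IH]; intros ws Hr Hi.
  - destruct ws as [|a [|b ws]]; cbn in *; try lia. tauto.
  - destruct ws as [|a ws]; cbn [length] in Hi; [lia|]. apply (IH ws); [apply Hr | lia].
Qed.

(** Letters are chosen once for each residue of the index modulo the length, so that they are
    periodic like the vertices. Absence of backtracking makes the word reduced, and closure puts its
    product in [Lambda(2q)]. *)
Lemma walk_letters p q w : prime p -> p mod 4 = 1 -> rel_prime p (2 * q) -> nb_closed_walk p q w ->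
  exists ws, gw p q (length w) ws /\ forall i, ceq q (vnth w i) (walk (vnth w 0) (vnth ws) i).
Proof.
  intros Hp Hp4 Hr (Hn & HL & HA & HB). set (n := length w) in *.
  assert (HL' : forall i, inL2 p (vnth w i)).
  { intro i. rewrite <- vnth_mod. apply HL, Nat.mod_upper_bound. lia. }
  assert (HA' : forall i, exists s, inS p s /\ ceq q (vnth w (S i)) (qmul (vnth w i) s)).
  { intro i. destruct (HA (Nat.modulo i n)) as (_ & s & Hs & E); [apply Nat.mod_upper_bound; lia|].
    exists s. split; auto. apply coset_eq_iff in E; auto. rewrite vnth_mod in E.
    pose proof (vnth_mod_S w i 1) as E2. cbn [plus] in E2. fold n in E2. rewrite E2 in E. exact E. }
  assert (HB' : forall i, ~ ceq q (vnth w (S (S i))) (vnth w i)).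
  { intros i E. apply (HB (Nat.modulo i n)); [apply Nat.mod_upper_bound; lia|]. apply coset_eq_iff; auto.
    rewrite vnth_mod. pose proof (vnth_mod_S w i 2) as E2. cbn [plus] in E2. fold n in E2. rewrite E2. exact E. }
  apply choice in HA'. destruct HA' as [s Hs]. set (ws := map s (seq 0 n)).
  assert (Lw : length ws = n) by (unfold ws; rewrite length_map, length_seq; auto).
  assert (Vs : forall i, vnth ws i = s (Nat.modulo i n)).
  { intro i. unfold vnth. rewrite Lw. unfold ws. rewrite nth_indep with (d' := s 0%nat).
    - rewrite map_nth, seq_nth; auto. apply Nat.mod_upper_bound; lia.
    - rewrite length_map, length_seq. apply Nat.mod_upper_bound; lia. }
  assert (Vs2 : forall i, inS p (vnth ws i) /\ ceq q (vnth w (S i)) (qmul (vnth w i) (vnth ws i))).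
  { intro i. rewrite Vs. destruct (Hs (Nat.modulo i n)) as [h1 h2]. split; auto.
    unfold n in h2 at 2. rewrite vnth_mod in h2. pose proof (vnth_mod_S w i 1) as E2. cbn [plus] in E2. fold n in E2. rewrite E2 in h2. exact h2. }
  assert (Hall : forall i, ceq q (vnth w i) (walk (vnth w 0) (vnth ws) i)).
  { induction i as [|i IH]; cbn [walk]; [apply ceq_refl|].
    apply (ceq_trans p q _ (qmul (vnth w i) (vnth ws i))); auto; [|apply Vs2 | apply ceq_mul_r; auto].
    apply inL2_mul; auto. apply (Vs2 i). }
  assert (FS : Forall (inS p) ws).
  { apply Forall_forall. intros a Ha. apply in_map_iff in Ha. destruct Ha as (i & <- & _). apply Hs. }
  exists ws. split; auto. split; [auto|split; [auto|split]].
  - apply (reduced_prim p); auto. apply reduced_nth. intros i Hi E. apply (HB' i).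
    destruct (Vs2 i) as [S1 C1]. destruct (Vs2 (S i)) as [_ C2].
    apply (ceq_trans p q _ (qmul (vnth w (S i)) (vnth ws (S i)))); auto.
    { apply inL2_mul; auto. apply (Vs2 (S i)). }
    apply (ceq_trans p q _ (qmul (qmul (vnth w i) (vnth ws i)) (vnth ws (S i)))); auto.
    { apply inL2_mul; [apply inL2_mul|]; auto; [apply S1 | apply (Vs2 (S i))]. }
    { apply ceq_mul_r; auto. }
    rewrite E, <- qmulA. replace (qmul (vnth ws i) (qconj (vnth ws i))) with (qscale (qnorm (vnth ws i)) q1).
    + rewrite qmul_scale_r, qmul_1_r. apply ceq_scale.
    + rewrite <- (qmul_1_r (qconj _)). rewrite qmul_conj_r. auto.
  - specialize (Hall n). unfold n in Hall at 1. rewrite <- (Nat.add_0_l (length w)), <- (Nat.mul_1_l (length w)) in Hall.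
    rewrite vnth_period in Hall. rewrite <- Lw, walk_vnth in Hall. apply ceq_sym in Hall.
    apply (ceq_mul_Lam_inv p) in Hall; auto.
Qed.

(** With [3 <= g], neither a generator nor a reduced product of two generators lies in [Lambda(2q)];
    so words give walks between distinct neighbours without backtracking. *)
Definition gmin (p q : Z) (g : nat) : Prop :=
  (exists ws, gw p q g ws) /\ (3 <= g)%nat /\ forall g' ws, (1 <= g' < g)%nat -> ~ gw p q g' ws.

Lemma gmin_no_S p q g s : prime p -> gmin p q g -> inS p s -> ~ Lam q s.
Proof.
  intros Hp (_ & Hg & Hm) Hs HL. apply (Hm 1%nat [s]); [lia|]. split; [auto|split; [auto|]].
  cbn [wprod]. rewrite qmul_1_r. split; auto. apply S_not_qdvd; auto.
Qed.

Lemma gmin_no_SS p q g s t : prime p -> p mod 4 = 1 -> gmin p q g -> inS p s -> inS p t -> t <> qconj s -> ~ Lam q (qmul s t).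
Proof.
  intros Hp Hp4 (_ & Hg & Hm) Hs Ht Hne HL. apply (Hm 2%nat [s; t]); [lia|]. split; [auto|split; [auto|split]].
  - apply reduced_prim; auto. cbn. auto.
  - cbn [wprod]. rewrite qmul_1_r. auto.
Qed.

(** Conjugation by the first letter would shorten a word that is not cyclically reduced. *)
Lemma gmin_cyclic p q g ws i : prime p -> p mod 4 = 1 -> rel_prime p (2 * q) -> gmin p q g -> gw p q g ws ->
  vnth ws (S i) <> qconj (vnth ws i).
Proof.
  intros Hp Hp4 Hr (_ & Hg & Hm) (FS & Lw & Dw & LL).
  assert (Hn : length ws <> 0%nat) by lia. pose proof (vnth_mod_S ws i 1) as E1. cbn [plus] in E1.
  rewrite <- (vnth_mod ws i), <- E1. clear E1.
  set (j := Nat.modulo i (length ws)). assert (Hj : (j < length ws)%nat) by (apply Nat.mod_upper_bound; auto).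
  destruct (Nat.lt_ge_cases (S j) (length ws)) as [Hlt|Hge].
  { apply nth_reduced; auto. apply (prim_reduced p); auto. }
  assert (Ej : S j = length ws) by lia. intro E.
  replace (S j) with (0 + 1 * length ws)%nat in E by lia. rewrite vnth_period in E.
  destruct ws as [|a ws]; [cbn in Hn; lia|]. destruct ws as [|b ws _] using rev_ind; [cbn in Lw; lia|].
  assert (Ea : vnth (a :: ws ++ [b]) 0 = a) by (rewrite vnth_small by (cbn; lia); auto).
  assert (Eb : vnth (a :: ws ++ [b]) j = b).
  { rewrite vnth_small by auto. cbn [length] in Ej. rewrite length_app in Ej. cbn [length] in Ej.
    replace j with (S (length ws)) by lia. cbn [nth]. rewrite app_nth2, Nat.sub_diag by lia. auto. }
  rewrite Ea, Eb in E. assert (Eb' : b = qconj a) by (rewrite E, qconjK; auto). subst b.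
  cbn [length] in Lw. rewrite length_app in Lw. cbn [length] in Lw.
  inversion FS as [|? ? Sa FS']; subst. apply Forall_app in FS'. destruct FS' as [FS' _].
  cbn [wprod] in LL, Dw. rewrite wprod_app in LL, Dw. cbn [wprod] in LL, Dw. rewrite qmul_1_r in LL, Dw.
  apply (Hm (length ws) ws); [lia|]. split; [auto|split; [auto|split]].
  - apply prim_factor_r in Dw. apply prim_factor_l in Dw. auto.
  - apply (Lam_sandwich q _ (qconj a)) in LL. rewrite qconjK in LL.
    assert (E3 : qmul (qconj a) (qmul (qmul a (qmul (wprod ws) (qconj a))) a) = qscale (p * p) (wprod ws)).
    { rewrite <- (inS_norm _ _ Sa). generalize (wprod ws). clear. intro x. rewrite <- !qmulA, qmul_conj_l, <- qscale_scale. f_equal. qring. }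
    rewrite E3 in LL. apply Lam_scale_inv in LL; auto. apply rel_prime_mul; auto.
Qed.

Lemma mkwalk_nb p q g x ws : prime p -> p mod 4 = 1 -> rel_prime p (2 * q) -> gmin p q g -> inL2 p x -> gw p q g ws ->
  nb_closed_walk p q (mkwalk x ws).
Proof.
  intros Hp Hp4 Hr Hg Hx Hw. assert (Hw' := Hw). destruct Hw' as (FS & Lw & Dw & LL). assert (Hg' := Hg). destruct Hg' as (_ & H3 & _).
  assert (Hne : ws <> []) by (intros ->; cbn in Lw; lia).
  assert (HC := fun i => mkwalk_ceq p q x ws i Hr Hx FS Hne LL).
  assert (HS : forall i, inS p (vnth ws i)) by (intro i; rewrite Forall_forall in FS; apply FS, vnth_in; auto).
  assert (HW : forall i, inL2 p (walk x (vnth ws) i)) by (intro i; apply walk_inL2; auto).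
  assert (HV : forall i, inL2 p (vnth (mkwalk x ws) i)).
  { intro i. assert (Hin : In (vnth (mkwalk x ws) i) (mkwalk x ws)).
    { apply vnth_in. intro E. apply (f_equal (@length quat)) in E. rewrite mkwalk_length in E. cbn in E. lia. }
    apply in_map_iff in Hin. destruct Hin as (j & <- & _). auto. }
  split; [rewrite mkwalk_length; lia|]. split; [auto|]. split.
  - intros i _. split.
    + intro E. apply coset_eq_iff in E; auto.
      assert (E2 : ceq q (walk x (vnth ws) i) (walk x (vnth ws) (S i))).
      { apply (ceq_trans p q _ (vnth (mkwalk x ws) i)); auto; [apply ceq_sym, HC|].
        apply (ceq_trans p q _ (vnth (mkwalk x ws) (S i))); auto. }
      apply ceq_sym in E2. cbn [walk] in E2. apply (ceq_mul_Lam_inv p) in E2; auto. revert E2. apply (gmin_no_S p q g); auto.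
    + exists (vnth ws i). split; auto. apply coset_eq_iff; auto.
      apply (ceq_trans p q _ (walk x (vnth ws) (S i))); auto. cbn [walk]. apply ceq_mul_r, ceq_sym, HC.
  - intros i _ E. apply coset_eq_iff in E; auto.
    assert (E2 : ceq q (walk x (vnth ws) (S (S i))) (walk x (vnth ws) i)).
    { apply (ceq_trans p q _ (vnth (mkwalk x ws) (S (S i)))); auto; [apply ceq_sym, HC|].
      apply (ceq_trans p q _ (vnth (mkwalk x ws) i)); auto. }
    cbn [walk] in E2. rewrite <- qmulA in E2. apply (ceq_mul_Lam_inv p) in E2; auto. revert E2.
    apply (gmin_no_SS p q g); auto. apply (gmin_cyclic p q g); auto.
Qed.

Lemma inL2_q1 p : inL2 p q1.
Proof. apply (inL2_intro p q1 0); [apply odd1_q1 | reflexivity]. Qed.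

Lemma gmin_girth p q g : prime p -> p mod 4 = 1 -> rel_prime p (2 * q) -> gmin p q g -> lps_girth p q g.
Proof.
  intros Hp Hp4 Hr Hg. assert (Hg' := Hg). destruct Hg' as ([ws Hws] & H3 & Hm). split.
  - exists (mkwalk q1 ws). split; [apply (mkwalk_nb p q g); auto; apply inL2_q1|]. rewrite mkwalk_length. apply Hws.
  - intros w Hw. destruct (walk_letters p q w Hp Hp4 Hr Hw) as (vs & Hvs & _). destruct Hw as (Hn & _).
    destruct (Nat.le_gt_cases g (length w)); auto. exfalso. apply (Hm (length w) vs); auto.
Qed.

Definition soc (q : Z) (w1 w2 : list quat) : Prop := length w1 = length w2 /\
  exists r, forall i, ceq q (vnth w1 (i + r)) (vnth w2 i).

Lemma soc_iff p q w1 w2 : rel_prime p (2 * q) -> w1 <> [] ->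
  (same_oriented_cycle p q w1 w2 <-> soc q w1 w2).
Proof.
  intros Hr Hne. assert (Hn : length w1 <> 0%nat) by (destruct w1; [congruence | discriminate]).
  split; intros (L & r & H); (split; [exact L|]); exists r.
  - intro i. specialize (H (Nat.modulo i (length w1)) (Nat.mod_upper_bound _ _ Hn)). apply coset_eq_iff in H; auto.
    rewrite L in H at 2. rewrite vnth_mod, Nat.add_comm, vnth_mod_S, Nat.add_comm in H. exact H.
  - intros i _. apply coset_eq_iff; auto.
Qed.

Lemma soc_refl q w : soc q w w.
Proof. split; [auto|]. exists 0%nat. intro i. rewrite Nat.add_0_r. apply ceq_refl. Qed.

Lemma soc_unshift q w1 w2 r : length w1 = length w2 -> (forall i, ceq q (vnth w1 (i + r)) (vnth w2 i)) ->
  forall i, ceq q (vnth w1 i) (vnth w2 (i + r * (length w1 - 1))).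
Proof.
  intros L H i. specialize (H (i + r * (length w1 - 1))%nat).
  destruct w1 as [|a w1]; [destruct w2; [|discriminate]; unfold vnth; cbn [length nth] in *; destruct (_ mod 0)%nat, (_ mod 0)%nat; apply ceq_refl|].
  replace (i + r * (length (a :: w1) - 1) + r)%nat with (i + r * length (a :: w1))%nat in H by (cbn [length]; nia).
  rewrite vnth_period in H. exact H.
Qed.

Lemma soc_sym q w1 w2 : soc q w1 w2 -> soc q w2 w1.
Proof.
  intros (L & r & H). split; [auto|]. exists (r * (length w1 - 1))%nat. intro i. apply ceq_sym, soc_unshift; auto.
Qed.

Lemma nb_ne p q w : nb_closed_walk p q w -> w <> [].
Proof. intros (H & _) ->. cbn in H. lia. Qed.

Lemma nb_inL2 p q w i : nb_closed_walk p q w -> inL2 p (vnth w i).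
Proof.
  intros (Hn & HL & _). rewrite <- vnth_mod. apply HL, Nat.mod_upper_bound. lia.
Qed.

(** The factor [g] accounts for the starting points on an oriented cycle. *)
Lemma kiss_exists p q g l GL : prime p -> p mod 4 = 1 -> rel_prime p (2 * q) -> gmin p q g ->
  indep (ceq q) l -> (forall x, In x l -> inL2 p x) -> (forall x, inL2 p x -> exists y, In y l /\ ceq q x y) ->
  NoDup GL -> (forall ws, In ws GL <-> gw p q g ws) ->
  exists n, lps_kiss p q n /\ Z.of_nat n <= zlen l * zlen GL /\ zlen l * zlen GL <= Z.of_nat n * Z.of_nat g.
Proof.
  intros Hp Hp4 Hr Hg HI HL HC NG HG.
  set (PL := list_prod l GL). assert (NPL : NoDup PL) by (apply nodup_prod; auto; apply HI).
  set (P := fun w => nb_closed_walk p q w /\ length w = g).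
  assert (Hg' := Hg). destruct Hg' as (_ & Hg3 & Hgm).
  (* Upper bound: a cycle is recovered from the representative of its initial vertex and its
     word. *)
  assert (HB : forall W, indep (soc q) W -> (forall w, In w W -> P w) -> zlen W <= zlen PL).
  { intros W [NW IW] HW.
    set (f := fun w => epsilon (inhabits (q1, @nil quat)) (fun xw => In (fst xw) l /\ ceq q (vnth w 0) (fst xw) /\
       In (snd xw) GL /\ forall i, ceq q (vnth w i) (walk (vnth w 0) (vnth (snd xw)) i))).
    assert (Hf : forall w, In w W -> In (fst (f w)) l /\ ceq q (vnth w 0) (fst (f w)) /\
       In (snd (f w)) GL /\ forall i, ceq q (vnth w i) (walk (vnth w 0) (vnth (snd (f w))) i)).
    { intros w Hw. unfold f. apply epsilon_spec. destruct (HW w Hw) as [Hnb Hlen].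
      destruct (HC (vnth w 0) (nb_inL2 p q w 0 Hnb)) as (x & Hx & Ex).
      destruct (walk_letters p q w Hp Hp4 Hr Hnb) as (ws & Hws & Hall). exists (x, ws). cbn [fst snd].
      split; [auto|split; [auto|split; [|auto]]]. apply HG. rewrite <- Hlen. auto. }
    assert (Hat := atmost_list PL (fun z => In z PL) (fun z h => h)).
    apply (atmost_inj f _ (fun w => In w W) _ Hat); auto.
    - intros w Hw. destruct (Hf w Hw) as (h1 & _ & h2 & _). rewrite (surjective_pairing (f w)). apply in_prod; auto.
    - intros w w' Hw Hw' E. apply IW; auto.
      destruct (Hf w Hw) as (h1 & h2 & h3 & h4). destruct (Hf w' Hw') as (k1 & k2 & k3 & k4).
      destruct (HW w Hw) as [Hnb Hlen]. destruct (HW w' Hw') as [Hnb' Hlen']. rewrite <- E in *.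
      split; [congruence|]. exists 0%nat. intro i. rewrite Nat.add_0_r.
      assert (HS : forall j, inS p (vnth (snd (f w)) j)).
      { intro j. apply HG in h3. destruct h3 as (FS & Lw & _). rewrite Forall_forall in FS. apply FS, vnth_in. intro h. rewrite h in Lw. cbn in Lw. lia. }
      apply (ceq_trans p q _ (walk (vnth w 0) (vnth (snd (f w))) i)); auto; [apply walk_inL2; auto; apply (nb_inL2 p q); auto|].
      apply (ceq_trans p q _ (walk (vnth w' 0) (vnth (snd (f w))) i)); auto; [apply walk_inL2; auto; apply (nb_inL2 p q); auto| |apply ceq_sym; auto].
      apply walk_ceq. apply (ceq_trans p q _ (fst (f w))); auto. apply ceq_sym; auto. }
  destruct (max_reps P (soc q) (length PL)) as (W & HW1 & HW2 & HW3).
  { intros; apply soc_refl. } { intros; apply soc_sym; auto. }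
  { intros W H1 H2. pose proof (HB W H1 H2). unfold zlen in H. lia. }
  exists (length W). split; [|split].
  - exists g. split; [apply gmin_girth; auto|]. exists W. split; [auto|split; [auto|split]].
    + intros i j Hi Hj Hij h. apply (soc_iff p) in h; auto.
      * revert h. apply indep_nth; auto.
      * apply (nb_ne p q). apply HW2. apply nth_In; auto.
    + intros w Hw Lw. destruct (HW3 w (conj Hw Lw)) as (w' & Hw' & E). exists w'. split; auto. apply soc_iff; auto. apply (nb_ne p q); auto.
  - pose proof (HB W HW1 HW2) as h. unfold PL in h. rewrite pair_list in h. exact h.
  - rewrite <- pair_list. fold PL.
    (* Lower bound: [(x, ws)] is recovered from a listed cycle and an offset below [g]. Equal data
       give walks that agree vertex by vertex, hence the same [x]; two different letters at the same
       place would give a word of length 2 in [Lambda(2q)]. *)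
    set (R := fun xw z => In (fst z) W /\ (snd z < g)%nat /\ forall i, ceq q (vnth (mkwalk (fst xw) (snd xw)) (i + snd z)) (vnth (fst z) i)).
    set (f := fun xw => epsilon (inhabits (@nil quat, 0%nat)) (R xw)).
    assert (Hnbm : forall xw, In xw PL -> P (mkwalk (fst xw) (snd xw)) /\ gw p q g (snd xw) /\ inL2 p (fst xw) /\ In (fst xw) l).
    { intros [x ws] Hxw. apply in_prod_iff in Hxw. destruct Hxw as [Hx Hws]. cbn [fst snd]. apply HG in Hws.
      split; [|split; auto]. split; [apply (mkwalk_nb p q g); auto|]. rewrite mkwalk_length. apply Hws. }
    assert (Hf : forall xw, In xw PL -> R xw (f xw)).
    { intros xw Hxw. unfold f. apply epsilon_spec. destruct (Hnbm xw Hxw) as (HP & _).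
      destruct (HW3 _ HP) as (w' & Hw' & L & r & Hrr). destruct HP as [Hnb Hlen].
      exists (w', Nat.modulo r g). split; [auto|]. cbn [fst snd]. split; [apply Nat.mod_upper_bound; lia|].
      intro i. rewrite <- Hlen. rewrite vnth_mod_S. auto. }
    assert (Hat := atmost_prod _ _ _ _ (atmost_list W (fun w => In w W) (fun w h => h)) (atmost_list (seq 0 g) (fun r => In r (seq 0 g)) (fun r h => h))).
    assert (Zg : zlen (seq 0 g) = Z.of_nat g) by (unfold zlen; rewrite length_seq; auto). rewrite Zg in Hat.
    change (zlen W) with (Z.of_nat (length W)) in Hat.
    apply (atmost_inj f _ (fun xw => In xw PL) _ Hat); auto.
    + intros xw Hxw. destruct (Hf xw Hxw) as (h1 & h2 & _). split; [auto|]. apply in_seq. lia.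
    + intros xw xw' Hxw Hxw' E. destruct (Hf xw Hxw) as (_ & _ & h). destruct (Hf xw' Hxw') as (h1' & _ & h'). rewrite <- E in *.
      destruct (Hnbm xw Hxw) as ([Hnb Hlen] & Gw & Lx & Ix). destruct (Hnbm xw' Hxw') as ([Hnb' Hlen'] & Gw' & Lx' & Ix').
      destruct xw as [x ws], xw' as [x' ws']. cbn [fst snd] in *. destruct (f (x, ws)) as [w r]. cbn [fst snd] in *.
      assert (Hw : nb_closed_walk p q w /\ length w = g) by (apply HW2; auto). destruct Hw as [Hw Lw].
      assert (HE : forall i, ceq q (vnth (mkwalk x ws) i) (vnth (mkwalk x' ws') i)).
      { intro i. pose proof (soc_unshift q (mkwalk x ws) w r (eq_trans Hlen (eq_sym Lw)) h i) as c1.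
        pose proof (soc_unshift q (mkwalk x' ws') w r (eq_trans Hlen' (eq_sym Lw)) h' i) as c2. rewrite Hlen in c1. rewrite Hlen' in c2.
        apply (ceq_trans p q _ _ _ Hr) with (3 := ceq_sym _ _ _ c2); auto. apply (nb_inL2 p q); auto. }
      assert (N1 : ws <> []) by (intros ->; destruct Gw as (_ & L & _); cbn in L; lia).
      assert (N2 : ws' <> []) by (intros ->; destruct Gw' as (_ & L & _); cbn in L; lia).
      destruct Gw as (FS & L & _ & LL). destruct Gw' as (FS' & L' & _ & LL').
      assert (HS : forall i, inS p (vnth ws i)) by (intro i; rewrite Forall_forall in FS; apply FS, vnth_in; auto).
      assert (HS' : forall i, inS p (vnth ws' i)) by (intro i; rewrite Forall_forall in FS'; apply FS', vnth_in; auto).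
      assert (HWk : forall i, ceq q (walk x (vnth ws) i) (walk x' (vnth ws') i)).
      { intro i. apply (ceq_trans p q _ (vnth (mkwalk x ws) i)); auto; [apply (nb_inL2 p q); auto | apply ceq_sym, (mkwalk_ceq p); auto|].
        apply (ceq_trans p q _ (vnth (mkwalk x' ws') i)); auto; [apply (nb_inL2 p q); auto | apply (mkwalk_ceq p); auto]. }
      assert (Exx : x = x') by (apply (proj2 HI); auto; apply (HWk 0%nat)). subst x'. f_equal.
      apply (nth_ext _ _ (Quat 0 0 0 0) (Quat 0 0 0 0)); [congruence|]. intros i Hi. rewrite <- !vnth_small by congruence.
      apply NNPP. intro Hd. pose proof (HWk (S i)) as c. cbn [walk] in c.
      assert (c2 : ceq q (qmul (walk x (vnth ws) i) (vnth ws i)) (qmul (walk x (vnth ws) i) (vnth ws' i))).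
      { apply (ceq_trans p q _ _ _ Hr) with (2 := c).
        - apply inL2_mul; [apply walk_inL2; auto | apply (HS' i)].
        - apply ceq_mul_r, ceq_sym, HWk. }
      apply (ceq_mul_both p) in c2; auto; [|apply walk_inL2; auto]. revert c2.
      apply (gmin_no_SS p q g); auto; [apply inS_conj; auto|]. rewrite qconjK. auto.
Qed.

(** * The limit *)

Lemma least_nat (P : nat -> Prop) n : P n -> exists m, P m /\ (m <= n)%nat /\ forall i, (i < m)%nat -> ~ P i.
Proof.
  induction n as [n IH] using lt_wf_ind. intro Hn.
  destruct (classic (exists i, (i < n)%nat /\ P i)) as [(i & Hi & Pi)|Hno].
  - destruct (IH i Hi Pi) as (m & Pm & Hm & Hmin). exists m. split; [auto|split; [lia|auto]].
  - exists n. split; [auto|split; [lia|]]. intros i Hi Pi. apply Hno; eauto.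
Qed.

Lemma pow_window p B : 2 <= p -> 1 <= B -> exists h : nat, B < p ^ Z.of_nat h /\ p ^ Z.of_nat h <= p * B.
Proof.
  intros Hp HB. destruct (least_nat (fun h => B < p ^ Z.of_nat h) (Z.to_nat B)) as (h & Hh & _ & Hmin).
  - rewrite Z2Nat.id by lia. pose proof (pow2_ge B ltac:(lia)).
    assert (2 ^ B <= p ^ B) by (apply Z.pow_le_mono_l; lia). lia.
  - exists h. split; auto. destruct h as [|h]; [cbn [Z.of_nat] in Hh; rewrite Z.pow_0_r in Hh; lia|].
    specialize (Hmin h ltac:(lia)). rewrite Nat2Z.inj_succ, Z.pow_succ_r by lia. apply Z.mul_le_mono_nonneg_l; lia.
Qed.

Lemma exponent_bound p E j c (k : nat) : 2 <= p -> E = 2 ^ j -> 0 <= j -> 0 <= c -> p ^ Z.of_nat k <= E ^ c -> Z.of_nat k <= j * c.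
Proof.
  intros Hp -> Hj Hc H. rewrite <- Z.pow_mul_r in H by lia.
  apply (Z.pow_le_mono_r_iff 2); [lia | nia |]. apply Z.le_trans with (p ^ Z.of_nat k); auto. apply Z.pow_le_mono_l; lia.
Qed.

(** All losses are powers of [E] with exponents independent of [a], whereas [q] is at least
    [E^(18 + 2 a)]. [K] is the number of words of minimal length. *)
Lemma good_graph p a : prime p -> p mod 4 = 1 -> 30 <= a -> exists q E (nv kis : nat) K,
  cls p q /\ lps_nverts p q nv /\ lps_kiss p q kis /\ 256 <= E /\
  E ^ (18 + 2 * a) <= q < E ^ (20 + 2 * a) /\
  Z.of_nat nv <= 4 * (q * (q * q)) /\ q * (q * q) <= Z.of_nat nv * E ^ 3 /\
  E ^ (2 * a - 4) <= K /\ K <= E ^ 4 * q /\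
  Z.of_nat kis <= Z.of_nat nv * K /\ Z.of_nat nv * K <= Z.of_nat kis * E.
Proof.
  intros Hp Hp4 Ha. pose proof (prime_ge_2 p Hp) as Hp2. assert (Op := prime1_odd p Hp4).
  (* The largest number whose representations by two squares are counted is at most [(E Y^3)^2] with
     [Y = E^(20 + 2 a)], and [2 + 6 (20 + 2 a) = 122 + 12 a]. *)
  destruct (r2_small (Z.to_nat (122 + 12 * a))) as (E0 & HE0 & Hr2).
  destruct (good_q p a (E0 + 28 * p + 256 + 4 * (122 + 12 * a)) Hp Hp4 Ha ltac:(lia)) as (j & q & E & Hj & HE & Hcls & Hq & Hgood).
  assert (Hlin : (122 + 12 * a) * Z.of_nat j <= E) by (rewrite HE; apply linear_le_pow2; lia).
  assert (HEj : Z.of_nat j + 1 <= E) by (rewrite HE; apply pow2_ge; lia).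
  assert (HEp : 28 * p <= E) by lia. assert (HE256 : 256 <= E) by lia.
  assert (Hj0 : 0 <= Z.of_nat j) by lia.
  assert (HF : forall n, n <= E ^ (122 + 12 * a) -> atmost E (G2 n)).
  { intros n Hn. apply Hr2; [lia|]. rewrite Z2Nat.id by lia. auto. }
  clear Hr2 Hj HEj HE0.
  assert (Ep : forall t, 0 <= t -> 0 < E ^ t) by (intros; apply Z.pow_pos_nonneg; lia).
  assert (Hqp : prime q) by apply Hcls. assert (Oq : Z.odd q = true) by (apply mod4_odd, Hcls).
  assert (Hne : p <> q) by (intro h; apply (cls_neq p q Hp Hcls); auto).
  assert (Hr := rel_prime_2q p q Hp Hqp Op Hne). pose proof (prime_ge_2 q Hqp) as Hq2.
  assert (Hqq : 0 < q * q) by nia.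
  assert (HqE : E < q).
  { apply Z.lt_le_trans with (E ^ (18 + 2 * a)); [|apply Hq]. rewrite <- (Z.pow_1_r E) at 1. apply Z.pow_lt_mono_r; lia. }
  set (Y := E ^ (20 + 2 * a)) in *. assert (HY0 : 0 < Y) by (apply Ep; lia).
  assert (HY : forall t c, 0 <= t -> 0 <= c -> E ^ c * Y ^ t = E ^ (c + t * (20 + 2 * a))).
  { intros t c Ht Hc. unfold Y. rewrite <- Z.pow_mul_r, <- Z.pow_add_r by nia. f_equal. ring. }
  destruct (pow_window p (28 * (q * q)) Hp2 ltac:(lia)) as (h0 & Hh1 & Hh2).
  assert (Hh3 : p ^ Z.of_nat h0 <= E * (q * q)) by nia.
  destruct (gw_exists p q h0 Hp Hp4 Hqp Oq Hne Hh1) as (g0 & ws0 & Hg0 & Hws0).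
  destruct (least_nat (fun g => (1 <= g)%nat /\ exists ws, gw p q g ws) g0) as (g & (Hg1 & ws & Hws) & Hgg & Hgmin).
  { split; [lia | eauto]. }
  assert (Hmin : forall g' vs, (1 <= g' < g)%nat -> ~ gw p q g' vs).
  { intros g' vs h1 h2. apply (Hgmin g'); [lia|]. split; [lia | eauto]. }
  assert (Hws' := Hws). destruct Hws' as (FS & Lw & Dw & LL).
  assert (Nw : qnorm (wprod ws) = p ^ Z.of_nat g) by (rewrite (wprod_norm p), Lw by auto; auto).
  destruct (norm_even q p (wprod ws) g Hp Hqp Hne) as [h Eg]; auto.
  { intros t h. apply (proj2 (cls_legendre p q Hp Hp4 Hcls)). eauto. }
  clear Lw. subst g. assert (Hh : (1 <= h)%nat) by lia.
  destruct (level_structure p q (wprod ws) h Hp Hqp Hne Op Oq (wprod_odd1 p ws FS) Dw LL Nw Hh)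
    as (e & m & v & He & Hm & Hpos & Hv & _).
  assert (Hph : p ^ Z.of_nat h <= p ^ Z.of_nat h0) by (apply Z.pow_le_mono_r; lia).
  assert (HmE : m <= E) by nia.
  assert (HpE : p ^ Z.of_nat h <= E * (q * q)) by lia.
  (* [h = 1] would give [q^2 < p], against [p <= E < q]. *)
  assert (Hh3' : (3 <= 2 * h)%nat).
  { destruct h as [|[|h]]; [lia | | lia]. exfalso. change (Z.of_nat 1) with 1 in Hpos. rewrite Z.pow_1_r in Hpos. nia. }
  assert (Hgm : gmin p q (2 * h)) by (split; [eauto | auto]).
  pose proof (Hgood (Z.of_nat h) m ltac:(lia) ltac:(lia) HpE Hpos (ex_intro _ v Hv)) as Hlow.
  pose proof (gw_lower p q h m _ Hp Hp4 Hqp Oq Hne Hm Hpos Hmin Hlow) as HKlow.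
  set (P := p ^ Z.of_nat h) in *. assert (HP0 : 0 < P) by (apply Z.pow_pos_nonneg; lia).
  assert (HqY : 0 <= q <= Y) by lia.
  assert (Hqq1 : q * q <= Y * Y) by (clear - HqY; apply Z.mul_le_mono_nonneg; lia).
  assert (Hqq2 : q * q <= Y ^ 2) by (replace (Y ^ 2) with (Y * Y) by ring; auto).
  assert (HPP : P * P <= E * (q * q) * (E * (q * q))) by (apply Z.mul_le_mono_nonneg; lia).
  destruct (gw_upper p q h E Hp Hp4 Hqp Oq Hne Hh) as (c & Hc1 & Hc2).
  { intros n Hn. apply HF. fold P in Hn. apply (Z.le_trans _ _ _ Hn). apply (Z.le_trans _ _ _ HPP).
    apply Z.le_trans with (E ^ 2 * Y ^ 4).
    - replace (E ^ 2 * Y ^ 4) with (E * Y ^ 2 * (E * Y ^ 2)) by ring. clear - Hqq2 Hqq HE256. apply Z.mul_le_mono_nonneg; nia.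
    - rewrite HY by lia. apply Z.pow_le_mono_r; lia. }
  fold P in Hc2. destruct (finite_enum c _ Hc1) as (GL & NG & HG).
  destruct (nverts_exists p q Hp Hqp Hne Op Oq) as (nv & Hnv & Hnv4).
  destruct (pow_window p (q * (q * q)) Hp2 ltac:(clear - Hq2; nia)) as (k & Hk1 & Hk2).
  assert (Hq3 : p * (q * (q * q)) <= E ^ 1 * Y ^ 3).
  { replace (E ^ 1 * Y ^ 3) with (E * (Y * (Y * Y))) by ring.
    clear - HEp Hp2 HqY Hqq Hqq1. apply Z.mul_le_mono_nonneg; [lia | lia | nia |]. apply Z.mul_le_mono_nonneg; lia. }
  assert (Hk3 : Z.of_nat k <= E).
  { apply Z.le_trans with (Z.of_nat j * (1 + 3 * (20 + 2 * a))).
    - apply (exponent_bound p E); auto; [lia|]. rewrite <- HY by lia. lia.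
    - clear - Hlin Hj0 Ha. nia. }
  assert (Hh4 : Z.of_nat (2 * h) <= E).
  { assert (H : Z.of_nat h <= Z.of_nat j * (1 + 2 * (20 + 2 * a))).
    - apply (exponent_bound p E); auto; [lia|]. rewrite <- HY by lia. fold P. rewrite Z.pow_1_r.
      apply (Z.le_trans _ _ _ HpE). apply Z.mul_le_mono_nonneg_l; [lia | exact Hqq2].
    - clear - H Hlin Hj0 Ha. nia. }
  pose proof (nverts_lower p q nv E k Hp Hp4 Hqp Oq Hne Hnv ltac:(lia)) as Hnl.
  assert (Hnl' : q * (q * q) <= Z.of_nat nv * (1 + 6 * E * Z.of_nat k)).
  { apply Hnl. intros n Hn. apply HF. apply (Z.le_trans _ _ _ Hn).
    apply Z.le_trans with (E ^ 1 * Y ^ 3 * (E ^ 1 * Y ^ 3)).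
    - assert (0 < p ^ Z.of_nat k) by (apply Z.pow_pos_nonneg; lia). apply Z.mul_le_mono_nonneg; lia.
    - rewrite HY, <- Z.pow_add_r by lia. apply Z.pow_le_mono_r; lia. }
  clear Hnl.
  apply nverts_iff in Hnv as Hnv'; auto. destruct Hnv' as (l & Hl & HI & HL & HC).
  destruct (kiss_exists p q (2 * h) l GL Hp Hp4 Hr Hgm HI HL HC NG HG) as (kis & Hkis & HK1 & HK2).
  assert (Hzl : zlen l = Z.of_nat nv) by (unfold zlen; rewrite Hl; auto). rewrite Hzl in HK1, HK2.
  exists q, E, nv, kis, (zlen GL).
  split; [auto|]. split; [auto|]. split; [auto|]. split; [auto|]. split; [auto|]. split; [auto|].
  split; [|split; [|split; [|split]]]; auto.
  - apply (Z.le_trans _ _ _ Hnl'). apply Z.mul_le_mono_nonneg_l; [lia|].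
    assert (6 * E * Z.of_nat k <= 6 * E * E) by (apply Z.mul_le_mono_nonneg_l; lia).
    replace (E ^ 3) with (E * (E * E)) by ring. nia.
  - apply (atleast_atmost _ _ _ HKlow). apply (atmost_le _ _ _ _ (atmost_list GL (fun x => In x GL) (fun x h => h))); [lia|].
    intros x Hx. apply HG; auto.
  - assert (HGL : zlen GL <= c) by (apply Hc1; auto; intros x Hx; apply HG; auto).
    apply (Z.le_trans _ _ _ HGL). assert (Hq3' : 0 < q * (q * q)) by nia.
    apply Z.mul_le_mono_pos_r with (q * (q * q)); auto. apply (Z.le_trans _ _ _ Hc2).
    apply Z.le_trans with (6 * E * (E * (q * q) * (E * (q * q)))); [apply Z.mul_le_mono_nonneg_l; lia|].
    replace (6 * E * (E * (q * q) * (E * (q * q)))) with (6 * (E * E * E * q * (q * (q * q)))) by ring.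
    replace (E ^ 4 * q * (q * (q * q))) with (E * (E * E * E * q * (q * (q * q)))) by ring.
    apply Z.mul_le_mono_nonneg_r; [|lia]. repeat apply Z.mul_nonneg_nonneg; lia.
  - apply (Z.le_trans _ _ _ HK2). apply Z.mul_le_mono_nonneg_l; lia.
Qed.

Definition lnZ (z : Z) : R := ln (IZR z).

Lemma lnZ_le x y : 0 < x <= y -> (lnZ x <= lnZ y)%R.
Proof.
  intros [Hx Hxy]. destruct (Z.eq_dec x y) as [->|]; [lra|]. left. apply ln_increasing; apply IZR_lt; lia.
Qed.

Lemma lnZ_mul x y : 0 < x -> 0 < y -> lnZ (x * y) = (lnZ x + lnZ y)%R.
Proof. intros Hx Hy. unfold lnZ. rewrite mult_IZR. apply ln_mult; apply IZR_lt; lia. Qed.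

Lemma lnZ_pow x t : 0 < x -> 0 <= t -> lnZ (x ^ t) = (IZR t * lnZ x)%R.
Proof.
  intros Hx Ht. unfold lnZ. rewrite <- (Z2Nat.id t) by auto. rewrite <- pow_IZR, <- INR_IZR_INZ. apply ln_pow. apply IZR_lt; auto.
Qed.

(** With [L = ln E], both [ln nv - 3 ln q] and [ln K - ln q] are bounded multiples of [L], and
    [ln kis] differs from [ln nv + ln K] by at most [L]. The total error [30 L] is divided by
    [ln nv >= 6 a L]. *)
Lemma ratio_bound q E (nv kis : nat) K a : 30 <= a -> 256 <= E -> E ^ (18 + 2 * a) <= q < E ^ (20 + 2 * a) ->
  Z.of_nat nv <= 4 * (q * (q * q)) -> q * (q * q) <= Z.of_nat nv * E ^ 3 ->
  E ^ (2 * a - 4) <= K -> K <= E ^ 4 * q ->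
  Z.of_nat kis <= Z.of_nat nv * K -> Z.of_nat nv * K <= Z.of_nat kis * E ->
  (Rabs (ln (INR kis) / ln (INR nv) - 4 / 3) <= 5 / IZR a)%R.
Proof.
  intros Ha HE [Hq1 Hq2] H1 H2 H3 H4 H5 H6.
  assert (Ep : forall t, 0 <= t -> 0 < E ^ t) by (intros; apply Z.pow_pos_nonneg; lia).
  pose proof (Ep (18 + 2 * a) ltac:(lia)). pose proof (Ep (20 + 2 * a) ltac:(lia)). pose proof (Ep (2 * a - 4) ltac:(lia)).
  pose proof (Ep 3 ltac:(lia)). pose proof (Ep 4 ltac:(lia)).
  assert (Hq0 : 0 < q) by lia. assert (Hq3 : 0 < q * (q * q)) by (repeat apply Z.mul_pos_pos; auto).
  set (n := Z.of_nat nv) in *. set (s := Z.of_nat kis) in *.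
  assert (Hn : 0 < n).
  { destruct (Z.le_gt_cases n 0); auto. assert (En : n = 0) by (unfold n in *; lia). rewrite En in H2. lia. }
  assert (HK : 0 < K) by lia.
  assert (Hs : 0 < s).
  { destruct (Z.le_gt_cases s 0); auto. assert (Es : s = 0) by (unfold s in *; lia). rewrite Es in H6.
    pose proof (Z.mul_pos_pos n K Hn HK). lia. }
  rewrite !INR_IZR_INZ. fold n s. fold (lnZ n) (lnZ s).
  set (L := lnZ E). assert (HL : (0 < L)%R).
  { unfold L, lnZ. rewrite <- ln_1. apply ln_increasing; [lra|]. apply IZR_lt. lia. }
  set (x := lnZ q). set (N := lnZ n). set (k := lnZ s). set (y := lnZ K).
  assert (A1 : ((18 + 2 * IZR a) * L <= x)%R).
  { pose proof (lnZ_le _ _ (conj H Hq1)) as h. rewrite lnZ_pow in h by lia. rewrite plus_IZR, mult_IZR in h. exact h. }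
  assert (A2 : (x <= (20 + 2 * IZR a) * L)%R).
  { pose proof (lnZ_le q _ (conj Hq0 (Z.lt_le_incl _ _ Hq2))) as h. rewrite lnZ_pow in h by lia. rewrite plus_IZR, mult_IZR in h. exact h. }
  assert (A3 : (N <= L + 3 * x)%R).
  { assert (h0 : n <= E * (q * (q * q))) by (apply (Z.le_trans _ _ _ H1); apply Z.mul_le_mono_nonneg_r; lia).
    pose proof (lnZ_le _ _ (conj Hn h0)) as h. rewrite !lnZ_mul in h by (repeat apply Z.mul_pos_pos; lia). fold L x N in h. lra. }
  assert (A4 : (3 * x <= N + 3 * L)%R).
  { pose proof (lnZ_le _ _ (conj Hq3 H2)) as h. rewrite !lnZ_mul, lnZ_pow in h by (try apply Z.mul_pos_pos; lia). fold L x N in h. lra. }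
  assert (A5 : ((2 * IZR a - 4) * L <= y)%R).
  { pose proof (lnZ_le (E ^ (2 * a - 4)) _ (conj H7 H3)) as h. rewrite lnZ_pow in h by lia. rewrite minus_IZR, mult_IZR in h. exact h. }
  assert (A6 : (y <= 4 * L + x)%R).
  { pose proof (lnZ_le _ _ (conj HK H4)) as h. rewrite lnZ_mul, lnZ_pow in h by lia. fold L x y in h. lra. }
  assert (A7 : (k <= N + y)%R).
  { pose proof (lnZ_le _ _ (conj Hs H5)) as h. rewrite lnZ_mul in h by lia. exact h. }
  assert (A8 : (N + y <= k + L)%R).
  { pose proof (lnZ_le (n * K) _ (conj (Z.mul_pos_pos _ _ Hn HK) H6)) as h. rewrite !lnZ_mul in h by lia. exact h. }
  assert (Ha' : (30 <= IZR a)%R) by (apply IZR_le; auto).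
  assert (HaL : (30 * L <= IZR a * L)%R) by (apply Rmult_le_compat_r; lra).
  assert (HN : (6 * (IZR a * L) <= N)%R) by lra.
  assert (HN0 : (0 < N)%R) by lra.
  replace (k / N - 4 / 3)%R with ((k - 4 / 3 * N) / N)%R by (field; lra).
  unfold Rdiv at 1. rewrite Rabs_mult, (Rabs_right (/ N)) by (left; apply Rinv_0_lt_compat; auto).
  assert (B1 : (Rabs (k - 4 / 3 * N) <= 30 * L)%R) by (apply Rabs_le; lra).
  apply Rmult_le_reg_r with (N * IZR a)%R; [apply Rmult_lt_0_compat; lra|].
  replace (Rabs (k - 4 / 3 * N) * / N * (N * IZR a))%R with (Rabs (k - 4 / 3 * N) * IZR a)%R by (field; lra).
  replace (5 / IZR a * (N * IZR a))%R with (5 * N)%R by (field; lra).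
  apply Rle_trans with (30 * L * IZR a)%R; [apply Rmult_le_compat_r; lra | lra].
Qed.

Theorem theorem1p3 (p : Z) :
  prime p -> p mod 4 = 1 ->
  exists (qs : nat -> Z) (nv kis : nat -> nat),
    (forall k,
        prime (qs k) /\ qs k mod 4 = 1 /\ qs k <> p /\
        legendre_minus_one p (qs k) /\
        lps_nverts p (qs k) (nv k) /\
        lps_kiss p (qs k) (kis k)) /\
    Un_cv (fun k => (ln (INR (kis k)) / ln (INR (nv k)))%R) (4 / 3)%R.
Proof.
  intros Hp Hp4.
  assert (H : forall k : nat, exists t : Z * nat * nat,
    (prime (fst (fst t)) /\ fst (fst t) mod 4 = 1 /\ fst (fst t) <> p /\ legendre_minus_one p (fst (fst t)) /\
     lps_nverts p (fst (fst t)) (snd (fst t)) /\ lps_kiss p (fst (fst t)) (snd t)) /\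
    (Rabs (ln (INR (snd t)) / ln (INR (snd (fst t))) - 4 / 3) <= 5 / IZR (30 + Z.of_nat k))%R).
  (* The exponent [a = 30 + k] starts at the least value that [good_graph] admits and grows with
     [k], so the error [5 / a] tends to 0. *)
  { intro k. destruct (good_graph p (30 + Z.of_nat k) Hp Hp4 ltac:(lia))
      as (q & E & nv & kis & K & Hq & Hnv & Hkis & HE & Hqr & H1 & H2 & H3 & H4 & H5 & H6).
    exists (q, nv, kis). cbn [fst snd]. split.
    - split; [apply Hq|]. split; [apply Hq|]. split; [apply cls_neq; auto|]. split; [apply cls_legendre; auto|]. auto.
    - apply (ratio_bound q E nv kis K); auto. lia. }
  apply choice in H. destruct H as [f Hf].
  exists (fun k => fst (fst (f k))), (fun k => snd (fst (f k))), (fun k => snd (f k)). split; [intro k; apply Hf|].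
  intros eps Heps. destruct (archimed (5 / eps)) as [Hup _]. exists (Z.to_nat (up (5 / eps))).
  intros k Hk. destruct (Hf k) as [_ Hb]. unfold Rdist. apply (Rle_lt_trans _ _ _ Hb).
  assert (H5 : (0 < 5 / eps)%R) by (apply Rdiv_lt_0_compat; lra).
  assert (Hk2 : (5 / eps < IZR (30 + Z.of_nat k))%R).
  { apply Rlt_le_trans with (1 := Hup). apply IZR_le. lia. }
  apply Rmult_lt_reg_r with (IZR (30 + Z.of_nat k)); [lra|].
  unfold Rdiv at 1. rewrite Rmult_assoc, Rinv_l, Rmult_1_r by lra.
  apply Rmult_lt_reg_l with (/ eps)%R; [apply Rinv_0_lt_compat; auto|].
  rewrite <- Rmult_assoc, Rinv_l, Rmult_1_l by lra. unfold Rdiv in Hk2. lra.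
Qed.
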